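(* Let $$P^{ij} = g^{ij}(u(x)) \frac{d}{dx} + b^{ij}_k (u(x))\, u^k_x + \sum_{m=1}^L \sum_{n=1}^L \mu^{mn} (w_m)^i_k (u(x)) u^k_x \left(\frac{d}{dx}\right)^{-1} \circ (w_n)^j_s (u(x)) u^s_x ,$$ where $g^{ij}(u)$ is a flat (nondegenerate, contravariant) metric and $\mu^{mn}$ is a nondegenerate symmetric constant matrix. The operator $P^{ij}$ is Hamiltonian if and only if $b^{ij}_k(u) = -g^{is}(u)\Gamma^j_{sk}(u)$, where $\Gamma^j_{sk}(u)$ is the flat connection generated by the flat metric $g^{ij}(u)$, and there locally exist functions $\Phi_n(u)$, $1\le n\le L$, such that $$(w_n)^i_j(u) = \nabla^i\nabla_j\Phi_n,$$ and the following relations are fulfilled: for all $1\le i,l\le N$, $1\le j,k\le L$, $$\sum_{n=1}^N \nabla^n\nabla_i\Phi_j\,\nabla_n\nabla_l\Phi_k = \sum_{n=1}^N \nabla^n\nabla_i\Phi_k\,\nabla_n\nabla_l\Phi_j,$$ and for all $1\le i,j,k,l\le N$, $$\sum_{m=1}^L\sum_{n=1}^L\mu^{mn}\nabla_i\nabla_j\Phi_m\nabla_k\nabla_l\Phi_n = \sum_{m=1}^L\sum_{n=1}^L\mu^{mn}\nabla_i\nabla_k\Phi_m\nabla_j\nabla_l\Phi_n .$$ Here $\nabla_i$ is the covariant differentiation defined by the flat connection $\Gamma^i_{jk}(u)$ and $\nabla^i=g^{is}(u)\nabla_s$. In particular, in this case the operator $$M^{ij}_{\lambda_1,\lambda_2}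 = \lambda_1\left(g^{ij}(u(x))\frac{d}{dx} - g^{is}(u(x))\Gamma^j_{sk}(u(x))\,u^k_x\right) + \lambda_2\sum_{m=1}^L\sum_{n=1}^L\mu^{mn}\nabla^i\nabla_k\Phi_m\,u^k_x\left(\frac{d}{dx}\right)^{-1}\circ\nabla^j\nabla_s\Phi_n\,u^s_x$$ is a Hamiltonian operator for any constants $\lambda_1$ and $\lambda_2$, and the systems of hydrodynamic type $$u^i_{t_n}=\nabla^i\nabla_j\Phi_n\,u^j_x,\qquad 1\le n\le L,$$ are always commuting integrable bi-Hamiltonian systems of hydrodynamic type.
   Context: Here $u=(u^1,\dots,u^N)$ are local coordinates, $u^i(x)$ are fields depending on one variable $x$, all coefficients are smooth functions of $u$, repeated upper/lower indices are summed from $1$ to $N$, and all considerations are local. An operator $P^{ij}$ is Hamiltonian if the bracket $\{I,J\}=\int \frac{\delta I}{\delta u^i(x)}P^{ij}\frac{\delta J}{\delta u^j(x)}dx$ on functionals of the fields is skew-symmetric and satisfies the Jacobi identity. Two Hamiltonian operators are compatible if any linear combination of them with constant coefficients is Hamiltonian. The paper works with the following known criterion (Ferapontov): an operator of the form $P^{ij}$ above (with any nondegenerate $g^{ij}$) is Hamiltonian if and only if $g^{ij}=g^{ji}$ and 1) $b^{ij}_k=-g^{is}\Gamma^j_{sk}$, where $\Gamma^j_{sk}$ is the Levi-Civita connection of $g^{ij}$; 2) $g^{ik}(w_n)^j_k=g^{jk}(w_n)^i_k$; 3) $\nabla_k(w_n)^i_j=\nabla_j(w_n)^i_k$; 4)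 $g^{is}R^j_{skl}=\sum_{m,n=1}^L\mu^{mn}\left((w_m)^i_l(w_n)^j_k-(w_m)^j_l(w_n)^i_k\right)$, where $R^j_{skl}$ is the Riemannian curvature tensor; 5) $(w_n)^i_s(w_m)^s_j=(w_m)^i_s(w_n)^s_j$. A system $u^i_t=V^i_k(u)u^k_x$ is Hamiltonian with respect to $M_{\lambda_1,\lambda_2}$ if it can be written as $u^i_t=M^{ij}_{\lambda_1,\lambda_2}\frac{\delta H}{\delta u^j(x)}$ with $H=\int h(u(x))\,dx$, where antiderivatives $(d/dx)^{-1}$ are defined up to additive constants; i.e. locally there exist functions $h(u)$, $Q_n(u)$ with $\partial Q_n/\partial u^s=(\nabla^j\nabla_s\Phi_n)\,\partial h/\partial u^j$ and $V^i_k=\lambda_1\nabla^i\nabla_kh+\lambda_2\sum_{m,n}\mu^{mn}\nabla^i\nabla_k\Phi_m\,Q_n$. ''Integrable bi-Hamiltonian'' means Hamiltonian with respect to both compatible operators $M_{1,0}$ and $M_{0,1}$. Two flows commute if their mixed derivatives agree, $(u^i_{t_n})_{t_m}=(u^i_{t_m})_{t_n}$.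
   Formalization: In the ''only if'' part the affinors w_n are assumed linearly independent over the constants on a connected coordinate domain; otherwise it fails, e.g. L=2, μ=diag(1,-1), w_1=w_2 arbitrary, where the nonlocal part vanishes. The ''if'' part and the final claims need no independence. *)

(* Defs.v *)
From HB Require Import structures.
From mathcomp Require Import all_boot all_order all_algebra.
From mathcomp Require Import all_classical all_reals all_analysis.
Set Implicit Arguments.
Unset Strict Implicit.
Unset Printing Implicit Defensive.
Import Order.TTheory GRing.Theory Num.Theory.
Import numFieldNormedType.Exports.
Local Open Scope classical_set_scope.
Local Open Scope ring_scope.

Section smooth.
Context {R : realType}.

Definition iter_derive {V : normedModType R} (vs : seq V) (f : V -> R) : V -> R :=
  foldr (fun v h => 'D_v h) f vs.

(* C^oo on the open set A: all iterated directional derivatives exist and are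
   continuous; on a finite-dimensional V this is the usual notion. *)
Definition smooth_on {V : normedModType R} (A : set V) (f : V -> R) : Prop :=
  forall (vs : seq V) (x : V), A x ->
    {for x, continuous (iter_derive vs f)} /\
    forall v : V, derivable (iter_derive vs f) x v.

Definition smooth_map {N : nat} (u : R -> 'rV[R]_N) : Prop :=
  forall i, smooth_on [set: R] (fun x : R => u x 0 i).

Definition smooth_field {N : nat} (U : set 'rV[R]_N) (u : R -> 'rV[R]_N) : Prop :=
  smooth_map u /\ forall x, U (u x).

(* Joint smoothness in the parameter s and in x. *)
Definition smooth_family {m N : nat} (S : set 'rV[R]_m)
    (u : 'rV[R]_m -> R -> 'rV[R]_N) : Prop :=
  forall i, smooth_on (S `*` [set: R]) (fun p : 'rV[R]_m * R => u p.1 p.2 0 i).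

Definition dx {N : nat} (u : R -> 'rV[R]_N) (x : R) : 'rV[R]_N :=
  \row_i 'D_1 (fun y : R => u y 0 i) x.

(* The value at u of the partial derivative of f with respect to u^i. *)
Definition pd {N : nat} (i : 'I_N) (f : 'rV[R]_N -> R) : 'rV[R]_N -> R :=
  'D_(delta_mx 0 i) f.

Definition pairing {N : nat} (xi v : R -> 'rV[R]_N) : R :=
  \int[lebesgue_measure]_x (\sum_i xi x 0 i * v x 0 i).

(* The skew-adjoint antiderivative, whose kernel is sgn(x - y) / 2. *)
Definition Dinv (f : R -> R) (x : R) : R :=
  2^-1 * (\int[lebesgue_measure]_(y in `]-oo, x]) f y
          - \int[lebesgue_measure]_(y in `[x, +oo[) f y).

End smooth.

Section hamiltonian.
Context {R : realType} {N : nat}.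
Implicit Type U : set 'rV[R]_N.

(* A functional I of U-valued fields that has a smooth variational derivative
   delta I / delta u supported in [-rad, rad]: along any smooth family u_s of
   fields, dI(u_s) = \int (delta I / delta u)(u_s) . du_s dx.  Because I only
   sees the restriction of the fields to [-rad, rad], the values of u_s have to
   lie in U only there.  The functionals \int f(x, u, u_x, ..., u^(k)) dx with f
   compactly supported in x are of this form. *)
Record functional U := Functional {
  fval :> (R -> 'rV[R]_N) -> R;
  vder : (R -> 'rV[R]_N) -> R -> 'rV[R]_N;
  rad : R;
  vder_supp : forall u x, rad < `|x| -> vder u x = 0;
  vderP : forall (m : nat) (S : set 'rV[R]_m) (u : 'rV[R]_m -> R -> 'rV[R]_N),
    open S -> smooth_family S u ->
    (forall s x, S s -> `|x| <= rad -> U (u s x)) ->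
    smooth_family S (fun s => vder (u s)) /\
    forall s v, S s ->
      is_derive s v (fun s' => fval (u s'))
        (pairing (vder (u s)) (fun x => 'D_v (u ^~ x) s))
}.

(* P u xi x is the vector with components (P^{ij} xi_j)(x), where the
   coefficients of P are taken at the field u. *)
Definition operator := (R -> 'rV[R]_N) -> (R -> 'rV[R]_N) -> R -> 'rV[R]_N.

Definition bracket (P : operator) U (I J : functional U) (u : R -> 'rV[R]_N) : R :=
  pairing (vder I u) (P u (vder J u)).

(* {F, K} for an arbitrary differentiable functional F:
   \int (delta F / delta u^i) P^{ij} (delta K / delta u^j) dx is the derivative
   of F at u in the direction P (delta K / delta u).  It is used for the
   nonlocal functionals F = {I, J}. *)
Definition outer_bracket (P : operator) U (F : (R -> 'rV[R]_N) -> R)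
    (K : functional U) (u : R -> 'rV[R]_N) : R :=
  'D_1 (fun e : R => F (fun x => u x + e *: P u (vder K u) x)) 0.

Definition skew_bracket U (P : operator) : Prop :=
  forall (I J : functional U) (u : R -> 'rV[R]_N), smooth_field U u ->
    bracket P I J u = - bracket P J I u.

Definition jacobi_bracket U (P : operator) : Prop :=
  forall (I J K : functional U) (u : R -> 'rV[R]_N), smooth_field U u ->
    outer_bracket P (bracket P I J) K u + outer_bracket P (bracket P J K) I u
    + outer_bracket P (bracket P K I) J u = 0.

Definition hamiltonian U (P : operator) : Prop :=
  skew_bracket U P /\ jacobi_bracket U P.

Definition op_comb (l1 : R) (P1 : operator) (l2 : R) (P2 : operator) : operator :=
  fun u xi x => l1 *: P1 u xi x + l2 *: P2 u xi x.

Definition compatible U (P1 P2 : operator) : Prop :=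
  [/\ hamiltonian U P1, hamiltonian U P2 &
      forall l1 l2 : R, hamiltonian U (op_comb l1 P1 l2 P2)].

(* g^{ij} d/dx + b^{ij}_k u^k_x *)
Definition local_op (g : 'rV[R]_N -> 'M[R]_N)
    (b : 'I_N -> 'I_N -> 'I_N -> 'rV[R]_N -> R) : operator :=
  fun u xi x => \row_i
    (\sum_j g (u x) i j * dx xi x 0 j
     + \sum_j \sum_k b i j k (u x) * dx u x 0 k * xi x 0 j).

(* sum_{m,n} mu^{mn} (w_m)^i_k u^k_x (d/dx)^{-1} o (w_n)^j_s u^s_x *)
Definition nonlocal_op (L : nat) (mu : 'M[R]_L)
    (w : 'I_L -> 'rV[R]_N -> 'M[R]_N) : operator :=
  fun u xi x => \row_i \sum_m \sum_n mu m n *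
    (\sum_k w m (u x) i k * dx u x 0 k) *
    Dinv (fun y => \sum_j \sum_s w n (u y) j s * dx u y 0 s * xi y 0 j) x.

Definition hydro_op (L : nat) (g : 'rV[R]_N -> 'M[R]_N)
    (b : 'I_N -> 'I_N -> 'I_N -> 'rV[R]_N -> R) (mu : 'M[R]_L)
    (w : 'I_L -> 'rV[R]_N -> 'M[R]_N) : operator :=
  fun u xi x => local_op g b u xi x + nonlocal_op mu w u xi x.

End hamiltonian.

Section geometry.
Context {R : realType} {N : nat}.
Implicit Type g : 'rV[R]_N -> 'M[R]_N.

(* g u i j is the contravariant g^{ij}(u), so that g_{ij} is invmx (g u) i j. *)
Definition christoffel g (j s k : 'I_N) (u : 'rV[R]_N) : R :=
  2^-1 * \sum_l g u j l *
    (pd s (fun v => invmx (g v) l k) u + pd k (fun v => invmx (g v) s l) u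
     - pd l (fun v => invmx (g v) s k) u).

Definition riemann g (j s k l : 'I_N) (u : 'rV[R]_N) : R :=
  pd k (christoffel g j l s) u - pd l (christoffel g j k s) u
  + \sum_a (christoffel g j k a u * christoffel g a l s u
            - christoffel g j l a u * christoffel g a k s u).

Definition flat_metric (U : set 'rV[R]_N) g : Prop :=
  [/\ forall i j, smooth_on U (fun u => g u i j),
      forall u, U u -> (g u)^T = g u,
      forall u, U u -> g u \in unitmx &
      forall u, U u -> forall j s k l, riemann g j s k l u = 0].

(* - g^{is} Gamma^j_{sk} *)
Definition lc_coef g (i j k : 'I_N) (u : 'rV[R]_N) : R :=
  - \sum_s g u i s * christoffel g j s k u.

(* nabla_i nabla_j Phi *)
Definition hess g (Phi : 'rV[R]_N -> R) (i j : 'I_N) (u : 'rV[R]_N) : R :=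
  pd i (pd j Phi) u - \sum_k christoffel g k i j u * pd k Phi u.

(* nabla^i nabla_j Phi *)
Definition hess_up g (Phi : 'rV[R]_N -> R) (u : 'rV[R]_N) : 'M[R]_N :=
  \matrix_(i, j) \sum_s g u i s * hess g Phi s j u.

End geometry.

Section objects.
Context {R : realType} {N L : nat}.
Implicit Types (U : set 'rV[R]_N) (g : 'rV[R]_N -> 'M[R]_N) (mu : 'M[R]_L)
  (w : 'I_L -> 'rV[R]_N -> 'M[R]_N) (Phi : 'I_L -> 'rV[R]_N -> R).

(* Linear independence over the constants.  If it fails, the nonlocal part of the
   operator does not determine the w_n: for mu = diag(1, -1) and w_1 = w_2 it is
   zero whatever w_1 is, so that the operator can be Hamiltonian with w_1, w_2
   arbitrary. *)
Definition lin_indep U w : Prop :=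
  forall c : 'I_L -> R,
    (forall u, U u -> \sum_n c n *: w n u = 0) -> forall n, c n = 0.

Definition potentials U g mu w Phi : Prop :=
  [/\ forall n, smooth_on U (Phi n),
      forall n u, U u -> w n u = hess_up g (Phi n) u,
      forall u, U u -> forall (i l : 'I_N) (j k : 'I_L),
        \sum_(n < N) hess_up g (Phi j) u n i * hess g (Phi k) n l u
        = \sum_(n < N) hess_up g (Phi k) u n i * hess g (Phi j) n l u &
      forall u, U u -> forall i j k l : 'I_N,
        \sum_m \sum_n mu m n * hess g (Phi m) i j u * hess g (Phi n) k l u
        = \sum_m \sum_n mu m n * hess g (Phi m) i k u * hess g (Phi n) j l u].

Definition locally_potential U g mu w : Prop :=
  forall p, U p -> exists V : set 'rV[R]_N,
    [/\ open V, V p, V `<=` U & exists Phi, potentials V g mu w Phi].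

Definition M_op g mu Phi (l1 l2 : R) : operator :=
  op_comb l1 (local_op g (lc_coef g))
          l2 (nonlocal_op mu (fun n => hess_up g (Phi n))).

(* The right-hand side A^i_k(u) u^k_x of a system of hydrodynamic type. *)
Definition flow (A : 'rV[R]_N -> 'M[R]_N) (u : R -> 'rV[R]_N) (x : R) : 'rV[R]_N :=
  \row_i \sum_k A (u x) i k * dx u x 0 k.

(* For u_t = flow A u and u_tau = flow B u, the two sides are (u^i_t)_tau and
   (u^i_tau)_t. *)
Definition commuting_flows U (A B : 'rV[R]_N -> 'M[R]_N) : Prop :=
  forall u : R -> 'rV[R]_N, smooth_field U u -> forall x i,
    'D_1 (fun e : R => flow A (fun y => u y + e *: flow B u y) x 0 i) 0
    = 'D_1 (fun e : R => flow B (fun y => u y + e *: flow A u y) x 0 i) 0.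

(* u_t = flow A u is u^i_t = M^{ij} (delta H / delta u^j) with H = \int h(u) dx,
   where Q_n(u(x)) is an antiderivative of
   (nabla^j nabla_s Phi_n) u^s_x (dh / du^j). *)
Definition hamiltonian_system U g mu Phi (l1 l2 : R)
    (A : 'rV[R]_N -> 'M[R]_N) : Prop :=
  forall p, U p -> exists V : set 'rV[R]_N,
    [/\ open V, V p, V `<=` U &
      exists (h : 'rV[R]_N -> R) (Q : 'I_L -> 'rV[R]_N -> R),
      [/\ smooth_on V h, forall n, smooth_on V (Q n),
          forall n s u, V u ->
            pd s (Q n) u = \sum_j hess_up g (Phi n) u j s * pd j h u &
          forall u i k, V u ->
            A u i k = l1 * hess_up g h u i k
              + l2 * \sum_m \sum_n mu m n * hess_up g (Phi m) u i k * Q n u]].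

Definition bihamiltonian_system U g mu Phi (A : 'rV[R]_N -> 'M[R]_N) : Prop :=
  [/\ compatible U (M_op g mu Phi 1 0) (M_op g mu Phi 0 1),
      hamiltonian_system U g mu Phi 1 0 A &
      hamiltonian_system U g mu Phi 0 1 A].

End objects.

(* Main.v *)
(** Work along a fixed curve u with the torsion-free flat connection of g.
    Sufficiency: in the cyclic sum of the Jacobi identity the second variations
    of the functionals cancel by their symmetry, the local part cancels by
    flatness, and what is left is a sum of terms
    S(a; xi, eta) = int D^-1(eta w u_x) mu V(a) xi, where V(a) is the covariant
    derivative of w u_x along a = P zeta.  Integrating by parts with the Codazzi
    equations, these terms cancel because g w is symmetric, the Gauss equation
    holds and the w_n commute.  The Codazzi equations and the symmetry say that
    w_n is a Hessian; the potentials come from integrating closed systems along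
    rays (Frobenius and Poincare).

    Necessity: test the bracket on linear functionals.  Skew-symmetry yields
    dg = b + b^T, the Jacobi identity on constant fields yields that b is torsion
    free, so b is the Levi-Civita connection.  Localizing zeta at a point where
    u_x = 0 and u_xx = z turns the Jacobi identity into an algebraic relation
    between the 2-jets of xi, eta at that point and the numbers D^-1(xi w u_x),
    D^-1(eta w u_x) there.  As U is connected, the curve can be continued through
    arbitrary 1-jets at other points, and linear independence of the w_n makes
    these numbers arbitrary; the four conditions are then read off one by one. *)
Require Import Defs.
From HB Require Import structures.
From mathcomp Require Import all_boot all_order all_algebra.
From mathcomp Require Import all_classical all_reals all_analysis.
From mathcomp Require Import ring lra.
Set Implicit Arguments.
Unset Strict Implicit.
Unset Printing Implicit Defensive.
Import Order.TTheory GRing.Theory Num.Theory.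
Import numFieldNormedType.Exports.
Local Open Scope classical_set_scope.
Local Open Scope ring_scope.

(** * Smooth functions *)

(** The direction [P zeta] in which a bracket is differentiated has tails: beyond the support of
    [zeta] the antiderivative is constant but in general not zero, and the perturbed field may leave
    U there. All identities are therefore integrals over a fixed interval [-r, r] beyond the
    supports. On it the kernel sgn(x - y) / 2 selects the antiderivative with opposite values at the
    two ends, so a product of two antiderivatives has equal boundary values and integration by parts
    leaves no boundary term. Expansions of first order in the parameter, uniform on [-r, r], pass
    through antiderivatives; the calculus of variations here rests on them.

    In the necessity part the order of the conditions is forced: self-adjointness and commutation
    come first, the Codazzi equations need both, and the Gauss equation needs all three. A potential
    costs two integrations: first of a covector field with prescribed covariant derivative, where
    flatness and Codazzi are the integrability conditions, then of the closed form so obtained. *)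

Section approx.
Context {R : realType}.

(** Neither a quotient nor a punctured neighbourhood occurs in this form, so estimates add up and
    can be integrated; every derivative that is not given by a library rule is obtained through
    it. *)
Lemma is_derive_approxP {V W : normedModType R} (f : V -> W) (x v : V) (d : W) :
  is_derive x v f d <->
  forall eta : R, 0 < eta ->
    \forall h \near (0 : R), `|f (x + h *: v) - f x - h *: d| <= eta * `|h|.
Proof.
have key (h : R) : h != 0 ->
    `|h^-1 *: (f (h *: v + x) - f x) - d| = `|h|^-1 * `|f (x + h *: v) - f x - h *: d|.
  move=> h0; rewrite -normrV ?unitfE// -normrZ [in RHS]scalerBr scalerA mulVf// scale1r.
  by rewrite (addrC x).
split=> [[fd fE] eta eta0|H].
  have : h^-1 *: ((f \o shift x) (h *: v) - f x) @[h --> 0^'] --> d by rewrite -fE.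
  move/cvgrPdist_le => /(_ eta eta0); rewrite /dnbhs/= near_withinE.
  apply: filterS => h /= H; have [->|h0] := eqVneq h 0.
    by rewrite !scale0r addr0 subr0 subrr !normr0 mulr0.
  by have := H h0; rewrite distrC key// mulrC ler_pdivrMr// normr_gt0.
suff C : h^-1 *: ((f \o shift x) (h *: v) - f x) @[h --> 0^'] --> d.
  by constructor; [apply/cvg_ex; exists d|exact: cvg_lim].
apply/cvgrPdist_le => eta eta0 /=.
rewrite /dnbhs/= near_withinE; have := H _ eta0; apply: filterS => h hh h0 /=.
by rewrite distrC key// mulrC ler_pdivrMr ?normr_gt0.
Qed.

Lemma is_derive_unique {V W : normedModType R} (f : V -> W) (x v : V) (d d' : W) :
  is_derive x v f d -> is_derive x v f d' -> d = d'.
Proof. by move=> [_ <-] [_ <-]. Qed.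

Lemma is_derive_line {V W : normedModType R} (f : V -> W) (x v : V) (t : R) (d : W) :
  is_derive (x + t *: v) v f d <-> is_derive t 1 (fun s : R => f (x + s *: v)) d.
Proof.
have E (h : R) : x + (t + h *: 1) *: v = x + t *: v + h *: v.
  by rewrite [h *: 1]mulr1 scalerDl addrA.
by rewrite !is_derive_approxP; split=> H eta /H; apply: filterS => h; rewrite E.
Qed.

Lemma near0_norm_lt {V : normedModType R} (e : R) :
  0 < e -> \forall h \near (0 : V), `|h| < e.
Proof.
move=> e0; apply/nbhs_ballP; exists e => // h.
by rewrite -ball_normE/= sub0r normrN.
Qed.

(** The mean value theorem with a reference slope: [d] need not be a derivative of [f]. It serves
    for total differentiability, mixed derivatives, bounds on antiderivatives and limits of
    derivatives alike. *)
Lemma mvt_approx (f df : R -> R) (d eta r : R) :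
  (forall t : R, `|t| <= r -> is_derive t 1 f (df t)) ->
  (forall t : R, `|t| <= r -> `|df t - d| <= eta) ->
  forall h, `|h| <= r -> `|f h - f 0 - h * d| <= eta * `|h|.
Proof.
move=> fd dfe h hr.
have mid (a b : R) : a <= b -> `|a| <= r -> `|b| <= r ->
    `|f b - f a - (b - a) * d| <= eta * (b - a).
  move=> ab ar br.
  have inr t : t \in `[a, b] -> `|t| <= r.
    by rewrite in_itv/= => /andP[at_ tb]; move: ar br; rewrite !ler_norml; lra.
  have [||c cab ->] := @MVT_segment R f df a b ab.
  - by move=> t; rewrite in_itv/= => /andP[t1 t2]; apply: fd; apply: inr; rewrite in_itv/= !ltW.
  - apply: derivable_within_continuous => t tab.
    by have [] := fd _ (inr _ tab).
  rewrite mulrC -mulrBr normrM mulrC (ger0_norm (_ : 0 <= b - a)) ?subr_ge0//.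
  by rewrite ler_wpM2r ?subr_ge0// dfe// inr.
have r0 : `|0 : R| <= r by rewrite normr0 (le_trans _ hr).
have [h0|h0] := leP 0 h.
  by have := mid 0 h h0 r0 hr; rewrite subr0 (ger0_norm h0).
have := mid h 0 (ltW h0) hr r0; rewrite sub0r (ltr0_norm h0) -normrN => H.
by apply: le_trans H; rewrite le_eqVlt; apply/orP; left; apply/eqP; congr (`|_|); ring.
Qed.

End approx.

Section fields.
Context {R : realType} {N : nat}.
Implicit Types (x h : 'rV[R]_N) (F : 'rV[R]_N -> R).

Lemma norm_mxE m n (A : 'M[R]_(m, n)) (e : R) : 0 <= e ->
  (`|A| <= e) = [forall i, forall j, `|A i j| <= e].
Proof.
move=> e0; apply/idP/idP => [Ae|/forallP H].
  apply/forallP => i; apply/forallP => j.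
  apply: le_trans Ae; rewrite [`|A|]mx_normrE.
  exact: (le_bigmax _ (fun ij => `|A ij.1 ij.2|) (i, j)).
rewrite [`|A|]mx_normrE.
by apply: bigmax_le => // -[i j] _ /=; have /forallP := H i; exact.
Qed.

Lemma norm_entry m n (A : 'M[R]_(m, n)) i j : `|A i j| <= `|A|.
Proof.
have := norm_mxE A (normr_ge0 A).
by rewrite lexx => /esym /forallP/(_ i)/forallP/(_ j).
Qed.

(** The corners of the staircase that leads from 0 to [h] along the coordinate axes. *)
Definition rtrunc (k : nat) (h : 'rV[R]_N) : 'rV[R]_N :=
  \row_i (if (i < k)%N then h 0 i else 0).

Lemma rtrunc_norm k h : `|rtrunc k h| <= `|h|.
Proof.
rewrite norm_mxE//; apply/forallP => i; apply/forallP => j; rewrite mxE.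
by case: ifP => _; rewrite ?normr0// norm_entry.
Qed.

(** Continuous partial derivatives give total differentiability: the mean value estimate is applied
    on each step of the staircase, where only one coordinate moves, and the errors are added. *)
Lemma C1_approx F x :
  (forall i : 'I_N, \forall y \near x, derivable F y (delta_mx 0 i)) ->
  (forall i, {for x, continuous (pd i F)}) ->
  forall eta : R, 0 < eta ->
    \forall h \near (0 : 'rV[R]_N),
      `|F (x + h) - F x - \sum_i h 0 i * pd i F x| <= eta * `|h|.
Proof.
move=> dF cF eta eta0.
(* Each of the N steps costs at most [e * |h|]; the added 1 keeps the quotient meaningful for N =
   0. *)
pose e := eta / (N%:R + 1).
have e0 : 0 < e by rewrite divr_gt0// ltr_wpDl.
have : \forall y \near x, forall i : 'I_N, derivable F y (delta_mx 0 i) /\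
    `|pd i F y - pd i F x| <= e.
  pose Q (i : 'I_N) y := derivable F y (delta_mx 0 i) /\ `|pd i F y - pd i F x| <= e.
  suff : \forall y \near x, forall i, Q i y by [].
  apply: (@filter_forall 'rV[R]_N 'I_N Q (nbhs x)) => i.
  near=> y; split; first by near: y; exact: dF.
  rewrite distrC; near: y; move/cvgrPdist_le: (cF i); exact.
move=> /nbhs_ballP[r/= r0 H].
have {}H y i : `|y - x| < r -> derivable F y (delta_mx 0 i) /\ `|pd i F y - pd i F x| <= e.
  by move=> yr; apply: H; rewrite -ball_normE/= distrC.
have r20 : 0 < r / 2 by rewrite divr_gt0.
have := @near0_norm_lt R 'rV[R]_N _ r20; apply: filterS => h hr.
have step k : (k < N)%N -> forall i : 'I_N, i = k :> nat ->
    `|F (x + rtrunc k.+1 h) - F (x + rtrunc k h) - h 0 i * pd i F x| <= e * `|h|.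
  move=> kN i ik.
  pose f (t : R) := F (x + rtrunc k h + t *: delta_mx 0 i).
  have E : rtrunc k.+1 h = rtrunc k h + h 0 i *: delta_mx 0 i.
    apply/rowP => j; rewrite !mxE/= ltnS leq_eqVlt -ik eq_sym.
    have [->|ji] := eqVneq j i; first by rewrite ltnn eqxx/= mulr1 add0r.
    have /negbTE -> : (i != j :> nat) by rewrite eq_sym.
    by rewrite /= mulr0 addr0.
  have small (t : R) : `|t| <= `|h| -> `|x + rtrunc k h + t *: delta_mx 0 i - x| < r.
    move=> th; rewrite addrC addrA addrA addNr add0r.
    rewrite (le_lt_trans (ler_normD _ _))// (splitr r) ltr_leD//.
      by rewrite (le_lt_trans (rtrunc_norm _ _)).
    apply: le_trans (ltW hr); apply: le_trans th.
    rewrite norm_mxE//; apply/forallP => a; apply/forallP => b; rewrite !mxE.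
    by case: andP => _; rewrite ?mulr1// mulr0 normr0.
  have := @mvt_approx R f (fun t => pd i F (x + rtrunc k h + t *: delta_mx 0 i))
    (pd i F x) e `|h|.
  move=> /(_ _ _ (h 0 i) (norm_entry _ _ _)).
  have -> : f (h 0 i) = F (x + rtrunc k.+1 h) by rewrite /f E addrA.
  have -> : f 0 = F (x + rtrunc k h) by rewrite /f scale0r addr0.
  move=> H'; apply: le_trans (H' _ _) _.
  - move=> t th; have [dFt _] := H _ i (small t th).
    exact: (is_derive_line F (x + rtrunc k h) (delta_mx 0 i) t _).1 (DeriveDef dFt erefl).
  - by move=> t th; have [] := H _ i (small t th).
  - by rewrite ler_wpM2l ?(ltW e0)// norm_entry.
have tel k : (k <= N)%N ->
    `|F (x + rtrunc k h) - F x - \sum_(i < N | (i < k)%N) h 0 i * pd i F x| <= k%:R * (e * `|h|).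
  elim: k => [_|k IH kN].
    rewrite big_pred0// mul0r subr0 (_ : rtrunc 0 h = 0) ?addr0 ?subrr ?normr0//.
    by apply/rowP => i; rewrite !mxE.
  have := step k kN (Ordinal kN) erefl; have := IH (ltnW kN).
  have -> : \sum_(i < N | (i < k.+1)%N) h 0 i * pd i F x =
      h 0 (Ordinal kN) * pd (Ordinal kN) F x + \sum_(i < N | (i < k)%N) h 0 i * pd i F x.
    rewrite (bigD1 (Ordinal kN))//=; congr (_ + _); apply: eq_bigl => i.
    by rewrite ltnS leq_eqVlt -val_eqE/=; case: ltngtP.
  move=> H1 H2; rewrite -natr1 mulrDl mul1r.
  apply: le_trans (lerD H1 H2); apply: le_trans (ler_normD _ _).
  rewrite le_eqVlt; apply/orP; left; apply/eqP; congr (`|_|); ring.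
have := tel N (leqnn N).
rewrite (_ : rtrunc N h = h); last by apply/rowP => i; rewrite mxE ltn_ord.
rewrite [X in `|_ - X|](eq_bigl xpredT); last by move=> i; rewrite ltn_ord.
move=> /le_trans; apply.
rewrite mulrA ler_wpM2r// /e mulrCA ler_piMr ?(ltW eta0)//.
by rewrite ler_pdivrMr ?mul1r ?lerDl// ltr_wpDl.
Unshelve. all: by end_near. Qed.

(** The inner map is differentiable in one direction only, so the outer function must be
    approximated in all directions at once, by [C1_approx]. *)
Lemma is_derive_comp {V : normedModType R} F (p : V -> 'rV[R]_N) (y v : V) (dp : 'rV[R]_N) :
  (forall i : 'I_N, \forall z \near p y, derivable F z (delta_mx 0 i)) ->
  (forall i, {for p y, continuous (pd i F)}) ->
  is_derive y v p dp ->
  is_derive y v (F \o p) (\sum_i dp 0 i * pd i F (p y)).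
Proof.
move=> dF cF; rewrite !is_derive_approxP => pD eta eta0.
pose S : R := \sum_i `|pd i F (p y)| + 1.
have S0 : 0 < S by rewrite ltr_wpDl// sumr_ge0.
pose K := `|dp| + 1; have K0 : 0 < K by rewrite ltr_wpDl.
have e10 : 0 < eta / 2 / K by rewrite !divr_gt0.
(* The bound 1 gives the Lipschitz estimate [|q| <= K * |h|]; the bound [eta / 2 / S] controls the
   linear term. The other half of [eta] goes to the remainder of [F]. *)
have e20 : 0 < Num.min 1 (eta / 2 / S) by rewrite lt_min ltr01 !divr_gt0.
have := C1_approx dF cF e10.
move=> /nbhs_ballP[r/= r0 HF].
have {HF} HF h : `|h| < r -> `|F (p y + h) - F (p y) - \sum_i h 0 i * pd i F (p y)| <= eta / 2 / K * `|h|.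
  by move=> hr; apply: HF; rewrite -ball_normE/= sub0r normrN.
have := pD _ e20.
have hr0 : 0 < r / K by rewrite divr_gt0.
move=> HP; move: (@near0_norm_lt R R _ hr0) HP; apply: filterS2 => h hr.
set q := p (y + h *: v) - p y => Hq.
have q1 : `|q - h *: dp| <= `|h|.
  by apply: le_trans Hq _; rewrite ler_piMl// ge_min lexx.
have q2 : `|q - h *: dp| <= eta / 2 / S * `|h|.
  by apply: le_trans Hq _; rewrite ler_wpM2r// ge_min lexx orbT.
have qh : `|q| <= K * `|h|.
  rewrite -(subrK (h *: dp) q) (le_trans (ler_normD _ _))// /K mulrDl mul1r addrC lerD//.
  by rewrite normrZ mulrC.
have qr : `|q| < r.
  rewrite (le_lt_trans qh)// mulrC -ltr_pdivlMr//.
have := HF q qr; rewrite [X in F X](_ : _ = p (y + h *: v)) => [H|]; last by rewrite /q addrC subrK.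
have Kh : `|F (p (y + h *: v)) - F (p y) - \sum_i q 0 i * pd i F (p y)| <= eta / 2 * `|h|.
  apply: le_trans H _.
  apply: (@le_trans _ _ (eta / 2 / K * (K * `|h|))).
    by rewrite ler_wpM2l// ltW.
  by rewrite mulrA divfK ?gt_eqF.
have E : \sum_i q 0 i * pd i F (p y) - h *: (\sum_i dp 0 i * pd i F (p y)) =
    \sum_i (q - h *: dp) 0 i * pd i F (p y).
  rewrite scaler_sumr -sumrB; apply: eq_bigr => i _.
  by rewrite !mxE /GRing.scale/=; ring.
rewrite -(subrKA (\sum_i q 0 i * pd i F (p y))) E.
rewrite (splitr eta) mulrDl (le_trans (ler_normD _ _))// lerD//.
apply: (@le_trans _ _ (\sum_i `|q - h *: dp| * `|pd i F (p y)|)).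
  rewrite (le_trans (ler_norm_sum _ _ _))// ler_sum// => i _.
  by rewrite normrM ler_wpM2r// norm_entry.
rewrite -mulr_sumr; apply: (@le_trans _ _ (`|q - h *: dp| * S)).
  by rewrite ler_wpM2l// lerDl.
by rewrite -ler_pdivlMr// mulrAC.
Qed.

End fields.

Section smoothness.
Context {R : realType}.

Lemma iter_derive_rcons {V : normedModType R} (vs : seq V) v (f : V -> R) :
  iter_derive (rcons vs v) f = iter_derive vs ('D_v f).
Proof. by rewrite /iter_derive foldr_rcons. Qed.

Section domain.
Context {V : normedModType R}.
Implicit Types (A : set V) (f g : V -> R).

Lemma smooth_onD A f v : smooth_on A f -> smooth_on A ('D_v f).
Proof. by move=> fA vs x Ax; have := fA (rcons vs v) x Ax; rewrite iter_derive_rcons. Qed.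

Lemma smooth_on_continuous A f x : smooth_on A f -> A x -> {for x, continuous f}.
Proof. by move=> fA Ax; have [] := fA [::] x Ax. Qed.

Lemma smooth_on_derivable A f x v : smooth_on A f -> A x -> derivable f x v.
Proof. by move=> fA Ax; have [_] := fA [::] x Ax; exact. Qed.

Lemma smooth_on_is_derive A f x v : smooth_on A f -> A x -> is_derive x v f ('D_v f x).
Proof. by move=> fA Ax; apply: DeriveDef => //; exact: smooth_on_derivable fA Ax. Qed.

Lemma smooth_on_sub A B f : A `<=` B -> smooth_on B f -> smooth_on A f.
Proof. by move=> AB fB vs x /AB; exact: fB. Qed.

Lemma near_open A x (P : V -> Prop) : open A -> A x -> (forall y, A y -> P y) ->
  \forall y \near x, P y.
Proof. by move=> oA Ax AP; apply: filterS (open_nbhs_nbhs (conj oA Ax)). Qed.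

Lemma eq_on_derive A f g v x : open A -> {in A, f =1 g} -> A x -> 'D_v f x = 'D_v g x.
Proof.
move=> oA fg Ax; apply: near_eq_derive; apply: near_open oA Ax _ => y Ay.
by apply: fg; rewrite inE.
Qed.

Lemma eq_on_continuous A f g x : open A -> {in A, f =1 g} -> A x ->
  {for x, continuous f} -> {for x, continuous g}.
Proof.
move=> oA fg Ax; rewrite /prop_for /continuous_at -(fg x) ?inE//.
apply: cvg_trans; apply: near_eq_cvg; apply: near_open oA Ax _ => y Ay.
by rewrite fg ?inE.
Qed.

(** Coinduction for smoothness: a class of functions continuous on [A] in which every member has its
    directional derivatives again in the class consists of smooth functions, since each iterated
    derivative agrees on [A] with a member. *)
Lemma smooth_coind A (C : (V -> R) -> Prop) : open A ->
  (forall f, C f -> forall x, A x -> {for x, continuous f}) ->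
  (forall f v, C f -> exists2 g, C g & forall x, A x -> is_derive x v f (g x)) ->
  forall f, C f -> smooth_on A f.
Proof.
move=> oA Cc Cd f Cf vs.
suff [g Cg fg] : exists2 g, C g & {in A, iter_derive vs f =1 g}.
  move=> x Ax; split.
    by apply: (eq_on_continuous oA _ Ax (Cc _ Cg x Ax)) => y yA; rewrite fg.
  move=> v; have [h Ch /(_ x Ax)[dg _]] := Cd _ v Cg.
  apply: near_eq_derivable dg; apply: near_open oA Ax _ => y Ay.
  by rewrite fg ?inE.
elim: vs => [|v vs [g Cg fg]]; first by exists f.
have [h Ch gh] := Cd _ v Cg; exists h => // x; rewrite inE => Ax.
by rewrite /= -/(iter_derive vs f) (eq_on_derive v oA fg Ax); have [_ ->] := gh x Ax.
Qed.

Lemma eq_smooth_on A f g : open A -> {in A, f =1 g} -> smooth_on A f -> smooth_on A g.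
Proof.
move=> oA fg fA.
refine (@smooth_coind A (fun h => exists2 k, smooth_on A k & {in A, k =1 h}) oA _ _ _ _).
- move=> h [k kA kh] x Ax.
  exact: eq_on_continuous oA kh Ax (smooth_on_continuous kA Ax).
- move=> h v [k kA kh]; exists ('D_v k); first by exists ('D_v k); [exact: smooth_onD|].
  move=> x Ax; apply: near_eq_is_derive (smooth_on_is_derive v kA Ax).
  by apply: near_open oA Ax _ => y Ay; rewrite kh ?inE.
- by exists f.
Qed.

(** The class for the coinduction is [f] itself together with all smooth functions. *)
Lemma smooth_of_derive A f (df : V -> V -> R) :
  (forall x, A x -> {for x, continuous f}) ->
  (forall x v, A x -> is_derive x v f (df v x)) ->
  open A -> (forall v, smooth_on A (df v)) -> smooth_on A f.
Proof.
move=> fc fd oA dfA.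
refine (@smooth_coind A (fun h => h = f \/ smooth_on A h) oA _ _ _ _); last by left.
- by move=> h [->//|hA] x Ax; exact: smooth_on_continuous hA Ax.
- move=> h v [->|hA].
    by exists (df v); [right|move=> x Ax; exact: fd].
  exists ('D_v h); first by right; exact: smooth_onD.
  by move=> x Ax; exact: smooth_on_is_derive hA Ax.
Qed.

End domain.

Lemma is_derive_linear_comp {V V' : normedModType R} (l : {linear V -> V'}) (f : V' -> R) x v d :
  is_derive (l x) (l v) f d -> is_derive x v (f \o l) d.
Proof.
rewrite !is_derive_approxP => H eta /H; apply: filterS => h.
by rewrite /= [l (_ + _)]linearD [l (_ *: _)]linearZ.
Qed.

Local Opaque smooth_on.

Section algebra.
Context {V : normedModType R} (A : set V) (oA : open A).

(** The derivative of a product or of a composite is a sum of products of such expressions. No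
    single closure rule is stable under differentiation, but the class generated by all of them is,
    so they are proved simultaneously by coinduction. Linear maps between arbitrary normed spaces
    are included for projections and slices of products. *)
Inductive smooth_alg : (V -> R) -> Prop :=
| alg_smooth f : smooth_on A f -> smooth_alg f
| alg_add f g : smooth_alg f -> smooth_alg g -> smooth_alg (fun x => f x + g x)
| alg_mul f g : smooth_alg f -> smooth_alg g -> smooth_alg (fun x => f x * g x)
| alg_inv f : smooth_alg f -> (forall x, A x -> f x != 0) -> smooth_alg (fun x => (f x)^-1)
| alg_comp N (U : set 'rV[R]_N) (F : 'rV[R]_N -> R) (p : V -> 'rV[R]_N) :
    open U -> smooth_on U F -> (forall x, A x -> U (p x)) ->
    (forall i, smooth_on A (fun x => p x 0 i)) -> smooth_alg (F \o p)
| alg_lin (V' : normedModType R) (B : set V') (F : V' -> R) (l : {linear V -> V'}) :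
    smooth_on B F -> continuous l -> (forall x, A x -> B (l x)) -> smooth_alg (F \o l).

Lemma smooth_cst_set (c : R) : smooth_on A (fun=> c).
Proof.
refine (@smooth_coind V A (fun h => exists c, h = fun=> c) oA _ _ _ _); last by exists c.
- by move=> f [{}c ->] x _; exact: cvg_cst.
- move=> f v [{}c ->]; exists (fun=> 0); first by exists 0.
  by move=> x _; exact: is_derive_cst.
Qed.

Lemma alg_sum (I : Type) (r : seq I) (f : I -> V -> R) : (forall i, smooth_alg (f i)) ->
  smooth_alg (fun x => \sum_(i <- r) f i x).
Proof.
move=> fA; elim: r => [|i r IH].
  rewrite (_ : (fun _ => _) = fun=> 0); last by apply/funext => x; rewrite big_nil.
  by apply: alg_smooth; exact: smooth_cst_set.
rewrite (_ : (fun _ => _) = fun x => f i x + \sum_(j <- r) f j x).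
  exact: alg_add.
by apply/funext => x; rewrite big_cons.
Qed.

Lemma continuous_mx m n (p : V -> 'M[R]_(m, n)) x :
  (forall i j, {for x, continuous (fun y => p y i j)}) -> {for x, continuous p}.
Proof.
move=> pc; apply/cvgrPdist_le => e e0.
pose Q (ij : 'I_m * 'I_n) y := `|p x ij.1 ij.2 - p y ij.1 ij.2| <= e.
have : \forall y \near x, forall ij, Q ij y.
  apply: (@filter_forall V ('I_m * 'I_n)%type Q (nbhs x)) => -[i j].
  by move/cvgrPdist_le : (pc i j); exact.
apply: filterS => y H; rewrite norm_mxE ?ltW//.
by apply/forallP => i; apply/forallP => j; rewrite !mxE; exact: (H (i, j)).
Qed.

Lemma is_derive_mx m n (p : V -> 'M[R]_(m, n)) x v (d : 'M[R]_(m, n)) :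
  (forall i j, is_derive x v (fun y => p y i j) (d i j)) -> is_derive x v p d.
Proof.
move=> pd.
have D : derivable p x v by apply/derivable_mxP => i j; have [] := pd i j.
constructor => //; rewrite derive_mx//; apply/matrixP => i j; rewrite mxE.
by have [_] := pd i j.
Qed.

Lemma smooth_on_comp_derive N (U : set 'rV[R]_N) (F : 'rV[R]_N -> R) (p : V -> 'rV[R]_N) x v :
  open U -> smooth_on U F -> U (p x) ->
  (forall i, derivable (fun y => p y 0 i) x v) ->
  is_derive x v (F \o p) (\sum_i 'D_v (fun y => p y 0 i) x * pd i F (p x)).
Proof.
move=> oU FU Upx dp.
have -> : \sum_i 'D_v (fun y => p y 0 i) x * pd i F (p x) =
    \sum_i (\row_i 'D_v (fun y => p y 0 i) x) 0 i * pd i F (p x).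
  by apply: eq_bigr => i _; rewrite mxE.
apply: is_derive_comp => [i|i|].
- by apply: near_open oU Upx _ => y Uy; exact: smooth_on_derivable FU Uy.
- by apply: smooth_on_continuous Upx; exact: smooth_onD.
- apply: is_derive_mx => i j; rewrite (ord1 i) mxE.
  by constructor; first exact: dp.
Qed.

Lemma smooth_algP f : smooth_alg f -> smooth_on A f.
Proof.
move: f; apply: smooth_coind => //.
- move=> f; elim => {f}.
  + by move=> f fA x Ax; exact: smooth_on_continuous fA Ax.
  + by move=> f g _ fc _ gc x Ax; apply: cvgD; [exact: fc|exact: gc].
  + by move=> f g _ fc _ gc x Ax; apply: cvgM; [exact: fc|exact: gc].
  + by move=> f _ fc f0 x Ax; apply: cvgV; [exact: f0|exact: fc].
  + move=> N U F p oU FU AU pA x Ax; apply: continuous_comp.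
      apply: continuous_mx => i j; rewrite (ord1 i).
      exact: smooth_on_continuous (pA j) Ax.
    exact: smooth_on_continuous FU (AU _ Ax).
  + move=> V' B F l FB lc AB x Ax; apply: continuous_comp; first exact: lc.
    exact: smooth_on_continuous FB (AB _ Ax).
- move=> f v; elim => {f}.
  + move=> f fA; exists ('D_v f); first by apply: alg_smooth; exact: smooth_onD.
    by move=> x Ax; exact: smooth_on_is_derive fA Ax.
  + move=> f g _ [f' f'A ff'] _ [g' g'A gg'].
    exists (fun x => f' x + g' x); first exact: alg_add.
    by move=> x Ax; apply: is_deriveD; [exact: ff'|exact: gg'].
  + move=> f g fA [f' f'A ff'] gA [g' g'A gg'].
    exists (fun x => f x * g' x + g x * f' x); first by apply: alg_add; exact: alg_mul.
    by move=> x Ax; apply: is_deriveM; [exact: ff'|exact: gg'].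
  + move=> f fA [f' f'A ff'] f0.
    exists (fun x => (-1) * ((f x)^-1 * (f x)^-1) * f' x).
      apply: alg_mul => //; apply: alg_mul; first by apply: alg_smooth; exact: smooth_cst_set.
      by apply: alg_mul; apply: alg_inv.
    move=> x Ax; have [df dfE] := ff' x Ax; constructor.
      by apply: derivableV => //; exact: f0.
    rewrite deriveV ?f0// dfE. congr (_ * _).
    by rewrite expr2 invfM mulN1r.
  + move=> N U F p oU FU AU pA.
    exists (fun x => \sum_i 'D_v (fun y => p y 0 i) x * pd i F (p x)).
      apply: alg_sum => i; apply: alg_mul; first by apply: alg_smooth; exact: smooth_onD.
      by apply: (alg_comp oU); [exact: smooth_onD|exact: AU|exact: pA].
    move=> x Ax; apply: (smooth_on_comp_derive oU FU (AU x Ax)) => i.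
    exact: smooth_on_derivable (pA i) Ax.
  + move=> V' B F l FB lc AB; exists ('D_(l v) F \o l).
      by apply: alg_lin lc AB; exact: smooth_onD.
    move=> x Ax; apply: is_derive_linear_comp.
    exact: smooth_on_is_derive FB (AB _ Ax).
Qed.

Lemma smooth_onDr f g : smooth_on A f -> smooth_on A g -> smooth_on A (fun x => f x + g x).
Proof. by move=> fA gA; apply: smooth_algP; apply: alg_add; apply: alg_smooth. Qed.

Lemma smooth_onM f g : smooth_on A f -> smooth_on A g -> smooth_on A (fun x => f x * g x).
Proof. by move=> fA gA; apply: smooth_algP; apply: alg_mul; apply: alg_smooth. Qed.

Lemma smooth_onN f : smooth_on A f -> smooth_on A (fun x => - f x).
Proof.
move=> fA; have -> : (fun x => - f x) = (fun x => (-1) * f x).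
  by apply/funext => x; rewrite mulN1r.
by apply: smooth_onM; [exact: smooth_cst_set|exact: fA].
Qed.

Lemma smooth_onV f : smooth_on A f -> (forall x, A x -> f x != 0) ->
  smooth_on A (fun x => (f x)^-1).
Proof. by move=> fA f0; apply: smooth_algP; apply: alg_inv f0; apply: alg_smooth. Qed.

Lemma smooth_on_sum (I : Type) (r : seq I) (f : I -> V -> R) :
  (forall i, smooth_on A (f i)) -> smooth_on A (fun x => \sum_(i <- r) f i x).
Proof. by move=> fA; apply: smooth_algP; apply: alg_sum => i; apply: alg_smooth. Qed.

Lemma smooth_on_comp N (U : set 'rV[R]_N) (F : 'rV[R]_N -> R) (p : V -> 'rV[R]_N) :
  open U -> smooth_on U F -> (forall x, A x -> U (p x)) ->
  (forall i, smooth_on A (fun x => p x 0 i)) -> smooth_on A (fun x => F (p x)).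
Proof. by move=> oU FU AU pA; apply: smooth_algP; exact: (alg_comp oU). Qed.

Lemma smooth_on_linear (V' : normedModType R) (B : set V') (F : V' -> R) (l : {linear V -> V'}) :
  smooth_on B F -> continuous l -> (forall x, A x -> B (l x)) -> smooth_on A (fun x => F (l x)).
Proof. by move=> FB lc AB; apply: smooth_algP; exact: (alg_lin FB). Qed.

End algebra.
End smoothness.

(** * Antiderivatives and integrals over intervals *)

Section primitive.
Context {R : realType}.
Implicit Types (f g : R -> R) (r rho : R).

(** Continuity is asked on an open ball, usually of radius [r + 1], so that the ends of [-r, r] are
    interior points and two-sided derivatives make sense there. *)
Definition cont_ball rho f := forall x : R, `|x| < rho -> {for x, continuous f}.

(** The oriented integral from 0 to [x]: for either sign of [x] one of the two intervals is empty or
    a point. *)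
Definition prim f (x : R) : R :=
  \int[lebesgue_measure]_(t in `[0, x]) f t - \int[lebesgue_measure]_(t in `[x, 0]) f t.

Definition Int r f : R := prim f r - prim f (- r).

Lemma cont_ball_within rho f (a b : R) : cont_ball rho f -> `|a| < rho -> `|b| < rho ->
  {within `[a, b], continuous f}.
Proof.
move=> fc; rewrite !ltr_norml => /andP[a1 a2] /andP[b1 b2].
apply: continuous_in_subspaceT => x; rewrite inE/= in_itv/= => /andP[ax xb].
by apply: fc; rewrite ltr_norml; apply/andP; split; lra.
Qed.

Lemma cont_ball_integrable rho f (a b : R) : cont_ball rho f -> `|a| < rho -> `|b| < rho ->
  lebesgue_measure.-integrable `[a, b] (EFin \o f).
Proof.
move=> fc ar br; apply: continuous_compact_integrable; first exact: segment_compact.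
exact: cont_ball_within fc ar br.
Qed.

Lemma Rintegral_point_or_empty f (a b : R) : b <= a ->
  \int[lebesgue_measure]_(t in `[a, b]) f t = 0.
Proof.
move=> ba; have [ab|ab] := ltP b a.
  by rewrite set_itv_ge ?Rintegral_set0// bnd_simp -ltNge.
have -> : b = a by apply/eqP; rewrite eq_le ab ba.
by rewrite set_itv1 Rintegral_set1.
Qed.

Lemma Rintegral_itv_split rho f (c a b : R) : cont_ball rho f -> `|c| < rho -> `|b| < rho ->
  c <= a -> a <= b ->
  \int[lebesgue_measure]_(t in `[a, b]) f t =
  \int[lebesgue_measure]_(t in `[c, b]) f t - \int[lebesgue_measure]_(t in `[c, a]) f t.
Proof.
move=> fc cr br ca ab.
rewrite Rintegral_itvB ?bnd_simp//; last exact: cont_ball_integrable fc cr br.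
rewrite Rintegral_itv_obnd_cbnd//.
have ar : `|a| < rho.
  by move: cr br; rewrite !ltr_norml => /andP[? ?] /andP[? ?]; apply/andP; split; lra.
apply: (integrableS _ _ _ (cont_ball_integrable fc ar br)) => //.
by move=> x /=; rewrite !in_itv/= => /andP[/ltW -> ->].
Qed.

Lemma primE rho f (c y : R) : cont_ball rho f -> `|c| < rho -> `|y| < rho ->
  c <= 0 -> c <= y -> 
  prim f y = \int[lebesgue_measure]_(t in `[c, y]) f t - \int[lebesgue_measure]_(t in `[c, 0]) f t.
Proof.
move=> fc cr yr c0 cy; rewrite /prim.
have r0 : `|0 : R| < rho by rewrite normr0 (le_lt_trans _ yr).
have [y0|y0] := leP 0 y.
  by rewrite (Rintegral_point_or_empty _ y0) subr0; exact: Rintegral_itv_split fc cr yr c0 y0.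
rewrite (Rintegral_point_or_empty _ (ltW y0)) sub0r.
by rewrite (Rintegral_itv_split fc cr r0 cy (ltW y0)) opprB.
Qed.

Lemma prim_derive rho f (x : R) : cont_ball rho f -> `|x| < rho -> is_derive x 1 (prim f) (f x).
Proof.
move=> fc xr; have fcx := fc x xr.
move: xr; rewrite ltr_norml => /andP[x1 x2].
(* Both lie strictly inside the ball, and between them lie [x] and 0. *)
pose c := (Num.min x 0 - rho) / 2; pose d := (Num.max x 0 + rho) / 2.
have [mx m0] : Num.min x 0 <= x /\ Num.min x 0 <= 0 by rewrite !ge_min !lexx orbT.
have [Mx M0] : x <= Num.max x 0 /\ 0 <= Num.max x 0 by rewrite !le_max !lexx orbT.
have mr : - rho < Num.min x 0 by rewrite lt_min x1; lra.
have Mr : Num.max x 0 < rho by rewrite gt_max x2; lra.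
have c1 : - rho < c by rewrite /c; lra.
have c2 : c < x by rewrite /c; lra.
have c3 : c < 0 by rewrite /c; lra.
have d1 : d < rho by rewrite /d; lra.
have d2 : x < d by rewrite /d; lra.
have cr : `|c| < rho by rewrite ltr_norml; apply/andP; split; lra.
have dr : `|d| < rho by rewrite ltr_norml; apply/andP; split; lra.
have [dG GE] := @continuous_FTC1_closed R f c x d d2 (cont_ball_integrable fc cr dr) c2 fcx.
set G := (fun _ => _) in dG GE.
apply: (@near_eq_is_derive _ _ _ (fun y => G y - \int[lebesgue_measure]_(t in `[c, 0]) f t)).
  near=> y.
  have /andP[y1 y2] : c < y < d.
    by near: y; apply: near_in_itvoo; rewrite in_itv/= c2 d2.
  rewrite (primE fc cr _ (ltW c3) (ltW y1))//.
  by rewrite ltr_norml; apply/andP; split; lra.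
rewrite -GE derive1E; have dcst := is_derive_cst (\int[lebesgue_measure]_(t in `[c, 0]) f t) x 1.
have := is_deriveB (DeriveDef dG erefl) dcst.
by rewrite subr0.
Unshelve. all: by end_near. Qed.

Lemma prim0 f : prim f 0 = 0.
Proof. by rewrite /prim subrr. Qed.

Lemma derive_ball_cst rho f (a b : R) :
  (forall x : R, `|x| < rho -> is_derive x 1 f 0) -> `|a| < rho -> `|b| < rho -> f a = f b.
Proof.
move=> df ar br.
pose s := Num.max `|a| `|b|.
have as_ : `|a| <= s by rewrite le_max lexx.
have bs : `|b| <= s by rewrite le_max lexx orbT.
have sr : s < rho by rewrite gt_max ar br.
have H x : `|x| <= s -> f x = f 0.
  have d1 (t : R) : `|t| <= s -> is_derive t 1 f ((fun=> 0) t).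
    by move=> ts; apply: df; exact: le_lt_trans sr.
  have d2 (t : R) : `|t| <= s -> `|(fun=> 0) t - 0 : R| <= 0.
    by move=> _; rewrite subrr normr0.
  move=> xs; have := mvt_approx d1 d2 xs.
  rewrite mulr0 mul0r subr0 normr_le0 subr_eq0 => /eqP; exact.
by rewrite (H a as_) (H b bs).
Qed.

Lemma prim_unique rho f F (a b : R) : cont_ball rho f ->
  (forall x : R, `|x| < rho -> is_derive x 1 F (f x)) ->
  `|a| < rho -> `|b| < rho -> prim f b - prim f a = F b - F a.
Proof.
move=> fc dF ar br.
have := @derive_ball_cst rho (fun x => prim f x - F x) a b.
move=> /(_ _ ar br) H; have {H} : prim f a - F a = prim f b - F b.
  apply: H => x xr; rewrite -(subrr (f x)).
  by apply: is_deriveB; [exact: prim_derive fc xr|exact: dF].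
by move=> /eqP; rewrite subr_eq => /eqP ->; ring.
Qed.

Lemma prim_eq rho f F x : cont_ball rho f ->
  (forall y : R, `|y| < rho -> is_derive y 1 F (f y)) -> `|x| < rho -> prim f x = F x - F 0.
Proof.
move=> fc dF xr; rewrite -(prim_unique fc dF _ xr) ?prim0 ?subr0// normr0.
exact: le_lt_trans xr.
Qed.

Lemma prim_linear rho f g (c : R) x : cont_ball rho f -> cont_ball rho g -> `|x| < rho ->
  prim (fun y => c * f y + g y) x = c * prim f x + prim g x.
Proof.
move=> fc gc xr.
have lc : cont_ball rho (fun y => c * f y + g y).
  move=> y yr; apply: cvgD; last exact: gc.
  by apply: cvgM; [exact: cvg_cst|exact: fc].
have := @prim_eq rho _ (fun y => c * prim f y + prim g y) x lc _ xr.
rewrite !prim0 mulr0 addr0 subr0; apply=> y yr.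
apply: is_deriveD; last exact: prim_derive gc yr.
by apply: is_deriveZ; exact: prim_derive fc yr.
Qed.

Lemma eq_prim rho f g x : {in [pred y : R | `|y| < rho], f =1 g} -> `|x| < rho ->
  prim f x = prim g x.
Proof.
move=> fg xr; rewrite /prim; congr (_ - _); apply: eq_Rintegral => y; rewrite inE/= in_itv/= => /andP[y1 y2];
apply: fg; rewrite inE/= ltr_norml; move: xr; rewrite ltr_norml => /andP[? ?]; apply/andP; split; lra.
Qed.

Lemma prim_bound rho f (M r : R) x : cont_ball rho f -> r < rho ->
  (forall y : R, `|y| <= r -> `|f y| <= M) -> `|x| <= r -> `|prim f x| <= M * `|x|.
Proof.
move=> fc rr fM xr.
have := @mvt_approx R (prim f) f 0 M r _ _ x xr.
rewrite mulr0 subr0 prim0 subr0; apply=> t tr; last by rewrite subr0 fM.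
by apply: prim_derive fc _; exact: le_lt_trans rr.
Qed.

End primitive.

Section line_integrals.
Context {R : realType}.
Implicit Types (f : R -> R) (r : R).

Definition supported r f := forall x : R, r < `|x| -> f x = 0.

Lemma eq_Int r f g : 0 <= r -> (forall x, `|x| <= r -> f x = g x) -> Int r f = Int r g.
Proof.
move=> r0 fg; rewrite /Int /prim.
by congr (_ - _ - (_ - _)); apply: eq_Rintegral => x; rewrite inE/= in_itv/= => /andP[? ?];
  apply: fg; rewrite ler_norml; apply/andP; split; lra.
Qed.

Lemma Int_derive r f F : 0 <= r -> cont_ball (r + 1) f ->
  (forall x : R, `|x| < r + 1 -> is_derive x 1 F (f x)) -> Int r f = F r - F (- r).
Proof.
move=> r0 fc dF; apply: (prim_unique fc dF); rewrite ?normrN ger0_norm//; lra.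
Qed.

Lemma Int_linear r f g (c : R) : 0 <= r -> cont_ball (r + 1) f -> cont_ball (r + 1) g ->
  Int r (fun x => c * f x + g x) = c * Int r f + Int r g.
Proof.
move=> r0 fc gc; rewrite /Int !(prim_linear c fc gc) ?normrN ?ger0_norm//; lra.
Qed.

Lemma cont_ballD rho f g : cont_ball rho f -> cont_ball rho g -> cont_ball rho (fun x => f x + g x).
Proof. by move=> fc gc x xr; apply: cvgD; [exact: fc|exact: gc]. Qed.

Lemma cont_ballM rho f g : cont_ball rho f -> cont_ball rho g -> cont_ball rho (fun x => f x * g x).
Proof. by move=> fc gc x xr; apply: cvgM; [exact: fc|exact: gc]. Qed.

Lemma cont_ballN rho f : cont_ball rho f -> cont_ball rho (fun x => - f x).
Proof. by move=> fc x xr; apply: cvgN; exact: fc. Qed.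

Lemma cont_ball_cst rho (c : R) : cont_ball rho (fun=> c).
Proof. by move=> x _; exact: cvg_cst. Qed.

Lemma cont_ball_sum rho I (s : seq I) (f : I -> R -> R) :
  (forall i, cont_ball rho (f i)) -> cont_ball rho (fun x => \sum_(i <- s) f i x).
Proof.
move=> fc; elim: s => [|i s IH].
  by under eq_fun do rewrite big_nil; exact: cont_ball_cst.
by under eq_fun do rewrite big_cons; exact: cont_ballD.
Qed.

Lemma IntD r f g : 0 <= r -> cont_ball (r + 1) f -> cont_ball (r + 1) g ->
  Int r (fun x => f x + g x) = Int r f + Int r g.
Proof.
move=> r0 fc gc; have := Int_linear 1 r0 fc gc; rewrite mul1r => <-.
by apply: eq_Int => // x _; rewrite mul1r.
Qed.

Lemma Int_cst0 r : Int r (fun=> 0 : R) = 0.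
Proof.
rewrite /Int /prim.
have E (a b : R) : \int[lebesgue_measure]_(t in `[a, b]) (0 : R) = 0.
  by rewrite /Rintegral integral0.
by rewrite !E; ring.
Qed.

Lemma IntZ r f (c : R) : 0 <= r -> cont_ball (r + 1) f ->
  Int r (fun x => c * f x) = c * Int r f.
Proof.
move=> r0 fc; have := Int_linear c r0 fc (@cont_ball_cst (r + 1) 0).
by rewrite Int_cst0 addr0 => <-; apply: eq_Int => // x _; rewrite addr0.
Qed.

Lemma IntN r f : 0 <= r -> cont_ball (r + 1) f -> Int r (fun x => - f x) = - Int r f.
Proof.
move=> r0 fc; have := IntZ (-1) r0 fc; rewrite mulN1r => <-.
by apply: eq_Int => // x _; rewrite mulN1r.
Qed.

Lemma IntB r f g : 0 <= r -> cont_ball (r + 1) f -> cont_ball (r + 1) g ->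
  Int r (fun x => f x - g x) = Int r f - Int r g.
Proof.
by move=> r0 fc gc; rewrite -IntN// -IntD//; exact: cont_ballN.
Qed.

Lemma Int_sum r I (s : seq I) (f : I -> R -> R) : 0 <= r ->
  (forall i, cont_ball (r + 1) (f i)) ->
  Int r (fun x => \sum_(i <- s) f i x) = \sum_(i <- s) Int r (f i).
Proof.
move=> r0 fc; elim: s => [|i s IH].
  by rewrite big_nil -[RHS](Int_cst0 r); apply: eq_Int => // x _; rewrite big_nil.
rewrite big_cons -IH -IntD//; last exact: cont_ball_sum.
by apply: eq_Int => // x _; rewrite big_cons.
Qed.

Lemma Int_bound r f (M : R) : 0 <= r -> cont_ball (r + 1) f ->
  (forall y : R, `|y| <= r -> `|f y| <= M) -> `|Int r f| <= 2 * M * r.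
Proof.
move=> r0 fc fM; rewrite /Int (le_trans (ler_normB _ _))//.
have rr : r < r + 1 by rewrite ltrDl.
have := prim_bound fc rr fM (x := r); have := prim_bound fc rr fM (x := - r).
by rewrite normrN (ger0_norm r0) => /(_ (lexx _)) H1 /(_ (lexx _)) H2; lra.
Qed.

Lemma Int_itv r f : 0 <= r -> cont_ball (r + 1) f ->
  \int[lebesgue_measure]_(t in `[- r, r]) f t = Int r f.
Proof.
move=> r0 fc.
have r1 : `|r| < r + 1 by rewrite ger0_norm//; lra.
have r2 : `|- r| < r + 1 by rewrite normrN.
rewrite /Int (primE fc r2 r1) ?(primE fc r2 r2); try lra.
by rewrite opprB [X in _ = _ - _ + (_ - X)]Rintegral_point_or_empty// subr0 subrK.
Qed.

Lemma supported_Rintegral r f : 0 <= r -> cont_ball (r + 1) f -> supported r f ->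
  \int[lebesgue_measure]_x f x = Int r f.
Proof.
move=> r0 fc fs; rewrite -Int_itv// [RHS]Rintegral_mkcond; apply: eq_Rintegral => x _.
rewrite /patch; case: ifPn => //; rewrite notin_setE/= in_itv/= => /negP.
by rewrite -ler_norml -ltNge => /fs.
Qed.

Lemma prim_supported r f (x : R) : 0 <= r -> cont_ball (r + 1) f -> supported r f ->
  `|x| < r + 1 -> (x <= - r -> prim f x = prim f (- r)) /\ (r <= x -> prim f x = prim f r).
Proof.
move=> r0 fc fs xr.
have H (a b : R) : a <= b -> `|a| < r + 1 -> `|b| < r + 1 ->
    (forall t, a < t -> t < b -> f t = 0) -> prim f b = prim f a.
  move=> ab ar br f0.
  have inr t : a <= t -> t <= b -> `|t| < r + 1.
    by move: ar br; rewrite !ltr_norml => /andP[? ?] /andP[? ?] ? ?; apply/andP; split; lra.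
  have [||c _ /eqP] := @MVT_segment R (prim f) (fun=> 0) a b ab.
  - move=> t; rewrite in_itv/= => /andP[t1 t2]; rewrite -(f0 t t1 t2).
    by apply: prim_derive fc (inr t (ltW t1) (ltW t2)).
  - apply: derivable_within_continuous => t; rewrite in_itv/= => /andP[t1 t2].
    by have [] := prim_derive fc (inr t t1 t2).
  - by rewrite mul0r subr_eq0 => /eqP.
have r1 : `|r| < r + 1 by rewrite ger0_norm//; lra.
have r2 : `|- r| < r + 1 by rewrite normrN.
split=> h.
  apply/esym; apply: H => // t t1 t2; apply: fs; rewrite ltr_normr; apply/orP; right; lra.
apply: H => // t t1 t2; apply: fs; rewrite ltr_normr; apply/orP; left; lra.
Qed.

(** Subtracting the mean of the end values makes the values at [r] and [-r] opposite: this is the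
    normalization of the antiderivative encoded by the kernel sgn(x - y) / 2, written without
    half-lines. *)
Lemma supported_Dinv r f (x : R) : 0 <= r -> cont_ball (r + 1) f -> supported r f ->
  `|x| < r + 1 -> Dinv f x = prim f x - 2^-1 * (prim f r + prim f (- r)).
Proof.
move=> r0 fc fs xr.
(* The half-lines are cut at [-s] and [s]: beyond the support and beyond [x], yet inside the ball of
   continuity. *)
pose s := (Num.max r `|x| + (r + 1)) / 2.
have [s1 s2] : r <= Num.max r `|x| /\ `|x| <= Num.max r `|x| by rewrite !le_max !lexx orbT.
have s3 : Num.max r `|x| < r + 1 by rewrite gt_max xr andbT; lra.
have rs : r < s by rewrite /s; lra.
have xs : `|x| < s by rewrite /s; lra.
have s0 : 0 <= s by lra.
have sr : `|s| < r + 1 by rewrite ger0_norm// /s; lra.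
have sr' : `|- s| < r + 1 by rewrite normrN.
have [x1 x2] : - s < x /\ x < s by move: xs; rewrite ltr_norml => /andP.
have fs' y : s < `|y| -> f y = 0 by move=> sy; apply: fs; exact: lt_trans sy.
have E1 : \int[lebesgue_measure]_(y in `]-oo, x]) f y = prim f x - prim f (- s).
  rewrite (primE fc sr' xr) ?(primE fc sr' sr'); try lra.
  rewrite opprB [X in _ = _ - _ + (_ - X)]Rintegral_point_or_empty// subr0 subrK.
  rewrite Rintegral_mkcond [RHS]Rintegral_mkcond; apply: eq_Rintegral => y _.
  rewrite /patch !mem_setE !in_itv/=; case: (leP y x) => yx; rewrite ?andbT ?andbF//.
  by case: leP => // ys; apply: fs'; rewrite ltr_normr; apply/orP; right; lra.
have E2 : \int[lebesgue_measure]_(y in `[x, +oo[) f y = prim f s - prim f x.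
  rewrite (primE fc sr' xr) ?(primE fc sr' sr); try lra.
  rewrite opprB addrA subrK -(Rintegral_itv_split fc sr' sr); try lra.
  rewrite Rintegral_mkcond [RHS]Rintegral_mkcond; apply: eq_Rintegral => y _.
  rewrite /patch !mem_setE !in_itv/=; case: (leP x y) => yx; rewrite ?andbT//.
  by case: leP => // ys; apply: fs'; rewrite ltr_normr; apply/orP; left; lra.
have [/(_ _) P1 _] := prim_supported r0 fc fs sr'.
have [_ /(_ _) P2] := prim_supported r0 fc fs sr.
rewrite /Dinv E1 E2 P1; last by lra.
by rewrite P2; last lra; field.
Qed.

End line_integrals.

(** * First-order expansions that are uniform on a compact interval *)

Section uniform.
Context {R : realType}.

(** The projection as a bundled linear map, the form in which [smooth_on_linear] can use it. *)
Lemma fst_linear_cont {V W : normedModType R} :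
  exists l : {linear (V * W)%type -> V}, (l =1 fst) /\ continuous l.
Proof.
have H : linear (fst : (V * W)%type -> V) by [].
exists (HB.pack_for {linear (V * W)%type -> V} (fst : (V * W)%type -> V) (GRing.isLinear.Build R (V * W)%type V *:%R fst H)).
split=> // x; exact: cvg_fst.
Qed.

Lemma snd_linear_cont {V W : normedModType R} :
  exists l : {linear (V * W)%type -> W}, (l =1 snd) /\ continuous l.
Proof.
have H : linear (snd : (V * W)%type -> W) by [].
exists (HB.pack_for {linear (V * W)%type -> W} (snd : (V * W)%type -> W) (GRing.isLinear.Build R (V * W)%type W *:%R snd H)).
split=> // x; exact: cvg_snd.
Qed.

Lemma smooth_on_linfun {V : normedModType R} (A : set V) (l : {linear V -> R}) :
  open A -> continuous l -> smooth_on A l.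
Proof.
move=> oA lc; apply: (@smooth_of_derive _ _ _ _ (fun v _ => l v)).
- by move=> x _; exact: lc.
- move=> x v _; apply/is_derive_approxP => eta eta0.
  apply: filterS (@near0_norm_lt R R 1 ltr01) => h _.
  rewrite [l (_ + _)]linearD [l (_ *: _)]linearZ /= [X in `|X|](_ : _ = 0).
    by rewrite normr0 mulr_ge0// ltW.
  by rewrite /GRing.scale/=; ring.
- exact: oA.
- by move=> v; exact: smooth_cst_set.
Qed.

Lemma pair_line {V W : normedModType R} (x a : V) (y : W) (h : R) :
  (x, y) + h *: (a, 0) = (x + h *: a, y).
Proof. by congr pair; rewrite /= scaler0 addr0. Qed.

Context {W : normedModType R}.
Implicit Types (O : set (W * R)%type) (phi : (W * R)%type -> R) (sb a b : W) (r : R).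

(** A local statement at each point of [-K, K] becomes uniform, by the near-covering form of
    compactness. *)
Lemma compact_unif (K : R) (P : R -> R -> Prop) :
  (forall x, `|x| <= K -> exists2 e : R, 0 < e &
     forall d y, `|y - x| < e -> `|d| < e -> P d y) ->
  exists2 d0 : R, 0 < d0 & forall d y, `|d| < d0 -> `|y| <= K -> P d y.
Proof.
move=> H; have /compact_near_coveringP cK := @segment_compact R (- K) K.
have [|e /= e0 eP] := @cK R (nbhs (0 : R)) P _ _; last first.
- exists e => // d y de yK; apply: (eP d) => /=; last by rewrite in_itv/= -ler_norml.
  by rewrite sub0r normrN.
- move=> x /=; rewrite in_itv/= -ler_norml => /H[e e0 eP].
  exists ([set y | `|y - x| < e], [set d | `|d| < e]) => /=.
    split; first by apply/nbhs_ballP; exists e => // y; rewrite -ball_normE/= distrC.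
    exact: (@near0_norm_lt R R e e0).
  by move=> [y d] /= [ye de]; exact: eP.
Qed.

Lemma unif_close O phi sb a b r (eta : R) : open O ->
  (forall q, O q -> {for q, continuous phi}) -> (forall x, `|x| <= r -> O (sb, x)) -> 0 < eta ->
  exists2 d : R, 0 < d & forall s t x, `|s| < d -> `|t| < d -> `|x| <= r ->
    O (sb + s *: a + t *: b, x) /\ `|phi (sb + s *: a + t *: b, x) - phi (sb, x)| <= eta.
Proof.
move=> oO pc sO eta0.
pose P (d x : R) := forall s t, `|s| <= `|d| -> `|t| <= `|d| ->
  O (sb + s *: a + t *: b, x) /\ `|phi (sb + s *: a + t *: b, x) - phi (sb, x)| <= eta.
have [x xr|d0 d00 H] := @compact_unif r P; last first.
  exists d0 => // s t x sd td xr.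
  have m0 : 0 <= Num.max `|s| `|t| by rewrite le_max normr_ge0.
  by apply: (H (Num.max `|s| `|t|) x); rewrite ?(ger0_norm m0) ?le_max ?lexx ?orbT ?gt_max ?sd.
have Ox := sO x xr.
have e20 : 0 < eta / 2 by rewrite divr_gt0.
have /cvgrPdist_le/(_ _ e20) C := pc _ Ox.
have /(filterI C)/nbhs_ballP[e/= e0 eB] := open_nbhs_nbhs (conj oO Ox).
pose K := `|a| + `|b| + 1.
have K1 : 1 <= K by rewrite lerDr addr_ge0.
have K0 : 0 < K by rewrite (lt_le_trans ltr01).
exists (e / K); first by rewrite divr_gt0.
have eK : e / K <= e by rewrite ler_pdivrMr// ler_peMr// ltW.
move=> d y ye; rewrite ltr_pdivlMr// => de s t sd td.
have inB s' t' : `|s'| <= `|d| -> `|t'| <= `|d| -> ball (sb, x) e (sb + s' *: a + t' *: b, y).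
  move=> sd' td'; split; rewrite -ball_normE/=; last by rewrite distrC (lt_le_trans ye).
  rewrite opprD opprD addrA addrA subrr sub0r -opprD normrN.
  apply: le_lt_trans de; rewrite (le_trans (ler_normD _ _))// !normrZ /K !mulrDr mulr1.
  by rewrite -[leLHS]addr0 lerD// lerD// ler_wpM2r.
have [h1 h2] := eB _ (inB s t sd td).
have z0 : `|0 : R| <= `|d| by rewrite normr0.
have [h3 _] := eB _ (inB 0 0 z0 z0).
split=> //; move: h1 h3; rewrite !scale0r !addr0 /= => h1 h3.
rewrite -(subrKA (phi (sb, x))) (le_trans (ler_normD _ _))// (splitr eta) lerD//.
by rewrite distrC.
Qed.

(** Two mean value estimates, along [b] and then along [a], with the partial derivatives uniformly
    close to their values at [sb] by [unif_close]. *)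
Lemma smooth_unif_expand O phi sb a b r (eta : R) : open O -> smooth_on O phi ->
  (forall x, `|x| <= r -> O (sb, x)) -> 0 < eta ->
  exists2 d : R, 0 < d & forall s t x, `|s| < d -> `|t| < d -> `|x| <= r ->
    `|phi (sb + s *: a + t *: b, x) - phi (sb, x)
       - s * 'D_(a, 0) phi (sb, x) - t * 'D_(b, 0) phi (sb, x)| <= eta * (`|s| + `|t|).
Proof.
move=> oO pO sO eta0.
have ca q : O q -> {for q, continuous ('D_(a, 0) phi)}.
  by move=> Oq; apply: smooth_on_continuous Oq; exact: smooth_onD.
have cb q : O q -> {for q, continuous ('D_(b, 0) phi)}.
  by move=> Oq; apply: smooth_on_continuous Oq; exact: smooth_onD.
have [d1 d10 H1] := unif_close a b oO ca sO eta0.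
have [d2 d20 H2] := unif_close a b oO cb sO eta0.
exists (Num.min d1 d2) => [|s t x]; first by rewrite lt_min d10.
rewrite !lt_min => /andP[s1 s2] /andP[t1 t2] xr.
have z0 : `|0 : R| < d2 by rewrite normr0.
have E1 : `|phi (sb + s *: a + t *: b, x) - phi (sb + t *: b, x) -
    s * 'D_(a, 0) phi (sb, x)| <= eta * `|s|.
  have := @mvt_approx R (fun h : R => phi (sb + h *: a + t *: b, x))
    (fun h : R => 'D_(a, 0) phi (sb + h *: a + t *: b, x)) ('D_(a, 0) phi (sb, x)) eta `|s|.
  rewrite scale0r addr0; apply=> // h hs.
    have Oh := (H1 h t x (le_lt_trans hs s1) t1 xr).1.
    have E h' : (sb + h' *: a + t *: b, x) = (sb + t *: b, x) + h' *: (a, 0 : R).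
      by rewrite pair_line addrAC.
    rewrite (_ : (fun _ => _) = fun h' => phi ((sb + t *: b, x) + h' *: (a, 0 : R))).
      apply: (is_derive_line phi (sb + t *: b, x) (a, 0 : R) h _).1.
      by rewrite -!E; exact: smooth_on_is_derive pO Oh.
    by apply/funext => h'; rewrite E.
  exact: (H1 h t x (le_lt_trans hs s1) t1 xr).2.
have E2 : `|phi (sb + t *: b, x) - phi (sb, x) - t * 'D_(b, 0) phi (sb, x)| <= eta * `|t|.
  have := @mvt_approx R (fun h : R => phi (sb + h *: b, x))
    (fun h : R => 'D_(b, 0) phi (sb + h *: b, x)) ('D_(b, 0) phi (sb, x)) eta `|t|.
  rewrite scale0r addr0; apply=> // h ht; have := H2 0 h x z0 (le_lt_trans ht t2) xr;
    rewrite scale0r addr0 => -[Oh Hh] //.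
  have E h' : (sb + h' *: b, x) = (sb, x) + h' *: (b, 0 : R).
    by rewrite pair_line.
  rewrite (_ : (fun _ => _) = fun h' => phi ((sb, x) + h' *: (b, 0 : R))).
    apply: (is_derive_line phi (sb, x) (b, 0 : R) h _).1.
    by rewrite -!E; exact: smooth_on_is_derive pO Oh.
  by apply/funext => h'; rewrite E.
rewrite mulrDr; apply: le_trans (lerD E1 E2); apply: le_trans (ler_normD _ _).
by rewrite le_eqVlt; apply/orP; left; apply/eqP; congr (`|_|); ring.
Qed.

End uniform.

(** * Symmetry of mixed derivatives *)

Section young.
Context {R : realType}.

(** The second difference over a square of side h is computed in both orders: it is [h * h * a2] and
    also [h * h * b1], up to o(h * h). Only differentiability of the two first derivatives at the
    origin enters, so the lemma applies to second variations of functionals as well as to second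
    derivatives of functions. *)
Lemma young (f A B : R -> R -> R) (r a1 a2 b1 b2 : R) : 0 < r ->
  (forall s t : R, `|s| < r -> `|t| < r -> is_derive s 1 (f ^~ t) (A s t)) ->
  (forall s t : R, `|s| < r -> `|t| < r -> is_derive t 1 (f s) (B s t)) ->
  (forall eta : R, 0 < eta -> exists2 d : R, 0 < d & forall s t, `|s| < d -> `|t| < d ->
    `|A s t - A 0 0 - s * a1 - t * a2| <= eta * (`|s| + `|t|)) ->
  (forall eta : R, 0 < eta -> exists2 d : R, 0 < d & forall s t, `|s| < d -> `|t| < d ->
    `|B s t - B 0 0 - s * b1 - t * b2| <= eta * (`|s| + `|t|)) ->
  a2 = b1.
Proof.
move=> r0 fA fB eA eB; apply/eqP; rewrite -subr_eq0 -normr_le0.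
apply/ler_addgt0Pl => eps eps0; rewrite addr0.
(* Each evaluation of the second difference is off by at most [3 * (eps / 6) * h * h]; the two
   errors together make [eps * h * h]. *)
have eta0 : 0 < eps / 6 by rewrite divr_gt0.
have [d1 d10 H1] := eA _ eta0; have [d2 d20 H2] := eB _ eta0.
pose h := Num.min r (Num.min d1 d2) / 2.
have m0 : 0 < Num.min r (Num.min d1 d2) by rewrite !lt_min r0 d10.
have h0 : 0 < h by rewrite divr_gt0.
have hm : h < Num.min r (Num.min d1 d2) by rewrite /h; lra.
move: (hm); rewrite !lt_min => /andP[hr /andP[hd1 hd2]].
have nh : `|h| = h by rewrite ger0_norm// ltW.
have z (c : R) : 0 < c -> `|0 : R| < c by rewrite normr0.
have P1 : `|(f h h - f h 0) - (f 0 h - f 0 0) - h * (h * a2)| <= 3 * (eps / 6) * h * h.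
  have := @mvt_approx R (fun s => f s h - f s 0) (fun s => A s h - A s 0) (h * a2)
    (3 * (eps / 6) * h) h _ _ h.
  rewrite nh; apply=> // s sh.
    by apply: is_deriveB; apply: fA; rewrite ?nh ?z//; exact: le_lt_trans hr.
  have s1 := le_lt_trans sh hd1; have hh1 : `|h| < d1 by rewrite nh.
  have := H1 s h s1 hh1; have := H1 s 0 s1 (z _ d10).
  rewrite nh normr0 mul0r subr0 addr0 => X1 X2.
  have -> : A s h - A s 0 - h * a2 =
    (A s h - A 0 0 - s * a1 - h * a2) - (A s 0 - A 0 0 - s * a1) by ring.
  apply: (le_trans (ler_normB _ _)).
  have : eps / 6 * `|s| <= eps / 6 * h by rewrite ler_wpM2l// ltW.
  by move: X1 X2; rewrite mulrDr; nra.
have P2 : `|(f h h - f 0 h) - (f h 0 - f 0 0) - h * (h * b1)| <= 3 * (eps / 6) * h * h.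
  have := @mvt_approx R (fun t => f h t - f 0 t) (fun t => B h t - B 0 t) (h * b1)
    (3 * (eps / 6) * h) h _ _ h.
  rewrite nh; apply=> // s sh.
    by apply: is_deriveB; apply: fB; rewrite ?nh ?z//; exact: le_lt_trans hr.
  have s1 := le_lt_trans sh hd2; have hh1 : `|h| < d2 by rewrite nh.
  have := H2 h s hh1 s1; have := H2 0 s (z _ d20) s1.
  rewrite nh normr0 mul0r subr0 add0r => X1 X2.
  have -> : B h s - B 0 s - h * b1 =
    (B h s - B 0 0 - h * b1 - s * b2) - (B 0 s - B 0 0 - s * b2) by ring.
  apply: (le_trans (ler_normB _ _)).
  have : eps / 6 * `|s| <= eps / 6 * h by rewrite ler_wpM2l// ltW.
  by move: X1 X2; rewrite mulrDr; nra.
have hh : 0 < h * h by rewrite mulr_gt0.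
rewrite -(ler_pM2r hh) -[X in _ * X <= _](gtr0_norm hh) -normrM.
have -> : (a2 - b1) * (h * h) = ((f h h - f 0 h) - (f h 0 - f 0 0) - h * (h * b1)) -
  ((f h h - f h 0) - (f 0 h - f 0 0) - h * (h * a2)) by ring.
by apply: (le_trans (ler_normB _ _)); apply: le_trans (lerD P2 P1) _; lra.
Qed.

(** A dummy real coordinate is added so that the uniform expansions, stated on a product with R,
    apply with the interval reduced to a point. *)
Lemma smooth_derive_sym {V : normedModType R} (U : set V) (F : V -> R) x v w :
  open U -> smooth_on U F -> U x -> 'D_v ('D_w F) x = 'D_w ('D_v F) x.
Proof.
move=> oU FU Ux.
have [l [lE lc]] := @fst_linear_cont R V R.
pose O : set (V * R)%type := [set p | U p.1].
have oO : open O by apply: open_comp => // p _; exact: cvg_fst.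
have lift G : smooth_on U G -> smooth_on O (fun p : (V * R)%type => G p.1).
  move=> GU; rewrite (_ : (fun _ => _) = fun p => G (l p)).
    by apply: (smooth_on_linear oO GU lc) => p; rewrite lE.
  by apply/funext => p; rewrite lE.
have dlift G a : smooth_on U G -> 'D_(a, 0 : R) (fun p : (V * R)%type => G p.1) (x, 0) = 'D_a G x.
  move=> GU; have [_ <-] : is_derive ((x, 0) : (V * R)%type) (a, 0 : R) (fun p : (V * R)%type => G p.1) ('D_a G x).
    apply/is_derive_approxP => eta eta0 /=.
    by have /is_derive_approxP/(_ _ eta0) := smooth_on_is_derive a GU Ux.
  by [].
have O0 y : `|y| <= 0 -> O (x, y) by [].
have exp G (eta : R) : smooth_on U G -> 0 < eta -> exists2 d : R, 0 < d & forall s t, `|s| < d -> `|t| < d ->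
    `|G (x + s *: w + t *: v) - G x - s * 'D_w G x - t * 'D_v G x| <= eta * (`|s| + `|t|).
  move=> GU eta0; have [d d0 H] := smooth_unif_expand w v oO (lift G GU) O0 eta0.
  exists d => // s t sd td; have n0 : `|0 : R| <= 0 by rewrite normr0.
  by have := H s t 0 sd td n0; rewrite /= !dlift.
have [r r0 near] : exists2 r : R, 0 < r & forall s t : R, `|s| < r -> `|t| < r -> U (x + s *: w + t *: v).
  have cst q : O q -> {for q, continuous (fun _ : (V * R)%type => 0 : R)} by move=> _; exact: cvg_cst.
  have [d d0 H] := unif_close w v oO cst O0 ltr01.
  by exists d => // s t sd td; have := (H s t 0 sd td); rewrite normr0 lexx => /(_ isT)[].
have := @young (fun s t => F (x + s *: w + t *: v)) (fun s t => 'D_w F (x + s *: w + t *: v))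
  (fun s t => 'D_v F (x + s *: w + t *: v)) r ('D_w ('D_w F) x) ('D_v ('D_w F) x) ('D_w ('D_v F) x) ('D_v ('D_v F) x) r0.
apply.
- move=> s t sr tr; rewrite (_ : (fun _ => _) = fun s => F ((x + t *: v) + s *: w)); last first.
    by apply/funext => s'; rewrite addrAC.
  apply: (is_derive_line F _ w s _).1; rewrite addrAC.
  exact: smooth_on_is_derive FU (near s t sr tr).
- move=> s t sr tr; apply: (is_derive_line F _ v t _).1.
  exact: smooth_on_is_derive FU (near s t sr tr).
- by move=> eta eta0; rewrite !scale0r !addr0; apply: (exp _ _ _ eta0); exact: smooth_onD.
- by move=> eta eta0; rewrite !scale0r !addr0; apply: (exp _ _ _ eta0); exact: smooth_onD.
Qed.

Lemma smooth_derive_sum {N : nat} (U : set 'rV[R]_N) (F : 'rV[R]_N -> R) x v :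
  open U -> smooth_on U F -> U x -> 'D_v F x = \sum_i v 0 i * pd i F x.
Proof.
move=> oU FU Ux.
have [_ <-] : is_derive x v (F \o id) (\sum_i v 0 i * pd i F x); last by [].
apply: is_derive_comp => i.
- by apply: near_open oU Ux _ => y Uy; exact: smooth_on_derivable FU Uy.
- by apply: smooth_on_continuous Ux; exact: smooth_onD.
Qed.

End young.

(** * Differentiation in a parameter, uniformly on an interval *)

Section UD.
Context {R : realType}.
Implicit Types (phi psi : R -> R -> R) (r : R).

(* A first-order expansion in the parameter, uniform on [-r, r]; unlike joint
   smoothness this passes to antiderivatives in x without further work. *)
Record UD r phi (dphi : R -> R) : Prop := {
  UD_cont : exists2 d : R, 0 < d & forall e, `|e| < d -> cont_ball (r + 1) (phi e);
  UD_dcont : cont_ball (r + 1) dphi;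
  UD_exp : forall eta : R, 0 < eta -> exists2 d : R, 0 < d & forall e x, `|e| < d -> `|x| <= r ->
    `|phi e x - phi 0 x - e * dphi x| <= eta * `|e| }.

Lemma UD_cont0 r phi dphi : UD r phi dphi -> cont_ball (r + 1) (phi 0).
Proof. by case=> -[d d0 H] _ _; apply: H; rewrite normr0. Qed.

Lemma UD_eq r phi psi dphi dpsi : UD r phi dphi ->
  (forall e x, phi e x = psi e x) -> (forall x, dphi x = dpsi x) -> UD r psi dpsi.
Proof.
by move=> H /funeq2P <- /funext <-.
Qed.

Lemma UD_cst r (f : R -> R) : cont_ball (r + 1) f -> UD r (fun=> f) (fun=> 0).
Proof.
move=> fc; split; [by exists 1|exact: cont_ball_cst|move=> eta eta0; exists 1 => // e x _ _].
by rewrite mulr0 subr0 subrr normr0 mulr_ge0// ltW.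
Qed.

Lemma UD_line r (f a : R -> R) : cont_ball (r + 1) f -> cont_ball (r + 1) a ->
  UD r (fun e x => f x + e * a x) a.
Proof.
move=> fc ac; split=> //.
  exists 1 => // e _; apply: cont_ballD => //; apply: cont_ballM => //; exact: cont_ball_cst.
move=> eta eta0; exists 1 => // e x _ _.
rewrite [X in `|X|](_ : _ = 0); last by ring.
by rewrite normr0 mulr_ge0// ltW.
Qed.

Lemma UDD r phi psi dphi dpsi : UD r phi dphi -> UD r psi dpsi ->
  UD r (fun e x => phi e x + psi e x) (fun x => dphi x + dpsi x).
Proof.
move=> [[d1 d10 c1] e1 a1] [[d2 d20 c2] e2 a2]; split.
- exists (Num.min d1 d2) => [|e]; first by rewrite lt_min d10.
  by rewrite lt_min => /andP[h1 h2]; apply: cont_ballD; [exact: c1|exact: c2].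
- exact: cont_ballD.
- move=> eta eta0; have h0 : 0 < eta / 2 by rewrite divr_gt0.
  have [b1 b10 H1] := a1 _ h0; have [b2 b20 H2] := a2 _ h0.
  exists (Num.min b1 b2) => [|e x]; first by rewrite lt_min b10.
  rewrite lt_min => /andP[h1 h2] xr.
  rewrite (splitr eta) mulrDl; apply: le_trans (lerD (H1 _ _ h1 xr) (H2 _ _ h2 xr)).
  by apply: le_trans (ler_normD _ _); rewrite le_eqVlt; apply/orP; left; apply/eqP; congr (`|_|); ring.
Qed.

Lemma cont_ball_bounded r f : cont_ball (r + 1) f ->
  exists2 M : R, 0 < M & forall x, `|x| <= r -> `|f x| <= M.
Proof.
move=> fc; have [r0|r0] := ltP r 0.
  by exists 1 => // x xr; have := le_lt_trans xr r0; rewrite normr_lt0.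
have rr : - r <= r by lra.
have r1 : `|r| < r + 1 by rewrite ger0_norm//; lra.
have r2 : `|- r| < r + 1 by rewrite normrN.
have fw := cont_ball_within fc r2 r1.
have nw : {within `[- r, r], continuous (fun x => `|f x|)}.
  move=> x; apply: continuous_comp; first exact: fw.
  exact: norm_continuous.
have [c _ H] := EVT_max rr nw.
exists (`|f c| + 1) => [|x xr]; first by rewrite ltr_wpDl.
by rewrite (le_trans (H x _)) ?lerDl// in_itv/= -ler_norml.
Qed.

Lemma UDM r phi psi dphi dpsi : UD r phi dphi -> UD r psi dpsi ->
  UD r (fun e x => phi e x * psi e x) (fun x => dphi x * psi 0 x + phi 0 x * dpsi x).
Proof.
move=> P Q; have p0 := UD_cont0 P; have q0 := UD_cont0 Q; move: P Q.
move=> [[d1 d10 c1] e1 a1] [[d2 d20 c2] e2 a2]; split.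
- exists (Num.min d1 d2) => [|e]; first by rewrite lt_min d10.
  by rewrite lt_min => /andP[h1 h2]; apply: cont_ballM; [exact: c1|exact: c2].
- by apply: cont_ballD; apply: cont_ballM.
move=> eta eta0.
have [M1 M10 HM1] := cont_ball_bounded p0; have [M2 M20 HM2] := cont_ball_bounded q0.
have [M3 M30 HM3] := cont_ball_bounded e1; have [M4 M40 HM4] := cont_ball_bounded e2.
have h1 : 0 < Num.min 1 (eta / 3 / M2) by rewrite lt_min ltr01 !divr_gt0.
have h2 : 0 < Num.min 1 (eta / 3 / M1) by rewrite lt_min ltr01 !divr_gt0.
have [b1 b10 H1] := a1 _ h1; have [b2 b20 H2] := a2 _ h2.
(* This bound on [e] makes the product of the two increments, which is of second order, smaller than
   [eta / 3 * |e|]. *)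
pose b3 := eta / 3 / ((1 + M3) * (1 + M4)).
have b30 : 0 < b3 by rewrite !divr_gt0// mulr_gt0// ltr_wpDl// ltW.
exists (Num.min b1 (Num.min b2 b3)) => [|e x]; first by rewrite !lt_min b10 b20.
rewrite !lt_min => /and3P[l1 l2 l3] xr.
have {}H1 := H1 _ _ l1 xr; have {}H2 := H2 _ _ l2 xr.
have X1 : `|phi e x - phi 0 x - e * dphi x| <= `|e|.
  by apply: le_trans H1 _; rewrite ler_piMl// ge_min lexx.
have X2 : `|psi e x - psi 0 x - e * dpsi x| <= `|e|.
  by apply: le_trans H2 _; rewrite ler_piMl// ge_min lexx.
have Y1 : `|phi e x - phi 0 x - e * dphi x| <= eta / 3 / M2 * `|e|.
  by apply: le_trans H1 _; rewrite ler_wpM2r// ge_min lexx orbT.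
have Y2 : `|psi e x - psi 0 x - e * dpsi x| <= eta / 3 / M1 * `|e|.
  by apply: le_trans H2 _; rewrite ler_wpM2r// ge_min lexx orbT.
have Z1 : `|phi e x - phi 0 x| <= (1 + M3) * `|e|.
  rewrite -(subrK (e * dphi x) (phi e x - phi 0 x)) mulrDl mul1r (le_trans (ler_normD _ _))// lerD//.
  by rewrite normrM mulrC ler_wpM2r// HM3.
have Z2 : `|psi e x - psi 0 x| <= (1 + M4) * `|e|.
  rewrite -(subrK (e * dpsi x) (psi e x - psi 0 x)) mulrDl mul1r (le_trans (ler_normD _ _))// lerD//.
  by rewrite normrM mulrC ler_wpM2r// HM4.
have -> : phi e x * psi e x - phi 0 x * psi 0 x - e * (dphi x * psi 0 x + phi 0 x * dpsi x) =
  (phi e x - phi 0 x - e * dphi x) * psi 0 x + phi 0 x * (psi e x - psi 0 x - e * dpsi x)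
  + (phi e x - phi 0 x) * (psi e x - psi 0 x) by ring.
have T1 : `|(phi e x - phi 0 x - e * dphi x) * psi 0 x| <= eta / 3 * `|e|.
  rewrite normrM; apply: (@le_trans _ _ (eta / 3 / M2 * `|e| * M2)).
    by rewrite ler_pM// HM2.
  by rewrite mulrAC divfK ?gt_eqF.
have T2 : `|phi 0 x * (psi e x - psi 0 x - e * dpsi x)| <= eta / 3 * `|e|.
  rewrite normrM; apply: (@le_trans _ _ (M1 * (eta / 3 / M1 * `|e|))).
    by rewrite ler_pM// HM1.
  by rewrite mulrC mulrAC divfK ?gt_eqF.
have T3 : `|(phi e x - phi 0 x) * (psi e x - psi 0 x)| <= eta / 3 * `|e|.
  rewrite normrM; apply: (@le_trans _ _ ((1 + M3) * `|e| * ((1 + M4) * `|e|))).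
    by rewrite ler_pM.
  have -> : (1 + M3) * `|e| * ((1 + M4) * `|e|) = `|e| * ((1 + M3) * (1 + M4)) * `|e| by ring.
  by rewrite ler_wpM2r// -ler_pdivlMr ?(ltW l3)// mulr_gt0// ltr_wpDl// ltW.
have -> : eta * `|e| = eta / 3 * `|e| + eta / 3 * `|e| + eta / 3 * `|e| by field.
apply: (le_trans (ler_normD _ _)); rewrite lerD//.
by apply: (le_trans (ler_normD _ _)); rewrite lerD.
Qed.

Lemma UD_sum r (I : Type) (s : seq I) (phi : I -> R -> R -> R) (dphi : I -> R -> R) :
  (forall i, UD r (phi i) (dphi i)) ->
  UD r (fun e x => \sum_(i <- s) phi i e x) (fun x => \sum_(i <- s) dphi i x).
Proof.
move=> H; elim: s => [|i s IH].
  have := @UD_cst r _ (@cont_ball_cst R (r + 1) 0) => /UD_eq; apply=> [e x|x]; by rewrite big_nil.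
by have /UD_eq := UDD (H i) IH; apply=> [e x|x]; rewrite big_cons.
Qed.

Lemma prim_continuous r f : cont_ball (r + 1) f -> cont_ball (r + 1) (prim f).
Proof.
move=> fc x xr; have [/derivable1_diffP/differentiable_continuous] := prim_derive fc xr.
by [].
Qed.

(** The error term is itself an antiderivative, of an error that is uniformly small on [-r, r];
    [prim_bound] multiplies it by at most [r]. *)
Lemma UD_prim r phi dphi : 0 <= r -> UD r phi dphi -> UD r (fun e => prim (phi e)) (prim dphi).
Proof.
move=> r0 P; have p0 := UD_cont0 P; move: P => [[d d0 c] e a]; split.
- by exists d => // e' ed; apply: prim_continuous; exact: c.
- exact: prim_continuous.
move=> eta eta0; have h0 : 0 < eta / (r + 1) by rewrite divr_gt0// ltr_wpDl.
have [b b0 H] := a _ h0; exists (Num.min b d) => [|e' x]; first by rewrite lt_min b0.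
rewrite lt_min => /andP[eb ed] xr.
have xr1 : `|x| < r + 1 by rewrite (le_lt_trans xr)// ltrDl.
have rr : r < r + 1 by rewrite ltrDl.
have cc : cont_ball (r + 1) (fun y => phi e' y - phi 0 y - e' * dphi y).
  apply: cont_ballD; first by apply: cont_ballD; [exact: c|exact: cont_ballN].
  by apply: cont_ballN; apply: cont_ballM => //; exact: cont_ball_cst.
have -> : prim (phi e') x - prim (phi 0) x - e' * prim dphi x =
    prim (fun y => phi e' y - phi 0 y - e' * dphi y) x.
  have := @prim_eq R (r + 1) _ (fun y => prim (phi e') y - prim (phi 0) y - e' * prim dphi y) x cc _ xr1.
  rewrite !prim0 mulr0 !subr0 => H'; symmetry; apply: H' => y yr.
  apply: is_deriveB; last by apply: is_deriveZ; exact: prim_derive yr.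
  by apply: is_deriveB; [exact: prim_derive (c _ ed) yr|exact: prim_derive yr].
apply: le_trans (prim_bound cc rr (M := eta / (r + 1) * `|e'|) _ xr) _; first by move=> y; exact: H.
rewrite mulrAC ler_wpM2r// -mulrA ler_piMr ?(ltW eta0)// mulrC ler_pdivrMr ?mul1r ?(ltW xr1)//.
by rewrite ltr_wpDl.
Qed.

(** Freezes the space variable; needed for the end values in the normalized antiderivative. *)
Lemma UD_at r phi dphi (c : R) : `|c| <= r -> UD r phi dphi ->
  UD r (fun e _ => phi e c) (fun=> dphi c).
Proof.
move=> cr [_ _ a]; split.
- by exists 1 => // e _; exact: cont_ball_cst.
- exact: cont_ball_cst.
- by move=> eta /a[d d0 H]; exists d => // e x ed _; exact: H.
Qed.

Lemma UD_is_derive r phi dphi (c : R) : `|c| <= r -> UD r phi dphi ->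
  is_derive (0 : R) 1 (fun e => phi e c) (dphi c).
Proof.
move=> cr [_ _ a]; apply/is_derive_approxP => eta /a[d d0 H].
apply: filterS (@near0_norm_lt R R d d0) => h hd.
by have := H h c hd cr; rewrite add0r [h *: 1]mulr1.
Qed.

Lemma UD_Int r phi dphi : 0 <= r -> UD r phi dphi ->
  is_derive (0 : R) 1 (fun e => Int r (phi e)) (Int r dphi).
Proof.
move=> r0 /(UD_prim r0) H.
by apply: is_deriveB; apply: UD_is_derive H; rewrite ?normrN ger0_norm.
Qed.

Lemma UD_smooth {W : normedModType R} r (O : set (W * R)%type) (phi : (W * R)%type -> R) (s a : W) :
  open O -> smooth_on O phi -> (forall x, `|x| <= r + 1 -> O (s, x)) ->
  UD r (fun e x => phi (s + e *: a, x)) (fun x => 'D_(a, 0) phi (s, x)).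
Proof.
move=> oO pO sO.
have pairc (t : W) x : {for x, continuous (fun y : R => (t, y))}.
  move=> P /nbhs_ballP[e/= e0 eP]; apply/nbhs_ballP; exists e => // y xy.
  by apply: eP; split => //=; exact: ballxx.
have pc q : O q -> {for q, continuous phi} by move=> Oq; exact: smooth_on_continuous Oq.
split.
- have [d d0 H] := unif_close a a oO pc sO ltr01; exists d => // e ed x xr.
  have z : `|0 : R| < d by rewrite normr0.
  have [] := H e 0 x ed z (ltW xr); rewrite scale0r addr0 => Ox _.
  apply: (@continuous_comp _ _ _ (fun y : R => (s + e *: a, y)) phi); first exact: pairc.
  exact: pc.
- move=> x xr; apply: (@continuous_comp _ _ _ (fun y : R => (s, y)) ('D_(a, 0) phi)).
    exact: pairc.
  by apply: smooth_on_continuous (sO x (ltW xr)); exact: smooth_onD.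
- move=> eta eta0.
  have sO' x : `|x| <= r -> O (s, x) by move=> xr; apply: sO; rewrite (le_trans xr)// lerDl.
  have [d d0 H] := smooth_unif_expand a a oO pO sO' eta0; exists d => // e x ed xr.
  have z : `|0 : R| < d by rewrite normr0.
  by have := H e 0 x ed z xr; rewrite !scale0r !addr0 mul0r subr0 normr0 addr0.
Qed.

End UD.

Section matrix_calculus.
Context {R : realType}.

Lemma is_derive_entry {V : normedModType R} m n (A : V -> 'M[R]_(m, n)) x v dA i j :
  is_derive x v A dA -> is_derive x v (fun y => A y i j) (dA i j).
Proof.
move=> [dd <-]; have /derivable_mxP/(_ i j) dij := dd.
by rewrite derive_mx// mxE; exact: DeriveDef dij erefl.
Qed.

Lemma is_derive_mulmx {V : normedModType R} m n p (A : V -> 'M[R]_(m, n)) (B : V -> 'M[R]_(n, p)) x v dA dB :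
  is_derive x v A dA -> is_derive x v B dB ->
  is_derive x v (fun y => A y *m B y) (dA *m B x + A x *m dB).
Proof.
move=> AD BD; apply: is_derive_mx => i j.
have -> : (dA *m B x + A x *m dB) i j =
    \sum_k (A x i k *: dB k j + B x k j *: dA i k).
  rewrite !mxE -big_split/=; apply: eq_bigr => k _.
  by rewrite /GRing.scale/= addrC [dA i k * _]mulrC.
under eq_fun do rewrite mxE.
rewrite (_ : (fun _ => _) = \sum_k (fun y => A y i k * B y k j)); last first.
  by apply/funext => y; rewrite fct_sumE.
apply: is_derive_sum => k.
exact: is_deriveM (is_derive_entry i k AD) (is_derive_entry k j BD).
Qed.

Lemma is_derive_trmx {V : normedModType R} m n (A : V -> 'M[R]_(m, n)) x v dA :
  is_derive x v A dA -> is_derive x v (fun y => (A y)^T) dA^T.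
Proof.
move=> AD; apply: is_derive_mx => i j; rewrite mxE.
under eq_fun do rewrite mxE.
exact: is_derive_entry.
Qed.

Definition cont_ballm m n rho (A : R -> 'M[R]_(m, n)) := forall i j, cont_ball rho (fun x => A x i j).

Lemma cont_ballmD m n rho (A B : R -> 'M[R]_(m, n)) :
  cont_ballm rho A -> cont_ballm rho B -> cont_ballm rho (fun x => A x + B x).
Proof.
by move=> Ac Bc i j; under eq_fun do rewrite mxE; apply: cont_ballD; [exact: Ac|exact: Bc].
Qed.

Lemma cont_ballmN m n rho (A : R -> 'M[R]_(m, n)) :
  cont_ballm rho A -> cont_ballm rho (fun x => - A x).
Proof. by move=> Ac i j; under eq_fun do rewrite mxE; apply: cont_ballN; exact: Ac. Qed.

Lemma cont_ballm_cst m n rho (A : 'M[R]_(m, n)) : cont_ballm rho (fun=> A).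
Proof. by move=> i j; exact: cont_ball_cst. Qed.

Lemma cont_ballm_tr m n rho (A : R -> 'M[R]_(m, n)) :
  cont_ballm rho A -> cont_ballm rho (fun x => (A x)^T).
Proof. by move=> Ac i j; under eq_fun do rewrite mxE; exact: Ac. Qed.

Lemma cont_ballm_mul m n p rho (A : R -> 'M[R]_(m, n)) (B : R -> 'M[R]_(n, p)) :
  cont_ballm rho A -> cont_ballm rho B -> cont_ballm rho (fun x => A x *m B x).
Proof.
move=> Ac Bc i j; under eq_fun do rewrite mxE; apply: cont_ball_sum => k.
by apply: cont_ballM; [exact: Ac|exact: Bc].
Qed.

Lemma cont_ballm_derive m n rho (A dA : R -> 'M[R]_(m, n)) :
  (forall x : R, `|x| < rho -> is_derive x 1 A (dA x)) -> cont_ballm rho A.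
Proof.
move=> AD i j x xr; have [/derivable1_diffP/differentiable_continuous H _] := is_derive_entry i j (AD x xr).
exact: H.
Qed.

Definition UDm m n r (A : R -> R -> 'M[R]_(m, n)) (dA : R -> 'M[R]_(m, n)) :=
  forall i j, UD r (fun e x => A e x i j) (fun x => dA x i j).

Lemma UDm_cst m n r (A : R -> 'M[R]_(m, n)) :
  cont_ballm (r + 1) A -> UDm r (fun=> A) (fun=> 0).
Proof.
move=> Ac i j; have /UD_eq := UD_cst (Ac i j); apply=> // x.
by rewrite mxE.
Qed.

Lemma UDmD m n r (A B : R -> R -> 'M[R]_(m, n)) dA dB : UDm r A dA -> UDm r B dB ->
  UDm r (fun e x => A e x + B e x) (fun x => dA x + dB x).
Proof.
by move=> HA HB i j; have /UD_eq := UDD (HA i j) (HB i j); apply=> [e x|x]; rewrite mxE.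
Qed.

Lemma UDm_tr m n r (A : R -> R -> 'M[R]_(m, n)) dA : UDm r A dA ->
  UDm r (fun e x => (A e x)^T) (fun x => (dA x)^T).
Proof. by move=> HA i j; have /UD_eq := HA j i; apply=> [e x|x]; rewrite mxE. Qed.

Lemma UDm_mul m n p r (A : R -> R -> 'M[R]_(m, n)) (B : R -> R -> 'M[R]_(n, p)) dA dB :
  UDm r A dA -> UDm r B dB ->
  UDm r (fun e x => A e x *m B e x) (fun x => dA x *m B 0 x + A 0 x *m dB x).
Proof.
move=> HA HB i j.
have := @UD_sum R r _ (index_enum 'I_n) (fun k e x => A e x i k * B e x k j)
  (fun k x => dA x i k * B 0 x k j + A 0 x i k * dB x k j) (fun k => UDM (HA i k) (HB k j)).
by move/UD_eq; apply=> [e x|x]; rewrite !mxE// big_split.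
Qed.

(** The normalized antiderivative of [supported_Dinv]. No support is required here, which lets it be
    applied to the intermediate integrands of an integration by parts. *)
Definition Nr r (f : R -> R) (x : R) : R := prim f x - 2^-1 * (prim f r + prim f (- r)).

Definition NN {L : nat} r (Y : R -> 'rV[R]_L) (x : R) : 'rV[R]_L :=
  \row_n Nr r (fun y => Y y 0 n) x.

Lemma NN_derive (L : nat) r (Y : R -> 'rV[R]_L) (x : R) : cont_ballm (r + 1) Y -> `|x| < r + 1 ->
  is_derive x 1 (NN r Y) (Y x).
Proof.
move=> Yc xr; apply: is_derive_mx => i j; rewrite (ord1 i).
under eq_fun do rewrite mxE.
have dc := is_derive_cst (2^-1 * (prim (fun y => Y y 0 j) r + prim (fun y => Y y 0 j) (- r))) x 1.
have := is_deriveB (prim_derive (Yc 0 j) xr) dc.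
by rewrite subr0.
Qed.

(** The reason why boundary terms disappear: a bilinear expression in two such antiderivatives takes
    the same value at [r] and at [-r]. *)
Lemma NN_boundary (L : nat) r (Y : R -> 'rV[R]_L) : NN r Y (- r) = - NN r Y r.
Proof. by apply/rowP => n; rewrite !mxE /Nr; field. Qed.

Lemma NND (L : nat) r (Y Z : R -> 'rV[R]_L) x : 0 <= r -> cont_ballm (r + 1) Y ->
  cont_ballm (r + 1) Z -> `|x| < r + 1 -> NN r (fun y => Y y + Z y) x = NN r Y x + NN r Z x.
Proof.
move=> r0 Yc Zc xr; apply/rowP => n; rewrite !mxE /Nr.
have E y : `|y| < r + 1 -> prim (fun y => (Y y + Z y) 0 n) y =
    prim (fun y => Y y 0 n) y + prim (fun y => Z y 0 n) y.
  move=> yr; have := prim_linear 1 (Yc 0 n) (Zc 0 n) yr; rewrite mul1r => <-.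
  by congr (prim _ y); apply/funext => t; rewrite mxE mul1r.
have r1 : `|r| < r + 1 by rewrite ger0_norm// ltrDl.
by rewrite !E// ?normrN//; ring.
Qed.

Lemma UDm_NN (L : nat) r (Y : R -> R -> 'rV[R]_L) dY : 0 <= r -> UDm r Y dY ->
  UDm r (fun e => NN r (Y e)) (NN r dY).
Proof.
move=> r0 H i j; rewrite (ord1 i).
have P := UD_prim r0 (H 0 j).
have P1 := UD_at (_ : `|r| <= r) P; have P2 := UD_at (_ : `|- r| <= r) P.
rewrite normrN ger0_norm// in P1 P2.
have C := UD_cst (@cont_ball_cst R (r + 1) (- 2^-1)).
have /UD_eq := UDD P (UDM C (UDD (P1 (lexx _)) (P2 (lexx _)))).
by apply=> [e x|x]; rewrite mxE /Nr; ring.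
Qed.

(** The points [r] and [-r] themselves are included, unlike in [supported], so that local boundary
    terms vanish. *)
Definition supp m n r (f : R -> 'M[R]_(m, n)) := forall x : R, r <= `|x| -> f x = 0.

Lemma Dinv_NN (L : nat) r (Y : R -> 'rV[R]_L) (x : R) : 0 <= r -> cont_ballm (r + 1) Y ->
  supp r Y -> `|x| < r + 1 -> \row_n Dinv (fun y => Y y 0 n) x = NN r Y x.
Proof.
move=> r0 Yc Ys xr; apply/rowP => n; rewrite !mxE (supported_Dinv r0)//.
by move=> y /ltW/Ys ->; rewrite mxE.
Qed.

End matrix_calculus.

(** * The operator along a fixed curve and its skew-symmetry *)

Section operator_along_curve.
Context {R : realType} {N L : nat} (mu : 'M[R]_L).

(** Coefficients are matrices depending on [x], covectors are rows, and the rows of [W] are the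
    vectors w_m u_x. The derivative of [xi] is a separate argument so that it can be expanded in the
    parameter independently of [xi]. *)
Definition opx r (g B : R -> 'M[R]_N) (W : R -> 'M[R]_(L, N)) (xi dxi : R -> 'rV[R]_N) (x : R) : 'rV[R]_N :=
  dxi x *m (g x)^T + xi x *m (B x)^T + NN r (fun y => xi y *m (W y)^T) x *m mu *m W x.

Lemma sc_tr (A : 'M[R]_1) : A 0 0 = A^T 0 0. Proof. by rewrite mxE. Qed.

Lemma addmxE m n (A B : 'M[R]_(m, n)) i j : (A + B) i j = A i j + B i j. Proof. by rewrite mxE. Qed.
Lemma oppmxE m n (A : 'M[R]_(m, n)) i j : (- A) i j = - A i j. Proof. by rewrite mxE. Qed.
Definition addoppE := (addmxE, oppmxE).

Lemma trDE m n (A B : 'M[R]_(m, n)) : (A + B)^T = A^T + B^T.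
Proof. by apply/matrixP => i j; rewrite !mxE. Qed.
Lemma trNE m n (A : 'M[R]_(m, n)) : (- A)^T = - A^T.
Proof. by apply/matrixP => i j; rewrite !mxE. Qed.

Hypothesis mu_sym : mu^T = mu.

(** The two pairings and the defect combine to the derivative of
    [xi g eta^T + N(eta W^T) mu N(xi W^T)^T]. Its first term vanishes at both ends by the supports,
    its second takes equal values there by [NN_boundary]. The defect is kept because necessity
    deduces its vanishing from skew-symmetry. *)
Lemma opx_skew_defect r g dg B W xi dxi eta deta : 0 <= r ->
  (forall x : R, `|x| < r + 1 -> (g x)^T = g x) ->
  (forall x : R, `|x| < r + 1 -> is_derive x 1 g (dg x)) ->
  cont_ballm (r + 1) dg -> cont_ballm (r + 1) B -> cont_ballm (r + 1) W ->
  (forall x : R, `|x| < r + 1 -> is_derive x 1 xi (dxi x)) -> cont_ballm (r + 1) dxi ->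
  (forall x : R, `|x| < r + 1 -> is_derive x 1 eta (deta x)) -> cont_ballm (r + 1) deta ->
  supp r xi -> supp r eta ->
  Int r (fun x => (xi x *m (opx r g B W eta deta x)^T) 0 0) =
  Int r (fun x => (xi x *m (B x + (B x)^T - dg x) *m (eta x)^T) 0 0)
  - Int r (fun x => (eta x *m (opx r g B W xi dxi x)^T) 0 0).
Proof.
move=> r0 gs gd dgc Bc Wc xid dxic etad detac xis etas.
have gc := cont_ballm_derive gd; have xic := cont_ballm_derive xid; have etac := cont_ballm_derive etad.
have Yx := cont_ballm_mul xic (cont_ballm_tr Wc); have Ye := cont_ballm_mul etac (cont_ballm_tr Wc).
have Nxd x (xr : `|x| < r + 1) := NN_derive Yx xr; have Ned x (xr : `|x| < r + 1) := NN_derive Ye xr.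
have Nxc := cont_ballm_derive Nxd; have Nec := cont_ballm_derive Ned.
have opc z dz : cont_ballm (r + 1) z -> cont_ballm (r + 1) dz ->
    cont_ballm (r + 1) (NN r (fun y => z y *m (W y)^T)) -> cont_ballm (r + 1) (opx r g B W z dz).
  move=> zc dzc Nzc; apply: cont_ballmD; first apply: cont_ballmD.
  - exact: cont_ballm_mul dzc (cont_ballm_tr gc).
  - exact: cont_ballm_mul zc (cont_ballm_tr Bc).
  - exact: cont_ballm_mul (cont_ballm_mul Nzc (@cont_ballm_cst _ _ _ _ mu)) Wc.
have C1 := cont_ballm_mul xic (cont_ballm_tr (opc _ _ etac detac Nec)); have c1 := C1 0 0.
have C2 := cont_ballm_mul etac (cont_ballm_tr (opc _ _ xic dxic Nxc)); have c2 := C2 0 0.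
have C3 := cont_ballm_mul (cont_ballm_mul xic (cont_ballmD (cont_ballmD Bc (cont_ballm_tr Bc)) (cont_ballmN dgc)))
  (cont_ballm_tr etac); have c3 := C3 0 0.
apply/eqP; rewrite eq_sym subr_eq -(IntD r0 c1 c2) eq_sym -subr_eq0 -(IntB r0 (cont_ballD c1 c2) c3); apply/eqP.
pose F x := xi x *m g x *m (eta x)^T + NN r (fun y => eta y *m (W y)^T) x *m mu *m (NN r (fun y => xi y *m (W y)^T) x)^T.
have Fd x (xr : `|x| < r + 1) := is_deriveD
  (is_derive_mulmx (is_derive_mulmx (xid x xr) (gd x xr)) (is_derive_trmx (etad x xr)))
  (is_derive_mulmx (is_derive_mulmx (Ned x xr) (is_derive_cst mu x 1)) (is_derive_trmx (Nxd x xr))).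
have Fd0 (x : R) : `|x| < r + 1 -> is_derive x 1 (fun x => F x 0 0)
    ((xi x *m (opx r g B W eta deta x)^T) 0 0 + (eta x *m (opx r g B W xi dxi x)^T) 0 0
     - (xi x *m (B x + (B x)^T - dg x) *m (eta x)^T) 0 0).
  move=> xr; have := is_derive_entry 0 0 (Fd x xr).
  congr is_derive; rewrite mulmx0 addr0 /opx.
  rewrite !(trDE, trNE, trmx_mul, trmxK, mulmxDl, mulmxDr, mulmxN, mulNmx) mu_sym !mulmxA !addoppE.
  rewrite (sc_tr (dxi x *m _ *m _)) (sc_tr (xi x *m (B x)^T *m _)).
  rewrite (sc_tr (NN r _ x *m _ *m _ *m _)) !trmx_mul !trmxK (gs x xr) mu_sym !mulmxA.
  by ring.
rewrite (Int_derive r0 (cont_ballD (cont_ballD c1 c2) (cont_ballN c3)) Fd0) /F.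
have rr : r <= `|r| by rewrite ger0_norm.
have rr' : r <= `|- r| by rewrite normrN ger0_norm.
rewrite !(xis _ rr) !(xis _ rr') !mul0mx !add0r !NN_boundary.
by rewrite trNE !mulNmx mulmxN opprK subrr.
Qed.

Lemma opx_skew r g B W xi dxi eta deta : 0 <= r ->
  (forall x : R, `|x| < r + 1 -> (g x)^T = g x) ->
  (forall x : R, `|x| < r + 1 -> is_derive x 1 g (B x + (B x)^T)) ->
  cont_ballm (r + 1) B -> cont_ballm (r + 1) W ->
  (forall x : R, `|x| < r + 1 -> is_derive x 1 xi (dxi x)) -> cont_ballm (r + 1) dxi ->
  (forall x : R, `|x| < r + 1 -> is_derive x 1 eta (deta x)) -> cont_ballm (r + 1) deta ->
  supp r xi -> supp r eta ->
  Int r (fun x => (xi x *m (opx r g B W eta deta x)^T) 0 0) =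
  - Int r (fun x => (eta x *m (opx r g B W xi dxi x)^T) 0 0).
Proof.
move=> r0 gs gd Bc Wc xid dxic etad detac xis etas.
have E := opx_skew_defect r0 gs gd (cont_ballmD Bc (cont_ballm_tr Bc)) Bc Wc xid dxic etad detac xis etas.
apply: (etrans E); rewrite -[RHS]add0r; congr (_ - _); rewrite -(Int_cst0 r); apply: (eq_Int r0) => x _.
by rewrite subrr mulmx0 mul0mx mxE.
Qed.

End operator_along_curve.

(** A covector living to the right of 0 influences the operator at 0 only through the number
    [- 2^-1 * Int r f]; necessity uses this to prescribe antiderivatives at 0. *)
Lemma Nr_right {R : realType} r (f : R -> R) : 0 <= r -> (forall x, x <= 0 -> f x = 0) ->
  Nr r f 0 = - 2^-1 * Int r f.
Proof.
move=> r0 f0; rewrite /Nr /Int prim0 add0r.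
have -> : prim f (- r) = 0; last by rewrite addr0 subr0 mulNr.
have E (a b : R) : b <= 0 -> \int[lebesgue_measure]_(t in `[a, b]) f t = 0.
  move=> b0; apply: (etrans (_ : _ = \int[lebesgue_measure]_(t in `[a, b]) (0 : R))); last by rewrite /Rintegral integral0.
  by apply: eq_Rintegral => x; rewrite inE/= in_itv/= => /andP[_ xb]; apply: f0; exact: le_trans xb b0.
by rewrite /prim !E ?subrr ?oppr_le0.
Qed.

(** * Variational derivatives along families of fields *)

Section smooth_curves.
Context {R : realType}.

Lemma is_derive_scalel (f : R -> R) (x v d : R) : is_derive x 1 f d -> is_derive x v f (v * d).
Proof.
move=> [/derivable1_diffP df fE]; constructor; first exact: diff_derivable.
rewrite deriveE// -[v in LHS]mulr1 -[v * 1]/(v *: (1 : R)) linearZ /= -fE deriveE//.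
Qed.

Lemma smooth_of_derive1 (f df : R -> R) : (forall x : R, is_derive x 1 f (df x)) ->
  smooth_on [set: R] df -> smooth_on [set: R] f.
Proof.
move=> fd dfs; refine (@smooth_of_derive R R [set: R] f (fun v x => v * df x) _ _ _ _).
- by move=> x _; have [/derivable1_diffP/differentiable_continuous H _] := fd x.
- by move=> x v _; exact: is_derive_scalel (fd x).
- exact: openT.
- by move=> v; apply: (smooth_onM openT _ dfs); exact: smooth_cst_set openT v.
Qed.

Context {N : nat}.
Implicit Types u a xi : R -> 'rV[R]_N.

Lemma smooth_map_derive u (x : R) : smooth_map u -> is_derive x 1 u (dx u x).
Proof.
move=> us; apply: is_derive_mx => i j; rewrite (ord1 i) mxE.
exact: smooth_on_is_derive (us j) I.
Qed.

Lemma smooth_map_dx u : smooth_map u -> smooth_map (dx u).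
Proof.
move=> us i; have := smooth_onD (1 : R) (us i).
by congr smooth_on; apply/funext => x; rewrite mxE.
Qed.

Lemma smooth_on_cont_ball rho (f : R -> R) : smooth_on [set: R] f -> cont_ball rho f.
Proof. by move=> fs x _; exact: smooth_on_continuous fs I. Qed.

Lemma smooth_map_cont rho u : smooth_map u -> cont_ballm rho u.
Proof. by move=> us i j; rewrite (ord1 i); exact: smooth_on_cont_ball (us j). Qed.

Lemma smooth_comp_curve (U : set 'rV[R]_N) (F : 'rV[R]_N -> R) u :
  open U -> smooth_on U F -> smooth_field U u -> smooth_on [set: R] (fun x => F (u x)).
Proof. by move=> oU FU [us uU]; apply: (smooth_on_comp openT oU FU) => // x _; exact: uU. Qed.

Lemma dx_line u a (e : R) : smooth_map u -> smooth_map a ->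
  dx (fun y => u y + e *: a y) = fun x => dx u x + e *: dx a x.
Proof.
move=> us as_; apply/funext => x; apply/rowP => i; rewrite !mxE.
have [_ <-] : is_derive x 1 (fun y => (u y + e *: a y) 0 i) ('D_1 (fun y => u y 0 i) x + e *: 'D_1 (fun y => a y 0 i) x).
  under eq_fun do rewrite !mxE.
  apply: is_deriveD; first exact: smooth_on_is_derive (us i) I.
  by apply: is_deriveZ; exact: smooth_on_is_derive (as_ i) I.
by [].
Qed.

Lemma is_derive_eq_dx u (x : R) d : is_derive x 1 u d -> dx u x = d.
Proof. by move=> H; apply/rowP => i; rewrite mxE; have [_] := is_derive_entry 0 i H. Qed.

End smooth_curves.

Section families.
Context {R : realType}.

Lemma smooth_on_snd {W : normedModType R} (O : set (W * R)%type) (f : R -> R) :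
  open O -> smooth_on [set: R] f -> smooth_on O (fun p => f p.2).
Proof.
move=> oO fs; have [l [lE lc]] := @snd_linear_cont R W R.
have -> : (fun p : (W * R)%type => f p.2) = (fun p => f (l p)) by apply/funext => p; rewrite lE.
by apply: (smooth_on_linear oO fs lc).
Qed.

Lemma smooth_on_fst {W : normedModType R} (O : set (W * R)%type) (f : {linear W -> R}) :
  open O -> continuous f -> smooth_on O (fun p => f p.1).
Proof.
move=> oO fc; have [l [lE lc]] := @fst_linear_cont R W R.
have -> : (fun p : (W * R)%type => f p.1) = (fun p => f (l p)) by apply/funext => p; rewrite lE.
by apply: (smooth_on_linear (B := [set: W]) oO _ lc) => //; exact: smooth_on_linfun openT fc.
Qed.

Lemma coord_linear (m : nat) (i : 'I_m) :
  exists l : {linear 'rV[R]_m -> R}, (forall s, l s = s 0 i) /\ continuous l.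
Proof.
have H : linear (fun s : 'rV[R]_m => s 0 i) by move=> c s t; rewrite !mxE.
exists (HB.pack_for {linear 'rV[R]_m -> R} (fun s : 'rV[R]_m => s 0 i) (GRing.isLinear.Build R 'rV[R]_m R *:%R _ H)).
by split=> // x; exact: coord_continuous.
Qed.

Lemma inr_linear {W : normedModType R} :
  exists l : {linear R -> (W * R)%type}, (forall x, l x = (0, x)) /\ continuous l.
Proof.
have H : linear (fun x : R => (0 : W, x)).
  by move=> c x y; congr pair; rewrite /= scaler0 addr0.
exists (HB.pack_for {linear R -> (W * R)%type} (fun x : R => (0 : W, x)) (GRing.isLinear.Build R R (W * R)%type *:%R _ H)).
split=> // x P /nbhs_ballP[e/= e0 eP]; apply/nbhs_ballP; exists e => // y xy.
by apply: eP; split => //=; exact: ballxx.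
Qed.

Lemma smooth_slice {W : normedModType R} (S : set W) (phi : (W * R)%type -> R) :
  smooth_on (S `*` [set: R]) phi -> S 0 -> smooth_on [set: R] (fun x => phi (0, x)).
Proof.
move=> ps S0; have [l [lE lc]] := @inr_linear W.
have -> : (fun x => phi (0, x)) = (fun x => phi (l x)) by apply/funext => x; rewrite lE.
by apply: (smooth_on_linear openT ps lc) => x _; rewrite lE.
Qed.

Lemma pair_liner {V W : normedModType R} (x : V) (y a : W) (h : R) :
  (x, y) + h *: (0, a) = (x, y + h *: a).
Proof. by congr pair; rewrite /= scaler0 addr0. Qed.

Lemma is_derive_slice {W : normedModType R} (phi : (W * R)%type -> R) (s : W) (x d : R) :
  is_derive (s, x) (0, 1 : R) phi d -> is_derive x 1 (fun y => phi (s, y)) d.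
Proof.
move=> /is_derive_approxP H; apply/is_derive_approxP => eta /H; apply: filterS => h.
by rewrite pair_liner.
Qed.

Lemma open_fst {W : normedModType R} (S : set W) : open S -> open (S `*` [set: R]).
Proof.
move=> oS; have -> : S `*` [set: R] = fst @^-1` S.
  by apply/seteqP; split=> q //= -[].
by apply: open_comp => // q _; exact: cvg_fst.
Qed.

Context {N : nat}.
Implicit Types u a xi : R -> 'rV[R]_N.

(** The directions [a] and [b] may be unbounded, so membership in U can be kept only over [-r, r];
    this is exactly what [vderP] asks for. *)
Lemma near_U (U : set 'rV[R]_N) u a b (r : R) : open U -> smooth_map u -> smooth_map a -> smooth_map b ->
  (forall x, `|x| <= r -> U (u x)) ->
  exists2 d : R, 0 < d & forall s t x, `|s| < d -> `|t| < d -> `|x| <= r -> U (u x + s *: a x + t *: b x).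
Proof.
move=> oU us as_ bs uU.
have cont (v : R -> 'rV[R]_N) x : smooth_map v -> {for x, continuous v}.
  by move=> vs; apply: continuous_mx => i j; rewrite (ord1 i); exact: smooth_on_continuous (vs j) I.
pose f (q : 'rV[R]_2 * R) := u q.2 + q.1 0 0 *: a q.2 + q.1 0 1 *: b q.2.
pose O := f @^-1` U.
have fc : continuous f.
  have c2 (v : R -> 'rV[R]_N) q : smooth_map v -> {for q, continuous (fun q : 'rV[R]_2 * R => v q.2)}.
    by move=> vs; apply: (@continuous_comp _ _ _ snd v); [exact: cvg_snd|exact: cont].
  have c1 (i : 'I_2) q : {for q, continuous (fun q : 'rV[R]_2 * R => q.1 0 i)}.
    by apply: (@continuous_comp _ _ _ fst (fun s : 'rV[R]_2 => s 0 i)); [exact: cvg_fst|exact: coord_continuous].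
  move=> q; apply: cvgD; first apply: cvgD; first exact: c2.
  - by apply: cvgZ; [exact: c1|exact: c2].
  - by apply: cvgZ; [exact: c1|exact: c2].
have oO : open O by apply: open_comp => // q _; exact: fc.
have O0 x : `|x| <= r -> O (0, x).
  by move=> xr; rewrite /O /f /= !mxE !scale0r !addr0; exact: uU.
have cst q : O q -> {for q, continuous (fun _ : ('rV[R]_2 * R)%type => 0 : R)} by move=> _; exact: cvg_cst.
have [d d0 H] := unif_close (delta_mx 0 0) (delta_mx 0 1) oO cst O0 ltr01.
exists d => // s t x sd td xr; have [] := H s t x sd td xr.
by rewrite /O /f /= !mxE /= !mulr1 !mulr0 !add0r addr0.
Qed.

Lemma UD_field (U : set 'rV[R]_N) (F : 'rV[R]_N -> R) u a (r : R) : open U -> smooth_on U F ->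
  smooth_map u -> smooth_map a -> (forall x, U (u x)) ->
  UD r (fun e x => F (u x + e *: a x)) (fun x => 'D_(a x) F (u x)).
Proof.
move=> oU FU us as_ uU.
have cont (v : R -> 'rV[R]_N) x : smooth_map v -> {for x, continuous v}.
  by move=> vs; apply: continuous_mx => i j; rewrite (ord1 i); exact: smooth_on_continuous (vs j) I.
pose f (q : R * R) := u q.2 + q.1 *: a q.2.
pose O := f @^-1` U.
have fc : continuous f.
  have c2 (v : R -> 'rV[R]_N) q : smooth_map v -> {for q, continuous (fun q : R * R => v q.2)}.
    by move=> vs; apply: (@continuous_comp _ _ _ snd v); [exact: cvg_snd|exact: cont].
  move=> q; apply: cvgD; first exact: c2.
  by apply: cvgZ; [exact: cvg_fst|exact: c2].
have oO : open O by apply: open_comp => // q _; exact: fc.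
have O0 x : `|x| <= r + 1 -> O (0, x).
  by move=> _; rewrite /O /f /= !scale0r !addr0; exact: uU.
have idl : smooth_on O (fun q : R * R => q.1).
  have H : linear (fun x : R => x) by [].
  by apply: (smooth_on_fst (f := HB.pack_for {linear R -> R} (fun x : R => x) (GRing.isLinear.Build R R R *:%R _ H)) oO) => x; exact: cvg_id.
have sF : smooth_on O (F \o f).
  apply: (smooth_on_comp oO oU FU) => [q Oq|i]; first exact: Oq.
  have -> : (fun q => f q 0 i) = (fun q => u q.2 0 i + q.1 * a q.2 0 i).
    by apply/funext => q; rewrite !mxE.
  apply: (smooth_onDr oO); first exact: smooth_on_snd oO (us i).
  by apply: (smooth_onM oO idl); exact: smooth_on_snd oO (as_ i).
have /UD_eq := UD_smooth (1 : R) oO sF O0; apply=> [e x|x].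
  by rewrite /= /f /= add0r [e *: 1]mulr1.
have [_ <-] : is_derive ((0, x) : R * R) (1 : R, 0 : R) (F \o f) ('D_(a x) F (u x)).
  apply/is_derive_approxP => eta eta0.
  have /is_derive_approxP/(_ _ eta0) := smooth_on_is_derive (a x) FU (uU x).
  by apply: filterS => h; rewrite pair_line /f /= scale0r addr0 add0r [h *: 1]mulr1.
by [].
Qed.

End families.

Section functionals.
Context {R : realType} {N : nat} (U : set 'rV[R]_N) (oU : open U).
Implicit Types (u a b : R -> 'rV[R]_N) (I : functional U).

(** The linearization of the variational derivative, that is the second variation of [I] as an
    operator on directions. *)
Definition dvder I u a (x : R) : 'rV[R]_N :=
  \row_i 'D_1 (fun e : R => vder I (fun y => u y + e *: a y) x 0 i) 0.

(** Two parameters, since the symmetry of the second variation is that of the mixed derivatives of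
    [I] along such a family. *)
Let fam u a b (s : 'rV[R]_2) (x : R) := u x + s 0 0 *: a x + s 0 1 *: b x.

Let box (d : R) : set 'rV[R]_2 := [set s | `|s 0 0| < d /\ `|s 0 1| < d].

Lemma open_box d : open (box d).
Proof.
have o (i : 'I_2) : open [set s : 'rV[R]_2 | `|s 0 i| < d].
  have -> : [set s : 'rV[R]_2 | `|s 0 i| < d] = (fun s => `|s 0 i|) @^-1` [set y | y < d] by [].
  apply: open_comp; last exact: open_lt.
  move=> s _; apply: (@continuous_comp _ _ _ (fun s : 'rV[R]_2 => s 0 i) (fun y => `|y|)).
    exact: coord_continuous.
  exact: norm_continuous.
exact: openI (o 0) (o 1).
Qed.

Lemma fam_smooth u a b d : smooth_map u -> smooth_map a -> smooth_map b ->
  smooth_family (box d) (fam u a b).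
Proof.
move=> us as_ bs i.
have oO := open_fst (@open_box d).
have [l0 [l0E l0c]] := @coord_linear R 2 0; have [l1 [l1E l1c]] := @coord_linear R 2 1.
have -> : (fun p : ('rV[R]_2 * R)%type => fam u a b p.1 p.2 0 i) =
    (fun p => u p.2 0 i + l0 p.1 * a p.2 0 i + l1 p.1 * b p.2 0 i).
  by apply/funext => p; rewrite !mxE l0E l1E.
apply: (smooth_onDr oO).
  apply: (smooth_onDr oO (smooth_on_snd oO (us i))).
  exact: (smooth_onM oO (smooth_on_fst oO l0c) (smooth_on_snd oO (as_ i))).
exact: (smooth_onM oO (smooth_on_fst oO l1c) (smooth_on_snd oO (bs i))).
Qed.

Section two_parameters.
Variables (I : functional U) (u a b : R -> 'rV[R]_N).
Hypotheses (uU : smooth_field U u) (as_ : smooth_map a) (bs : smooth_map b).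

Let phi (i : 'I_N) (p : ('rV[R]_2 * R)%type) := vder I (fam u a b p.1) p.2 0 i.

Lemma fam_functional : exists2 d : R, 0 < d &
  (forall i, smooth_on (box d `*` [set: R]) (phi i)) /\
  forall s v, box d s -> is_derive s v (fun s' => I (fam u a b s'))
    (pairing (vder I (fam u a b s)) (fun x => 'D_v (fam u a b ^~ x) s)).
Proof.
have [us uin] := uU.
have [d d0 H] := near_U (r := Defs.rad I) oU us as_ bs (fun x _ => uin x).
have sU s x : box d s -> `|x| <= Defs.rad I -> U (fam u a b s x) by case=> s0 s1 xr; exact: H.
have [h1 h2] := vderP (f := I) (@open_box d) (@fam_smooth u a b d us as_ bs) sU.
by exists d.
Qed.

Lemma fam0 (e : R) : fam u a b (0 + e *: delta_mx 0 0) = fun y => u y + e *: a y.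
Proof. by apply/funext => y; rewrite /fam !mxE /= mulr1 mulr0 !add0r scale0r addr0. Qed.

Lemma fam1 (e : R) : fam u a b (0 + e *: delta_mx 0 1) = fun y => u y + e *: b y.
Proof. by apply/funext => y; rewrite /fam !mxE /= mulr1 mulr0 !add0r scale0r addr0. Qed.

Lemma box0 d : 0 < d -> box d 0.
Proof. by move=> d0; split; rewrite mxE normr0. Qed.

Lemma UD_slice (F : ('rV[R]_2 * R)%type -> R) d (v : 'rV[R]_2) r : 0 < d ->
  smooth_on (box d `*` [set: R]) F ->
  UD r (fun e x => F (0 + e *: v, x)) (fun x => 'D_(v, 0) F (0, x)).
Proof.
move=> d0 Fs; apply: (UD_smooth v (open_fst (@open_box d)) Fs) => x _.
by split => //; exact: box0.
Qed.

Lemma dvderE0 x : dvder I u a x = \row_i 'D_(delta_mx 0 0, 0) (phi i) (0, x).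
Proof.
have [d d0 [ps _]] := fam_functional; apply/rowP => i; rewrite !mxE.
have H := UD_is_derive (lexx `|x|) (UD_slice (delta_mx 0 0) `|x| d0 (ps i)).
have -> : (fun e : R => vder I (fun y => u y + e *: a y) x 0 i) =
    (fun e => phi i (0 + e *: delta_mx 0 0, x)) by apply/funext => e; rewrite /phi fam0.
by case: H.
Qed.

Lemma dvderE1 x : dvder I u b x = \row_i 'D_(delta_mx 0 1, 0) (phi i) (0, x).
Proof.
have [d d0 [ps _]] := fam_functional; apply/rowP => i; rewrite !mxE.
have H := UD_is_derive (lexx `|x|) (UD_slice (delta_mx 0 1) `|x| d0 (ps i)).
have -> : (fun e : R => vder I (fun y => u y + e *: b y) x 0 i) =
    (fun e => phi i (0 + e *: delta_mx 0 1, x)) by apply/funext => e; rewrite /phi fam1.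
by case: H.
Qed.

Lemma vder_smooth : smooth_map (vder I u).
Proof.
have [d d0 [ps _]] := fam_functional => i.
have := smooth_slice (ps i) (box0 d0); congr smooth_on; apply/funext => x; rewrite /phi /=.
by have := fam0 0; rewrite scale0r addr0 => ->; under eq_fun do rewrite scale0r addr0.
Qed.

Lemma dvder_smooth : smooth_map (dvder I u a).
Proof.
have [d d0 [ps _]] := fam_functional => i.
have := smooth_slice (smooth_onD (delta_mx 0 0, 0) (ps i)) (box0 d0).
by congr smooth_on; apply/funext => x; rewrite dvderE0 mxE.
Qed.

Lemma UD_vder r : UDm r (fun e => vder I (fun y => u y + e *: a y)) (dvder I u a).
Proof.
have [d d0 [ps _]] := fam_functional => i j; rewrite (ord1 i).
have /UD_eq := UD_slice (delta_mx 0 0) r d0 (ps j); apply=> [e x|x].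
  by rewrite /phi /= fam0.
by rewrite dvderE0 mxE.
Qed.

(** The derivatives in the parameter and in [x] are exchanged by [smooth_derive_sym] in the joint
    variable, which the joint smoothness of [vder] permits. *)
Lemma UD_dx_vder r : UDm r (fun e => dx (vder I (fun y => u y + e *: a y))) (dx (dvder I u a)).
Proof.
have [d d0 [ps _]] := fam_functional => i j; rewrite (ord1 i).
have oO := open_fst (@open_box d).
have near_e : \forall e \near (0 : R), box d (0 + e *: delta_mx 0 0).
  apply: filterS (@near0_norm_lt R R d d0) => e ed.
  by split; rewrite !mxE /= ?mulr1 ?mulr0 !add0r// normr0.
have B e x : box d (0 + e *: delta_mx 0 0) ->
    'D_(0, 1 : R) (phi j) (0 + e *: delta_mx 0 0, x) =
    dx (vder I (fun y => u y + e *: a y)) x 0 j.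
  move=> be; rewrite mxE -fam0.
  have Oe : (box d `*` [set: R]) (0 + e *: delta_mx 0 0, x) by [].
  by have [_ <-] := is_derive_slice (smooth_on_is_derive (0, 1 : R) (ps j) Oe).
have [c cx ex] := UD_slice (delta_mx 0 0) r d0 (smooth_onD (0, 1 : R) (ps j)).
have E x : 'D_(delta_mx 0 0, 0 : R) ('D_(0, 1 : R) (phi j)) (0, x) = dx (dvder I u a) x 0 j.
  have O0 : (box d `*` [set: R]) (0, x) by split => //; exact: box0.
  rewrite (smooth_derive_sym _ _ oO (ps j) O0) mxE.
  have [_ <-] := is_derive_slice (smooth_on_is_derive (0, 1 : R) (smooth_onD (delta_mx 0 0, 0 : R) (ps j)) O0).
  by congr ('D_1 _ x); apply/funext => y; rewrite dvderE0 mxE.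
have be e : `|e| < d -> box d (0 + e *: delta_mx 0 0).
  by move=> ed; split; rewrite !mxE /= ?mulr1 ?mulr0 !add0r// normr0.
split.
- have [c1 c10 H] := c; exists (Num.min c1 d) => [|e]; first by rewrite lt_min c10.
  rewrite lt_min => /andP[h1 h2]; have := H e h1; congr cont_ball; apply/funext => x.
  by rewrite B//; exact: be.
- by move: cx; congr cont_ball; apply/funext => x.
- move=> eta /ex[c1 c10 H]; exists (Num.min c1 d) => [|e x]; first by rewrite lt_min c10.
  rewrite lt_min => /andP[h1 h2] xr; have := H e x h1 xr.
  by rewrite !B ?E//; apply: be => //; rewrite normr0.
Qed.

Lemma dvder_supp x : Defs.rad I < `|x| -> dvder I u a x = 0.
Proof.
move=> xr; apply/rowP => i; rewrite !mxE.
have -> : (fun e : R => vder I (fun y => u y + e *: a y) x 0 i) = cst 0.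
  by apply/funext => e; rewrite vder_supp// mxE.
by rewrite derive_cst.
Qed.

Lemma pairingE (f v : R -> 'rV[R]_N) r : 0 <= r -> cont_ballm (r + 1) f -> cont_ballm (r + 1) v ->
  supp r f -> pairing f v = Int r (fun x => (f x *m (v x)^T) 0 0).
Proof.
move=> r0 fc vc fs; rewrite /pairing -(supported_Rintegral r0).
- by apply: eq_Rintegral => x _; rewrite mxE; apply: eq_bigr => i _; rewrite mxE.
- exact: (cont_ballm_mul fc (cont_ballm_tr vc)).
- by move=> x /ltW/fs ->; rewrite mul0mx mxE.
Qed.

(** [young] for the functional along the two-parameter family. Its first derivatives are pairings
    with the variational derivative; integrating the uniform expansion of the integrand over [-r, r]
    expands these pairings to first order. *)
Lemma second_variation r : Defs.rad I < r -> 0 <= r ->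
  Int r (fun x => (dvder I u b x *m (a x)^T) 0 0) =
  Int r (fun x => (dvder I u a x *m (b x)^T) 0 0).
Proof.
move=> rI r0; have [d d0 [ps pd]] := fam_functional.
have oO := open_fst (@open_box d).
pose pt (s t : R) : 'rV[R]_2 := 0 + s *: delta_mx 0 0 + t *: delta_mx 0 1.
have bpt s t : `|s| < d -> `|t| < d -> box d (pt s t).
  by move=> sd td; split; rewrite !mxE /= ?mulr1 ?mulr0 ?addr0 ?add0r.
have pcont i s x : box d s -> {for x, continuous (fun y => phi i (s, y))}.
  move=> bsd; apply: (@continuous_comp _ _ _ (fun y : R => (s, y)) (phi i)).
    move=> P /nbhs_ballP[e/= e0 eP]; apply/nbhs_ballP; exists e => // y xy.
    by apply: eP; split => //=; exact: ballxx.
  exact: smooth_on_continuous (ps i) _.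
have vc s : box d s -> cont_ballm (r + 1) (vder I (fam u a b s)).
  by move=> bsd i j x _; rewrite (ord1 i); exact: (pcont j s x bsd).
have vs s : supp r (vder I (fam u a b s)).
  by move=> x rx; apply: vder_supp; exact: lt_le_trans rx.
have key (c : R -> 'rV[R]_N) (eta : R) : smooth_map c -> 0 < eta ->
    exists2 e : R, 0 < e & forall s t, `|s| < e -> `|t| < e ->
    `|pairing (vder I (fam u a b (pt s t))) c - pairing (vder I (fam u a b (pt 0 0))) c
      - s * Int r (fun x => (dvder I u a x *m (c x)^T) 0 0)
      - t * Int r (fun x => (dvder I u b x *m (c x)^T) 0 0)| <= eta * (`|s| + `|t|).
  move=> cs eta0; have cc : cont_ballm (r + 1) c by exact: smooth_map_cont.
  pose psi (p : ('rV[R]_2 * R)%type) := \sum_i phi i p * c p.2 0 i.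
  have psis : smooth_on (box d `*` [set: R]) psi.
    apply: (smooth_on_sum oO) => i; apply: (smooth_onM oO (ps i)).
    exact: smooth_on_snd oO (cs i).
  have dpsi v x : 'D_(v, 0 : R) psi (0, x) = \sum_i 'D_(v, 0 : R) (phi i) (0, x) * c x 0 i.
    have O0 : (box d `*` [set: R]) (0, x) by split => //; exact: box0.
    have H : is_derive ((0, x) : ('rV[R]_2 * R)%type) (v, 0 : R)
        (\sum_i (fun p : ('rV[R]_2 * R)%type => phi i p * c p.2 0 i))
        (\sum_i (phi i (0, x) *: (0 : R) + c x 0 i *: 'D_(v, 0 : R) (phi i) (0, x))).
      apply: is_derive_sum => i.
      apply: (is_deriveM (smooth_on_is_derive (v, 0 : R) (ps i) O0)).
      apply/is_derive_approxP => e e0; apply: filterS (@near0_norm_lt R R 1 ltr01) => h _.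
      by rewrite pair_line /= subrr scaler0 subr0 normr0 mulr_ge0// ltW.
    have -> : psi = \sum_i (fun p : ('rV[R]_2 * R)%type => phi i p * c p.2 0 i).
      by apply/funext => p; rewrite fct_sumE.
    have [_ ->] := H; apply: eq_bigr => i _.
    by rewrite scaler0 add0r mulrC.
  have r21 : 0 < 2 * r + 1 by rewrite ltr_wpDl// mulr_ge0.
  (* The integration runs over an interval of length [2 * r]; the added 1 covers r = 0. *)
  have eta'0 : 0 < eta / (2 * r + 1) by rewrite divr_gt0.
  have O0 x : `|x| <= r -> (box d `*` [set: R]) (0, x) by split => //; exact: box0.
  have [e e0 H] := smooth_unif_expand (delta_mx 0 0) (delta_mx 0 1) oO psis O0 eta'0.
  have pairE s : box d s -> pairing (vder I (fam u a b s)) c = Int r (fun x => psi (s, x)).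
    move=> bsd; rewrite (pairingE r0 (vc s bsd) cc (vs s)); congr Int; apply/funext => x.
    by rewrite mxE; apply: eq_bigr => i _; rewrite mxE.
  have dpc (v : 'rV[R]_2) : cont_ball (r + 1) (fun x => 'D_(v, 0 : R) psi (0, x)).
    by apply: smooth_on_cont_ball; apply: smooth_slice (smooth_onD _ psis) (box0 d0).
  have psic s : box d s -> cont_ball (r + 1) (fun x => psi (s, x)).
    move=> bsd; apply: cont_ball_sum => i; apply: cont_ballM; last exact: cc.
    by move=> x _; exact: pcont.
  have EA (v : 'rV[R]_2) (f : R -> 'rV[R]_N) : (forall x, f x = \row_i 'D_(v, 0) (phi i) (0, x)) ->
      Int r (fun x => (f x *m (c x)^T) 0 0) = Int r (fun x => 'D_(v, 0 : R) psi (0, x)).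
    move=> fE; congr Int; apply/funext => x; rewrite fE mxE dpsi; apply: eq_bigr => i _.
    by rewrite !mxE.
  rewrite (EA _ _ dvderE0) (EA _ _ dvderE1).
  exists (Num.min d e) => [|s t]; first by rewrite lt_min d0.
  rewrite !lt_min => /andP[sd se] /andP[td te].
  have b00 : box d (pt 0 0) by apply: bpt; rewrite normr0.
  have bst := bpt s t sd td.
  rewrite !pairE//.
  have C1 := psic _ bst; have C2 := psic _ b00.
  have C3 := cont_ballM (@cont_ball_cst R (r + 1) s) (dpc (delta_mx 0 0)).
  have C4 := cont_ballM (@cont_ball_cst R (r + 1) t) (dpc (delta_mx 0 1)).
  have C12 := cont_ballD C1 (cont_ballN C2); have C123 := cont_ballD C12 (cont_ballN C3).
  rewrite -(IntZ s r0 (dpc _)) -(IntZ t r0 (dpc _)) -(IntB r0 C1 C2) -(IntB r0 C12 C3) -(IntB r0 C123 C4).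
  have := Int_bound r0 (cont_ballD C123 (cont_ballN C4)) (M := eta / (2 * r + 1) * (`|s| + `|t|)).
  move=> /(_ _)/le_trans; apply.
    move=> y yr; have := H s t y se te yr.
    by rewrite /pt !scale0r !addr0.
  have -> : 2 * (eta / (2 * r + 1) * (`|s| + `|t|)) * r =
    (eta * (`|s| + `|t|)) * (2 * r / (2 * r + 1)) by ring.
  by rewrite ler_piMr ?mulr_ge0 ?addr_ge0 ?(ltW eta0)// ler_pdivrMr// mul1r lerDl.
have dfam0 s x : 'D_(delta_mx 0 0) (fam u a b ^~ x) s = a x.
  have [_ //] : is_derive s (delta_mx 0 0) (fam u a b ^~ x) (a x).
  apply/is_derive_approxP => e e0; apply: filterS (@near0_norm_lt R R 1 ltr01) => h _.
  rewrite /fam !mxE /= mulr1 mulr0 addr0 scalerDl.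
  rewrite [X in `|X|](_ : _ = 0) ?normr0 ?mulr_ge0 ?(ltW e0)//.
  by apply/rowP => i; rewrite !mxE; ring.
have dfam1 s x : 'D_(delta_mx 0 1) (fam u a b ^~ x) s = b x.
  have [_ //] : is_derive s (delta_mx 0 1) (fam u a b ^~ x) (b x).
  apply/is_derive_approxP => e e0; apply: filterS (@near0_norm_lt R R 1 ltr01) => h _.
  rewrite /fam !mxE /= mulr1 mulr0 addr0 scalerDl.
  rewrite [X in `|X|](_ : _ = 0) ?normr0 ?mulr_ge0 ?(ltW e0)//.
  by apply/rowP => i; rewrite !mxE; ring.
apply: (@young R (fun s t => I (fam u a b (pt s t)))
  (fun s t => pairing (vder I (fam u a b (pt s t))) a)
  (fun s t => pairing (vder I (fam u a b (pt s t))) b) d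
  (Int r (fun x => (dvder I u a x *m (a x)^T) 0 0)) _ _
  (Int r (fun x => (dvder I u b x *m (b x)^T) 0 0)) d0).
- move=> s t sd td; have H := pd (pt s t) (delta_mx 0 0) (bpt s t sd td).
  have -> : (fun s0 => I (fam u a b (pt s0 t))) =
      (fun s0 => I (fam u a b (t *: delta_mx 0 1 + s0 *: delta_mx 0 0))).
    by apply/funext => s0; rewrite /pt add0r addrC.
  apply: (is_derive_line (fun s' => I (fam u a b s')) _ _ s _).1.
  move: H; rewrite /pt add0r [_ + t *: _]addrC; congr is_derive; congr pairing.
  by apply/funext => x; rewrite dfam0.
- move=> s t sd td; have H := pd (pt s t) (delta_mx 0 1) (bpt s t sd td).
  apply: (is_derive_line (fun s' => I (fam u a b s')) _ _ t _).1.
  by move: H; congr is_derive; congr pairing; apply/funext => x; rewrite dfam1.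
- by move=> eta eta0; exact: key.
- by move=> eta eta0; exact: key.
Qed.

End two_parameters.
End functionals.

Section smooth_matrices.
Context {R : realType}.

Lemma smR_cst (c : R) : smooth_on [set: R] (fun=> c).
Proof. by apply: smooth_cst_set; exact: openT. Qed.

Lemma smR_D (f g : R -> R) : smooth_on [set: R] f -> smooth_on [set: R] g ->
  smooth_on [set: R] (fun x => f x + g x).
Proof. by move=> fs gs; apply: smooth_onDr; [exact: openT|exact: fs|exact: gs]. Qed.

Lemma smR_M (f g : R -> R) : smooth_on [set: R] f -> smooth_on [set: R] g ->
  smooth_on [set: R] (fun x => f x * g x).
Proof. by move=> fs gs; apply: smooth_onM; [exact: openT|exact: fs|exact: gs]. Qed.

Lemma smR_N (f : R -> R) : smooth_on [set: R] f -> smooth_on [set: R] (fun x => - f x).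
Proof. by move=> fs; apply: smooth_onN; [exact: openT|exact: fs]. Qed.

Lemma smR_sum (I : Type) (r : seq I) (f : I -> R -> R) :
  (forall i, smooth_on [set: R] (f i)) -> smooth_on [set: R] (fun x => \sum_(i <- r) f i x).
Proof. by move=> fs; apply: smooth_on_sum; [exact: openT|exact: fs]. Qed.

Definition smm m n (A : R -> 'M[R]_(m, n)) := forall i j, smooth_on [set: R] (fun x => A x i j).

Lemma eq_smm m n (A B : R -> 'M[R]_(m, n)) : smm A -> (forall x, A x = B x) -> smm B.
Proof. by move=> H /funext <-. Qed.

Lemma smmD m n (A B : R -> 'M[R]_(m, n)) : smm A -> smm B -> smm (fun x => A x + B x).
Proof.
move=> HA HB i j; under eq_fun do rewrite mxE.
exact: smR_D (HA i j) (HB i j).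
Qed.

Lemma smmN m n (A : R -> 'M[R]_(m, n)) : smm A -> smm (fun x => - A x).
Proof.
move=> HA i j; under eq_fun do rewrite mxE.
exact: smR_N (HA i j).
Qed.

Lemma smm_tr m n (A : R -> 'M[R]_(m, n)) : smm A -> smm (fun x => (A x)^T).
Proof. by move=> HA i j; under eq_fun do rewrite mxE; exact: HA. Qed.

Lemma smm_mul m n p (A : R -> 'M[R]_(m, n)) (B : R -> 'M[R]_(n, p)) :
  smm A -> smm B -> smm (fun x => A x *m B x).
Proof.
move=> HA HB i j; under eq_fun do rewrite mxE.
by apply: smR_sum => k; exact: smR_M (HA i k) (HB k j).
Qed.

Lemma smm_cst m n (A : 'M[R]_(m, n)) : smm (fun=> A).
Proof. by move=> i j; exact: smR_cst _. Qed.

Lemma smm_map N (u : R -> 'rV[R]_N) : smooth_map u -> smm u.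
Proof. by move=> us i j; rewrite (ord1 i); exact: us. Qed.

Lemma smm_cont m n rho (A : R -> 'M[R]_(m, n)) : smm A -> cont_ballm rho A.
Proof. by move=> HA i j; exact: smooth_on_cont_ball (HA i j). Qed.

Lemma smm_NN L r (Y : R -> 'rV[R]_L) : smm Y -> smm (NN r Y).
Proof.
move=> HY i j; rewrite (ord1 i).
apply: (smooth_of_derive1 _ (HY 0 j)) => x.
under eq_fun do rewrite mxE.
have fc rho : cont_ball rho (fun y => Y y 0 j) by exact: smooth_on_cont_ball (HY 0 j).
have xr : `|x| < `|x| + 1 by rewrite ltrDl.
have dc := is_derive_cst (2^-1 * (prim (fun y => Y y 0 j) r + prim (fun y => Y y 0 j) (- r))) x 1.
by have := is_deriveB (prim_derive (fc _) xr) dc; rewrite subr0.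
Qed.

Definition mdx m n (A : R -> 'M[R]_(m, n)) (x : R) : 'M[R]_(m, n) :=
  \matrix_(i, j) 'D_1 (fun y : R => A y i j) x.

Lemma smm_mdx m n (A : R -> 'M[R]_(m, n)) : smm A -> smm (mdx A).
Proof.
move=> HA i j; have := smooth_onD (1 : R) (HA i j).
by congr smooth_on; apply/funext => x; rewrite mxE.
Qed.

Lemma mdx_eq m n (A : R -> 'M[R]_(m, n)) (x : R) dA : is_derive x 1 A dA -> mdx A x = dA.
Proof. by move=> H; apply/matrixP => i j; rewrite mxE; have [_] := is_derive_entry i j H. Qed.

Lemma smooth_map_smm N (u : R -> 'rV[R]_N) : smm u -> smooth_map u.
Proof. by move=> H i; exact: H. Qed.

(** Near any [x] the antiderivative agrees with a normalized primitive over an interval that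
    contains both the support and [x]; its derivative is [f]. *)
Lemma Dinv_smooth r (f : R -> R) : 0 <= r -> smooth_on [set: R] f -> supported r f ->
  smooth_on [set: R] (Dinv f).
Proof.
move=> r0 fs fr; apply: (smooth_of_derive1 _ fs) => x.
pose s := Num.max r `|x|.
have [s1 s2] : r <= s /\ `|x| <= s by rewrite !le_max !lexx orbT.
have s0 : 0 <= s by exact: le_trans s1.
have fc : cont_ball (s + 1) f by exact: smooth_on_cont_ball.
have fs' : supported s f by move=> y sy; apply: fr; exact: le_lt_trans sy.
have xs : `|x| < s + 1 by rewrite (le_lt_trans s2)// ltrDl.
have dc := is_derive_cst (2^-1 * (prim f s + prim f (- s))) x 1.
apply: near_eq_is_derive; last first.
  by have := is_deriveB (prim_derive fc xs) dc; rewrite subr0; exact.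
have : \forall y \near x, `|y| < s + 1.
  have oB : open [set y : R | `|y| < s + 1].
    have -> : [set y : R | `|y| < s + 1] = (fun y : R => `|y|) @^-1` [set z | z < s + 1] by [].
    by apply: open_comp; [move=> y _; exact: norm_continuous|exact: open_lt].
  exact: (open_nbhs_nbhs (conj oB xs)).
by apply: filterS => y ys; rewrite /= (supported_Dinv s0 fc fs' ys).
Qed.

End smooth_matrices.

Section opx_variation.
Context {R : realType}.

Lemma UDm_cont m n r (A : R -> R -> 'M[R]_(m, n)) dA : UDm r A dA ->
  \forall e \near (0 : R), cont_ballm (r + 1) (A e).
Proof.
move=> H.
pose Q (ij : 'I_m * 'I_n) (e : R) := cont_ball (r + 1) (fun x => A e x ij.1 ij.2).
suff : \forall e \near (0 : R), forall ij, Q ij e by apply: filterS => e He i j; exact: (He (i, j)).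
apply: (@filter_forall R ('I_m * 'I_n)%type Q (nbhs (0 : R))) => -[i j].
have [[d d0 Hd] _ _] := H i j; apply: filterS (@near0_norm_lt R R d d0) => e; exact: Hd.
Qed.

Lemma eq00 (A B : 'M[R]_1) : A = B -> A 0 0 = B 0 0. Proof. by move=> ->. Qed.

Lemma is_derive_eqv (f : R -> R) (x v d d' : R) : is_derive x v f d -> d = d' -> is_derive x v f d'.
Proof. by move=> H <-. Qed.

Lemma is_derive_near (f g : R -> R) (x d : R) : is_derive x 1 f d ->
  (\forall e \near x, f e = g e) -> is_derive x 1 g d.
Proof. by move=> H fg; exact: near_eq_is_derive fg H. Qed.

Lemma opx_derive {N L : nat} (mu : 'M[R]_L) r (X H dH : R -> R -> 'rV[R]_N) (g B : R -> R -> 'M[R]_N)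
    (W : R -> R -> 'M[R]_(L, N)) X' H' dH' g' B' W' : 0 <= r ->
  UDm r X X' -> UDm r H H' -> UDm r dH dH' -> UDm r g g' -> UDm r B B' -> UDm r W W' ->
  is_derive (0 : R) 1 (fun e : R => Int r (fun x => (X e x *m (opx mu r (g e) (B e) (W e) (H e) (dH e) x)^T) 0 0))
    (Int r (fun x => (X' x *m (opx mu r (g 0) (B 0) (W 0) (H 0) (dH 0) x)^T
      + X 0 x *m (opx mu r (g 0) (B 0) (W 0) H' dH' x)^T
      + X 0 x *m (dH 0 x *m (g' x)^T + H 0 x *m (B' x)^T
        + (NN r (fun y => H 0 y *m (W' y)^T) x *m mu *m W 0 x
           + NN r (fun y => H 0 y *m (W 0 y)^T) x *m mu *m W' x))^T) 0 0)).
Proof.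
move=> r0 HX HH HdH Hg HB HW.
have HY := UDm_mul HH (UDm_tr HW); have HN := UDm_NN r0 HY.
have Hmu := UDm_cst (@cont_ballm_cst R L L (r + 1) mu).
have HP := UDmD (UDmD (UDm_mul HdH (UDm_tr Hg)) (UDm_mul HH (UDm_tr HB)))
  (UDm_mul (UDm_mul HN Hmu) HW).
have HF := UDm_mul HX (UDm_tr HP).
apply: (is_derive_eqv (UD_Int r0 (HF 0 0))).
apply: (eq_Int r0) => x xr; apply: eq00.
have xr1 : `|x| < r + 1 by rewrite (le_lt_trans xr)// ltrDl.
have cH : cont_ballm (r + 1) (H 0) by move=> i j; exact: UD_cont0 (HH i j).
have cW : cont_ballm (r + 1) (W 0) by move=> i j; exact: UD_cont0 (HW i j).
have cH' : cont_ballm (r + 1) H' by move=> i j; exact: UD_dcont (HH i j).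
have cW' : cont_ballm (r + 1) W' by move=> i j; exact: UD_dcont (HW i j).
rewrite (NND r0 (cont_ballm_mul cH' (cont_ballm_tr cW)) (cont_ballm_mul cH (cont_ballm_tr cW')) xr1).
rewrite mulmx0 addr0 -[RHS]addrA; congr (_ + _); rewrite -mulmxDr; congr (_ *m _).
rewrite -linearD; congr (_^T) => /=; rewrite /opx !mulmxDl.
move: (NN r _ x *m mu *m W' x) (NN r _ x *m mu *m W 0 x) (NN r _ x *m mu *m W 0 x) => A1 A2 A3.
by apply/rowP => i; rewrite !addoppE; ring.
Qed.

End opx_variation.

(** * The operator in matrix form and its first variation *)

Section operator.
Context {R : realType} {N L : nat}.
Implicit Types (u a xi eta : R -> 'rV[R]_N).

Definition bv (b : 'I_N -> 'I_N -> 'I_N -> 'rV[R]_N -> R) (p v : 'rV[R]_N) : 'M[R]_N :=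
  \matrix_(i, j) \sum_k b i j k p * v 0 k.

Definition dbv (b : 'I_N -> 'I_N -> 'I_N -> 'rV[R]_N -> R) (p a v : 'rV[R]_N) : 'M[R]_N :=
  \matrix_(i, j) \sum_k 'D_a (b i j k) p * v 0 k.

(** Row m is w_m(p) applied to [a], so the double sum over m and n in the nonlocal part becomes a
    product with [mu]. *)
Definition wm (w : 'I_L -> 'rV[R]_N -> 'M[R]_N) (p a : 'rV[R]_N) : 'M[R]_(L, N) :=
  \matrix_(m, i) \sum_k w m p i k * a 0 k.

Definition dwm (w : 'I_L -> 'rV[R]_N -> 'M[R]_N) (p a v : 'rV[R]_N) : 'M[R]_(L, N) :=
  \matrix_(m, i) \sum_k 'D_a (fun q => w m q i k) p * v 0 k.

Definition dmx m n (F : 'rV[R]_N -> 'M[R]_(m, n)) (p a : 'rV[R]_N) : 'M[R]_(m, n) :=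
  \matrix_(i, j) 'D_a (fun q => F q i j) p.

Variables (U : set 'rV[R]_N) (G : 'rV[R]_N -> 'M[R]_N)
  (b : 'I_N -> 'I_N -> 'I_N -> 'rV[R]_N -> R) (mu : 'M[R]_L)
  (w : 'I_L -> 'rV[R]_N -> 'M[R]_N).
Hypotheses (oU : open U) (Gs : forall i j, smooth_on U (fun p => G p i j))
  (bs : forall i j k, smooth_on U (b i j k))
  (ws : forall m i j, smooth_on U (fun p => w m p i j))
  (mu_sym : mu^T = mu).

Lemma smm_G u : smooth_field U u -> smm (fun x => G (u x)).
Proof. by move=> uU i j; exact: smooth_comp_curve oU (Gs i j) uU. Qed.

Lemma smm_bv u v : smooth_field U u -> smooth_map v -> smm (fun x => bv b (u x) (v x)).
Proof.
move=> uU vs i j; under eq_fun do rewrite mxE.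
apply: smR_sum => k.
exact: smR_M (smooth_comp_curve oU (bs i j k) uU) (vs k).
Qed.

Lemma smm_wm u v : smooth_field U u -> smooth_map v -> smm (fun x => wm w (u x) (v x)).
Proof.
move=> uU vs i j; under eq_fun do rewrite mxE.
apply: smR_sum => k.
exact: smR_M (smooth_comp_curve oU (ws i j k) uU) (vs k).
Qed.

Definition hop := hydro_op G b mu w.

Definition opu r u eta (x : R) : 'rV[R]_N :=
  opx mu r (fun x => G (u x)) (fun x => bv b (u x) (dx u x)) (fun x => wm w (u x) (dx u x)) eta (dx eta) x.

(** The support of [eta] is what turns [Dinv] into the antiderivative over a bounded interval; at
    larger [|x|] the formula is not claimed. *)
Lemma hopE r u eta x : 0 <= r -> supp r eta ->
  cont_ballm (r + 1) (fun y => eta y *m (wm w (u y) (dx u y))^T) -> `|x| < r + 1 ->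
  hop u eta x = opu r u eta x.
Proof.
move=> r0 es ec xr; apply/rowP => i; rewrite /hop /hydro_op /opu /opx /local_op /nonlocal_op.
rewrite !addmxE ![(\row__ _) _ _]mxE; congr (_ + _ + _).
- by rewrite [RHS]mxE; apply: eq_bigr => j _; rewrite [_^T _ _]mxE mulrC.
- rewrite [RHS]mxE; apply: eq_bigr => j _; rewrite [_^T _ _]mxE [bv _ _ _ _ _]mxE mulr_sumr.
  by apply: eq_bigr => k _; rewrite mulrC.
rewrite -(Dinv_NN r0 ec _ xr); last by move=> y /es ->; rewrite mul0mx.
rewrite mxE; apply: eq_bigr => m _; rewrite !mxE mulr_suml; apply: eq_bigr => n _.
rewrite !mxE -[in mu m n]mu_sym mxE.
have -> : (fun y => \sum_j \sum_s w n (u y) j s * dx u y 0 s * eta y 0 j) =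
    (fun y => (eta y *m (wm w (u y) (dx u y))^T) 0 n); last by ring.
apply/funext => y; rewrite mxE; apply: eq_bigr => j _.
by rewrite !mxE mulr_sumr; apply: eq_bigr => k _; rewrite mulrC.
Qed.

Lemma bracket_Int r u xi eta : 0 <= r -> supp r xi -> supp r eta ->
  cont_ballm (r + 1) xi -> cont_ballm (r + 1) eta -> cont_ballm (r + 1) (dx eta) ->
  cont_ballm (r + 1) (fun x => G (u x)) -> cont_ballm (r + 1) (fun x => bv b (u x) (dx u x)) ->
  cont_ballm (r + 1) (fun x => wm w (u x) (dx u x)) ->
  pairing xi (hop u eta) = Int r (fun x => (xi x *m (opu r u eta x)^T) 0 0).
Proof.
move=> r0 xs es xc ec dec gc bc wc.
have Yc := cont_ballm_mul ec (cont_ballm_tr wc).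
have Nc : cont_ballm (r + 1) (NN r (fun x => eta x *m (wm w (u x) (dx u x))^T)).
  by apply: cont_ballm_derive => x xr; exact: NN_derive Yc xr.
have oc : cont_ballm (r + 1) (opu r u eta).
  apply: cont_ballmD; first apply: cont_ballmD.
  - exact: cont_ballm_mul dec (cont_ballm_tr gc).
  - exact: cont_ballm_mul ec (cont_ballm_tr bc).
  - exact: cont_ballm_mul (cont_ballm_mul Nc (@cont_ballm_cst _ _ _ _ mu)) wc.
have := pairingE r0 xc oc xs; rewrite /pairing => <-.
apply: eq_Rintegral => x _; apply: eq_bigr => i _.
have [rx|xr] := leP r `|x|; first by rewrite xs// mxE !mul0r.
by rewrite (hopE r0 es Yc)// (lt_le_trans xr)// lerDl.
Qed.

Lemma smm_opu r u eta : smooth_field U u -> smooth_map eta -> smm (opu r u eta).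
Proof.
move=> uU es; have [us _] := uU; have dus := smooth_map_dx us; have des := smooth_map_dx es.
apply: smmD; first apply: smmD.
- exact: smm_mul (smm_map des) (smm_tr (smm_G uU)).
- exact: smm_mul (smm_map es) (smm_tr (smm_bv uU dus)).
- apply: smm_mul (smm_wm uU dus); apply: smm_mul (@smm_cst _ _ _ mu).
  exact: smm_NN (smm_mul (smm_map es) (smm_tr (smm_wm uU dus))).
Qed.

Lemma hop_smooth r u eta : 0 <= r -> smooth_field U u -> smooth_map eta -> supp r eta ->
  smooth_map (hop u eta).
Proof.
move=> r0 uU es er i; have [us _] := uU; have dus := smooth_map_dx us; have des := smooth_map_dx es.
rewrite /hop /hydro_op /local_op /nonlocal_op.
under eq_fun do rewrite addmxE ![(\row__ _) _ _]mxE.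
have Gc i' j := smm_G uU i' j; have bc i' j k := smooth_comp_curve oU (bs i' j k) uU.
have wc m i' j := smooth_comp_curve oU (ws m i' j) uU.
apply: smR_D; first apply: smR_D.
- by apply: smR_sum => j; exact: smR_M (Gc i j) (des j).
- apply: smR_sum => j; apply: smR_sum => k.
  exact: smR_M (smR_M (bc i j k) (dus k)) (es j).
- apply: smR_sum => m; apply: smR_sum => n.
  apply: smR_M.
    apply: (smR_M (smR_cst _)); apply: smR_sum => k.
    exact: smR_M (wc m i k) (dus k).
  apply: (Dinv_smooth r0) => [|x /ltW/er ex].
    apply: smR_sum => j; apply: smR_sum => k.
    exact: smR_M (smR_M (wc n j k) (dus k)) (es j).
  by rewrite ex big1// => j _; rewrite big1// => k _; rewrite [(0 : 'rV__) _ _]mxE mulr0.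
Qed.

Section variation.
Variables (r : R) (u a : R -> 'rV[R]_N).
Hypotheses (r0 : 0 <= r) (uU : smooth_field U u) (as_ : smooth_map a).

(** The derivative at e = 0 of the rows w_m u_x along u + e a: one term from the coefficients, one
    from the velocity. *)
Definition dW (x : R) := dwm w (u x) (a x) (dx u x) + wm w (u x) (dx a x).

(** The derivative of the operator along u + e a with [eta] held fixed; the two nonlocal terms come
    from the factor inside and the factor outside the antiderivative. *)
Definition opvar eta (x : R) : 'rV[R]_N :=
  dx eta x *m (dmx G (u x) (a x))^T + eta x *m (dbv b (u x) (a x) (dx u x) + bv b (u x) (dx a x))^T
  + (NN r (fun y => eta y *m (dW y)^T) x *m mu *m wm w (u x) (dx u x)
     + NN r (fun y => eta y *m (wm w (u y) (dx u y))^T) x *m mu *m dW x).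

Let ue (e : R) (x : R) := u x + e *: a x.

Lemma UD_dxu i : UD r (fun e x => dx (ue e) x 0 i) (fun x => dx a x 0 i).
Proof.
have [us _] := uU; have dus := smooth_map_dx us; have das := smooth_map_dx as_.
have /UD_eq := UD_line (smooth_on_cont_ball (rho := r + 1) (dus i)) (smooth_on_cont_ball (rho := r + 1) (das i)).
by apply=> // e x; rewrite (dx_line e us as_) !mxE.
Qed.

Lemma ue0 x : ue 0 x = u x. Proof. by rewrite /ue scale0r addr0. Qed.

Lemma ue0E : ue 0 = u. Proof. by apply/funext => x; rewrite ue0. Qed.

Lemma UD_F (F : 'rV[R]_N -> R) : smooth_on U F -> UD r (fun e x => F (ue e x)) (fun x => 'D_(a x) F (u x)).
Proof. by have [us uin] := uU; move=> FU; exact: UD_field oU FU us as_ uin. Qed.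

Lemma UDm_G : UDm r (fun e x => G (ue e x)) (fun x => dmx G (u x) (a x)).
Proof. by move=> i j; have /UD_eq := UD_F (Gs i j); apply=> // x; rewrite mxE. Qed.

Lemma UDm_bv : UDm r (fun e x => bv b (ue e x) (dx (ue e) x))
  (fun x => dbv b (u x) (a x) (dx u x) + bv b (u x) (dx a x)).
Proof.
move=> i j; have /UD_eq := UD_sum (index_enum 'I_N) (fun k => UDM (UD_F (bs i j k)) (UD_dxu k)).
apply=> [e x|x]; rewrite !mxE// -big_split; apply: eq_bigr => k _ /=.
by rewrite ue0E.
Qed.

Lemma UDm_wm : UDm r (fun e x => wm w (ue e x) (dx (ue e) x)) dW.
Proof.
move=> i j; have /UD_eq := UD_sum (index_enum 'I_N) (fun k => UDM (UD_F (ws i j k)) (UD_dxu k)).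
apply=> [e x|x]; rewrite !mxE// -big_split; apply: eq_bigr => k _ /=.
by rewrite ue0E.
Qed.

Lemma bracket_derive (Ifn Jfn : functional U) : Defs.rad Ifn < r -> Defs.rad Jfn < r ->
  is_derive (0 : R) 1 (fun e : R => bracket hop Ifn Jfn (fun x => u x + e *: a x))
    (Int r (fun x => (dvder Ifn u a x *m (opu r u (vder Jfn u) x)^T
      + vder Ifn u x *m (opu r u (dvder Jfn u a) x)^T
      + vder Ifn u x *m (opvar (vder Jfn u) x)^T) 0 0)).
Proof.
move=> Ir Jr.
have HI := UD_vder oU Ifn uU as_ as_ r; have HJ := UD_vder oU Jfn uU as_ as_ r.
have HdJ := UD_dx_vder oU Jfn uU as_ as_ r.
have H := opx_derive mu r0 HI HJ HdJ UDm_G UDm_bv UDm_wm.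
have e0 : (fun y => u y + 0 *: a y) = u by exact: ue0E.
rewrite /= !e0 ue0E in H; apply: (is_derive_near H).
have CI := UDm_cont HI; have CJ := UDm_cont HJ; have CdJ := UDm_cont HdJ.
  have CG := UDm_cont UDm_G; have CB := UDm_cont UDm_bv; have CW := UDm_cont UDm_wm.
  apply: filterS3 (filterI CI CJ) (filterI CdJ CG) (filterI CB CW) => e [cI cJ] [cdJ cG] [cB cW].
  have sI : supp r (vder Ifn (ue e)) by move=> x rx; apply: vder_supp; exact: lt_le_trans rx.
  have sJ : supp r (vder Jfn (ue e)) by move=> x rx; apply: vder_supp; exact: lt_le_trans rx.
  by rewrite /bracket (bracket_Int r0 sI sJ cI cJ cdJ cG cB cW).
Qed.

End variation.
End operator.

Local Opaque Int.

(** * Flat connections and the Jacobi identity *)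

Section contraction.
Context {R : realType} {N : nat} (U : set 'rV[R]_N) (oU : open U).

(** One contraction for Christoffel symbols, for the w_m and for the systems to be integrated, so
    that a single chain rule along curves serves them all. *)
Definition ct m n (F : 'I_m -> 'I_n -> 'I_N -> 'rV[R]_N -> R) (p a : 'rV[R]_N) : 'M[R]_(m, n) :=
  \matrix_(i, j) \sum_k F i j k p * a 0 k.

Definition dct m n (F : 'I_m -> 'I_n -> 'I_N -> 'rV[R]_N -> R) (p a v : 'rV[R]_N) : 'M[R]_(m, n) :=
  \matrix_(i, j) \sum_k 'D_a (F i j k) p * v 0 k.

Lemma curve_chain (F : 'rV[R]_N -> R) (u : R -> 'rV[R]_N) (x : R) :
  smooth_on U F -> smooth_field U u -> is_derive x 1 (fun y => F (u y)) ('D_(dx u x) F (u x)).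
Proof.
move=> FU [us uU]; rewrite (smooth_derive_sum _ oU FU (uU x)).
under eq_bigr do rewrite mxE.
apply: (smooth_on_comp_derive oU FU (uU x)) => i.
by have [] := smooth_on_is_derive (1 : R) (us i) (I : [set: R] x).
Qed.

Lemma dmx_curve m n (F : 'rV[R]_N -> 'M[R]_(m, n)) (u : R -> 'rV[R]_N) (x : R) :
  (forall i j, smooth_on U (fun p => F p i j)) -> smooth_field U u ->
  is_derive x 1 (fun y => F (u y)) (dmx F (u x) (dx u x)).
Proof. by move=> FU uU; apply: is_derive_mx => i j; rewrite mxE; exact: curve_chain. Qed.

Lemma ct_curve m n (F : 'I_m -> 'I_n -> 'I_N -> 'rV[R]_N -> R) (u a : R -> 'rV[R]_N) (x : R) :
  (forall i j k, smooth_on U (F i j k)) -> smooth_field U u -> smooth_map a ->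
  is_derive x 1 (fun y => ct F (u y) (a y)) (dct F (u x) (dx u x) (a x) + ct F (u x) (dx a x)).
Proof.
move=> FU uU as_; apply: is_derive_mx => i j.
have -> : (dct F (u x) (dx u x) (a x) + ct F (u x) (dx a x)) i j =
    \sum_k (F i j k (u x) *: dx a x 0 k + a x 0 k *: 'D_(dx u x) (F i j k) (u x)).
  rewrite !mxE -big_split; apply: eq_bigr => k _ /=.
  by rewrite mxE /GRing.scale/=; ring.
under eq_fun do rewrite mxE.
rewrite (_ : (fun _ => _) = \sum_k (fun y => F i j k (u y) * a y 0 k)); last first.
  by apply/funext => y; rewrite fct_sumE.
apply: is_derive_sum => k; apply: is_deriveM; first exact: curve_chain.
by rewrite mxE; exact: smooth_on_is_derive (as_ k) I.
Qed.

Lemma ct_smm m n (F : 'I_m -> 'I_n -> 'I_N -> 'rV[R]_N -> R) (u a : R -> 'rV[R]_N) :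
  (forall i j k, smooth_on U (F i j k)) -> smooth_field U u -> smooth_map a ->
  smm (fun y => ct F (u y) (a y)).
Proof.
move=> FU uU as_ i j; under eq_fun do rewrite mxE.
by apply: smR_sum => k; apply: smR_M; [exact: smooth_comp_curve oU (FU i j k) uU|exact: as_].
Qed.

Lemma dct_smm m n (F : 'I_m -> 'I_n -> 'I_N -> 'rV[R]_N -> R) (u a v : R -> 'rV[R]_N) :
  (forall i j k, smooth_on U (F i j k)) -> smooth_field U u -> smooth_map a -> smooth_map v ->
  smm (fun y => dct F (u y) (a y) (v y)).
Proof.
move=> FU uU as_ vs i j; under eq_fun do rewrite mxE.
apply: smR_sum => k; apply: smR_M; last exact: vs.
have [us uin] := uU.
have -> : (fun x => 'D_(a x) (F i j k) (u x)) = (fun x => \sum_l a x 0 l * pd l (F i j k) (u x)).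
  by apply/funext => x; exact: smooth_derive_sum oU (FU i j k) (uin x).
apply: smR_sum => l; apply: smR_M; first exact: as_.
by apply: (smooth_comp_curve oU _ uU); exact: smooth_onD.
Qed.

Lemma ctD m n (F : 'I_m -> 'I_n -> 'I_N -> 'rV[R]_N -> R) p a c :
  ct F p (a + c) = ct F p a + ct F p c.
Proof.
apply/matrixP => i j; rewrite !mxE -big_split; apply: eq_bigr => k _ /=.
by rewrite mxE mulrDr.
Qed.

Lemma ctN m n (F : 'I_m -> 'I_n -> 'I_N -> 'rV[R]_N -> R) p a : ct F p (- a) = - ct F p a.
Proof.
apply/matrixP => i j; rewrite !mxE -sumrN; apply: eq_bigr => k _ /=.
by rewrite mxE mulrN.
Qed.

Lemma ct0 m n (F : 'I_m -> 'I_n -> 'I_N -> 'rV[R]_N -> R) p : ct F p 0 = 0.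
Proof. by apply/matrixP => i j; rewrite !mxE big1// => k _; rewrite mxE mulr0. Qed.

Lemma dct0r m n (F : 'I_m -> 'I_n -> 'I_N -> 'rV[R]_N -> R) p a : dct F p a 0 = 0.
Proof. by apply/matrixP => i j; rewrite !mxE big1// => k _; rewrite mxE mulr0. Qed.

End contraction.

Section connection.
Context {R : realType} {N L : nat} (U : set 'rV[R]_N) (oU : open U).
Variables (G : 'rV[R]_N -> 'M[R]_N) (c : 'I_N -> 'I_N -> 'I_N -> 'rV[R]_N -> R)
  (mu : 'M[R]_L) (w : 'I_L -> 'rV[R]_N -> 'M[R]_N).

(* The matrix of X |-> Gamma_a X acting on row vectors; covectors are acted on
   by its transpose.  [c i s k] is Gamma^i_{sk}. *)
Definition gam : 'rV[R]_N -> 'rV[R]_N -> 'M[R]_N := ct (fun s i k => c i s k).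
Definition dgam : 'rV[R]_N -> 'rV[R]_N -> 'rV[R]_N -> 'M[R]_N := dct (fun s i k => c i s k).

(** The metric and the symbols are independent arguments: in the pencil the metric is multiplied by
    a constant, possibly 0, while the symbols stay those of the original metric. *)
Definition lcb (i j k : 'I_N) (p : 'rV[R]_N) : R := - \sum_s G p i s * c j s k p.

(* G may be degenerate: the metric lambda_1 g of the pencil is needed for
   lambda_1 = 0 as well. *)
Record flat_connection : Prop := FlatConnection {
  fc_G : forall i j, smooth_on U (fun p => G p i j);
  fc_c : forall i j k, smooth_on U (c i j k);
  fc_sym : forall p, U p -> (G p)^T = G p;
  fc_tor : forall p, U p -> forall i s k, c i s k p = c i k s p;
  fc_met : forall p a, U p -> dmx G p a = - ((gam p a)^T *m G p) - G p *m gam p a;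
  fc_flat : forall p a v, U p ->
    dgam p v a - dgam p a v + gam p a *m gam p v - gam p v *m gam p a = 0 }.

Hypotheses (FC : flat_connection) (ws : forall m i j, smooth_on U (fun p => w m p i j))
  (mu_sym : mu^T = mu).

Lemma gam_sym p a v : U p -> a *m gam p v = v *m gam p a.
Proof.
move=> Up; apply/rowP => i; rewrite !mxE.
under eq_bigr do rewrite mxE mulr_sumr.
under [RHS]eq_bigr do rewrite mxE mulr_sumr.
rewrite exchange_big /=; apply: eq_bigr => k _; apply: eq_bigr => s _.
by rewrite (fc_tor FC Up); ring.
Qed.

Lemma lcb_smooth i j k : smooth_on U (lcb i j k).
Proof.
apply: (smooth_onN oU); apply: (smooth_on_sum oU) => s.
by apply: (smooth_onM oU); [exact: fc_G FC _ _|exact: fc_c FC _ _ _].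
Qed.

Lemma bv_lcb p v : bv lcb p v = - (G p *m gam p v).
Proof.
apply/matrixP => i j; rewrite !mxE -sumrN.
under eq_bigr do rewrite /lcb mulNr mulr_suml -sumrN.
rewrite exchange_big /=; apply: eq_bigr => s _.
rewrite mxE mulr_sumr -sumrN; apply: eq_bigr => k _.
by rewrite mulrA.
Qed.

Lemma dbv_lcb p a v : U p -> dbv lcb p a v = - (dmx G p a *m gam p v + G p *m dgam p a v).
Proof.
move=> Up; apply/matrixP => i j; rewrite !mxE -big_split /= -sumrN.
have E k : 'D_a (lcb i j k) p = - \sum_s ('D_a (fun q => G q i s) p * c j s k p + G p i s * 'D_a (c j s k) p).
  have H : is_derive p a (- \sum_s (fun q => G q i s * c j s k q))
      (- \sum_s (G p i s *: 'D_a (c j s k) p + c j s k p *: 'D_a (fun q => G q i s) p)).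
    apply: is_deriveN; apply: is_derive_sum => s; apply: is_deriveM.
      exact: smooth_on_is_derive (fc_G FC i s) Up.
    exact: smooth_on_is_derive (fc_c FC j s k) Up.
  have -> : lcb i j k = - \sum_s (fun q => G q i s * c j s k q).
    by apply/funext => q; rewrite /lcb fctE fct_sumE.
  have [_ ->] := H; congr (- _); apply: eq_bigr => s _.
  by rewrite /GRing.scale/=; ring.
under eq_bigr do rewrite E mulNr mulr_suml -sumrN.
rewrite exchange_big /=; apply: eq_bigr => s _.
rewrite !mxE !mulr_sumr -big_split /= -sumrN.
by apply: eq_bigr => k _; ring.
Qed.

Lemma Int_subl n r (f g h : R -> 'rV[R]_n) : 0 <= r -> smm f -> smm g -> smm h ->
  Int r (fun x => ((f x - g x) *m (h x)^T) 0 0) =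
  Int r (fun x => (f x *m (h x)^T) 0 0) - Int r (fun x => (g x *m (h x)^T) 0 0).
Proof.
move=> r0 fs gs hs; have th := smm_tr hs.
have C1 : cont_ballm (r + 1) _ := smm_cont (smm_mul fs th).
have C2 : cont_ballm (r + 1) _ := smm_cont (smm_mul gs th).
rewrite -(IntB r0 (C1 0 0) (C2 0 0)); apply: (eq_Int r0) => x _.
by rewrite mulmxBl !addoppE.
Qed.

Section along.
Variables (r : R) (u : R -> 'rV[R]_N).
Hypotheses (r0 : 0 <= r) (uU : smooth_field U u).

Let us : smooth_map u. Proof. by case: uU. Qed.
Let uin x : U (u x). Proof. by case: uU. Qed.

Definition Wu (x : R) : 'M[R]_(L, N) := wm w (u x) (dx u x).
Definition Nu (eta : R -> 'rV[R]_N) := NN r (fun y => eta y *m (Wu y)^T).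
Definition gu (a : R -> 'rV[R]_N) (x : R) : 'M[R]_N := gam (u x) (a x).

(* Covariant derivative of the vectors w_m u_x along a deformation of the
   curve with velocity a. *)
Definition Vu (a : R -> 'rV[R]_N) (x : R) : 'M[R]_(L, N) := dW w u a x + Wu x *m gu a x.

Definition Sterm (a xi eta : R -> 'rV[R]_N) : R :=
  Int r (fun x => (Nu eta x *m mu *m Vu a x *m (xi x)^T) 0 0).

Notation P := (opu G lcb mu w r u).

(** With the Levi-Civita coefficients the local part is the covariant derivative of [eta] along the
    curve, raised by the metric. *)
Lemma opu_lcb eta x : P eta x = (dx eta x - eta x *m (gam (u x) (dx u x))^T) *m G (u x) + Nu eta x *m mu *m Wu x.
Proof.
rewrite /opu /opx bv_lcb (fc_sym FC (uin x)) trNE trmx_mul (fc_sym FC (uin x)).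
by rewrite mulmxBl mulmxN mulmxA.
Qed.

Lemma smm_W : smm Wu.
Proof. by apply: (smm_wm oU ws uU); exact: smooth_map_dx. Qed.

Lemma smm_N eta : smooth_map eta -> smm (Nu eta).
Proof. by move=> es; apply: smm_NN; exact: smm_mul (smm_map es) (smm_tr smm_W). Qed.

Lemma smm_gu a : smooth_map a -> smm (gu a).
Proof. by move=> as_; apply: (ct_smm oU _ uU as_) => *; exact: fc_c FC _ _ _. Qed.

Lemma smm_dW a : smooth_map a -> smm (dW w u a).
Proof.
move=> as_; apply: smmD.
- apply: (dct_smm (F := fun m i k p => w m p i k) oU _ uU as_ (smooth_map_dx us)) => *; exact: ws.
- by apply: (smm_wm oU ws uU); exact: smooth_map_dx.
Qed.

Lemma smm_V a : smooth_map a -> smm (Vu a).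
Proof. by move=> as_; apply: smmD; [exact: smm_dW|exact: smm_mul smm_W (smm_gu as_)]. Qed.

Lemma smm_P eta : smooth_map eta -> smm (P eta).
Proof. by move=> es; exact: (smm_opu mu oU (fc_G FC) lcb_smooth ws r uU es). Qed.

Section direction.
Variable a : R -> 'rV[R]_N.
Hypothesis as_ : smooth_map a.

Definition cov (eta : R -> 'rV[R]_N) (x : R) : 'rV[R]_N := eta x *m (gu a x)^T.

Lemma cov_smooth eta : smooth_map eta -> smooth_map (cov eta).
Proof. by move=> es; apply: smooth_map_smm; exact: smm_mul (smm_map es) (smm_tr (smm_gu as_)). Qed.

Lemma dx_cov eta x : smooth_map eta ->
  dx (cov eta) x = dx eta x *m (gu a x)^T + eta x *m (dgam (u x) (dx u x) (a x) + gam (u x) (dx a x))^T.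
Proof.
move=> es; apply: is_derive_eq_dx; apply: is_derive_mulmx; first exact: smooth_map_derive.
apply: is_derive_trmx.
by apply: (ct_curve (F := fun s i k => c i s k) oU _ _ uU as_) => *; exact: fc_c FC _ _ _.
Qed.

(** The variation written covariantly. Flatness exchanges the derivatives of the connection along
    [a] and along u_x, the compatibility with the metric removes its derivative, and [dW] is
    completed to [Vu] by the term with [cov]; no curvature term remains. *)
Lemma opvar_cov eta x : smooth_map eta -> `|x| < r + 1 ->
  opvar G lcb mu w r u a eta x = - (P eta x *m gu a x) - P (cov eta) x
    + (NN r (fun y => eta y *m (Vu a y)^T) x *m mu *m Wu x + Nu eta x *m mu *m Vu a x).
Proof.
move=> es xr; rewrite !opu_lcb (dx_cov x es) /opvar -/(Wu x) -/(Nu eta).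
rewrite bv_lcb (dbv_lcb _ _ (uin x)) (fc_met FC _ (uin x)) -/(gu a x).
have E : NN r (fun y => eta y *m (Vu a y)^T) x =
    NN r (fun y => eta y *m (dW w u a y)^T) x + Nu (cov eta) x.
  rewrite /Nu -(NND r0 _ _ xr).
  - congr (NN r _ x); apply/funext => y; rewrite /Vu /cov.
    by rewrite trDE mulmxDr trmx_mul mulmxA.
  - by apply: smm_cont; exact: smm_mul (smm_map es) (smm_tr (smm_dW as_)).
  - by apply: smm_cont; exact: smm_mul (smm_map (cov_smooth es)) (smm_tr smm_W).
rewrite E /Vu /cov.
have := fc_flat FC (a x) (dx u x) (uin x); rewrite -/(gu a x).
move: (gu a x) (gam (u x) (dx u x)) (gam (u x) (dx a x)) (dgam _ _ (a x)) (dgam _ (a x) _) => ga gv gda d1 d2 flat.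
have {}flat : d1 = d2 - ga *m gv + gv *m ga.
  by apply/eqP; rewrite -subr_eq0 -flat; apply/eqP/matrixP => i j; rewrite !addoppE; ring.
rewrite flat.
have Gs := fc_sym FC (uin x).
move: (NN r (fun y => _ *m (dW _ _ _ _)^T) x) (Nu _ x) (Nu _ x) (dW _ _ _ x) (Wu x) => n1 n2 n3 dw W.
rewrite !(trDE, trNE, trmx_mul, trmxK) Gs.
rewrite !(mulmxDl, mulmxDr, mulmxBl, mulmxBr, mulmxN, mulNmx, mulmxA).
by apply/rowP => i; rewrite !addoppE; ring.
Qed.

Lemma supp_cov eta : supp r eta -> supp r (cov eta).
Proof. by move=> es x /es; rewrite /cov => ->; rewrite mul0mx. Qed.

Lemma P_skew xi eta : smooth_map xi -> smooth_map eta -> supp r xi -> supp r eta ->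
  Int r (fun x => (xi x *m (P eta x)^T) 0 0) = - Int r (fun x => (eta x *m (P xi x)^T) 0 0).
Proof.
move=> xs es xr er.
have H1 (x : R) : `|x| < r + 1 -> (G (u x))^T = G (u x) by move=> _; exact: (fc_sym FC (uin x)).
have H2 (x : R) : `|x| < r + 1 -> is_derive x 1 (fun x => G (u x))
    (bv lcb (u x) (dx u x) + (bv lcb (u x) (dx u x))^T).
  move=> _; rewrite !bv_lcb trNE trmx_mul (fc_sym FC (uin x)).
  have := dmx_curve oU x (fc_G FC) uU; congr is_derive; rewrite (fc_met FC _ (uin x)).
  by rewrite addrC.
have H3 : cont_ballm (r + 1) (fun x => bv lcb (u x) (dx u x)).
  by apply: smm_cont; exact: (smm_bv oU lcb_smooth uU (smooth_map_dx us)).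
have dc (v : R -> 'rV[R]_N) : smooth_map v -> cont_ballm (r + 1) (dx v).
  by move=> vs; apply: smooth_map_cont; exact: smooth_map_dx.
have H4 : cont_ballm (r + 1) Wu by exact: smm_cont smm_W.
exact: (opx_skew mu_sym r0 H1 H2 H3 H4 (fun x _ => smooth_map_derive x xs) (dc _ xs)
  (fun x _ => smooth_map_derive x es) (dc _ es) xr er).
Qed.

(** The antiderivative is moved from [eta V(a)^T] to [xi W^T] by differentiating the product of the
    two; [NN_boundary] disposes of the end values. *)
Lemma S_parts xi eta : smooth_map xi -> smooth_map eta -> supp r xi -> supp r eta ->
  Int r (fun x => (xi x *m (NN r (fun y => eta y *m (Vu a y)^T) x *m mu *m Wu x)^T) 0 0) = - Sterm a eta xi.
Proof.
move=> xs es xr er.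
have Vs := smm_V as_; have cmu := @smm_cst R _ _ mu.
have sV : smm (fun y => eta y *m (Vu a y)^T) by exact: smm_mul (smm_map es) (smm_tr Vs).
have sW : smm (fun y => xi y *m (Wu y)^T) by exact: smm_mul (smm_map xs) (smm_tr smm_W).
have sN := smm_NN r sV; have sNx := smm_N xs.
have C1 : cont_ballm (r + 1) _ := smm_cont (smm_mul (smm_map xs) (smm_tr (smm_mul (smm_mul sN cmu) smm_W))).
have C2 : cont_ballm (r + 1) _ := smm_cont (smm_mul (smm_mul (smm_mul sNx cmu) Vs) (smm_tr (smm_map es))).
apply/eqP; rewrite -addr_eq0 -(IntD r0 (C1 0 0) (C2 0 0)); apply/eqP.
pose F x := NN r (fun y => eta y *m (Vu a y)^T) x *m mu *m (Nu xi x)^T.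
have Fd0 (x : R) : `|x| < r + 1 -> is_derive x 1 (fun x => F x 0 0)
    ((xi x *m (NN r (fun y => eta y *m (Vu a y)^T) x *m mu *m Wu x)^T) 0 0
     + (Nu xi x *m mu *m Vu a x *m (eta x)^T) 0 0).
  move=> xr1.
  have H := is_derive_mulmx (is_derive_mulmx (NN_derive (smm_cont sV) xr1) (is_derive_cst mu x 1))
    (is_derive_trmx (NN_derive (smm_cont sW) xr1)).
  have := is_derive_entry 0 0 H; congr is_derive.
  rewrite mulmx0 addr0 addmxE addrC -[cst mu x]/mu -/(Nu xi); congr (_ + _).
    by rewrite [RHS]sc_tr !trmx_mul !trmxK !mulmxA.
  by rewrite [LHS]sc_tr !trmx_mul !trmxK mu_sym !mulmxA.
rewrite (Int_derive r0 (cont_ballD (C1 0 0) (C2 0 0)) Fd0) /F /Nu !NN_boundary.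
by rewrite trNE !mulNmx mulmxN opprK subrr.
Qed.

(** Skew-symmetry moves the operator off [eta'] and off [cov eta]. What depends on [xi'] and [eta']
    then appears only as a covariant second variation, and the nonlocal remainder is antisymmetric
    in [xi] and [eta]. *)
Lemma bracket_variation xi eta xi' eta' : smooth_map xi -> smooth_map eta -> smooth_map xi' -> smooth_map eta' ->
  supp r xi -> supp r eta -> supp r eta' ->
  Int r (fun x => (xi' x *m (P eta x)^T + xi x *m (P eta' x)^T + xi x *m (opvar G lcb mu w r u a eta x)^T) 0 0)
  = Int r (fun x => ((xi' x - cov xi x) *m (P eta x)^T) 0 0)
    - Int r (fun x => ((eta' x - cov eta x) *m (P xi x)^T) 0 0)
    + Sterm a xi eta - Sterm a eta xi.
Proof.
move=> xs es xs' es' xr er er'.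
have Vs := smm_V as_; have cmu := @smm_cst R _ _ mu.
have sV : smm (fun y => eta y *m (Vu a y)^T) by exact: smm_mul (smm_map es) (smm_tr Vs).
have Pe := smm_P es; have Px := smm_P xs; have Pe' := smm_P es'.
have ce := cov_smooth es; have cx := cov_smooth xs; have Pce := smm_P ce.
have K f g (Hf : smm (f : R -> 'rV[R]_N)) (Hg : smm (g : R -> 'rV[R]_N)) :
    cont_ball (r + 1) (fun x => (f x *m (g x)^T) 0 0) := smm_cont (smm_mul Hf (smm_tr Hg)) (i := 0) (j := 0).
have c1 := K _ _ (smm_map xs') Pe; have c2 := K _ _ (smm_map xs) Pe'.
have c3 := K _ _ (smm_map cx) Pe; have c4 := K _ _ (smm_map xs) Pce.
have c5 := K _ _ (smm_map xs) (smm_mul (smm_mul (smm_NN r sV) cmu) smm_W).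
have c6 := K _ _ (smm_map xs) (smm_mul (smm_mul (smm_N es) cmu) Vs).
have c7 := K _ _ (smm_map es') Px; have c8 := K _ _ (smm_map ce) Px.
have sk1 := P_skew xs es' xr er'; have sk2 := P_skew xs ce xr (supp_cov er).
have sp := S_parts xs es xr er.
have e6 : Int r (fun x => (xi x *m (Nu eta x *m mu *m Vu a x)^T) 0 0) = Sterm a xi eta.
  apply: (eq_Int r0) => x _; rewrite [LHS]sc_tr trmx_mul trmxK.
  by [].
have -> : Int r (fun x => (xi' x *m (P eta x)^T + xi x *m (P eta' x)^T + xi x *m (opvar G lcb mu w r u a eta x)^T) 0 0)
  = Int r (fun x => (xi' x *m (P eta x)^T) 0 0 + (xi x *m (P eta' x)^T) 0 0
     - (cov xi x *m (P eta x)^T) 0 0 - (xi x *m (P (cov eta) x)^T) 0 0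
     + (xi x *m (NN r (fun y => eta y *m (Vu a y)^T) x *m mu *m Wu x)^T) 0 0
     + (xi x *m (Nu eta x *m mu *m Vu a x)^T) 0 0).
  apply: (eq_Int r0) => x xr1; rewrite opvar_cov//; last by rewrite (le_lt_trans xr1)// ltrDl.
  move: (P (cov eta) x) (P eta x) (P eta' x) (NN r _ x *m mu *m _) (Nu eta x *m mu *m _) => A1 A2 A3 A4 A5.
  rewrite !trDE !trNE trmx_mul /cov !(mulmxDr, mulmxN) mulmxA !addoppE.
  by ring.
have d12 := cont_ballD c1 c2; have d3 := cont_ballD d12 (cont_ballN c3).
have d4 := cont_ballD d3 (cont_ballN c4); have d5 := cont_ballD d4 c5.
rewrite (IntD r0 d5 c6) (IntD r0 d4 c5) (IntB r0 d3 c4) (IntB r0 d12 c3) (IntD r0 c1 c2).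
have q1 := Int_subl r0 (smm_map xs') (smm_map cx) Pe.
have q2 := Int_subl r0 (smm_map es') (smm_map ce) Px.
have alg (a1 a2 a3 a4 a5 a6 a7 a8 Q1 Q2 t1 t2 : R) : Q1 = a1 - a3 -> Q2 = a7 - a8 -> a2 = - a7 ->
  a4 = - a8 -> a5 = - t2 -> a6 = t1 -> a1 + a2 - a3 - a4 + a5 + a6 = Q1 - Q2 + t1 - t2.
  by move=> -> -> -> -> -> ->; ring.
exact (alg _ _ _ _ _ _ _ _ _ _ _ _ q1 q2 sk1 sk2 sp e6).
Qed.

End direction.
End along.
End connection.

Section jacobi.
Context {R : realType} {N L : nat} (U : set 'rV[R]_N) (oU : open U).
Variables (G : 'rV[R]_N -> 'M[R]_N) (c : 'I_N -> 'I_N -> 'I_N -> 'rV[R]_N -> R)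
  (mu : 'M[R]_L) (w : 'I_L -> 'rV[R]_N -> 'M[R]_N).
Hypotheses (FC : flat_connection U G c) (ws : forall m i j, smooth_on U (fun p => w m p i j))
  (mu_sym : mu^T = mu).

Notation P := (hop G (lcb G c) mu w).
Notation opP := (opu G (lcb G c) mu w).

Section along.
Variables (r : R) (u : R -> 'rV[R]_N).
Hypotheses (r0 : 0 <= r) (uU : smooth_field U u).

(** The second variation of [I] corrected by the connection, as a bilinear form in the two
    directions. *)
Definition covder (I : functional U) (a b : R -> 'rV[R]_N) : R :=
  Int r (fun x => ((dvder I u a x - cov c u a (vder I u) x) *m (b x)^T) 0 0).

Lemma supp_vder (I : functional U) : Defs.rad I < r -> supp r (vder I u).
Proof. by move=> Ir x rx; apply: vder_supp; exact: lt_le_trans rx. Qed.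

Lemma supp_dvder (I : functional U) a : smooth_map a -> Defs.rad I < r -> supp r (dvder I u a).
Proof. move=> as_ Ir x rx; have Ix := lt_le_trans Ir rx; exact (dvder_supp u a Ix). Qed.

(** The second variation is symmetric by [second_variation], the correction because the connection
    is torsion free. *)
Lemma covder_sym (I : functional U) a b : smooth_map a -> smooth_map b -> Defs.rad I < r ->
  covder I a b = covder I b a.
Proof.
move=> as_ bs Ir.
have vs := vder_smooth oU I uU as_ as_; have da := dvder_smooth oU I uU as_ as_.
have db := dvder_smooth oU I uU bs bs.
have ca := cov_smooth oU FC uU as_ vs; have cb := cov_smooth oU FC uU bs vs.
rewrite /covder (Int_subl r0 (smm_map da) (smm_map ca) (smm_map bs)).
rewrite (Int_subl r0 (smm_map db) (smm_map cb) (smm_map as_)).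
congr (_ - _); first exact (esym (second_variation oU uU as_ bs Ir r0)).
apply: (eq_Int r0) => x _; rewrite [LHS]sc_tr [RHS]sc_tr /cov /gu !trmx_mul !trmxK !mulmxA.
by have [_ uin] := uU; rewrite (gam_sym FC _ _ (uin x)).
Qed.

Lemma hop_opu eta x : smooth_map eta -> supp r eta -> `|x| < r + 1 -> P u eta x = opP r u eta x.
Proof.
move=> es er xr; apply: (hopE _ _ mu_sym r0 er) => //.
exact: smm_cont (smm_mul (smm_map es) (smm_tr (smm_W oU ws uU))).
Qed.

Lemma P_smooth eta : smooth_map eta -> supp r eta -> smooth_map (P u eta).
Proof. by move=> es er; exact: (hop_smooth mu oU (fc_G FC) (lcb_smooth oU FC) ws r0 uU es er). Qed.

Lemma outer_bracketE (I J K : functional U) : Defs.rad I < r -> Defs.rad J < r -> Defs.rad K < r ->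
  outer_bracket P (bracket P I J) K u =
  covder I (P u (vder K u)) (P u (vder J u)) - covder J (P u (vder K u)) (P u (vder I u))
  + Sterm c mu w r u (P u (vder K u)) (vder I u) (vder J u)
  - Sterm c mu w r u (P u (vder K u)) (vder J u) (vder I u).
Proof.
move=> Ir Jr Kr; have cst0 : smooth_map (fun _ : R => 0 : 'rV[R]_N).
  by apply: smooth_map_smm; exact: smm_cst.
have v_s (F : functional U) := vder_smooth oU F uU cst0 cst0.
have as_ := P_smooth (v_s K) (supp_vder Kr).
have [_ E] := bracket_derive oU (fc_G FC) (lcb_smooth oU FC) ws mu_sym r0 uU as_ Ir Jr.
have dI := dvder_smooth oU I uU as_ as_; have dJ := dvder_smooth oU J uU as_ as_.
have V := bracket_variation oU FC ws mu_sym r0 uU as_ (v_s I) (v_s J) dI dJ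
  (supp_vder Ir) (supp_vder Jr) (supp_dvder as_ Jr).
have E1 : Int r (fun x => ((dvder I u (P u (vder K u)) x - cov c u (P u (vder K u)) (vder I u) x) *m (opP r u (vder J u) x)^T) 0 0) = covder I (P u (vder K u)) (P u (vder J u)).
  apply: (eq_Int r0) => x xr; rewrite (hop_opu (v_s J) (supp_vder Jr)) //.
  by rewrite (le_lt_trans xr)// ltrDl.
have E2 : Int r (fun x => ((dvder J u (P u (vder K u)) x - cov c u (P u (vder K u)) (vder J u) x) *m (opP r u (vder I u) x)^T) 0 0) = covder J (P u (vder K u)) (P u (vder I u)).
  apply: (eq_Int r0) => x xr; rewrite (hop_opu (v_s I) (supp_vder Ir)) //.
  by rewrite (le_lt_trans xr)// ltrDl.
have alg (o X a b a' b' s t : R) : o = X -> X = a - b + s - t -> a = a' -> b = b' -> o = a' - b' + s - t.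
  by move=> -> -> -> ->.
exact (alg _ _ _ _ _ _ _ _ E V E1 E2).
Qed.

(** The six covariant second variations in the cyclic sum pair off: each functional contributes its
    form once with each sign and with the two directions exchanged. *)
Lemma jacobi_reduction (I J K : functional U) : Defs.rad I < r -> Defs.rad J < r -> Defs.rad K < r ->
  let S A B C := Sterm c mu w r u (P u (vder C u)) (vder A u) (vder B u)
                 - Sterm c mu w r u (P u (vder C u)) (vder B u) (vder A u) in
  outer_bracket P (bracket P I J) K u + outer_bracket P (bracket P J K) I u
    + outer_bracket P (bracket P K I) J u = S I J K + S J K I + S K I J.
Proof.
move=> Ir Jr Kr S; have cst0 : smooth_map (fun _ : R => 0 : 'rV[R]_N).
  by apply: smooth_map_smm; exact: smm_cst.
have a_s (F : functional U) (Fr : Defs.rad F < r) := P_smooth (vder_smooth oU F uU cst0 cst0) (supp_vder Fr).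
have alg (o1 o2 o3 d1 d2 d3 d1' d2' d3' s1 s2 s3 s4 s5 s6 : R) :
  o1 = d1 - d2' + s1 - s2 -> o2 = d2 - d3' + s3 - s4 -> o3 = d3 - d1' + s5 - s6 ->
  d1 = d1' -> d2 = d2' -> d3 = d3' -> o1 + o2 + o3 = (s1 - s2) + (s3 - s4) + (s5 - s6).
  by move=> -> -> -> -> -> ->; ring.
exact (alg _ _ _ _ _ _ _ _ _ _ _ _ _ _ _ (outer_bracketE Ir Jr Kr) (outer_bracketE Jr Kr Ir)
  (outer_bracketE Kr Ir Jr) (covder_sym (a_s _ Kr) (a_s _ Jr) Ir) (covder_sym (a_s _ Ir) (a_s _ Kr) Jr)
  (covder_sym (a_s _ Jr) (a_s _ Ir) Kr)).
Qed.

End along.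
End jacobi.

(** * Sufficiency of the conditions *)

Section sufficiency.
Context {R : realType} {N L : nat} (U : set 'rV[R]_N) (oU : open U).
Variables (G : 'rV[R]_N -> 'M[R]_N) (c : 'I_N -> 'I_N -> 'I_N -> 'rV[R]_N -> R)
  (mu : 'M[R]_L) (w : 'I_L -> 'rV[R]_N -> 'M[R]_N).

(** The Gauss equation is contracted with two vectors: with zero curvature it says that the
    contraction of the w_m with [v] and [a] through [mu] is symmetric in the two free upper
    indices. *)
Record ferapontov_conditions : Prop := FerapontovConditions {
  fer_self_adjoint : forall p m, U p -> G p *m (w m p)^T = w m p *m G p;
  fer_codazzi : forall p a v, U p ->
    dwm w p a v + wm w p v *m gam c p a = dwm w p v a + wm w p a *m gam c p v;
  fer_gauss : forall p a v, U p ->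
    ((wm w p v)^T *m mu *m wm w p a)^T = (wm w p v)^T *m mu *m wm w p a;
  fer_commute : forall p m n, U p -> w m p *m w n p = w n p *m w m p }.

Definition wcomb (k : 'rV[R]_L) (p : 'rV[R]_N) : 'M[R]_N := \sum_m k 0 m *: w m p.

(** At a fixed [x] an antiderivative is a row of L numbers, and the nonlocal term is a single
    combination of the w_m; self-adjointness and commutation pass to such combinations. *)
Lemma mul_wm k p a : k *m wm w p a = a *m (wcomb k p)^T.
Proof.
apply/rowP => i; rewrite !mxE.
under eq_bigr do rewrite mxE mulr_sumr.
rewrite exchange_big /=; apply: eq_bigr => s _.
rewrite mxE /wcomb summxE mulr_sumr; apply: eq_bigr => m _.
by rewrite mxE; ring.
Qed.

Hypotheses (FC : flat_connection U G c) (ws : forall m i j, smooth_on U (fun p => w m p i j))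
  (mu_sym : mu^T = mu) (F : ferapontov_conditions).

Lemma wcomb_sym k p : U p -> G p *m (wcomb k p)^T = wcomb k p *m G p.
Proof.
move=> Up; rewrite /wcomb linear_sum /= mulmx_sumr mulmx_suml; apply: eq_bigr => m _.
by rewrite linearZ /= -scalemxAr -scalemxAl (fer_self_adjoint F).
Qed.

Lemma wcomb_comm k l p : U p -> wcomb k p *m wcomb l p = wcomb l p *m wcomb k p.
Proof.
move=> Up; rewrite /wcomb !mulmx_sumr; under eq_bigr do rewrite mulmx_suml.
under [RHS]eq_bigr do rewrite mulmx_suml.
rewrite exchange_big /=; apply: eq_bigr => m _; apply: eq_bigr => n _.
by rewrite -!scalemxAr -!scalemxAl (fer_commute F) // !scalerA mulrC.
Qed.

Section along.
Variables (r : R) (u : R -> 'rV[R]_N).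
Hypotheses (r0 : 0 <= r) (uU : smooth_field U u).

Let us : smooth_map u. Proof. by case: uU. Qed.
Let uin x : U (u x). Proof. by case: uU. Qed.
Let du : smooth_map (dx u). Proof. exact: smooth_map_dx. Qed.

Notation nab xi := (fun x => dx xi x - xi x *m (gam c (u x) (dx u x))^T).
Notation Nw := (Nu w r u).
Notation P := (opu G (lcb G c) mu w r u).

Definition Tint a xi eta : R :=
  Int r (fun x => (Nw eta x *m mu *m wm w (u x) (a x) *m (nab xi x)^T) 0 0).

Lemma smm_nab xi : smooth_map xi -> smm (nab xi).
Proof.
move=> xs; apply: smmD; first exact: smm_map (smooth_map_dx xs).
exact: smmN (smm_mul (smm_map xs) (smm_tr (smm_gu oU FC uU du))).
Qed.

(** [V(a)] contains the derivative of [a]; integration by parts removes it. Differentiating the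
    antiderivative produces [Q], which is symmetric in its two covectors by the Gauss equation and
    cancels in the difference. *)
Lemma Sterm_antisym a xi eta : smooth_map a -> smooth_map xi -> smooth_map eta -> supp r xi -> supp r eta ->
  Sterm c mu w r u a xi eta - Sterm c mu w r u a eta xi = Tint a eta xi - Tint a xi eta.
Proof.
move=> as_ xs es xr er.
have swa := smm_wm oU ws uU as_; have cmu := @smm_cst R _ _ mu; have sW := smm_W oU ws uU.
pose Q (x y : R -> 'rV[R]_N) := Int r (fun t => (y t *m (wm w (u t) (dx u t))^T *m mu *m wm w (u t) (a t) *m (x t)^T) 0 0).
suff K x y : smooth_map x -> smooth_map y -> supp r x -> Sterm c mu w r u a x y = - Tint a x y - Q x y.
  rewrite (K _ _ xs es xr) (K _ _ es xs er).
  have -> : Q eta xi = Q xi eta.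
    apply: (eq_Int r0) => t _; rewrite [LHS]sc_tr; apply: eq00; rewrite !trmx_mul trmxK.
    have E : eta t *m ((wm w (u t) (dx u t))^T *m mu *m wm w (u t) (a t))^T *m (xi t)^T =
        eta t *m ((wm w (u t) (dx u t))^T *m mu *m wm w (u t) (a t)) *m (xi t)^T.
      by rewrite (fer_gauss F _ _ (uin t)).
    by move: E; rewrite !trmx_mul trmxK !mulmxA.
  by move: (Tint a xi eta) (Q xi eta) (Tint a eta xi) => t1 t2 t3; ring.
move=> xs' ys' xr'.
have sN := smm_N oU ws r uU ys'; have V := smm_V oU FC ws uU as_; have nx := smm_nab xs'.
have xt := smm_tr (smm_map xs').
have C1 : cont_ballm (r + 1) _ := smm_cont (smm_mul (smm_mul (smm_mul sN cmu) V) xt).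
have C2 : cont_ballm (r + 1) _ := smm_cont (smm_mul (smm_mul (smm_mul sN cmu) swa) (smm_tr nx)).
have C3 : cont_ballm (r + 1) _ := smm_cont (smm_mul (smm_mul (smm_mul (smm_mul (smm_map ys') (smm_tr sW)) cmu) swa) xt).
have alg (a1 a2 a3 : R) : a1 + a2 + a3 = 0 -> a1 = - a2 - a3 by move=> /eqP; rewrite -addrA addr_eq0 => /eqP ->; ring.
apply: alg; rewrite /Tint /Q /Sterm.
have D1 := cont_ballD (C1 0 0) (C2 0 0).
have E1 := IntD r0 (C1 0 0) (C2 0 0); have E2 := IntD r0 D1 (C3 0 0).
apply: (etrans (congr1 (fun z => z + _) (esym E1))); apply: (etrans (esym E2)).
pose Z x0 := (Nw y x0 *m mu *m wm w (u x0) (a x0) *m (x x0)^T).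
have Fd0 (t : R) : `|t| < r + 1 -> is_derive t 1 (fun t => Z t 0 0)
   ((Nw y t *m mu *m Vu c w u a t *m (x t)^T) 0 0 +
    (Nw y t *m mu *m wm w (u t) (a t) *m (nab x t)^T) 0 0 +
    (y t *m (wm w (u t) (dx u t))^T *m mu *m wm w (u t) (a t) *m (x t)^T) 0 0).
  move=> tr.
  have sY : cont_ballm (r + 1) (fun x => y x *m (Wu w u x)^T) := smm_cont (smm_mul (smm_map ys') (smm_tr sW)).
  have dwa : is_derive t 1 (fun y => wm w (u y) (a y))
    (dwm w (u t) (dx u t) (a t) + wm w (u t) (dx a t)) := ct_curve (F := fun m i k p => w m p i k) oU t (fun m i k => ws m i k) uU as_.
  have H := is_derive_mulmx (is_derive_mulmx (is_derive_mulmx (NN_derive sY tr) (is_derive_cst mu t 1)) dwa)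
    (is_derive_trmx (smooth_map_derive t xs')).
  have := is_derive_entry 0 0 H; rewrite -[cst mu t]/mu -/(Nu _ _ _ _) => H'.
  apply: (is_derive_eqv H'); rewrite mulmx0 addr0.
  (* By the Codazzi equations [V(a)] is the covariant derivative of w(a) along the curve, so it fits
     into a total derivative. *)
  have EV : Vu c w u a t = wm w (u t) (dx a t) +
      (dwm w (u t) (dx u t) (a t) + wm w (u t) (a t) *m gam c (u t) (dx u t)).
    by rewrite -(fer_codazzi F _ _ (uin t)) /Vu /dW /Wu /gu -addrA addrCA addrA.
  rewrite EV.
  move: (Nw y t) (wm w (u t) (a t)) (wm w (u t) (dx a t)) (dwm w (u t) (dx u t) (a t)) => n1 wa wda dw.
  rewrite trDE trNE trmx_mul trmxK !(mulmxDl, mulmxDr, mulmxN, mulmxA) !addoppE /Wu.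
  by ring.
rewrite (Int_derive r0 (cont_ballD D1 (C3 0 0)) Fd0) /Z.
have rr : r <= `|r| by rewrite ger0_norm.
have rr' : r <= `|- r| by rewrite normrN ger0_norm.
by rewrite !(xr' _ rr) !(xr' _ rr') trmx0 !mulmx0 mxE subrr.
Qed.

(** [Tint] for [a = P zeta], split into the local ([Aint]) and the nonlocal ([Bint]) part of P. *)
Definition Aint zeta xi eta : R :=
  Int r (fun x => (Nw eta x *m mu *m wm w (u x) (nab zeta x *m G (u x)) *m (nab xi x)^T) 0 0).
Definition Bint zeta xi eta : R :=
  Int r (fun x => (Nw eta x *m mu *m wm w (u x) (Nw zeta x *m mu *m Wu w u x) *m (nab xi x)^T) 0 0).

Lemma wmD p a b : wm w p (a + b) = wm w p a + wm w p b.
Proof. exact: (ctD (fun m i k p => w m p i k)). Qed.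

Lemma TintE a zeta xi eta : smooth_map zeta -> smooth_map xi -> smooth_map eta ->
  (forall x, `|x| <= r -> a x = P zeta x) -> Tint a xi eta = Aint zeta xi eta + Bint zeta xi eta.
Proof.
move=> zs xs es aE.
have sN := smm_N oU ws r uU es; have cmu := @smm_cst R _ _ mu; have sW := smm_W oU ws uU.
have sG := smm_G oU (fc_G FC) uU.
have s1 := smm_mul (smm_nab zs) sG; have s2 := smm_mul (smm_mul (smm_N oU ws r uU zs) cmu) sW.
have C1 : cont_ballm (r + 1) _ := smm_cont (smm_mul (smm_mul (smm_mul sN cmu) (smm_wm oU ws uU (smooth_map_smm s1))) (smm_tr (smm_nab xs))).
have C2 : cont_ballm (r + 1) _ := smm_cont (smm_mul (smm_mul (smm_mul sN cmu) (smm_wm oU ws uU (smooth_map_smm s2))) (smm_tr (smm_nab xs))).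
rewrite /Aint /Bint -(IntD r0 (C1 0 0) (C2 0 0)); apply: (eq_Int r0) => x xr.
by rewrite (aE x xr) (opu_lcb mu w FC r uU) wmD mulmxDr mulmxDl addmxE.
Qed.

(** Self-adjointness of the combination of the w_m with respect to the metric. *)
Lemma Aint_sym zeta xi eta : Aint zeta xi eta = Aint xi zeta eta.
Proof.
apply: (eq_Int r0) => x _; rewrite !mul_wm [LHS]sc_tr !trmx_mul !trmxK !mulmxA.
by rewrite (fc_sym FC (uin x)) -[_ *m wcomb _ _ *m _]mulmxA -(wcomb_sym _ (uin x)) !mulmxA.
Qed.

(** Two combinations of the w_m act one after the other, with coefficients from [zeta] and [eta];
    they commute. *)
Lemma Bint_sym zeta xi eta : Bint zeta xi eta = Bint eta xi zeta.
Proof.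
apply: (eq_Int r0) => x _; apply: eq00; rewrite /Wu.
move: (Nw eta x *m mu) (Nw zeta x *m mu) => k l; rewrite !mul_wm; congr (_ *m _).
by rewrite -!mulmxA -!trmx_mul (wcomb_comm _ _ (uin x)).
Qed.

End along.

Theorem hydro_op_hamiltonian : hamiltonian U (hydro_op G (lcb G c) mu w).
Proof.
have cst0 : smooth_map (fun _ : R => 0 : 'rV[R]_N) by apply: smooth_map_smm; exact: smm_cst.
split.
  move=> I J u uU; have [us uin] := uU.
  pose r := `|Defs.rad I| + `|Defs.rad J| + 1.
  have r0 : 0 <= r by rewrite !addr_ge0.
  have Ir : Defs.rad I < r by have := ler_norm (Defs.rad I); have := normr_ge0 (Defs.rad J); rewrite /r; lra.
  have Jr : Defs.rad J < r by have := ler_norm (Defs.rad J); have := normr_ge0 (Defs.rad I); rewrite /r; lra.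
  have Is := vder_smooth oU I uU cst0 cst0; have Js := vder_smooth oU J uU cst0 cst0.
  have du := smooth_map_dx us.
  have cG : cont_ballm (r + 1) (fun x => G (u x)) := smm_cont (smm_G oU (fc_G FC) uU).
  have cB : cont_ballm (r + 1) (fun x => bv (lcb G c) (u x) (dx u x)) := smm_cont (smm_bv oU (lcb_smooth oU FC) uU du).
  have cW : cont_ballm (r + 1) (fun x => wm w (u x) (dx u x)) := smm_cont (smm_W oU ws uU).
  rewrite /bracket -/(hop G (lcb G c) mu w).
  have [sI sJ] := (supp_vder u Ir, supp_vder u Jr).
  have cI := @smooth_map_cont R N (r + 1) _ Is; have cJ := @smooth_map_cont R N (r + 1) _ Js.
  have cdI := @smooth_map_cont R N (r + 1) _ (smooth_map_dx Is); have cdJ := @smooth_map_cont R N (r + 1) _ (smooth_map_dx Js).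
  rewrite (bracket_Int mu_sym r0 sI sJ cI cJ cdJ cG cB cW) (bracket_Int mu_sym r0 sJ sI cJ cI cdI cG cB cW).
  exact (P_skew oU FC ws mu_sym r0 uU Is Js sI sJ).
move=> I J K u uU; have [us uin] := uU.
(* Strictly larger than the three radii, which may be negative, so that all covectors vanish at the
   ends. *)
pose r := `|Defs.rad I| + `|Defs.rad J| + `|Defs.rad K| + 1.
have r0 : 0 <= r by rewrite !addr_ge0.
have nn := (normr_ge0 (Defs.rad I), normr_ge0 (Defs.rad J), normr_ge0 (Defs.rad K)).
have Ir : Defs.rad I < r by have := ler_norm (Defs.rad I); case: nn => -[]; rewrite /r; lra.
have Jr : Defs.rad J < r by have := ler_norm (Defs.rad J); case: nn => -[]; rewrite /r; lra.
have Kr : Defs.rad K < r by have := ler_norm (Defs.rad K); case: nn => -[]; rewrite /r; lra.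
have vs (A : functional U) := vder_smooth oU A uU cst0 cst0.
have E (A B C : functional U) : Defs.rad A < r -> Defs.rad B < r -> Defs.rad C < r ->
    let a := hop G (lcb G c) mu w u (vder C u) in
    Sterm c mu w r u a (vder A u) (vder B u) - Sterm c mu w r u a (vder B u) (vder A u) =
    (Aint r u (vder C u) (vder B u) (vder A u) + Bint r u (vder C u) (vder B u) (vder A u))
    - (Aint r u (vder C u) (vder A u) (vder B u) + Bint r u (vder C u) (vder A u) (vder B u)).
  move=> Ar Br Cr a.
  have as_ : smooth_map a := P_smooth oU mu FC ws r0 uU (vs C) (supp_vder u Cr).
  have aE x : `|x| <= r -> a x = opu G (lcb G c) mu w r u (vder C u) x.
    move=> xr; apply: (hop_opu oU G c ws mu_sym r0 uU (vs C) (supp_vder u Cr)).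
    by rewrite (le_lt_trans xr)// ltrDl.
  have T1 := Sterm_antisym r0 uU as_ (vs A) (vs B) (supp_vder u Ar) (supp_vder u Br).
  have T2 := TintE r0 uU (vs C) (vs B) (vs A) aE; have T3 := TintE r0 uU (vs C) (vs A) (vs B) aE.
  exact (etrans T1 (congr2 (fun x y => x - y) T2 T3)).
(* The cyclic sum contains six terms A and six terms B, each kind three times with either sign; the
   two symmetries match them in pairs. *)
apply: (etrans (jacobi_reduction oU FC ws mu_sym r0 uU Ir Jr Kr)).
have alg (s1 s2 s3 a1 b1 a2 b2 a3 b3 a1' b1' a2' b2' a3' b3' : R) :
  s1 = (a1 + b1) - (a2 + b2) -> s2 = (a3 + b3) - (a1' + b1') -> s3 = (a2' + b2') - (a3' + b3') ->
  a1 = a3' -> a2 = a3 -> a1' = a2' -> b1 = b1' -> b2 = b2' -> b3 = b3' -> s1 + s2 + s3 = 0.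
  by move=> -> -> -> -> -> -> -> -> ->; ring.
exact (alg _ _ _ _ _ _ _ _ _ _ _ _ _ _ _ (E I J K Ir Jr Kr) (E J K I Jr Kr Ir) (E K I J Kr Ir Jr)
  (Aint_sym r0 uU _ _ _) (Aint_sym r0 uU _ _ _) (Aint_sym r0 uU _ _ _)
  (Bint_sym r0 uU _ _ _) (Bint_sym r0 uU _ _ _) (Bint_sym r0 uU _ _ _)).
Qed.

End sufficiency.

(** * The Levi-Civita connection *)

Section smooth_inverse.
Context {R : realType} {V : normedModType R} (U : set V) (oU : open U).

Lemma smooth_on_prod (I : Type) (r : seq I) (f : I -> V -> R) :
  (forall i, smooth_on U (f i)) -> smooth_on U (fun x => \prod_(i <- r) f i x).
Proof.
move=> fU; elim: r => [|i r IH].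
  by under eq_fun do rewrite big_nil; exact: smooth_cst_set oU 1.
by under eq_fun do rewrite big_cons; exact: (smooth_onM oU (fU i) IH).
Qed.

Lemma smooth_det n (A : V -> 'M[R]_n) : (forall i j, smooth_on U (fun x => A x i j)) ->
  smooth_on U (fun x => \det (A x)).
Proof.
move=> AU; rewrite /determinant; apply: (smooth_on_sum oU) => s.
by apply: (smooth_onM oU (smooth_cst_set oU _)); apply: smooth_on_prod => i; exact: AU.
Qed.

Lemma smooth_invmx n (A : V -> 'M[R]_n) : (forall i j, smooth_on U (fun x => A x i j)) ->
  (forall x, U x -> A x \in unitmx) -> forall i j, smooth_on U (fun x => invmx (A x) i j).
Proof.
move=> AU Aunit i j.
apply: (eq_smooth_on (f := fun x => (\det (A x))^-1 * ((-1) ^+ (j + i) * \det (row' j (col' i (A x))))) oU).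
  by move=> x; rewrite inE => Ux; rewrite /invmx (Aunit _ Ux) !mxE /cofactor.
apply: (smooth_onM oU); first apply: (smooth_onV oU).
- exact: smooth_det AU.
- by move=> x Ux; have := Aunit _ Ux; rewrite unitmxE unitfE.
- apply: (smooth_onM oU (smooth_cst_set oU _)); apply: smooth_det => k l.
  by under eq_fun do rewrite !mxE; exact: AU.
Qed.

End smooth_inverse.

Section levi_civita.
Context {R : realType} {N : nat} (U : set 'rV[R]_N) (oU : open U).
Variable g : 'rV[R]_N -> 'M[R]_N.
Hypothesis gf : flat_metric U g.

Let gU : forall i j, smooth_on U (fun p => g p i j). Proof. by case: gf. Qed.
Let gs p : U p -> (g p)^T = g p. Proof. by case: gf => _ + _ _; exact. Qed.
Let gu p : U p -> g p \in unitmx. Proof. by case: gf => _ _ + _; exact. Qed.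

Lemma invmx_smooth i j : smooth_on U (fun p => invmx (g p) i j).
Proof. exact: (smooth_invmx oU gU gu i j). Qed.

Lemma invmx_sym p i j : U p -> invmx (g p) i j = invmx (g p) j i.
Proof. by move=> Up; rewrite -[in LHS](gs Up) -trmx_inv mxE. Qed.

Lemma pd_invmx_sym p s i j : U p ->
  pd s (fun q => invmx (g q) i j) p = pd s (fun q => invmx (g q) j i) p.
Proof.
by move=> Up; apply: (eq_on_derive _ oU) => // q; rewrite inE => Uq; exact: invmx_sym.
Qed.

Lemma christoffel_smooth i j k : smooth_on U (christoffel g i j k).
Proof.
have dh s l m : smooth_on U (pd s (fun v => invmx (g v) l m)) by exact: smooth_onD (invmx_smooth l m).
apply: (smooth_onM oU (smooth_cst_set oU _)); apply: (smooth_on_sum oU) => l.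
apply: (smooth_onM oU (gU _ _)); apply: (smooth_onDr oU); last by apply: (smooth_onN oU); exact: dh.
by apply: (smooth_onDr oU); exact: dh.
Qed.

Lemma christoffel_sym p i j k : U p -> christoffel g i j k p = christoffel g i k j p.
Proof.
move=> Up; congr (_ * _); apply: eq_bigr => l _; congr (_ * (_ - _)).
  by rewrite addrC (pd_invmx_sym _ _ _ Up) [in X in _ + X](pd_invmx_sym _ _ _ Up).
exact: pd_invmx_sym.
Qed.

(** The Christoffel symbols of the first kind. *)
Lemma lower_christoffel p m s k : U p ->
  \sum_j invmx (g p) m j * christoffel g j s k p =
  2^-1 * (pd s (fun v => invmx (g v) m k) p + pd k (fun v => invmx (g v) s m) p
     - pd m (fun v => invmx (g v) s k) p).
Proof.
move=> Up; rewrite /christoffel; under eq_bigr do rewrite mulrCA.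
rewrite -mulr_sumr; congr (_ * _); under eq_bigr do rewrite mulr_sumr.
rewrite exchange_big /= (bigD1 m)//= [X in _ + X]big1 ?addr0 => [|l lm].
  under eq_bigr do rewrite mulrA.
  rewrite -mulr_suml; have := congr1 (fun A : 'M[R]_N => A m m) (mulVmx (gu Up)).
  by rewrite !mxE eqxx => ->; rewrite mul1r.
under eq_bigr do rewrite mulrA.
rewrite -mulr_suml; have := congr1 (fun A : 'M[R]_N => A m l) (mulVmx (gu Up)).
by rewrite !mxE eq_sym (negbTE lm) => ->; rewrite mul0r.
Qed.

(** Adding two symbols of the first kind with the outer indices exchanged leaves one derivative of
    the covariant metric. *)
Lemma dinv_gam p a : U p -> dmx (fun q => invmx (g q)) p a =
  gam (christoffel g) p a *m invmx (g p) + (gam (christoffel g) p a *m invmx (g p))^T.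
Proof.
move=> Up; apply/matrixP => s m; rewrite !mxE (smooth_derive_sum _ oU (invmx_smooth s m) Up).
have E s' m' : \sum_j gam (christoffel g) p a s' j * invmx (g p) j m' =
    \sum_k a 0 k * (2^-1 * (pd s' (fun v => invmx (g v) m' k) p + pd k (fun v => invmx (g v) s' m') p
     - pd m' (fun v => invmx (g v) s' k) p)).
  under eq_bigr do rewrite mxE mulr_suml.
  rewrite exchange_big; apply: eq_bigr => k _ /=; rewrite -(lower_christoffel _ _ _ Up) mulr_sumr.
  by apply: eq_bigr => j _; rewrite (invmx_sym _ _ Up); ring.
rewrite !E -big_split; apply: eq_bigr => k _ /=.
rewrite (pd_invmx_sym k m s Up).
by field.
Qed.

(** The contravariant form of compatibility follows from the covariant one by differentiating
    [g *m invmx g = 1]. *)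
Lemma dmx_metric p a : U p ->
  dmx g p a = - ((gam (christoffel g) p a)^T *m g p) - g p *m gam (christoffel g) p a.
Proof.
move=> Up.
have gd : is_derive p a g (dmx g p a).
  by apply: is_derive_mx => i j; rewrite mxE; exact: smooth_on_is_derive (gU i j) Up.
have hd : is_derive p a (fun q => invmx (g q)) (dmx (fun q => invmx (g q)) p a).
  by apply: is_derive_mx => i j; rewrite mxE; exact: smooth_on_is_derive (invmx_smooth i j) Up.
have H : dmx g p a *m invmx (g p) + g p *m dmx (fun q => invmx (g q)) p a = 0.
  apply/matrixP => i j; have [_ <-] := is_derive_entry i j (is_derive_mulmx gd hd).
  rewrite [RHS]mxE; have [_ <-] := is_derive_cst ((1%:M : 'M[R]_N) i j : R^o) p a; apply: near_eq_derive.
  by apply: near_open oU Up _ => q Uq; rewrite mulmxV// gu.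
move: H => /(congr1 (mulmx ^~ (g p))); rewrite mul0mx mulmxDl mulmxKV ?gu//.
rewrite (dinv_gam _ Up) trmx_mul trmx_inv (gs Up) !(mulmxDl, mulmxDr).
rewrite !mulmxA mulmxKV ?gu// mulmxV ?gu// mul1mx => /eqP; rewrite addr_eq0 => /eqP ->.
by rewrite opprD addrC.
Qed.

(** The last clause is the Riemann tensor contracted with v^k a^l, written as a commutator of
    matrices acting on rows. *)
Lemma flat_connection_christoffel : flat_connection U g (christoffel g).
Proof.
split.
- exact: gU.
- exact: christoffel_smooth.
- exact: gs.
- by move=> p Up i s k; exact: christoffel_sym.
- by move=> p a; exact: dmx_metric.
move=> p a v Up; have [_ _ _ flat] := gf.
apply/matrixP => s j; rewrite [RHS]mxE !addoppE.
pose Q (k l : 'I_N) := v 0 k * a 0 l.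
have D (x y : 'rV[R]_N) : dgam (christoffel g) p x y s j =
    \sum_k \sum_l (x 0 k * y 0 l) * pd k (christoffel g j s l) p.
  rewrite mxE exchange_big; apply: eq_bigr => l _ /=.
  rewrite (smooth_derive_sum _ oU (christoffel_smooth j s l) Up) mulr_suml.
  by apply: eq_bigr => k _; ring.
have M (x y : 'rV[R]_N) : (gam (christoffel g) p x *m gam (christoffel g) p y) s j =
    \sum_k \sum_l (y 0 k * x 0 l) * \sum_b christoffel g b s l p * christoffel g j b k p.
  rewrite mxE; under eq_bigr do rewrite !mxE mulr_suml.
  under eq_bigr do under eq_bigr do rewrite mulr_sumr.
  under [RHS]eq_bigr do under eq_bigr do rewrite mulr_sumr.
  rewrite exchange_big /=; under eq_bigr do rewrite exchange_big /=.
  rewrite exchange_big; apply: eq_bigr => k _; apply: eq_bigr => l _; apply: eq_bigr => b _ /=.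
  by ring.
rewrite (D v a) (D a v) (M a v) (M v a).
have swap (F : 'I_N -> 'I_N -> R) : \sum_k \sum_l (a 0 k * v 0 l) * F k l = \sum_k \sum_l Q k l * F l k.
  by rewrite exchange_big; apply: eq_bigr => k _; apply: eq_bigr => l _; rewrite /Q; ring.
rewrite !swap -sumrN -!big_split /= -sumrN -big_split big1 // => k _ /=.
rewrite -sumrN -!big_split /= -sumrN -big_split big1 // => l _ /=.
rewrite -!mulrN -!mulrDr; apply/eqP; rewrite mulf_eq0; apply/orP; right; apply/eqP.
rewrite -[RHS](flat p Up j s k l) /riemann big_split sumrN /=.
have Es (x y z t : 'I_N) : pd t (christoffel g x y z) p = pd t (christoffel g x z y) p.
  by apply: (eq_on_derive _ oU) => // q; rewrite inE => Uq; exact: christoffel_sym.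
rewrite (Es j s l) (Es j s k) addrA; congr (_ + _ + _ - _).
  by apply: eq_bigr => b _; rewrite mulrC (christoffel_sym _ _ _ Up) (christoffel_sym b _ _ Up).
by apply: eq_bigr => b _; rewrite mulrC (christoffel_sym _ _ _ Up) (christoffel_sym b _ _ Up).
Qed.

End levi_civita.

(** * Hessians and potentials *)

Section hessian.
Context {R : realType} {N : nat} (U : set 'rV[R]_N) (oU : open U).
Variable g : 'rV[R]_N -> 'M[R]_N.
Hypothesis gf : flat_metric U g.
Let FC := flat_connection_christoffel oU gf.

Definition hessm (Phi : 'rV[R]_N -> R) (p : 'rV[R]_N) : 'M[R]_N := \matrix_(i, j) hess g Phi i j p.

Definition grad (Phi : 'rV[R]_N -> R) (p : 'rV[R]_N) : 'rV[R]_N := \row_k pd k Phi p.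

Lemma hess_upE Phi p : hess_up g Phi p = g p *m hessm Phi p.
Proof. by apply/matrixP => i j; rewrite !mxE; apply: eq_bigr => s _; rewrite mxE. Qed.

Variable Phi : 'rV[R]_N -> R.
Hypothesis PhiU : smooth_on U Phi.

Let pU i : smooth_on U (pd i Phi). Proof. exact: smooth_onD. Qed.
Let ppU i j : smooth_on U (pd i (pd j Phi)). Proof. exact: smooth_onD. Qed.

Lemma hess_smooth i j : smooth_on U (hess g Phi i j).
Proof.
apply: (smooth_onDr oU (ppU i j)); apply: (smooth_onN oU); apply: (smooth_on_sum oU) => k.
exact: (smooth_onM oU (christoffel_smooth oU gf k i j) (pU k)).
Qed.

Lemma hess_sym p i j : U p -> hess g Phi i j p = hess g Phi j i p.
Proof.
move=> Up; rewrite /hess /pd (smooth_derive_sym _ _ oU PhiU Up); congr (_ - _).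
by apply: eq_bigr => k _; rewrite (christoffel_sym oU gf _ _ _ Up).
Qed.

Lemma hessm_sym p : U p -> (hessm Phi p)^T = hessm Phi p.
Proof. by move=> Up; apply/matrixP => i j; rewrite !mxE hess_sym. Qed.

Lemma derive_hess p a i j : U p -> 'D_a (hess g Phi i j) p =
  'D_a (pd i (pd j Phi)) p - \sum_k ('D_a (christoffel g k i j) p * pd k Phi p + christoffel g k i j p * 'D_a (pd k Phi) p).
Proof.
move=> Up.
have H : is_derive p a (pd i (pd j Phi) - \sum_k (fun q => christoffel g k i j q * pd k Phi q))
   ('D_a (pd i (pd j Phi)) p - \sum_k (christoffel g k i j p *: 'D_a (pd k Phi) p + pd k Phi p *: 'D_a (christoffel g k i j) p)).
  apply: is_deriveB; first exact: smooth_on_is_derive (ppU i j) Up.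
  apply: is_derive_sum => k; apply: is_deriveM; last exact: smooth_on_is_derive (pU k) Up.
  exact: smooth_on_is_derive (christoffel_smooth oU gf k i j) Up.
have -> : hess g Phi i j = pd i (pd j Phi) - \sum_k (fun q => christoffel g k i j q * pd k Phi q).
  by apply/funext => q; rewrite /hess !fctE fct_sumE.
have [_ ->] := H; congr (_ - _); apply: eq_bigr => k _.
by rewrite /GRing.scale /=; ring.
Qed.

(** Third derivatives commute, and the antisymmetric part of the remaining terms is the curvature
    applied to the gradient, hence zero. *)
Lemma codazzi_hess p a v : U p ->
  v *m (dmx (hessm Phi) p a - hessm Phi p *m (gam (christoffel g) p a)^T) =
  a *m (dmx (hessm Phi) p v - hessm Phi p *m (gam (christoffel g) p v)^T).
Proof.
move=> Up.
pose c := christoffel g.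
pose dg (x : 'rV[R]_N) : 'rV[R]_N := \row_k 'D_x (pd k Phi) p.
pose T3 (x y : 'rV[R]_N) : 'rV[R]_N := \row_j \sum_i x 0 i * 'D_y (pd i (pd j Phi)) p.
have T3s x y : T3 x y = T3 y x.
  apply/rowP => j; rewrite [LHS]mxE [RHS]mxE.
  have DE z i : 'D_z (pd i (pd j Phi)) p = \sum_k z 0 k * pd k (pd i (pd j Phi)) p.
    exact: (smooth_derive_sum z oU (ppU i j) Up).
  have DS (z t : 'rV[R]_N) : \sum_i z 0 i * 'D_t (pd i (pd j Phi)) p = \sum_i \sum_k z 0 i * (t 0 k * pd k (pd i (pd j Phi)) p).
    by apply: eq_bigr => i _; rewrite DE -mulr_sumr.
  have alg (F : 'I_N -> 'I_N -> R) : (forall k l, F k l = F l k) ->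
    \sum_i \sum_k x 0 i * (y 0 k * F k i) = \sum_i \sum_k y 0 i * (x 0 k * F k i).
    move=> Fs; rewrite exchange_big; apply: eq_bigr => k _; apply: eq_bigr => l _ /=.
    by rewrite (Fs k l); ring.
  apply: (etrans (DS x y)); apply: (etrans _ (esym (DS y x))).
  apply: (alg (fun k i => pd k (pd i (pd j Phi)) p)) => k l.
  exact: (smooth_derive_sym (delta_mx 0 k) (delta_mx 0 l) oU (pU j) Up).
have H x : x *m hessm Phi p = dg x - grad Phi p *m (gam c p x)^T.
  apply/rowP => j; rewrite !addoppE !mxE (smooth_derive_sum _ oU (pU j) Up).
  under eq_bigr do rewrite !mxE /hess mulrBr.
  rewrite sumrB; congr (_ - _).
  under eq_bigr do rewrite mulr_sumr.
  under [RHS]eq_bigr do rewrite !mxE mulr_sumr.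
  rewrite exchange_big; apply: eq_bigr => k _; apply: eq_bigr => i _ /=.
  by rewrite /c (christoffel_sym oU gf k i j Up); ring.
have Es (x y z : 'I_N) t : 'D_t (christoffel g x y z) p = 'D_t (christoffel g x z y) p.
  by apply: (eq_on_derive _ oU) => // q; rewrite inE => Uq; exact: (christoffel_sym oU gf).
have D x y : x *m dmx (hessm Phi) p y = T3 x y - grad Phi p *m (dgam c p y x)^T - dg y *m (gam c p x)^T.
  apply/rowP => j; rewrite !addoppE !mxE.
  have E i : dmx (hessm Phi) p y i j = 'D_y (hess g Phi i j) p.
    by rewrite mxE; congr ('D__ _ _); apply/funext => q; rewrite mxE.
  under eq_bigr do rewrite E (derive_hess _ _ _ Up) mulrBr.
  rewrite sumrB -addrA; congr (_ + _).
  rewrite -opprD; congr (- _); rewrite -big_split /=.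
  under eq_bigr do rewrite mulr_sumr.
  rewrite exchange_big; apply: eq_bigr => k _ /=; rewrite !mxE !mulr_sumr -big_split.
  apply: eq_bigr => i _ /=; rewrite /c (Es k j i) (christoffel_sym oU gf k i j Up); ring.
rewrite !mulmxBr !mulmxA !D !H T3s.
have := fc_flat FC a v Up; rewrite -/c.
move: (gam c p a) (gam c p v) (dgam c p a v) (dgam c p v a) => ga gv d1 d2 flat.
have {flat} -> : d2 = d1 - ga *m gv + gv *m ga.
  by apply/eqP; rewrite -subr_eq0 -flat; apply/eqP/matrixP => i j; rewrite !addoppE; ring.
rewrite !(trDE, trNE, trmx_mul) !(mulmxBl, mulmxDr, mulmxN, mulmxA).
by apply/rowP => i; rewrite !addoppE; ring.
Qed.

End hessian.

Section codazzi_factor.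
Context {R : realType} {N : nat} (U : set 'rV[R]_N) (oU : open U).
Variables (g H W : 'rV[R]_N -> 'M[R]_N).
Hypotheses (gf : flat_metric U g) (HU : forall i j, smooth_on U (fun p => H p i j))
  (Hs : forall p, U p -> (H p)^T = H p) (WE : forall p, U p -> W p = g p *m H p).
Let FC := flat_connection_christoffel oU gf.

(** The metric is parallel, so lowering an index commutes with covariant differentiation: the
    Codazzi equations for [W] and for [H] are equivalent. *)
Lemma codazzi_factor p a (v : 'rV[R]_N) : U p ->
  v *m (dmx W p a)^T + v *m (W p)^T *m gam (christoffel g) p a =
  v *m (dmx H p a - H p *m (gam (christoffel g) p a)^T) *m g p.
Proof.
move=> Up; have gU : forall i j, smooth_on U (fun p => g p i j) by case: gf.
have gd : is_derive p a g (dmx g p a).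
  by apply: is_derive_mx => i j; rewrite mxE; exact: smooth_on_is_derive (gU i j) Up.
have hd : is_derive p a H (dmx H p a).
  by apply: is_derive_mx => i j; rewrite mxE; exact: smooth_on_is_derive (HU i j) Up.
have -> : dmx W p a = dmx g p a *m H p + g p *m dmx H p a.
  apply/matrixP => i j; have [_ <-] := is_derive_entry i j (is_derive_mulmx gd hd).
  rewrite mxE; apply: (eq_on_derive _ oU) => // q; rewrite inE => Uq.
  by rewrite (WE Uq).
have dHs : (dmx H p a)^T = dmx H p a.
  apply/matrixP => i j; rewrite !mxE; apply: (eq_on_derive _ oU) => // q; rewrite inE => Uq.
  by rewrite -[in RHS](Hs Uq) [in RHS]mxE.
rewrite (WE Up) (fc_met FC _ Up) !(trDE, trNE, trmx_mul, trmxK) dHs (Hs Up) (fc_sym FC Up).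
rewrite !(mulmxDl, mulmxBl, mulmxDr, mulmxBr, mulNmx, mulmxN, mulmxA).
by apply/rowP => j; rewrite !addoppE; ring.
Qed.

End codazzi_factor.

Section potential_conditions.
Context {R : realType} {N L : nat} (U : set 'rV[R]_N) (oU : open U).
Variables (g : 'rV[R]_N -> 'M[R]_N) (mu : 'M[R]_L) (w : 'I_L -> 'rV[R]_N -> 'M[R]_N)
  (Phi : 'I_L -> 'rV[R]_N -> R).
Hypotheses (gf : flat_metric U g) (PhiU : forall n, smooth_on U (Phi n))
  (wE : forall n u, U u -> w n u = hess_up g (Phi n) u).
Let FC := flat_connection_christoffel oU gf.

Let wE' n p : U p -> w n p = g p *m hessm g (Phi n) p.
Proof. by move=> /(wE n) ->; exact: hess_upE. Qed.

Lemma hess_up_smooth n i j : smooth_on U (fun p => hess_up g (Phi n) p i j).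
Proof.
under eq_fun do rewrite mxE.
apply: (smooth_on_sum oU) => k; apply: (smooth_onM oU); first by case: gf.
exact: hess_smooth.
Qed.

Lemma w_self_adjoint p m : U p -> g p *m (w m p)^T = w m p *m g p.
Proof.
move=> Up; rewrite (wE' m Up) trmx_mul (fc_sym FC Up) (hessm_sym oU gf (PhiU m) Up).
by rewrite mulmxA.
Qed.

Lemma dwmE p a v : dwm w p a v = \matrix_(m, i) (v *m (dmx (w m) p a)^T) 0 i.
Proof.
apply/matrixP => m i; rewrite !mxE; apply: eq_bigr => k _.
by rewrite !mxE mulrC.
Qed.

Lemma wmE p v : wm w p v = \matrix_(m, i) (v *m (w m p)^T) 0 i.
Proof. by apply/matrixP => m i; rewrite !mxE; apply: eq_bigr => k _; rewrite mxE mulrC. Qed.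

Lemma w_codazzi p a v : U p ->
  dwm w p a v + wm w p v *m gam (christoffel g) p a = dwm w p v a + wm w p a *m gam (christoffel g) p v.
Proof.
move=> Up; apply/matrixP => m i; rewrite !addmxE.
have E x y : dwm w p x y m i + (wm w p y *m gam (christoffel g) p x) m i =
    (y *m (dmx (hessm g (Phi m)) p x - hessm g (Phi m) p *m (gam (christoffel g) p x)^T) *m g p) 0 i.
  have -> : (wm w p y *m gam (christoffel g) p x) m i = (y *m (w m p)^T *m gam (christoffel g) p x) 0 i.
    by rewrite wmE !mxE; apply: eq_bigr => k _; rewrite mxE.
  have HU k l : smooth_on U (fun q => hessm g (Phi m) q k l).
    by under eq_fun do rewrite mxE; exact: (hess_smooth oU gf (PhiU m) k l).
  have Hs q (Uq : U q) := hessm_sym oU gf (PhiU m) Uq.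
  by rewrite dwmE mxE -addmxE (codazzi_factor oU gf HU Hs (wE' m) x y Up).
apply: (etrans (E a v)); apply: (etrans _ (esym (E v a))).
by rewrite (codazzi_hess oU gf (PhiU m) _ _ Up).
Qed.

(** The analogue of [wm] for the covariant Hessians, whose rows are covectors. *)
Definition hm p (v : 'rV[R]_N) : 'M[R]_(L, N) := \matrix_(m, i) (v *m hessm g (Phi m) p) 0 i.

Lemma wm_hm p v : U p -> wm w p v = hm p v *m g p.
Proof.
move=> Up; apply/matrixP => m i; rewrite wmE mxE (wE' m Up) trmx_mul (fc_sym FC Up).
rewrite (hessm_sym oU gf (PhiU m) Up) mulmxA [LHS]mxE [RHS]mxE.
by apply: eq_bigr => k _; rewrite [hm p v m k]mxE.
Qed.

Lemma gauss_hm p a v : U p -> (wm w p v)^T *m mu *m wm w p a =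
  g p *m ((hm p v)^T *m mu *m hm p a) *m g p.
Proof. by move=> Up; rewrite !wm_hm// trmx_mul (fc_sym FC Up) !mulmxA. Qed.

Lemma hm_entries p a v j k : U p -> ((hm p v)^T *m mu *m hm p a) j k =
  \sum_i \sum_l (v 0 i * a 0 l) *
    \sum_m \sum_n mu m n * hess g (Phi m) i j p * hess g (Phi n) k l p.
Proof.
move=> Up.
have W x m s : hm p x m s = \sum_i x 0 i * hess g (Phi m) i s p.
  by rewrite !mxE; apply: eq_bigr => i _; rewrite mxE.
have -> : ((hm p v)^T *m mu *m hm p a) j k = \sum_m \sum_n mu m n * hm p v m j * hm p a n k.
  rewrite mxE; under eq_bigr do rewrite mxE mulr_suml.
  rewrite exchange_big; apply: eq_bigr => m _; apply: eq_bigr => n _ /=.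
  by rewrite [(hm p v)^T _ _]mxE; ring.
transitivity (\sum_m \sum_n \sum_i \sum_l (v 0 i * a 0 l) *
    (mu m n * hess g (Phi m) i j p * hess g (Phi n) k l p)).
  apply: eq_bigr => m _; apply: eq_bigr => n _; rewrite !W -mulrA big_distrlr /= mulr_sumr.
  apply: eq_bigr => i _; rewrite mulr_sumr; apply: eq_bigr => l _.
  by rewrite (hess_sym oU gf (PhiU n) k l Up); ring.
under eq_bigr do rewrite exchange_big.
rewrite exchange_big; apply: eq_bigr => i _ /=.
under eq_bigr do rewrite exchange_big.
rewrite exchange_big; apply: eq_bigr => l _ /=.
by rewrite mulr_sumr; apply: eq_bigr => m _; rewrite mulr_sumr.
Qed.

Lemma hess_product p j k i l : U p ->
  \sum_(n < N) hess_up g (Phi j) p n i * hess g (Phi k) n l p =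
  (hessm g (Phi j) p *m g p *m hessm g (Phi k) p) i l.
Proof.
move=> Up; rewrite mxE; apply: eq_bigr => n _; rewrite [hessm _ (Phi k) _ _ _]mxE; congr (_ * _).
have <- : (hessm g (Phi j) p *m g p)^T = hess_up g (Phi j) p.
  by rewrite trmx_mul (fc_sym FC Up) (hessm_sym oU gf (PhiU j) Up) hess_upE.
by rewrite mxE.
Qed.

Lemma conditions_of_potentials : potentials U g mu w Phi ->
  ferapontov_conditions U g (christoffel g) mu w.
Proof.
move=> [_ _ r3 r4]; split.
- by move=> p m Up; exact: w_self_adjoint.
- by move=> p a v Up; exact: w_codazzi.
- move=> p a v Up; rewrite (gauss_hm _ _ Up).
  have E : ((hm p v)^T *m mu *m hm p a)^T = (hm p v)^T *m mu *m hm p a.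
    apply/matrixP => j k; rewrite [LHS]mxE (hm_entries _ _ _ _ Up) (hm_entries _ _ _ _ Up).
    by apply: eq_bigr => i _; apply: eq_bigr => l _; rewrite (r4 p Up).
  move: (_ *m hm p a) E => X E.
  by rewrite !trmx_mul (fc_sym FC Up) E mulmxA.
- move=> p m n Up; rewrite (wE' m Up) (wE' n Up) !mulmxA -!(mulmxA (g p)); congr (_ *m _).
  by apply/matrixP => i l; rewrite -!(hess_product _ _ _ _ Up); exact: r3.
Qed.

(** The metric is invertible, so it can be cancelled on both sides of the commutation and Gauss
    equations; basis vectors for [a] and [v] then pick out the components. *)
Lemma potentials_of_conditions : (forall p m n, U p -> w m p *m w n p = w n p *m w m p) ->
  (forall p a v, U p -> ((wm w p v)^T *m mu *m wm w p a)^T = (wm w p v)^T *m mu *m wm w p a) ->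
  potentials U g mu w Phi.
Proof.
move=> c5 c4; split; [exact: PhiU|exact: wE| |].
- move=> p Up i l j k; rewrite !(hess_product _ _ _ _ Up).
  have gu : g p \in unitmx by case: gf => _ _ + _; exact.
  have := c5 p j k Up; rewrite (wE' j Up) (wE' k Up) => E.
  move: (hessm g (Phi j) p) (hessm g (Phi k) p) (g p) gu E => A B C Cu E.
  have {}E : A *m C *m B = B *m C *m A.
    by apply: (can_inj (mulKmx Cu)); rewrite !mulmxA; move: E; rewrite !mulmxA.
  by rewrite E.
- move=> p Up i j k l.
  have gu : g p \in unitmx by case: gf => _ _ + _; exact.
  have E : ((hm p (delta_mx 0 i))^T *m mu *m hm p (delta_mx 0 l))^T =
      (hm p (delta_mx 0 i))^T *m mu *m hm p (delta_mx 0 l).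
    have := c4 p (delta_mx 0 l) (delta_mx 0 i) Up; rewrite (gauss_hm _ _ Up).
    move: (_ *m hm p _) => X; rewrite !trmx_mul (fc_sym FC Up) mulmxA => E.
    by apply: (can_inj (mulKmx gu)); apply: (can_inj (mulmxK gu)).
  have := congr1 (fun A : 'M[R]_N => A k j) E; rewrite [X in X = _ -> _]mxE.
  rewrite (hm_entries _ _ _ _ Up) (hm_entries _ _ _ _ Up).
  have K (F : 'I_N -> 'I_N -> R) : \sum_i' \sum_l' ((delta_mx 0 i : 'rV[R]_N) 0 i' * (delta_mx 0 l : 'rV[R]_N) 0 l') * F i' l' = F i l.
    rewrite (bigD1 i)//= [X in _ + X]big1 ?addr0 => [|i' i'i]; last first.
      by rewrite big1// => l' _; rewrite mxE eqxx (negbTE i'i) !mul0r.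
    rewrite (bigD1 l)//= [X in _ + X]big1 ?addr0 => [|l' l'l]; last first.
      by rewrite !mxE !eqxx (negbTE l'l) mulr0 mul0r.
    by rewrite !mxE !eqxx !mul1r.
  by rewrite (K (fun i l => \sum_m \sum_n mu m n * hess g (Phi m) i j p * hess g (Phi n) k l p))
    (K (fun i l => \sum_m \sum_n mu m n * hess g (Phi m) i k p * hess g (Phi n) j l p)).
Qed.

End potential_conditions.

Section extensionality.
Context {R : realType} {N L : nat} (U : set 'rV[R]_N) (oU : open U).
Variables (g : 'rV[R]_N -> 'M[R]_N) (b b' : 'I_N -> 'I_N -> 'I_N -> 'rV[R]_N -> R)
  (mu : 'M[R]_L) (w : 'I_L -> 'rV[R]_N -> 'M[R]_N).
Hypotheses (gs : forall i j, smooth_on U (fun p => g p i j)) (bs : forall i j k, smooth_on U (b i j k))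
  (ws : forall m i j, smooth_on U (fun p => w m p i j)) (mu_sym : mu^T = mu)
  (bb : forall p i j k, U p -> b i j k p = b' i j k p).

Notation P := (hydro_op g b mu w).
Notation P' := (hydro_op g b' mu w).

Lemma hydro_op_ext u xi x : U (u x) -> P u xi x = P' u xi x.
Proof.
move=> Ux; rewrite /hydro_op; congr (_ + _); apply/rowP => i; rewrite !mxE; congr (_ + _).
by apply: eq_bigr => j _; apply: eq_bigr => k _; rewrite (bb _ _ _ Ux).
Qed.

(** The two operators agree only where the field lies in U, and the outer bracket perturbs the
    field. For small parameters it stays in U over the support of the first covector, which is all
    that the bracket integrates; the nonlocal parts of the two operators are literally equal. *)
Lemma hamiltonian_ext : hamiltonian U P -> hamiltonian U P'.
Proof.
have E u xi : smooth_field U u -> P u xi = P' u xi.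
  by move=> [_ uU]; apply/funext => x; exact: hydro_op_ext.
have cst0 : smooth_map (fun _ : R => 0 : 'rV[R]_N) by apply: smooth_map_smm; exact: smm_cst.
move=> [sk ja]; split.
  by move=> I J u uU; rewrite /bracket -!(E u _ uU); exact: (sk I J u uU).
move=> I J K u uU; have := ja I J K u uU.
have O (A B C : functional U) : outer_bracket P (bracket P A B) C u = outer_bracket P' (bracket P' A B) C u.
  have [us uin] := uU.
  pose r := Num.max (Defs.rad C + 1) 0.
  have r0 : 0 <= r by rewrite le_max lexx orbT.
  have Cr : Defs.rad C < r by rewrite lt_max ltrDl ltr01.
  have as_ : smooth_map (P u (vder C u)) := hop_smooth mu oU gs bs ws r0 uU (vder_smooth oU C uU cst0 cst0) (supp_vder u Cr).
  rewrite /outer_bracket -(E u _ uU); apply: near_eq_derive.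
  have [d d0 Hd] := near_U (r := Defs.rad A) oU us as_ cst0 (fun x _ => uin x).
  apply: filterS (@near0_norm_lt R R d d0) => e ed.
  apply: eq_Rintegral => x _; apply: eq_bigr => i _.
  have [xA|xA] := leP `|x| (Defs.rad A); last by rewrite vder_supp// mxE !mul0r.
  congr (_ * _); rewrite hydro_op_ext//.
  by have := Hd e 0 x ed; rewrite normr0 scaler0 addr0 => H; exact: H d0 xA.
have alg (x y z x' y' z' : R) : x = x' -> y = y' -> z = z' -> x + y + z = 0 -> x' + y' + z' = 0.
  by move=> -> -> ->.
exact (alg _ _ _ _ _ _ (O I J K) (O J K I) (O K I J)).
Qed.

End extensionality.

Section restriction.
Context {R : realType} {N L : nat} (U V : set 'rV[R]_N).
Hypotheses (VU : V `<=` U).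

Lemma flat_metric_sub (g : 'rV[R]_N -> 'M[R]_N) : flat_metric U g -> flat_metric V g.
Proof.
move=> [g1 g2 g3 g4]; split.
- by move=> i j; exact: (smooth_on_sub VU (g1 i j)).
- by move=> u /VU; exact: g2.
- by move=> u /VU; exact: g3.
- by move=> u /VU; exact: g4.
Qed.

End restriction.

(** * The pencil of compatible operators *)

Section pencil.
Context {R : realType} {N L : nat} (U : set 'rV[R]_N) (oU : open U).
Variables (g : 'rV[R]_N -> 'M[R]_N) (mu : 'M[R]_L) (Phi : 'I_L -> 'rV[R]_N -> R).
Hypothesis gf : flat_metric U g.

Lemma flat_connection_scale (c : 'I_N -> 'I_N -> 'I_N -> 'rV[R]_N -> R) l :
  flat_connection U g c -> flat_connection U (fun p => l *: g p) c.
Proof.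
move=> [h1 h2 h3 h4 h5 h6]; split=> //.
- move=> i j; under eq_fun do rewrite mxE.
  exact: (smooth_onM oU (smooth_cst_set oU l) (h1 i j)).
- by move=> p Up; rewrite linearZ /= h3.
- move=> p a Up; rewrite -scalemxAl -scalemxAr -scalerN -scalerBr -h5//.
  apply/matrixP => i j; rewrite !mxE.
  have [_ ->] : is_derive p a (fun q => (l *: g q) i j) (l * 'D_a (fun q => g q i j) p); last by [].
  under eq_fun do rewrite mxE.
  by apply: is_deriveZ; exact: smooth_on_is_derive (h1 i j) Up.
Qed.

(** A member of the pencil is again an operator of the same form, with metric [l1 *: g], unchanged
    Christoffel symbols and matrix [l2 *: mu]. The conditions are homogeneous, so sufficiency
    applies to it directly, including l1 = 0 or l2 = 0. *)
Lemma M_opE l1 l2 : M_op g mu Phi l1 l2 =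
  hydro_op (fun p => l1 *: g p) (lcb (fun p => l1 *: g p) (christoffel g)) (l2 *: mu) (fun n => hess_up g (Phi n)).
Proof.
apply/funext => u; apply/funext => xi; apply/funext => x; rewrite /M_op /op_comb /hydro_op; congr (_ + _).
  apply/rowP => i; rewrite !mxE mulrDr !mulr_sumr; congr (_ + _).
    by apply: eq_bigr => j _; rewrite [X in _ = X * _]mxE mulrA.
  apply: eq_bigr => j _; rewrite !mulr_sumr; apply: eq_bigr => k _.
  rewrite /lc_coef /lcb; under [in RHS]eq_bigr do rewrite [X in X * _]mxE -mulrA.
  by rewrite -mulr_sumr; ring.
apply/rowP => i; rewrite !mxE mulr_sumr; apply: eq_bigr => m _.
by rewrite mulr_sumr; apply: eq_bigr => n _; rewrite [(l2 *: mu) m n]mxE; ring.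
Qed.

Hypotheses (mu_sym : mu^T = mu) (pot : potentials U g mu (fun n => hess_up g (Phi n)) Phi).

Let PhiU n : smooth_on U (Phi n). Proof. by case: pot. Qed.

Lemma M_op_hamiltonian l1 l2 : hamiltonian U (M_op g mu Phi l1 l2).
Proof.
rewrite M_opE; have FC := flat_connection_christoffel oU gf.
have [c2 c3 c4 c5] := conditions_of_potentials oU gf PhiU (fun n u _ => erefl) pot.
have ws m i j := hess_up_smooth oU gf PhiU m i j.
apply: (hydro_op_hamiltonian oU (flat_connection_scale l1 FC) ws).
  by rewrite linearZ /= mu_sym.
split => //.
- by move=> p m Up; rewrite -scalemxAl -scalemxAr c2.
- by move=> p a v Up; rewrite -scalemxAr -scalemxAl linearZ /= c4.
Qed.

Lemma M_op_compatible : compatible U (M_op g mu Phi 1 0) (M_op g mu Phi 0 1).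
Proof.
split; [exact: M_op_hamiltonian|exact: M_op_hamiltonian|].
move=> l1 l2; have -> : op_comb l1 (M_op g mu Phi 1 0) l2 (M_op g mu Phi 0 1) = M_op g mu Phi l1 l2.
  apply/funext => u; apply/funext => xi; apply/funext => x; rewrite /M_op /op_comb.
  by rewrite !scale1r !scale0r addr0 add0r.
exact: M_op_hamiltonian.
Qed.

End pencil.

(** * Commuting flows *)

Section commuting.
Context {R : realType} {N L : nat} (U : set 'rV[R]_N) (oU : open U).
Variables (c : 'I_N -> 'I_N -> 'I_N -> 'rV[R]_N -> R) (w : 'I_L -> 'rV[R]_N -> 'M[R]_N).
Hypotheses (ws : forall m i j, smooth_on U (fun p => w m p i j))
  (tor : forall p, U p -> forall i s k, c i s k p = c i k s p)
  (cod : forall p a v, U p -> dwm w p a v + wm w p v *m gam c p a = dwm w p v a + wm w p a *m gam c p v)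
  (com : forall p m n, U p -> w m p *m w n p = w n p *m w m p).

Let gs p a v : U p -> a *m gam c p v = v *m gam c p a.
Proof.
move=> Up; apply/rowP => i; rewrite !mxE.
under eq_bigr do rewrite mxE mulr_sumr.
under [RHS]eq_bigr do rewrite mxE mulr_sumr.
rewrite exchange_big /=; apply: eq_bigr => k _; apply: eq_bigr => s _.
by rewrite (tor Up); ring.
Qed.

Lemma dmx_codazzi p m a v : U p ->
  v *m (dmx (w m) p a)^T + v *m (w m p)^T *m gam c p a = a *m (dmx (w m) p v)^T + a *m (w m p)^T *m gam c p v.
Proof.
move=> /(cod a v) /(congr1 (fun A => row m A)); rewrite !linearD /= !row_mul.
have W x : row m (wm w p x) = x *m (w m p)^T.
  by apply/rowP => i; rewrite mxE wmE mxE.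
have D x y : row m (dwm w p x y) = y *m (dmx (w m) p x)^T.
  by apply/rowP => i; rewrite mxE dwmE mxE.
by rewrite !W !D.
Qed.

Lemma dmx_comm p m n v : U p ->
  dmx (w m) p v *m w n p + w m p *m dmx (w n) p v = dmx (w n) p v *m w m p + w n p *m dmx (w m) p v.
Proof.
move=> Up.
have D k : is_derive p v (w k) (dmx (w k) p v).
  by apply: is_derive_mx => i j; rewrite mxE; exact: smooth_on_is_derive (ws k i j) Up.
apply/matrixP => i j.
have [_ <-] := is_derive_entry i j (is_derive_mulmx (D m) (D n)).
have [_ <-] := is_derive_entry i j (is_derive_mulmx (D n) (D m)).
by apply: (eq_on_derive _ oU) => // q; rewrite inE => Uq; rewrite com.
Qed.

Lemma flowE m u x : flow (w m) u x = dx u x *m (w m (u x))^T.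
Proof. by apply/rowP => i; rewrite mxE [RHS]mxE; apply: eq_bigr => k _; rewrite [_^T _ _]mxE mulrC. Qed.

Lemma is_derive_flow m u a x : smooth_field U u -> smooth_map a ->
  is_derive (0 : R) 1 (fun e : R => flow (w m) (fun y => u y + e *: a y) x)
    (dx a x *m (w m (u x))^T + dx u x *m (dmx (w m) (u x) (a x))^T).
Proof.
move=> [us uin] as_.
have H : is_derive (0 : R) 1 (fun e : R => w m (u x + e *: a x)) (dmx (w m) (u x) (a x)).
  apply: is_derive_mx => i j; have F := smooth_on_is_derive (a x) (ws m i j) (uin x).
  have {}F : is_derive (u x + 0 *: a x) (a x) (fun q => w m q i j) (dmx (w m) (u x) (a x) i j).
    by rewrite scale0r addr0 mxE.
  exact ((is_derive_line (fun q => w m q i j) (u x) (a x) 0 _).1 F).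
have D : is_derive (0 : R) 1 (fun e : R => dx u x + e *: dx a x) (dx a x).
  apply/is_derive_approxP => eta e0; apply: filterE => h.
  rewrite add0r scale0r addr0 [h%:A]mulr1 addrAC addrK subrr normr0.
  by rewrite mulr_ge0// ltW.
have := is_derive_mulmx D (is_derive_trmx H); rewrite !scale0r !addr0.
congr is_derive; apply/funext => e; rewrite flowE (dx_line e us as_).
by [].
Qed.

(** The terms with u_xx cancel because the w_m commute. The terms quadratic in u_x cancel by the
    Codazzi equations together with the derivative of the commutation relation. *)
Lemma flows_commute m n : commuting_flows U (w m) (w n).
Proof.
move=> u uU x i; have [us uin] := uU; have dus := smooth_map_dx us.
have fs k : smooth_map (flow (w k) u).
  apply: smooth_map_smm; apply: (@eq_smm _ _ _ (fun y => dx u y *m (w k (u y))^T)).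
    apply: smm_mul; first exact: smm_map.
    by apply: smm_tr; exact: (smm_G oU (ws k) uU).
  by move=> y; rewrite flowE.
have dxf k y : dx (flow (w k) u) y = dx (dx u) y *m (w k (u y))^T + dx u y *m (dmx (w k) (u y) (dx u y))^T.
  apply: is_derive_eq_dx.
  have -> : flow (w k) u = fun y => dx u y *m (w k (u y))^T by apply/funext => z; rewrite flowE.
  apply: is_derive_mulmx; first exact: smooth_map_derive.
  apply: is_derive_trmx; exact: (dmx_curve oU y (ws k) uU).
have E k l : 'D_1 (fun e : R => flow (w k) (fun y => u y + e *: flow (w l) u y) x 0 i) 0 =
    ((dx (dx u) x *m (w l (u x))^T + dx u x *m (dmx (w l) (u x) (dx u x))^T) *m (w k (u x))^T
     + dx u x *m (dmx (w k) (u x) (dx u x *m (w l (u x))^T))^T) 0 i.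
  by have [_ ->] := is_derive_entry 0 i (is_derive_flow k x uU (fs l)); rewrite dxf flowE.
apply: (etrans (E m n)); apply: (etrans _ (esym (E n m))).
apply: (congr1 (fun A : 'rV[R]_N => A 0 i)).
move: (uin x) (dx u x) (dx (dx u) x); move: (u x) => p Up v v2.
have C k l : w k p *m w l p = w l p *m w k p by exact: com.
have S k l : v *m (dmx (w k) p (v *m (w l p)^T))^T =
    v *m (w l p)^T *m (dmx (w k) p v)^T + v *m (w l p)^T *m (w k p)^T *m gam c p v - v *m (w k p)^T *m gam c p (v *m (w l p)^T).
  by apply/eqP; rewrite eq_sym subr_eq; apply/eqP; rewrite -(dmx_codazzi k (v *m (w l p)^T) v Up).
rewrite (S m n) (S n m) (gs (v *m (w m p)^T) (v *m (w n p)^T) Up) {S}.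
have := congr1 (fun A => v *m A^T) (dmx_comm m n v Up).
have /(congr1 trmx) := C m n.
move: (dmx (w m) p v) (dmx (w n) p v) (w m p) (w n p) (gam c p v) (gam c p _) => dm dn A B ga gb.
rewrite !trmx_mul => AB; rewrite !trDE !trmx_mul !mulmxDr !mulmxDl !mulmxA => D.
rewrite -!(mulmxA _ B^T A^T) AB !mulmxA.
move: D => /(congr1 (fun x => x - v *m B^T *m dm^T)); rewrite addrAC subrr add0r => D.
by rewrite D; apply/rowP => j; rewrite !addoppE; ring.
Qed.

End commuting.

(** * Integrals depending on a parameter, and geometric convergence *)

Section parametric_integral.
Context {R : realType} {W : normedModType R} (S : set W) (oS : open S).

Lemma unif_nbhs (phi : (W * R)%type -> R) q (K eta : R) :
  (forall z, (S `*` [set: R]) z -> {for z, continuous phi}) -> S q -> 0 < eta ->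
  \forall q' \near q, forall t, `|t| <= K -> `|phi (q', t) - phi (q, t)| <= eta.
Proof.
move=> pc Sq eta0; have /compact_near_coveringP cK := @segment_compact R (- K) K.
suff H : forall t, `[- K, K]%classic t -> \forall t' \near t & q' \near nbhs q, `|phi (q', t') - phi (q, t')| <= eta.
  apply: filterS (@cK W (nbhs q) (fun q' t => `|phi (q', t) - phi (q, t)| <= eta) _ H) => q' Hq' t tK.
  by apply: Hq'; rewrite /= in_itv /= -ler_norml.
move=> t _.
have e20 : 0 < eta / 2 by rewrite divr_gt0.
have /cvgrPdist_le/(_ _ e20)[[A B] /= [nA nB] AB] := pc (q, t) (conj Sq I).
exists (B, A) => // -[t' q'] /= [Bt' Aq'].
have h1 := AB (q', t') (conj Aq' Bt'); have h2 := AB (q, t') (conj (nbhs_singleton nA) Bt').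
rewrite -(subrKA (phi (q, t))) (le_trans (ler_normD _ _))// (splitr eta) lerD//.
by rewrite distrC.
Qed.

Lemma param_prim_derive (phi : (W * R)%type -> R) q v : smooth_on (S `*` [set: R]) phi -> S q ->
  is_derive q v (fun q => prim (fun t => phi (q, t)) 1) (prim (fun t => 'D_(v, 0) phi (q, t)) 1).
Proof.
move=> ps Sq; have H := UD_smooth (r := 1) v (open_fst oS) ps (fun x _ => conj Sq I).
have c1 : `|1 : R| <= 1 by rewrite normr1.
have := UD_is_derive c1 (UD_prim ler01 H) => D.
have := (is_derive_line (fun q => prim (fun t => phi (q, t)) 1) q v 0 (prim (fun t => 'D_(v, 0) phi (q, t)) 1)).2 D.
by rewrite scale0r addr0.
Qed.

(** Coinduction over all integrals of smooth integrands: differentiating under the integral sign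
    stays in this class. *)
Lemma param_prim_smooth (phi : (W * R)%type -> R) : smooth_on (S `*` [set: R]) phi ->
  smooth_on S (fun q => prim (fun t => phi (q, t)) 1).
Proof.
move=> ps.
refine (@smooth_coind R W S (fun f => exists2 phi, smooth_on (S `*` [set: R]) phi & f = fun q => prim (fun t => phi (q, t)) 1) oS _ _ _ _); last by exists phi.
- move=> _ [psi pss ->] q Sq; apply/cvgrPdist_le => eta eta0.
  have pc z : (S `*` [set: R]) z -> {for z, continuous psi} by exact: smooth_on_continuous pss.
  (* With the zero direction [UD_smooth] yields just continuity in [t], on the ball of radius 1 + 1
     around the interval [0, 1] of integration. *)
  have cb q' : S q' -> cont_ball (2 : R) (fun t => psi (q', t)).
    move=> Sq'; have := UD_cont0 (UD_smooth (r := 1) 0 (open_fst oS) pss (fun x _ => conj Sq' I)).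
    by rewrite scale0r addr0 -[1 + 1]/(2 : R).
  apply: filterS2 (unif_nbhs 1 pc Sq eta0) (open_nbhs_nbhs (conj oS Sq)) => q' H Sq'.
  rewrite distrC -mulN1r addrC -(prim_linear (rho := 2) _ (cb _ Sq) (cb _ Sq')) ?normr1 ?ltr1n//.
  have := @prim_bound R 2 (fun y => -1 * psi (q, y) + psi (q', y)) eta 1 1.
  rewrite normr1 mulr1; apply => //; last 2 first.
  + by rewrite ltr1n.
  + by move=> y y1; rewrite mulN1r addrC; exact: H.
  by apply: cont_ballD; [apply: cont_ballM; [exact: cont_ball_cst|exact: cb]|exact: cb].
- move=> _ v [psi pss ->]; exists (fun q => prim (fun t => 'D_(v, 0) psi (q, t)) 1).
    by exists ('D_(v, 0) psi); [exact: smooth_onD|reflexivity].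
  by move=> q Sq; exact: param_prim_derive.
Qed.

End parametric_integral.

Section geometric_limit.
Context {R : realType}.

Definition hpow (k : nat) : R := 2^-1 ^+ k.

Lemma hpow_gt0 k : 0 < hpow k. Proof. by rewrite exprn_gt0// invr_gt0. Qed.

Lemma hpowS k : hpow k = 2 * hpow k.+1.
Proof. by rewrite /hpow exprS mulrA divff ?mul1r. Qed.

Lemma hpow_small (e : R) : 0 < e -> exists k, hpow k < e.
Proof.
move=> e0; exists (Num.truncn e^-1).+1.
have i0 : 0 < e^-1 by rewrite invr_gt0.
rewrite -[X in _ < X]invrK /hpow exprVn ltf_pV2 ?posrE ?exprn_gt0//.
apply: lt_trans (truncnS_gt _) _; rewrite -natrX ltr_nat; exact: ltn_expl.
Qed.

(** Nested intervals around [x k] of half-length [2 * C * hpow k]; the limit is the supremum of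
    their left ends and comes with an explicit rate. *)
Lemma geometric_limit (x : nat -> R) (C : R) : (forall k, `|x k.+1 - x k| <= C * hpow k) ->
  exists l, forall k, `|x k - l| <= 2 * C * hpow k.
Proof.
move=> H.
pose lo k := x k - 2 * C * hpow k; pose up k := x k + 2 * C * hpow k.
have C0 : 0 <= C by have := le_trans (normr_ge0 _) (H 0%N); rewrite /hpow expr0 mulr1.
have Hk k : lo k <= lo k.+1 /\ up k.+1 <= up k.
  have := H k; rewrite ler_norml /lo /up (hpowS k) => /andP[h1 h2].
  by split; lra.
have lom k m : (k <= m)%N -> lo k <= lo m.
  by move=> /subnK <-; elim: (m - k)%N => [|d IH] //; rewrite addSn (le_trans IH)//; exact: (Hk _).1.
have upm k m : (k <= m)%N -> up m <= up k.
  by move=> /subnK <-; elim: (m - k)%N => [|d IH] //; rewrite addSn (le_trans _ IH)//; exact: (Hk _).2.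
have lu k : lo k <= up k.
  have : 0 <= 2 * C * hpow k by rewrite !mulr_ge0// ltW// hpow_gt0.
  by rewrite /lo /up; lra.
have lou k m : lo k <= up m.
  have [km|/ltnW mk] := leqP k m; first exact: le_trans (lom _ _ km) (lu m).
  exact: le_trans (lu k) (upm _ _ mk).
pose E := [set lo k | k in [set: nat]].
have E0 : has_sup E.
  by split; [exists (lo 0%N), 0%N|exists (up 0%N) => _ [k _ <-]; exact: lou].
exists (sup E) => k; rewrite ler_norml.
have h1 : lo k <= sup E by apply: (sup_upper_bound E0); exists k.
have h2 : sup E <= up k by apply: ge_sup; [case: E0|move=> _ [m _ <-]; exact: lou].
by rewrite /lo /up in h1 h2 *; apply/andP; split; lra.
Qed.

Lemma le_hpow_limit (a b C : R) : 0 <= C -> (forall k, a <= b + C * hpow k) -> a <= b.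
Proof.
move=> C0 H; apply/ler_addgt0Pr => e e0.
have C1 : 0 < C + 1 by rewrite ltr_wpDl.
have [k hk] := hpow_small (divr_gt0 e0 C1).
apply: le_trans (H k) _; rewrite lerD2l.
rewrite ltr_pdivlMr// in hk; apply: le_trans (ltW hk); rewrite mulrC ler_wpM2l ?lerDl//.
exact: ltW (hpow_gt0 k).
Qed.

End geometric_limit.

Local Opaque prim.

(** * Integration of closed systems on a ball *)

Section reparametrization.
Context {R : realType}.

(* A rational substitute for the parameter of a segment: tau maps R into
   [-1, 1], so that p + tau t (q - p) stays in a ball around p for every t. *)
Definition tau (t : R) : R := 2 * t * (1 + t ^+ 2)^-1.
Definition dtau (t : R) : R := 2 * (1 - t ^+ 2) * ((1 + t ^+ 2)^-1 * (1 + t ^+ 2)^-1).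

Let den (t : R) : 0 < 1 + t ^+ 2. Proof. by rewrite ltr_pwDl// sqr_ge0. Qed.

Lemma tau_bound t : `|tau t| <= 1.
Proof.
have d := den t; rewrite /tau normrM [`|_^-1|]gtr0_norm ?invr_gt0// ler_pdivrMr// mul1r ler_norml.
have := sqr_ge0 (t - 1); have := sqr_ge0 (t + 1); rewrite !expr2 => h1 h2.
by apply/andP; split; nra.
Qed.

Lemma dtau_bound t : `|dtau t| <= 2.
Proof.
have d := den t; have dd := mulr_gt0 d d.
rewrite /dtau -invfM normrM normfV (gtr0_norm dd) ler_pdivrMr//.
have := sqr_ge0 t; move: (t ^+ 2) => s s0.
by rewrite ler_norml; apply/andP; split; nra.
Qed.

Lemma tau0 : tau 0 = 0. Proof. by rewrite /tau mulr0 mul0r. Qed.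
Lemma tau1 : tau 1 = 1. Proof. by rewrite /tau mulr1 expr1n divff. Qed.

Lemma smR_id : smooth_on [set: R] (fun t : R => t).
Proof. by have := @smooth_on_linfun R R [set: R] idfun openT (fun x => cvg_id). Qed.

Let smd : smooth_on [set: R] (fun t => (1 + t ^+ 2)^-1).
Proof.
apply: (smooth_onV openT) => [|t _]; last by rewrite gt_eqF.
by apply: (smR_D (smR_cst 1)); exact: smR_M smR_id smR_id.
Qed.

Lemma tau_smooth : smooth_on [set: R] tau.
Proof. exact: smR_M (smR_M (smR_cst 2) smR_id) smd. Qed.

Lemma dtau_smooth : smooth_on [set: R] dtau.
Proof.
apply: smR_M (smR_M smd smd); apply: (smR_M (smR_cst 2)).
by apply: (smR_D (smR_cst 1)); apply: smR_N; exact: smR_M smR_id smR_id.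
Qed.

Lemma tau_derive (t : R) : is_derive t 1 tau (dtau t).
Proof.
have h1 : is_derive t 1 (fun t : R => 2 * t) 2.
  by have := is_deriveM (is_derive_cst (2 : R) t 1) (is_derive_id t 1) => H; apply: (is_derive_eqv H); rewrite scaler0 addr0 /GRing.scale /= mulr1.
have h2 : is_derive t 1 (fun t : R => 1 + t * t) (2 * t).
  have := is_deriveD (is_derive_cst (1 : R) t 1) (is_deriveM (is_derive_id t 1) (is_derive_id t 1)) => H.
  by apply: (is_derive_eqv H); rewrite add0r /GRing.scale /=; ring.
have n0 : 1 + t * t != 0 by rewrite gt_eqF// -expr2.
have h3 := @is_deriveV R (fun t : R => 1 + t * t) t _ _ n0 h2.
have H := is_deriveM h1 h3.
have -> : tau = (fun t : R => 2 * t) * (fun t => (1 + t * t)^-1).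
  by apply/funext => s; rewrite /tau fctE expr2.
apply: (is_derive_eqv H); rewrite /dtau /GRing.scale /= !expr2.
by field.
Qed.

End reparametrization.

Lemma is_derive_eqg {R : realType} {V W : normedModType R} (f : V -> W) (x v : V) (d d' : W) :
  is_derive x v f d -> d = d' -> is_derive x v f d'.
Proof. by move=> H <-. Qed.

Lemma is_derive_slicel {R : realType} {W : normedModType R} (phi : (W * R)%type -> R) q v t d :
  is_derive (q, t) (v, 0 : R) phi d -> is_derive q v (fun q => phi (q, t)) d.
Proof.
move=> /is_derive_approxP H; apply/is_derive_approxP => eta /H; apply: filterS => h.
by rewrite pair_line.
Qed.

Lemma mxZE {R : realType} m n (a : R) (A : 'M[R]_(m, n)) i j : (a *: A) i j = a * A i j.
Proof. by rewrite mxE. Qed.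

Lemma cont_near {R : realType} {W : normedModType R} (f : W -> R) q (eta : R) :
  {for q, continuous f} -> 0 < eta -> \forall q' \near q, `|f q - f q'| <= eta.
Proof. by move=> /cvgrPdist_le H eta0; exact: H. Qed.

Lemma near_line {R : realType} {W : normedModType R} (P : W -> Prop) (q w : W) :
  (\forall q' \near q, P q') -> exists2 e : R, 0 < e & forall t : R, `|t| < e -> P (q + t *: w).
Proof.
move=> /nbhs_ballP[e /= e0 He].
have w1 : 0 < `|w| + 1 by rewrite ltr_wpDl.
exists (e / (`|w| + 1)) => [|t]; first by rewrite divr_gt0.
rewrite ltr_pdivlMr// => te; apply: He.
rewrite -ball_normE /= opprD addrA subrr sub0r normrN normrZ; apply: le_lt_trans te.
by rewrite ler_wpM2l// lerDl.
Qed.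

Lemma near_norm_ball {R : realType} {W : normedModType R} (P : W -> Prop) (p : W) :
  (\forall q \near p, P q) -> exists2 e : R, 0 < e & forall q, `|q - p| < e -> P q.
Proof.
move=> /nbhs_ballP[e /= e0 He]; exists e => // q qe; apply: He.
by rewrite -ball_normE /= distrC.
Qed.

Lemma near_forall_ball {R : realType} {W : normedModType R} (T : finType) (Q : T -> W -> Prop) (p : W) :
  (forall z, \forall q \near p, Q z q) -> exists2 e : R, 0 < e & forall q, `|q - p| < e -> forall z, Q z q.
Proof. by move=> H; apply: near_norm_ball; exact: filter_forall. Qed.

Lemma uniform_limit_continuous {R : realType} {W : normedModType R} (B : set W) (f : nat -> W -> R) (F : W -> R) (C : R) q :
  open B -> (forall k q, B q -> `|f k q - F q| <= C * hpow k) -> (forall k, {for q, continuous (f k)}) ->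
  B q -> {for q, continuous F}.
Proof.
move=> oB H fc Bq; apply/cvgrPdist_le => eta eta0.
have C0 : 0 <= C by have := le_trans (normr_ge0 _) (H 0%N q Bq); rewrite /hpow expr0 mulr1.
have C1 : 0 < 4 * (C + 1) by rewrite mulr_gt0// ltr_wpDl.
have [k] := hpow_small (divr_gt0 eta0 C1); rewrite ltr_pdivlMr// => hk.
have e2 : 0 < eta / 2 by rewrite divr_gt0.
apply: filterS2 (cont_near (fc k) e2) (open_nbhs_nbhs (conj oB Bq)) => q' h1 Bq'.
have h2 := H k q Bq; have h3 := H k q' Bq'.
have -> : F q - F q' = - (f k q - F q) + (f k q - f k q') + (f k q' - F q') by ring.
apply: le_trans (ler_normD _ _) _; apply: le_trans (lerD (ler_normD _ _) (lexx _)) _.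
rewrite normrN; move: h1 h2 h3 hk; have := @hpow_gt0 R k.
by move: (hpow k) `|_| `|_| `|_| => z n1 n2 n3; nra.
Qed.

Section frobenius.
Context {R : realType} {N n : nat}.
Variables (FA : 'I_n -> 'I_n -> 'I_N -> 'rV[R]_N -> R) (Fc : 'I_1 -> 'I_n -> 'I_N -> 'rV[R]_N -> R).
Implicit Types (q w y : 'rV[R]_N) (X : 'rV[R]_N -> 'rV[R]_n).
Notation A := (ct FA).
Notation c := (ct Fc).

Section ball.
Variables (p0 : 'rV[R]_N) (rho : R).
Let B : set 'rV[R]_N := [set q | `|q - p0| < rho].
Hypotheses (FAs : forall i j k, smooth_on B (FA i j k)) (Fcs : forall i j k, smooth_on B (Fc i j k)).
Hypotheses
  (intA : forall q w y, B q -> dct FA q w y - dct FA q y w + A q w *m A q y - A q y *m A q w = 0)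
  (intc : forall q w y, B q -> dct Fc q w y - dct Fc q y w + c q w *m A q y - c q y *m A q w = 0).

Lemma ball_norm_open : open B.
Proof.
have -> : B = ball p0 rho by apply/seteqP; split => q; rewrite -ball_normE /B /= distrC.
exact: ball_open.
Qed.
Let oB := ball_norm_open.

Definition seg q (t : R) : 'rV[R]_N := p0 + tau t *: (q - p0).

Lemma seg_in q t : B q -> B (seg q t).
Proof.
rewrite /B /= /seg addrAC subrr add0r => Bq; rewrite normrZ (le_lt_trans _ Bq)//.
by rewrite -[leRHS]mul1r ler_wpM2r// tau_bound.
Qed.

Definition smv X := forall j, smooth_on B (fun q => X q 0 j).

(** The system to be solved is dX = X A + c in every direction [w]; [intA] and [intc] are its
    integrability conditions. *)
Definition rhs X q w : 'rV[R]_n := X q *m A q w + c q w.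

Definition pint X (z : 'rV[R]_N * R) : 'rV[R]_n := dtau z.2 *: rhs X (seg z.1 z.2) (z.1 - p0).

(** The Picard map with value 0 at [p0]: the right-hand side is integrated along the ray from [p0]
    to [q]. *)
Definition step X q : 'rV[R]_n := \row_j prim (fun t => pint X (q, t) 0 j) 1.

Let oBR : open (B `*` [set: R]) := open_fst oB.

Lemma seg_comp (F : 'rV[R]_N -> R) : smooth_on B F -> smooth_on (B `*` [set: R]) (fun z => F (seg z.1 z.2)).
Proof.
move=> Fs; apply: (smooth_on_comp oBR oB Fs) => [z [Bz _]|i]; first exact: seg_in.
have -> : (fun z : 'rV[R]_N * R => seg z.1 z.2 0 i) = (fun z => p0 0 i + tau z.2 * (z.1 0 i - p0 0 i)).
  by apply/funext => z; rewrite !mxE.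
have [l [lE lc]] := @coord_linear R N i.
have s1 : smooth_on (B `*` [set: R]) (fun z => z.1 0 i).
  by have := @smooth_on_fst R _ (B `*` [set: R]) l oBR lc; under eq_fun do rewrite lE.
apply: (smooth_onDr oBR (smooth_cst_set oBR _)); apply: (smooth_onM oBR).
  exact: smooth_on_snd oBR tau_smooth.
exact: (smooth_onDr oBR s1 (smooth_cst_set oBR (- p0 0 i))).
Qed.

Lemma pint_smooth X j : smv X -> smooth_on (B `*` [set: R]) (fun z => pint X z 0 j).
Proof.
move=> Xs.
have sy k : smooth_on (B `*` [set: R]) (fun z => (z.1 - p0) 0 k).
  have [l [lE lc]] := @coord_linear R N k.
  have s1 : smooth_on (B `*` [set: R]) (fun z => z.1 0 k).
    by have := @smooth_on_fst R _ (B `*` [set: R]) l oBR lc; under eq_fun do rewrite lE.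
  by under eq_fun do rewrite !mxE; exact: (smooth_onDr oBR s1 (smooth_cst_set oBR (- p0 0 k))).
have sc m (F : 'I_m -> 'I_n -> 'I_N -> 'rV[R]_N -> R) i : (forall i j k, smooth_on B (F i j k)) ->
    smooth_on (B `*` [set: R]) (fun z => ct F (seg z.1 z.2) (z.1 - p0) i j).
  move=> Fs; under eq_fun do rewrite mxE.
  by apply: (smooth_on_sum oBR) => k; apply: (smooth_onM oBR); [exact: seg_comp|exact: sy].
have -> : (fun z => pint X z 0 j) = fun z => dtau z.2 *
    (\sum_i X (seg z.1 z.2) 0 i * A (seg z.1 z.2) (z.1 - p0) i j + c (seg z.1 z.2) (z.1 - p0) 0 j).
  apply/funext => z; rewrite /pint [LHS]mxE; congr (_ * _); rewrite /rhs addmxE; congr (_ + _).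
  by rewrite [LHS]mxE.
apply: (smooth_onM oBR); first exact: (smooth_on_snd oBR dtau_smooth).
apply: (smooth_onDr oBR); last exact: sc.
by apply: (smooth_on_sum oBR) => i; apply: (smooth_onM oBR); [exact: seg_comp (Xs i)|exact: sc].
Qed.

Lemma step_smooth X : smv X -> smv (step X).
Proof.
move=> Xs j; under eq_fun do rewrite mxE.
exact: (param_prim_smooth oB (pint_smooth j Xs)).
Qed.

Lemma seg_derive (F : 'rV[R]_N -> R) q w t : smooth_on B F -> B q ->
  is_derive q w (fun q => F (seg q t)) (tau t * 'D_w F (seg q t)).
Proof.
move=> Fs Bq; have Bs := seg_in t Bq.
apply/is_derive_approxP => eta eta0.
have /is_derive_approxP H := smooth_on_is_derive (tau t *: w) Fs Bs.
have -> : tau t * 'D_w F (seg q t) = 'D_(tau t *: w) F (seg q t).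
  rewrite (smooth_derive_sum w oB Fs Bs) (smooth_derive_sum _ oB Fs Bs) mulr_sumr.
  by apply: eq_bigr => i _; rewrite mxE mulrA.
apply: filterS (H eta eta0) => h.
have -> // : seg (q + h *: w) t = seg q t + h *: (tau t *: w).
by apply/rowP => i; rewrite !mxE; ring.
Qed.

(** Measures how far [X] is from solving the system in directions other than that of the ray. *)
Definition defect X q w : 'rV[R]_n := dmx X q w - rhs X q w.

Lemma ct_seg_derive m k (F : 'I_m -> 'I_k -> 'I_N -> 'rV[R]_N -> R) q w t :
  (forall i j k, smooth_on B (F i j k)) -> B q ->
  is_derive q w (fun q => ct F (seg q t) (q - p0)) (tau t *: dct F (seg q t) w (q - p0) + ct F (seg q t) w).
Proof.
move=> Fs Bq; apply: is_derive_mx => i j; under eq_fun do rewrite mxE.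
have -> : (fun q => \sum_l F i j l (seg q t) * (q - p0) 0 l) = \sum_l (fun q => F i j l (seg q t) * (q - p0) 0 l).
  by apply/funext => z; rewrite fct_sumE.
rewrite !mxE mulr_sumr -big_split /=; apply: is_derive_sum => l.
have D : is_derive q w (fun q => (q - p0) 0 l) (w 0 l).
  have := is_derive_entry 0 l (is_deriveB (is_derive_id q w) (is_derive_cst p0 q w)).
  by rewrite subr0.
have H := is_deriveM (seg_derive w t (Fs i j l) Bq) D.
by apply: (is_derive_eqg H); rewrite /GRing.scale /=; ring.
Qed.

Lemma pint_derive X q w t : smv X -> B q ->
  is_derive q w (fun q => pint X (q, t))
    (dtau t *: (tau t *: (dmx X (seg q t) w *m A (seg q t) (q - p0) + X (seg q t) *m dct FA (seg q t) w (q - p0)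
       + dct Fc (seg q t) w (q - p0)) + rhs X (seg q t) w)).
Proof.
move=> Xs Bq.
have DX : is_derive q w (fun q => X (seg q t)) (tau t *: dmx X (seg q t) w).
  by apply: is_derive_mx => i j; rewrite (ord1 i) !mxE; exact: seg_derive (Xs j) Bq.
have D := is_deriveZ (dtau t) (is_deriveD (is_derive_mulmx DX (ct_seg_derive w t FAs Bq)) (ct_seg_derive w t Fcs Bq)).
apply: (is_derive_eqg D); congr (_ *: _); rewrite /rhs !scalerDr -!scalemxAl mulmxDr -scalemxAr.
by rewrite -!addrA; congr (_ + (_ + _)); exact: addrCA.
Qed.

Lemma seg_smooth q : B q -> smooth_field B (seg q).
Proof.
move=> Bq; split; last by move=> t; exact: seg_in.
move=> i; under eq_fun do rewrite !mxE.
exact: smR_D (smR_cst _) (smR_M tau_smooth (smR_cst _)).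
Qed.

Lemma dx_seg q t : dx (seg q) t = dtau t *: (q - p0).
Proof.
apply: is_derive_eq_dx; apply: is_derive_mx => i j; under eq_fun do rewrite !mxE.
rewrite (ord1 i) !mxE.
have H := is_deriveD (is_derive_cst (p0 0 j) t 1) (is_deriveM (tau_derive t) (is_derive_cst (q 0 j - p0 0 j) t 1)).
by apply: (is_derive_eqg H); rewrite add0r scaler0 add0r /GRing.scale /= mulrC.
Qed.

Lemma dmxZr m k (F : 'rV[R]_N -> 'M[R]_(m, k)) q y (a : R) : (forall i j, smooth_on B (fun p => F p i j)) ->
  B q -> dmx F q (a *: y) = a *: dmx F q y.
Proof.
move=> Fs Bq; apply/matrixP => i j; rewrite !mxE (smooth_derive_sum _ oB (Fs i j) Bq).
rewrite (smooth_derive_sum y oB (Fs i j) Bq) mulr_sumr.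
by apply: eq_bigr => l _; rewrite mxE mulrA.
Qed.

Lemma dctZr m k (F : 'I_m -> 'I_k -> 'I_N -> 'rV[R]_N -> R) q y w (a : R) :
  (forall i j k, smooth_on B (F i j k)) -> B q -> dct F q (a *: y) w = a *: dct F q y w.
Proof.
move=> Fs Bq; apply/matrixP => i j; rewrite !mxE mulr_sumr; apply: eq_bigr => l _.
rewrite (smooth_derive_sum _ oB (Fs i j l) Bq) (smooth_derive_sum y oB (Fs i j l) Bq).
rewrite mulrA mulr_sumr; congr (_ * _).
by apply: eq_bigr => x _; rewrite mxE mulrA.
Qed.

(** By integrability this total derivative is the integrand of the derivative of [step] up to terms
    that contain [defect X]. *)
Lemma rhs_curve X q w (t : R) : smv X -> B q -> is_derive t 1 (fun t => tau t *: rhs X (seg q t) w)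
  (dtau t *: (tau t *: (dmx X (seg q t) (q - p0) *m A (seg q t) w + X (seg q t) *m dct FA (seg q t) (q - p0) w
       + dct Fc (seg q t) (q - p0) w) + rhs X (seg q t) w)).
Proof.
move=> Xs Bq; have sq := seg_smooth Bq.
have cw : smooth_map (fun _ : R => w) by apply: smooth_map_smm; exact: smm_cst.
have Xs' i j : smooth_on B (fun p => X p i j) by rewrite (ord1 i); exact: Xs.
have D1 := dmx_curve oB t Xs' sq; have D2 := ct_curve oB t FAs sq cw; have D3 := ct_curve oB t Fcs sq cw.
have dw : dx (fun _ : R => w) t = 0 by apply: is_derive_eq_dx; exact: is_derive_cst.
rewrite dw ct0 addr0 dx_seg in D2; rewrite dw ct0 addr0 dx_seg in D3; rewrite dx_seg in D1.
rewrite (dmxZr _ _ Xs' (seg_in t Bq)) in D1; rewrite (dctZr _ _ _ FAs (seg_in t Bq)) in D2.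
rewrite (dctZr _ _ _ Fcs (seg_in t Bq)) in D3.
have D := is_deriveD (is_derive_mulmx D1 D2) D3.
apply: is_derive_mx => i j; rewrite (ord1 i); under eq_fun do rewrite mxE.
have H := is_deriveM (tau_derive t) (is_derive_entry 0 j D).
apply: (is_derive_eqg H); rewrite /rhs -scalemxAl -scalemxAr /GRing.scale /= !mxE.
by ring.
Qed.

(** The discrepancy between the two integrands. It is linear in the defect, so it disappears for a
    solution and can be estimated along the iteration. *)
Definition kappa X q w t : 'rV[R]_n := (dtau t * tau t) *:
  (defect X (seg q t) w *m A (seg q t) (q - p0) - defect X (seg q t) (q - p0) *m A (seg q t) w).

Lemma step_derive X q w j : smv X -> B q ->
  dmx (step X) q w 0 j = rhs X q w 0 j + prim (fun t => kappa X q w t 0 j) 1.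
Proof.
move=> Xs Bq; rewrite mxE.
have ps := pint_smooth j Xs.
have -> : (fun q => step X q 0 j) = (fun q => prim (fun t => pint X (q, t) 0 j) 1).
  by apply/funext => z; rewrite mxE.
have [_ ->] := param_prim_derive oB w ps Bq.
have E t : 'D_(w, 0) (fun z => pint X z 0 j) (q, t) =
    (dtau t *: (tau t *: (dmx X (seg q t) w *m A (seg q t) (q - p0) + X (seg q t) *m dct FA (seg q t) w (q - p0)
       + dct Fc (seg q t) w (q - p0)) + rhs X (seg q t) w)) 0 j.
  have D1 := is_derive_entry 0 j (pint_derive w t Xs Bq).
  have D2 := smooth_on_is_derive (w, 0 : R) ps (conj Bq I : (B `*` [set: R]) (q, t)).
  exact (is_derive_unique (is_derive_slicel D2) D1).
pose f t := 'D_(w, 0) (fun z => pint X z 0 j) (q, t).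
pose gg t := (dtau t *: (tau t *: (dmx X (seg q t) (q - p0) *m A (seg q t) w + X (seg q t) *m dct FA (seg q t) (q - p0) w
       + dct Fc (seg q t) (q - p0) w) + rhs X (seg q t) w)) 0 j.
have fc : cont_ball (2 : R) f.
  have := UD_cont0 (UD_smooth (r := 1) 0 oBR (smooth_onD (w, 0 : R) ps) (fun x _ => conj Bq I)).
  by rewrite scale0r addr0 -[1 + 1]/(2 : R).
have K t : f t = gg t + kappa X q w t 0 j.
  rewrite /f E /gg /kappa -addmxE; rewrite /defect /rhs.
  have Bs := seg_in t Bq; have iA := intA w (q - p0) Bs; have ic := intc w (q - p0) Bs.
  have {}iA : dct FA (seg q t) w (q - p0) = dct FA (seg q t) (q - p0) w
      - A (seg q t) w *m A (seg q t) (q - p0) + A (seg q t) (q - p0) *m A (seg q t) w.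
    by apply/eqP; rewrite -subr_eq0 -iA; apply/eqP/matrixP => a b; rewrite !addoppE; ring.
  have {}ic : dct Fc (seg q t) w (q - p0) = dct Fc (seg q t) (q - p0) w
      - c (seg q t) w *m A (seg q t) (q - p0) + c (seg q t) (q - p0) *m A (seg q t) w.
    by apply/eqP; rewrite -subr_eq0 -ic; apply/eqP/matrixP => a b; rewrite !addoppE; ring.
  rewrite iA ic.
  move: (dct FA (seg q t) (q - p0) w) (dct Fc (seg q t) (q - p0) w) (A (seg q t) w) (A (seg q t) (q - p0)) (c (seg q t) w) (c (seg q t) (q - p0))
    (dmx X (seg q t) w) (dmx X (seg q t) (q - p0)) (X (seg q t)) => a1 c1 Aw Ay cw cy Dw Dy x.
  rewrite !(mulmxDl, mulmxBl, mulmxDr, mulmxBr, mulNmx, mulmxN, mulmxA, opprD).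
  by rewrite !(mxZE, addmxE, oppmxE); ring.
have kc : cont_ball (2 : R) (fun t => kappa X q w t 0 j).
  apply: smooth_on_cont_ball; under eq_fun do rewrite mxZE.
  apply: (smR_M (smR_M dtau_smooth tau_smooth)).
  have sq := seg_smooth Bq.
  have cs (v : 'rV[R]_N) : smooth_map (fun _ : R => v) by apply: smooth_map_smm; exact: smm_cst.
  have sA v : smm (fun t => A (seg q t) v) := ct_smm oB FAs sq (cs v).
  have sc v : smm (fun t => c (seg q t) v) := ct_smm oB Fcs sq (cs v).
  have sX : smm (fun t => X (seg q t)).
    by move=> a b; rewrite (ord1 a); exact: smooth_comp_curve oB (Xs b) sq.
  have sD v : smm (fun t => defect X (seg q t) v).
    apply: smmD; last exact: smmN (smmD (smm_mul sX (sA v)) (sc v)).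
    move=> a b; rewrite (ord1 a); under eq_fun do rewrite mxE.
    exact: smooth_comp_curve oB (smooth_onD v (Xs b)) sq.
  exact (smmD (smm_mul (sD w) (sA (q - p0))) (smmN (smm_mul (sD (q - p0)) (sA w))) 0 j).
have gc : cont_ball (2 : R) gg.
  have -> : gg = fun t => f t - kappa X q w t 0 j by apply/funext => t; rewrite K addrK.
  exact: cont_ballD fc (cont_ballN kc).
have l1 : `|1 : R| < 2 by rewrite normr1 ltr1n.
(* The factor [tau] vanishes at 0 and equals 1 at 1, where the segment has reached [q]. *)
have G : prim gg 1 = rhs X q w 0 j.
  have := prim_eq gc (fun t _ => is_derive_entry 0 j (rhs_curve w t Xs Bq)) l1 => ->.
  by rewrite tau0 scale0r [X in _ - X]mxE subr0 tau1 scale1r /seg tau1 scale1r addrC subrK.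
rewrite -G -[prim gg 1]mul1r -(prim_linear 1 gc kc l1); apply: (eq_prim (rho := 2) _ l1) => t _.
by rewrite mul1r -K.
Qed.

Section estimates.
Variable M : R.
Hypotheses (M0 : 0 < M) (Mrho : M * rho <= 16^-1)
  (HA : forall q (x : 'rV[R]_n) a, B q -> `|x *m A q a| <= M * `|x| * `|a|)
  (Hc : forall q a, B q -> `|c q a| <= M * `|a|).

Lemma norm_rowP (v : 'rV[R]_n) (e : R) : 0 <= e -> (forall j, `|v 0 j| <= e) -> `|v| <= e.
Proof.
move=> e0 H; rewrite norm_mxE//; apply/forallP => i; apply/forallP => j.
by rewrite (ord1 i); exact: H.
Qed.

Lemma pint_cont X q j : smv X -> B q -> cont_ball (2 : R) (fun t => pint X (q, t) 0 j).
Proof.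
move=> Xs Bq; have := UD_cont0 (UD_smooth (r := 1) 0 oBR (pint_smooth j Xs) (fun x _ => conj Bq I)).
by rewrite scale0r addr0 -[1 + 1]/(2 : R).
Qed.

Lemma prim1_bound (f : R -> R) (C : R) : cont_ball (2 : R) f -> (forall t, `|f t| <= C) -> `|prim f 1| <= C.
Proof.
move=> fc fC; have := @prim_bound R 2 f C 1 1 fc; rewrite normr1 mulr1; apply => //.
by rewrite ltr1n.
Qed.

(** [|dtau| <= 2] and [M * rho <= 16^-1] give the factor 1/8, which is weakened to the ratio 1/2
    used throughout. *)
Lemma step_contract X X' d : smv X -> smv X' -> 0 <= d -> (forall q, B q -> `|X q - X' q| <= d) ->
  forall q, B q -> `|step X q - step X' q| <= d * 2^-1.
Proof.
move=> Xs Xs' d0 H q Bq; apply: norm_rowP => [|j]; first by rewrite divr_ge0.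
have l1 : `|1 : R| < 2 by rewrite normr1 ltr1n.
have c1 : cont_ball (2 : R) (fun t => pint X (q, t) 0 j) := pint_cont Xs Bq.
have c2 : cont_ball (2 : R) (fun t => pint X' (q, t) 0 j) := pint_cont Xs' Bq.
rewrite addmxE oppmxE ![step _ _ _ _]mxE addrC -mulN1r -(prim_linear (-1) c2 c1 l1).
apply: prim1_bound => [|t].
  by apply: cont_ballD => //; apply: cont_ballM => //; exact: cont_ball_cst.
have Bs := seg_in t Bq.
have -> : -1 * pint X' (q, t) 0 j + pint X (q, t) 0 j =
    dtau t * ((X (seg q t) - X' (seg q t)) *m A (seg q t) (q - p0)) 0 j.
  by rewrite /pint /rhs !mxZE /= mulmxBl !addoppE; ring.
rewrite normrM.
have h1 := norm_entry ((X (seg q t) - X' (seg q t)) *m A (seg q t) (q - p0)) 0 j.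
have h2 := HA (X (seg q t) - X' (seg q t)) (q - p0) Bs; have h3 := H _ Bs.
have h4 : `|q - p0| <= rho by exact: ltW.
have h5 : M * `|X (seg q t) - X' (seg q t)| * `|q - p0| <= 16^-1 * d.
  apply: le_trans (_ : M * d * rho <= _); last by rewrite mulrAC ler_wpM2r.
  apply: ler_pM => //; first by rewrite mulr_ge0// ltW.
  by rewrite ler_wpM2l// ltW.
have h6 := le_trans h1 (le_trans h2 h5).
apply: le_trans (_ : 2 * (16^-1 * d) <= _); last by lra.
by apply: ler_pM => //; exact: dtau_bound.
Qed.

Definition picard k : 'rV[R]_N -> 'rV[R]_n := iter k step (fun=> 0).

Lemma picard_smooth k : smv (picard k).
Proof.
elim: k => [|k IH]; last exact: step_smooth.
by move=> j; under eq_fun do rewrite mxE; exact: smooth_cst_set oB 0.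
Qed.

(** The first iterate is at most 2 / 16 = 1/8 because only the term with [c] is present; afterwards
    the contraction halves the distance. *)
Lemma picard_dist k q : B q -> `|picard k.+1 q - picard k q| <= 8^-1 * @hpow R k.
Proof.
elim: k q => [|k IH] q Bq; last first.
  have := step_contract (picard_smooth k.+1) (picard_smooth k) _ IH Bq.
  rewrite -!/(picard _.+1) (@hpowS R k) => H; apply: le_trans (H _) _.
    by rewrite !mulr_ge0// ltW// hpow_gt0.
  by lra.
rewrite /hpow expr0 mulr1 /= subr0; apply: norm_rowP => [|j] //.
have s0 := picard_smooth 0.
have cp : cont_ball (2 : R) (fun t => pint (picard 0) (q, t) 0 j) := pint_cont s0 Bq.
rewrite mxE; apply: (prim1_bound cp) => t.
have Bs := seg_in t Bq; rewrite /pint /rhs mul0mx add0r mxZE normrM /=.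
have h1 := norm_entry (c (seg q t) (q - p0)) 0 j; have h2 := Hc (q - p0) Bs.
have h3 : M * `|q - p0| <= 16^-1 by apply: le_trans Mrho; rewrite ler_wpM2l// ltW.
apply: le_trans (_ : 2 * 16^-1 <= _); last by lra.
apply: ler_pM => //; first exact: dtau_bound.
exact: le_trans h1 (le_trans h2 h3).
Qed.

Lemma kappa_cont X q w j : smv X -> B q -> cont_ball (2 : R) (fun t => kappa X q w t 0 j).
Proof.
move=> Xs Bq.
apply: smooth_on_cont_ball; under eq_fun do rewrite mxZE.
apply: (smR_M (smR_M dtau_smooth tau_smooth)).
have sq := seg_smooth Bq.
have cs (v : 'rV[R]_N) : smooth_map (fun _ : R => v) by apply: smooth_map_smm; exact: smm_cst.
have sA v : smm (fun t => A (seg q t) v) := ct_smm oB FAs sq (cs v).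
have sc v : smm (fun t => c (seg q t) v) := ct_smm oB Fcs sq (cs v).
have sX : smm (fun t => X (seg q t)).
  by move=> a b; rewrite (ord1 a); exact: smooth_comp_curve oB (Xs b) sq.
have sD v : smm (fun t => defect X (seg q t) v).
  apply: smmD; last exact: smmN (smmD (smm_mul sX (sA v)) (sc v)).
  move=> a b; rewrite (ord1 a); under eq_fun do rewrite mxE.
  exact: smooth_comp_curve oB (smooth_onD v (Xs b)) sq.
exact (smmD (smm_mul (sD w) (sA (q - p0))) (smmN (smm_mul (sD (q - p0)) (sA w))) 0 j).
Qed.

(** Two terms in [kappa], each at most [16^-1 * e * |w|], times a weight at most 2, give 1/4 of the
    old defect. The second summand arises because the right-hand side is evaluated at [X] instead of
    [step X]. *)
Lemma step_defect X e d : smv X -> 0 <= e -> (forall q w, B q -> `|defect X q w| <= e * `|w|) ->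
  (forall q, B q -> `|step X q - X q| <= d) ->
  forall q w, B q -> `|defect (step X) q w| <= (4^-1 * e + M * d) * `|w|.
Proof.
move=> Xs e0 He Hd q w Bq.
have d0 : 0 <= d by exact: le_trans (normr_ge0 _) (Hd q Bq).
have E j : defect (step X) q w 0 j = prim (fun t => kappa X q w t 0 j) 1 - ((step X q - X q) *m A q w) 0 j.
  rewrite /defect addmxE oppmxE (step_derive w j Xs Bq) /rhs mulmxBl !addoppE.
  by move: (prim _ _) => z; ring.
apply: norm_rowP => [|j]; first by rewrite mulr_ge0// addr_ge0// mulr_ge0// ltW.
rewrite E mulrDl (le_trans (ler_normB _ _))// lerD//; last first.
  apply: le_trans (norm_entry _ _ _) _; apply: le_trans (HA _ _ Bq) _.
  by rewrite ler_wpM2r// ler_wpM2l ?Hd// ltW.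
have ck : cont_ball (2 : R) (fun t => kappa X q w t 0 j) := kappa_cont Xs Bq.
apply: (prim1_bound ck) => t; rewrite /kappa mxZE normrM.
have Bs := seg_in t Bq; have h4 : `|q - p0| <= rho by exact: ltW.
have t2 : `|dtau t * tau t| <= 2.
  by rewrite normrM -[leRHS]mulr1; apply: ler_pM => //; [exact: dtau_bound|exact: tau_bound].
have K (v1 v2 : 'rV[R]_N) C : `|v1| * `|v2| <= C ->
    `|defect X (seg q t) v1 *m A (seg q t) v2| <= M * e * C.
  move=> vC; apply: le_trans (HA _ _ Bs) _; rewrite -!mulrA ler_wpM2l//; first exact: ltW.
  apply: le_trans (_ : e * (`|v1| * `|v2|) <= _); last by rewrite ler_wpM2l.
  by rewrite mulrA ler_wpM2r// He.
have k1 := K w (q - p0) (rho * `|w|); have k2 := K (q - p0) w (rho * `|w|).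
have {}k1 := k1 _; have {}k2 := k2 _.
have wr : `|w| * `|q - p0| <= rho * `|w| by rewrite mulrC ler_wpM2r.
have rw_ : `|q - p0| * `|w| <= rho * `|w| by rewrite ler_wpM2r.
have h1 := norm_entry (defect X (seg q t) w *m A (seg q t) (q - p0) - defect X (seg q t) (q - p0) *m A (seg q t) w) 0 j.
have h2 := le_trans h1 (le_trans (ler_normB _ _) (lerD (k1 wr) (k2 rw_))).
have h3 : M * e * (rho * `|w|) <= 16^-1 * (e * `|w|).
  by rewrite (_ : M * e * (rho * `|w|) = M * rho * (e * `|w|)) ?ler_wpM2r ?mulr_ge0//; ring.
apply: le_trans (_ : 2 * (2 * (16^-1 * (e * `|w|))) <= _).
  by apply: ler_pM => //; apply: le_trans h2 _; lra.
by lra.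
Qed.

(** With the distance [8^-1 * hpow k] the recursion has factor 1/4 + 1/8, which is below 1/2. At the
    start the defect is the term with [c] alone. *)
Lemma picard_defect k q w : B q -> `|defect (picard k) q w| <= M * @hpow R k * `|w|.
Proof.
elim: k q w => [|k IH] q w Bq.
  rewrite /hpow expr0 mulr1; apply: le_trans (Hc w Bq); rewrite /defect /rhs mul0mx add0r.
  have -> : dmx (picard 0) q w = 0.
    apply/rowP => j; rewrite [LHS]mxE [RHS]mxE.
    have [_ ->] : is_derive q w (fun q => picard 0 q 0 j) 0; last by [].
    by under eq_fun do rewrite mxE; exact: is_derive_cst.
  by rewrite sub0r normrN.
have hk := @hpow_gt0 R k.
have := step_defect (picard_smooth k) _ IH (fun q Bq => picard_dist k Bq) w Bq.
rewrite -/(picard k.+1) => H; apply: le_trans (H _) _.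
  by rewrite mulr_ge0// ltW.
rewrite ler_wpM2r// (@hpowS R k); have := mulr_gt0 M0 (@hpow_gt0 R k.+1); rewrite (mulrCA M 2).
by move: (@hpow R k.+1) => z; nra.
Qed.

Lemma picard_limit : exists X : 'rV[R]_N -> 'rV[R]_n, forall q, B q -> forall k,
  `|picard k q - X q| <= 4^-1 * hpow k.
Proof.
have H q j : exists l, B q -> forall k, `|picard k q 0 j - l| <= 4^-1 * hpow k.
  have [Bq|nB] := pselect (B q); last by exists 0.
  have [k|l Hl] := @geometric_limit R (fun k => picard k q 0 j) 8^-1.
    apply: le_trans (picard_dist k Bq); apply: le_trans (norm_entry _ 0 j).
    by rewrite addmxE oppmxE.
  exists l => _ k; apply: le_trans (Hl k) _.
  by rewrite (_ : 2 * 8^-1 = 4^-1) //; lra.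
have [f Hf] := choice (fun z : ('rV[R]_N * 'I_n)%type => H z.1 z.2).
exists (fun q => \row_j f (q, j)) => q Bq k; apply: norm_rowP => [|j].
  by rewrite mulr_ge0// ltW// hpow_gt0.
by rewrite addmxE oppmxE [(\row_ _ _) _ _]mxE; exact: (Hf (q, j) Bq k).
Qed.

Variable X : 'rV[R]_N -> 'rV[R]_n.
Hypothesis XE : forall q, B q -> forall k, `|picard k q - X q| <= 4^-1 * hpow k.

Lemma limit_continuous q j : B q -> {for q, continuous (fun q => X q 0 j)}.
Proof.
move=> Bq; apply: (uniform_limit_continuous (f := fun k q => picard k q 0 j) (C := 4^-1) oB _ _ Bq) => k.
  by move=> q' Bq'; have := le_trans (norm_entry _ 0 j) (XE Bq' k); rewrite addmxE oppmxE.
exact: smooth_on_continuous (picard_smooth k j) Bq.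
Qed.

Lemma limit_rhs_continuous q w j : B q -> {for q, continuous (fun q => rhs X q w 0 j)}.
Proof.
move=> Bq; have ctc m (F : 'I_m -> 'I_n -> 'I_N -> 'rV[R]_N -> R) i : (forall i j k, smooth_on B (F i j k)) ->
    {for q, continuous (fun q => ct F q w i j)}.
  move=> Fs; apply: (smooth_on_continuous _ Bq); under eq_fun do rewrite mxE.
  by apply: (smooth_on_sum oB) => k; apply: (smooth_onM oB (Fs i j k)); exact: smooth_cst_set oB _.
have -> : (fun q => rhs X q w 0 j) = (fun q => \sum_i X q 0 i * A q w i j + c q w 0 j).
  by apply/funext => z; rewrite /rhs addmxE [X in X + _ = _]mxE.
apply: (@continuousD R R^o); last exact: ctc.
have -> : (fun q => \sum_i X q 0 i * A q w i j) = \sum_i (fun q => X q 0 i * A q w i j).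
  by apply/funext => z; rewrite fct_sumE.
elim/big_ind : _ => [|f1 f2 c1 c2|i _]; first exact: cst_continuous.
  exact: (@continuousD R R^o).
by apply: (@continuousM R); [exact: limit_continuous|exact: ctc].
Qed.

(** The mean value estimate holds for each iterate with an error that is geometric in k, since the
    derivatives of the iterates approach [rhs X] by [picard_defect]. Letting k tend to infinity
    leaves the continuity error of [rhs X]. *)
Lemma limit_derive q w j : B q -> is_derive q w (fun q => X q 0 j) (rhs X q w 0 j).
Proof.
move=> Bq; apply/is_derive_approxP => eta eta0.
have e2 : 0 < eta / 2 by rewrite divr_gt0.
have C := cont_near (limit_rhs_continuous (w := w) (j := j) Bq) e2.
have [e e0 He] := near_line w (filterI C (open_nbhs_nbhs (conj oB Bq))).
apply: filterS (@near0_norm_lt R R _ e0) => h hr.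
(* The two summands bound the effect of replacing the iterate by its limit and the defect of the
   iterate; the factor 2 and the 1 are slack. *)
pose K := (M * `|w| * 4^-1 + M * `|w|) * 2 + 1.
have K0 : 0 <= K by rewrite /K addr_ge0// mulr_ge0// addr_ge0// !mulr_ge0// ltW.
have near_ t : `|t| <= `|h| -> `|t| < e by move=> /le_lt_trans; apply.
have Bt t : `|t| <= `|h| -> B (q + t *: w) by move=> /near_/He[].
have Ct t : `|t| <= `|h| -> `|rhs X q w 0 j - rhs X (q + t *: w) w 0 j| <= eta / 2 by move=> /near_/He[].
have dk k : `|picard k (q + h *: w) 0 j - picard k q 0 j - h * rhs X q w 0 j| <= (eta / 2 + K * hpow k) * `|h|.
  have := @mvt_approx R (fun t => picard k (q + t *: w) 0 j) (fun t => dmx (picard k) (q + t *: w) w 0 j)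
    (rhs X q w 0 j) (eta / 2 + K * hpow k) `|h|.
  rewrite scale0r addr0; apply => //.
    move=> t th; rewrite mxE.
    exact ((is_derive_line (fun q => picard k q 0 j) q w t _).1 (smooth_on_is_derive w (picard_smooth k j) (Bt t th))).
  move=> t th; have Bs := Bt t th.
  have E : dmx (picard k) (q + t *: w) w 0 j - rhs X q w 0 j = defect (picard k) (q + t *: w) w 0 j
     + ((picard k (q + t *: w) - X (q + t *: w)) *m A (q + t *: w) w) 0 j
     - (rhs X q w 0 j - rhs X (q + t *: w) w 0 j).
    rewrite /defect mulmxBl /rhs !addoppE; ring.
  rewrite E; apply: le_trans (ler_normB _ _) _; rewrite addrC lerD ?Ct//.
  apply: le_trans (ler_normD _ _) _.
  have h1 := le_trans (norm_entry _ 0 j) (picard_defect k w Bs).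
  have h2 := le_trans (norm_entry _ 0 j) (HA (picard k (q + t *: w) - X (q + t *: w)) w Bs).
  have h3 : M * `|picard k (q + t *: w) - X (q + t *: w)| * `|w| <= M * (4^-1 * hpow k) * `|w|.
    by rewrite ler_wpM2r// ler_wpM2l ?XE// ltW.
  apply: le_trans (lerD h1 (le_trans h2 h3)) _; rewrite /K.
  have := @hpow_gt0 R k; have : 0 <= M * `|w| by rewrite mulr_ge0// ltW.
  by move: (hpow k) => z; rewrite [M * z * _]mulrAC [M * (_ * z) * _]mulrAC; move: (M * `|w|) => y; nra.
have hN : 0 <= K * `|h| + 2^-1 by rewrite addr_ge0// mulr_ge0.
have lim : `|X (q + h *: w) 0 j - X q 0 j - h * rhs X q w 0 j| <= (eta / 2) * `|h|.
  apply: (le_hpow_limit hN) => k.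
  have a1 := le_trans (norm_entry _ 0 j) (XE (Bt h (lexx _)) k).
  have a2 := le_trans (norm_entry _ 0 j) (XE Bq k); have a3 := dk k.
  rewrite addmxE oppmxE in a1; rewrite addmxE oppmxE in a2.
  have -> : X (q + h *: w) 0 j - X q 0 j - h * rhs X q w 0 j =
     (picard k (q + h *: w) 0 j - picard k q 0 j - h * rhs X q w 0 j)
     - (picard k (q + h *: w) 0 j - X (q + h *: w) 0 j) + (picard k q 0 j - X q 0 j) by ring.
  apply: le_trans (ler_normD _ _) _; apply: le_trans (lerD (ler_normB _ _) (lexx _)) _.
  move: a1 a2 a3; move: (hpow k) `|h| `|_| `|_| `|_| => z hh n1 n2 n3; lra.
by apply: le_trans lim _; rewrite ler_wpM2r//; lra.
Qed.

(** Affine expressions in [X] with smooth coefficients are closed under differentiation because [X]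
    solves the system; coinduction bootstraps continuity to smoothness. *)
Lemma limit_smooth : smv X.
Proof.
move=> j0.
pose C (f : 'rV[R]_N -> R) := exists (al : 'I_n -> 'rV[R]_N -> R) (be : 'rV[R]_N -> R),
  [/\ forall i, smooth_on B (al i), smooth_on B be & f = fun q => \sum_i al i q * X q 0 i + be q].
refine (@smooth_coind R _ B C oB _ _ _ _); last first.
- exists (fun i _ => (i == j0)%:R), (fun=> 0); split.
  + by move=> i; exact: smooth_cst_set oB _.
  + exact: smooth_cst_set oB 0.
  + apply/funext => q; rewrite addr0 (bigD1 j0)//= eqxx mul1r big1 ?addr0// => i /negbTE ->.
    by rewrite mul0r.
- move=> _ v [al [be [als bes ->]]].
  have As i j : smooth_on B (fun q => A q v i j).
    under eq_fun do rewrite mxE.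
    by apply: (smooth_on_sum oB) => k; apply: (smooth_onM oB (FAs i j k)); exact: smooth_cst_set oB _.
  have cs j : smooth_on B (fun q => c q v 0 j).
    under eq_fun do rewrite mxE.
    by apply: (smooth_on_sum oB) => k; apply: (smooth_onM oB (Fcs 0 j k)); exact: smooth_cst_set oB _.
  pose al' i q := 'D_v (al i) q + \sum_j al j q * A q v i j.
  pose be' q := 'D_v be q + \sum_j al j q * c q v 0 j.
  exists (fun q => \sum_i al' i q * X q 0 i + be' q).
    exists al', be'; split.
    + move=> i; apply: (smooth_onDr oB); first exact: smooth_onD.
      by apply: (smooth_on_sum oB) => j; exact: (smooth_onM oB (als j) (As i j)).
    + apply: (smooth_onDr oB); first exact: smooth_onD.
      by apply: (smooth_on_sum oB) => j; exact: (smooth_onM oB (als j) (cs j)).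
    + reflexivity.
  move=> q Bq.
  have H : is_derive q v (\sum_i (fun q => al i q * X q 0 i) + be)
      (\sum_i (al i q *: rhs X q v 0 i + X q 0 i *: 'D_v (al i) q) + 'D_v be q).
    apply: is_deriveD; last exact: smooth_on_is_derive bes Bq.
    apply: is_derive_sum => i; apply: is_deriveM; last exact: limit_derive.
    exact: smooth_on_is_derive (als i) Bq.
  have -> : (fun q => \sum_i al i q * X q 0 i + be q) = \sum_i (fun q => al i q * X q 0 i) + be.
    by apply/funext => z; rewrite fctE fct_sumE.
  apply: (is_derive_eqg H); rewrite /al' /be' addrCA addrC; congr (_ + _).
  have RE : \sum_i ('D_v (al i) q + \sum_j al j q * A q v i j) * X q 0 i =
      \sum_i ('D_v (al i) q * X q 0 i + \sum_j al j q * A q v i j * X q 0 i).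
    by apply: eq_bigr => i _; rewrite mulrDl mulr_suml.
  rewrite RE /GRing.scale /=.
  rewrite [in RHS]big_split /= -addrA [X in _ = _ + (X + _)]exchange_big /= -!big_split /=.
  apply: eq_bigr => j _; rewrite /rhs addmxE [X in al j q * (X + _)]mxE mulrDr mulr_sumr.
  rewrite [X q 0 j * _]mulrC [LHS]addrC; congr (_ + (_ + _)).
  by apply: eq_bigr => i _; ring.
- move=> _ [al [be [als bes ->]]] q Bq.
  apply: (@continuousD R R^o); last exact: smooth_on_continuous bes Bq.
  have -> : (fun q => \sum_i al i q * X q 0 i) = \sum_i (fun q => al i q * X q 0 i).
    by apply/funext => z; rewrite fct_sumE.
  elim/big_ind : _ => [|f1 f2 c1 c2|i _]; first exact: cst_continuous.
    exact: (@continuousD R R^o).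
  by apply: (@continuousM R); [exact: smooth_on_continuous (als i) Bq|exact: limit_continuous].
Qed.

End estimates.
End ball.

Lemma ct_bound m (F : 'I_m -> 'I_n -> 'I_N -> 'rV[R]_N -> R) (U : set 'rV[R]_N) p : open U -> U p ->
  (forall i j k, smooth_on U (F i j k)) -> exists M e : R, [/\ 0 < M, 0 < e &
    forall q, `|q - p| < e -> forall (x : 'rV[R]_m) a, `|x *m ct F q a| <= M * `|x| * `|a|].
Proof.
move=> oU Up Fs.
pose K := \sum_(z : 'I_m * 'I_n * 'I_N) (`|F z.1.1 z.1.2 z.2 p| + 1).
have K0 : 0 <= K by apply: sumr_ge0 => z _; rewrite addr_ge0.
pose Q (z : 'I_m * 'I_n * 'I_N) q := `|F z.1.1 z.1.2 z.2 q| <= K.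
have [|e e0 H] := @near_forall_ball R _ ('I_m * 'I_n * 'I_N)%type Q p.
  move=> z.
  apply: filterS (cont_near (smooth_on_continuous (Fs z.1.1 z.1.2 z.2) Up) ltr01) => q hq.
  rewrite /Q /K (bigD1 z)//= -[F _ _ _ q](subKr (F z.1.1 z.1.2 z.2 p)).
  apply: le_trans (ler_normB _ _) _; apply: le_trans (lerD (lexx _) hq) _.
  by rewrite lerDl; apply: sumr_ge0 => z' _; rewrite addr_ge0.
exists (K * (m * N)%:R + 1), e; split => //; first by rewrite ltr_wpDl// mulr_ge0.
move=> q /H Hq x a; rewrite norm_mxE; last first.
  by rewrite !mulr_ge0// addr_ge0// mulr_ge0.
apply/forallP => i0; apply/forallP => j; rewrite (ord1 i0) mxE.
apply: le_trans (ler_norm_sum _ _ _) _.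
apply: le_trans (_ : \sum_(i < m) (`|x| * (K * `|a| *+ N)) <= _).
  apply: ler_sum => i _; rewrite normrM; apply: ler_pM => //; first exact: norm_entry.
  rewrite mxE; apply: le_trans (ler_norm_sum _ _ _) _.
  apply: le_trans (_ : \sum_(k < N) (K * `|a|) <= _); last by rewrite sumr_const card_ord.
  apply: ler_sum => k _; rewrite normrM; apply: ler_pM => //; last exact: norm_entry.
  exact: (Hq (i, j, k)).
rewrite sumr_const card_ord -[_ *+ N]mulr_natr -[_ *+ m]mulr_natr natrM.
have xa : 0 <= `|x| * `|a| by rewrite mulr_ge0.
rewrite -subr_ge0; apply: le_trans xa _; rewrite le_eqVlt; apply/orP; left; apply/eqP.
by ring.
Qed.

Lemma frobenius (U : set 'rV[R]_N) p : open U -> U p ->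
  (forall i j k, smooth_on U (FA i j k)) -> (forall i j k, smooth_on U (Fc i j k)) ->
  (forall q w y, U q -> dct FA q w y - dct FA q y w + A q w *m A q y - A q y *m A q w = 0) ->
  (forall q w y, U q -> dct Fc q w y - dct Fc q y w + c q w *m A q y - c q y *m A q w = 0) ->
  exists V : set 'rV[R]_N, [/\ open V, V p, V `<=` U & exists X : 'rV[R]_N -> 'rV[R]_n,
    (forall j, smooth_on V (fun q => X q 0 j)) /\
    forall q w j, V q -> is_derive q w (fun q => X q 0 j) ((X q *m A q w + c q w) 0 j)].
Proof.
move=> oU Up FAs Fcs iA ic.
have [M1 [e1 [M10 e10 H1]]] := ct_bound oU Up FAs; have [M2 [e2 [M20 e20 H2]]] := ct_bound oU Up Fcs.
have [e3 e30 H3] := near_norm_ball (open_nbhs_nbhs (conj oU Up)).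
pose M := M1 + M2; have M0 : 0 < M by rewrite addr_gt0.
have [e e0 He] : exists2 e : R, 0 < e & forall q, `|q - p| < e ->
    [/\ U q, forall (x : 'rV[R]_n) a, `|x *m A q a| <= M1 * `|x| * `|a| &
      forall (x : 'rV[R]_1) a, `|x *m c q a| <= M2 * `|x| * `|a|].
  exists (Num.min e1 (Num.min e2 e3)) => [|q]; first by rewrite !lt_min e10 e20.
  by rewrite !lt_min => /and3P[q1 q2 q3]; split; [exact: H3|exact: H1|exact: H2].
(* The ball is shrunk until [M * rho <= 16^-1], the smallness required by the contraction. *)
pose rho := Num.min e (16^-1 / M).
have rho0 : 0 < rho by rewrite lt_min e0 divr_gt0.
have BU q : `|q - p| < rho -> `|q - p| < e by rewrite lt_min => /andP[].
pose B : set 'rV[R]_N := [set q | `|q - p| < rho].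
have BsubU : B `<=` U by move=> q /BU/He[].
have MR : M * rho <= 16^-1.
  by rewrite mulrC -ler_pdivlMr// ge_min lexx orbT.
have HA q (x : 'rV[R]_n) a : B q -> `|x *m A q a| <= M * `|x| * `|a|.
  by move=> /BU/He[_ h _]; apply: le_trans (h x a) _; rewrite !ler_wpM2r// lerDl ltW.
have Hc q a : B q -> `|c q a| <= M * `|a|.
  move=> /BU/He[_ _ h]; have := h 1%:M a; rewrite mul1mx => /le_trans; apply.
  rewrite ler_wpM2r// -[leRHS]mulr1; apply: ler_pM; [exact: ltW|exact: normr_ge0|by rewrite lerDr ltW|].
  rewrite norm_mxE//; apply/forallP => i; apply/forallP => j.
  by rewrite (ord1 i) (ord1 j) mxE eqxx normr1.
have FAs' i j k := smooth_on_sub BsubU (FAs i j k); have Fcs' i j k := smooth_on_sub BsubU (Fcs i j k).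
have iA' q w y (Bq : B q) := iA q w y (BsubU q Bq); have ic' q w y (Bq : B q) := ic q w y (BsubU q Bq).
have [X XE] := picard_limit FAs' Fcs' M0 MR HA Hc.
exists B; split.
- exact: ball_norm_open.
- by rewrite /B /= subrr normr0.
- exact: BsubU.
exists X; split.
  exact: (limit_smooth FAs' Fcs' iA' ic' M0 MR HA Hc XE).
by move=> q w j Bq; exact: (limit_derive FAs' Fcs' iA' ic' M0 MR HA Hc XE w j Bq).
Qed.

End frobenius.

Local Transparent prim.

(** * Closed forms and Hessian potentials *)

Section poincare.
Context {R : realType} {N : nat}.

(** The linear system with one unknown and A = 0: its integrability condition is closedness. *)
Lemma poincare (U : set 'rV[R]_N) (th : 'I_N -> 'rV[R]_N -> R) p : open U -> U p ->
  (forall i, smooth_on U (th i)) ->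
  (forall q (a v : 'rV[R]_N), U q -> \sum_k 'D_a (th k) q * v 0 k = \sum_k 'D_v (th k) q * a 0 k) ->
  exists V : set 'rV[R]_N, [/\ open V, V p, V `<=` U & exists F : 'rV[R]_N -> R,
    smooth_on V F /\ forall q i, V q -> pd i F q = th i q].
Proof.
move=> oU Up ths cl.
pose FA (i j : 'I_1) (k : 'I_N) (q : 'rV[R]_N) : R := 0.
pose Fc (i j : 'I_1) (k : 'I_N) (q : 'rV[R]_N) : R := th k q.
have A0 q a : ct FA q a = 0.
  by apply/matrixP => i j; rewrite !mxE big1// => k _; rewrite mul0r.
have dA0 q a v : dct FA q a v = 0.
  by apply/matrixP => i j; rewrite !mxE big1// => k _; rewrite derive_cst mul0r.
have [||q w y Uq|q w y Uq|V [oV Vp VU [X [Xs Xd]]]] := @frobenius R N 1 FA Fc U p oU Up.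
- by move=> i j k; exact: smooth_cst_set oU 0.
- by move=> i j k; exact: ths.
- by rewrite !dA0 !A0 mul0mx !subr0 addr0.
- rewrite !A0 !mulmx0 subr0 addr0; apply/matrixP => i j.
  by rewrite !addoppE [in LHS]mxE [X in _ - X]mxE mxE; apply/eqP; rewrite subr_eq0; apply/eqP; exact: cl.
exists V; split=> //; exists (fun q => X q 0 0); split; first exact: Xs.
move=> q i Vq; have [_] := Xd q (delta_mx 0 i) 0 Vq; rewrite /pd => ->.
rewrite A0 mulmx0 add0r mxE (bigD1 i)//= mxE !eqxx mulr1 big1 ?addr0// => k /negbTE ki.
by rewrite mxE ki andbF mulr0.
Qed.

Lemma common_ball (T : finType) (V : T -> set 'rV[R]_N) p : (forall m, open (V m)) -> (forall m, V m p) ->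
  exists W : set 'rV[R]_N, [/\ open W, W p & forall m, W `<=` V m].
Proof.
move=> oV Vp; have [|e e0 He] := @near_forall_ball R _ T (fun m q => V m q) p.
  by move=> m; exact: (open_nbhs_nbhs (conj (oV m) (Vp m))).
exists [set q | `|q - p| < e]; split.
- exact: ball_norm_open.
- by rewrite /= subrr normr0.
- by move=> m q /He.
Qed.

End poincare.

Section potentials_exist.
Context {R : realType} {N : nat} (U : set 'rV[R]_N) (oU : open U).
Variables (g H : 'rV[R]_N -> 'M[R]_N).
Hypotheses (gf : flat_metric U g) (HU : forall i j, smooth_on U (fun p => H p i j))
  (Hs : forall p, U p -> (H p)^T = H p)
  (cod : forall p a v, U p ->
    v *m (dmx H p a - H p *m (gam (christoffel g) p a)^T) = a *m (dmx H p v - H p *m (gam (christoffel g) p v)^T)).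
Let FC := flat_connection_christoffel oU gf.

(** A covector field X with covariant derivative [H] is found first; flatness and Codazzi make that
    system integrable. As [H] is symmetric and the connection torsion free, X is closed, hence a
    gradient. *)
Lemma hessian_potential p : U p -> exists V : set 'rV[R]_N, [/\ open V, V p, V `<=` U &
  exists Phi : 'rV[R]_N -> R, smooth_on V Phi /\ forall q i j, V q -> hess g Phi i j q = H q i j].
Proof.
move=> Up.
pose FA (i j k : 'I_N) := christoffel g i j k.
pose Fc (i : 'I_1) (j k : 'I_N) (q : 'rV[R]_N) : R := H q k j.
have AE q a : ct FA q a = (gam (christoffel g) q a)^T by apply/matrixP => i j; rewrite !mxE.
have dAE q a v : dct FA q a v = (dgam (christoffel g) q a v)^T by apply/matrixP => i j; rewrite !mxE.
have cE q a : ct Fc q a = a *m H q.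
  by apply/matrixP => i j; rewrite (ord1 i) !mxE; apply: eq_bigr => k _; rewrite mulrC.
have dcE q a v : dct Fc q a v = v *m dmx H q a.
  by apply/matrixP => i j; rewrite (ord1 i) !mxE; apply: eq_bigr => k _; rewrite mxE mulrC.
have [||q w y Uq|q w y Uq|V [oV Vp VU [X [Xs Xd]]]] := @frobenius R N N FA Fc U p oU Up.
- by move=> i j k; exact: (christoffel_smooth oU gf i j k).
- by move=> i j k; exact: HU.
- rewrite !AE !dAE; have := congr1 trmx (fc_flat FC y w Uq).
  by rewrite !(trDE, trNE, trmx_mul) trmx0.
- rewrite !AE !cE !dcE; have := cod w y Uq; rewrite !mulmxBr !mulmxA => E.
  have {}E : y *m dmx H q w = w *m dmx H q y - w *m H q *m (gam (christoffel g) q y)^T + y *m H q *m (gam (christoffel g) q w)^T.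
    by apply/eqP; rewrite -subr_eq; apply/eqP.
  by rewrite E; apply/rowP => j; rewrite [RHS]mxE !addoppE; ring.
have [||W [oW Wp WV [Phi [Ps Pd]]]] := @poincare R N V (fun i q => X q 0 i) p oV Vp.
- exact: Xs.
- move=> q a v Vq.
  have E (x z : 'rV[R]_N) : \sum_k 'D_x (fun q => X q 0 k) q * z 0 k = ((X q *m (gam (christoffel g) q x)^T + x *m H q) *m z^T) 0 0.
    rewrite mxE; apply: eq_bigr => k _; have [_ ->] := Xd q x k Vq.
    by rewrite AE cE [z^T _ _]mxE.
  rewrite (E a v) (E v a); apply: eq00; rewrite -[LHS]trmxK -[RHS]trmxK; congr (_^T).
  rewrite !trmx_mul !trmxK !trDE !trmx_mul !trmxK (Hs (VU _ Vq)) !mulmxDr !mulmxA (gam_sym FC v a (VU _ Vq)).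
  congr (_ + _); apply/matrixP => i j; rewrite (ord1 i) (ord1 j) [LHS]sc_tr.
  by rewrite !trmx_mul trmxK (Hs (VU _ Vq)) mulmxA.
exists W; split=> //; first by move=> q /WV/VU.
exists Phi; split=> // q i j Wq; have Vq := WV _ Wq; rewrite /hess.
have -> : pd i (pd j Phi) q = 'D_(delta_mx 0 i) (fun q => X q 0 j) q.
  by apply: (eq_on_derive _ oW) => // z; rewrite inE => Wz; exact: Pd.
have [_ ->] := Xd q (delta_mx 0 i) j Vq.
rewrite AE cE addmxE -rowE [X in _ + X - _]mxE mxE addrAC.
have -> : \sum_k christoffel g k i j q * pd k Phi q = \sum_k X q 0 k * (gam (christoffel g) q (delta_mx 0 i))^T k j.
  apply: eq_bigr => k _; rewrite (Pd q k Wq) mxE mxE (bigD1 i)//= mxE !eqxx mulr1 big1 ?addr0.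
    by rewrite mulrC (christoffel_sym oU gf k i j (VU _ Vq)).
  by move=> l /negbTE li; rewrite mxE li andbF mulr0.
by rewrite subrr add0r.
Qed.

End potentials_exist.

Section conditions_potential.
Context {R : realType} {N L : nat} (U : set 'rV[R]_N) (oU : open U).
Variables (g : 'rV[R]_N -> 'M[R]_N) (mu : 'M[R]_L) (w : 'I_L -> 'rV[R]_N -> 'M[R]_N).
Hypotheses (gf : flat_metric U g) (ws : forall m i j, smooth_on U (fun p => w m p i j)).
Let FC := flat_connection_christoffel oU gf.

Lemma conditions_locally_potential : ferapontov_conditions U g (christoffel g) mu w ->
  locally_potential U g mu w.
Proof.
move=> [c2 c3 c4 c5] p Up.
have gu q : U q -> g q \in unitmx by case: gf => _ _ + _; exact.
(* Lowering the index: by self-adjointness this matrix is symmetric, and it inherits the Codazzi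
   equations. *)
pose H m q := invmx (g q) *m w m q.
have HU m i j : smooth_on U (fun q => H m q i j).
  under eq_fun do rewrite mxE.
  apply: (smooth_on_sum oU) => k; exact: (smooth_onM oU (invmx_smooth oU gf i k) (ws m k j)).
have Hs m q : U q -> (H m q)^T = H m q.
  move=> Uq; rewrite /H trmx_mul trmx_inv (fc_sym FC Uq).
  apply: (can_inj (mulKmx (gu q Uq))); rewrite mulKVmx ?gu// mulmxA (c2 q m Uq) mulmxK ?gu//.
have wE m q : U q -> w m q = g q *m H m q by move=> Uq; rewrite /H mulKVmx ?gu.
have cod m q a v : U q ->
    v *m (dmx (H m) q a - H m q *m (gam (christoffel g) q a)^T) = a *m (dmx (H m) q v - H m q *m (gam (christoffel g) q v)^T).
  move=> Uq; apply: (can_inj (mulmxK (gu q Uq))).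
  rewrite -(codazzi_factor oU gf (HU m) (Hs m) (wE m) _ _ Uq) -(codazzi_factor oU gf (HU m) (Hs m) (wE m) _ _ Uq).
  exact: (dmx_codazzi c3 m a v Uq).
have K m := hessian_potential oU gf (HU m) (Hs m) (cod m) Up.
have [V HV] := choice K.
have [W [oW Wp WV]] := common_ball (fun m => let: And4 o _ _ _ := HV m in o) (fun m => let: And4 _ o _ _ := HV m in o).
have KP m : exists Phi : 'rV[R]_N -> R, smooth_on (V m) Phi /\ forall q i j, V m q -> hess g Phi i j q = H m q i j.
  by case: (HV m).
have [Phi HPhi] := choice KP.
exists (W `&` U); have WU : W `&` U `<=` U by move=> q [].
split=> //; first exact: openI.
exists Phi.
have oWU : open (W `&` U) by exact: openI.
apply: (potentials_of_conditions oWU (flat_metric_sub WU gf)).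
- move=> n; apply: (smooth_on_sub _ (HPhi n).1) => q [Wq _]; exact: WV.
- move=> n q [Wq Uq]; rewrite (wE n q Uq) hess_upE; congr (_ *m _); apply/matrixP => i j.
  by rewrite [RHS]mxE ((HPhi n).2 q i j (WV n q Wq)).
- by move=> q m n [_ Uq]; exact: c5.
- by move=> q a v [_ Uq]; exact: c4.
Qed.

(** The conditions are pointwise or involve first derivatives at one point, so they may be checked
    on a neighbourhood of each point. *)
Lemma locally_potential_conditions : locally_potential U g mu w ->
  ferapontov_conditions U g (christoffel g) mu w.
Proof.
move=> H.
have K p : U p -> exists V : set 'rV[R]_N, V p /\ ferapontov_conditions V g (christoffel g) mu w.
  move=> Up; have [V [oV Vp VU [Phi pot]]] := H p Up; exists V; split=> //.
  have [h1 h2 _ _] := pot.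
  exact: (conditions_of_potentials oV (flat_metric_sub VU gf) h1 h2 pot).
split.
- by move=> p m /K[V [Vp [c2 _ _ _]]]; exact: c2.
- by move=> p a v /K[V [Vp [_ c3 _ _]]]; exact: c3.
- by move=> p a v /K[V [Vp [_ _ c4 _]]]; exact: c4.
- by move=> p m n /K[V [Vp [_ _ _ c5]]]; exact: c5.
Qed.

End conditions_potential.

(** Closedness of the forms (grad Phi_n) W_m, reduced to matrices: the part with the Hessian is
    symmetric by the commutation relation, the part with the gradient by Codazzi. *)
Lemma closed_form_algebra {R : realType} {N : nat} (a v phi : 'rV[R]_N) (H W ga gv da dv : 'M[R]_N) :
  (H *m W)^T = H *m W -> v *m da^T + v *m W^T *m ga = a *m dv^T + a *m W^T *m gv ->
  (a *m H *m W + phi *m (ga^T *m W + da)) *m v^T = (v *m H *m W + phi *m (gv^T *m W + dv)) *m a^T.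
Proof.
move=> HW cd; rewrite !mulmxDl; congr (_ + _).
  apply/matrixP => i j; rewrite (ord1 i) (ord1 j) [LHS]sc_tr trmx_mul trmxK -!mulmxA trmx_mul HW.
  by rewrite !mulmxA.
rewrite -!mulmxA; congr (_ *m _); apply: trmx_inj.
by rewrite !trmx_mul !trmxK !trDE !trmx_mul !trmxK !mulmxDr !mulmxA addrC cd addrC.
Qed.

(** * The two Hamiltonian representations of the flows *)

Section systems.
Context {R : realType} {N L : nat} (U : set 'rV[R]_N) (oU : open U).
Variables (g : 'rV[R]_N -> 'M[R]_N) (mu : 'M[R]_L) (Phi : 'I_L -> 'rV[R]_N -> R).
Hypotheses (gf : flat_metric U g) (pot : potentials U g mu (fun n => hess_up g (Phi n)) Phi).
Let FC := flat_connection_christoffel oU gf.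
Let PhiU n : smooth_on U (Phi n). Proof. by case: pot. Qed.

Lemma derive_grad n q a : U q -> dmx (grad (Phi n)) q a =
  a *m hessm g (Phi n) q + grad (Phi n) q *m (gam (christoffel g) q a)^T.
Proof.
move=> Uq; apply/rowP => j; rewrite addmxE !mxE.
have pU : smooth_on U (pd j (Phi n)) by exact: smooth_onD.
have -> : (fun q => grad (Phi n) q 0 j) = pd j (Phi n) by apply/funext => z; rewrite mxE.
rewrite (smooth_derive_sum a oU pU Uq).
have -> : \sum_k grad (Phi n) q 0 k * (gam (christoffel g) q a)^T k j =
    \sum_i a 0 i * \sum_k christoffel g k i j q * pd k (Phi n) q.
  under eq_bigr do rewrite !mxE mulr_sumr.
  rewrite exchange_big; apply: eq_bigr => i _ /=; rewrite mulr_sumr; apply: eq_bigr => k _.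
  by rewrite (christoffel_sym oU gf k i j Uq); ring.
rewrite -big_split; apply: eq_bigr => i _ /=.
by rewrite mxE /hess; ring.
Qed.

(** The Hamiltonian density is Phi_n. The functions Q_m must exist although their coefficient is 0;
    they are primitives of closed forms. *)
Lemma hamiltonian_system_local n : hamiltonian_system U g mu Phi 1 0 (hess_up g (Phi n)).
Proof.
move=> p Up.
have CD := conditions_of_potentials oU gf PhiU (fun n u _ => erefl) pot.
have ws m i j := hess_up_smooth oU gf PhiU m i j.
pose th m s q := \sum_j hess_up g (Phi m) q j s * pd j (Phi n) q.
have ths m s : smooth_on U (th m s).
  apply: (smooth_on_sum oU) => j; apply: (smooth_onM oU (ws m j s)); exact: smooth_onD.
have cl m q (a v : 'rV[R]_N) : U q -> \sum_k 'D_a (th m k) q * v 0 k = \sum_k 'D_v (th m k) q * a 0 k.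
  move=> Uq.
  pose W := hess_up g (Phi m).
  have gd x : is_derive q x (grad (Phi n)) (dmx (grad (Phi n)) q x).
    apply: is_derive_mx => i j; rewrite (ord1 i) mxE.
    have -> : (fun q => grad (Phi n) q 0 j) = pd j (Phi n) by apply/funext => z; rewrite mxE.
    by have pU : smooth_on U (pd j (Phi n)) := smooth_onD _ (PhiU n); exact: smooth_on_is_derive pU Uq.
  have wd x : is_derive q x W (dmx W q x).
    by apply: is_derive_mx => i j; rewrite mxE; exact: smooth_on_is_derive (ws m i j) Uq.
  have E (x z : 'rV[R]_N) : \sum_k 'D_x (th m k) q * z 0 k =
     ((x *m hessm g (Phi n) q *m W q + grad (Phi n) q *m ((gam (christoffel g) q x)^T *m W q + dmx W q x)) *m z^T) 0 0.
    have D := is_derive_mulmx (gd x) (wd x).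
    rewrite mxE; apply: eq_bigr => k _; rewrite [z^T _ _]mxE; congr (_ * _).
    have [_ D0] := is_derive_entry 0 k D.
    rewrite derive_grad// mulmxDl in D0; rewrite mulmxDr mulmxA addrA -D0; congr ('D__ _ _).
    apply/funext => y; rewrite /th mxE; apply: eq_bigr => j _; rewrite [grad _ _ _ _]mxE mulrC.
    by [].
  apply: (etrans (E a v)); apply: (etrans _ (esym (E v a))).
  apply: eq00; apply: closed_form_algebra; last exact: (dmx_codazzi (fer_codazzi CD) m a v Uq).
  rewrite /W hess_upE !trmx_mul (fc_sym FC Uq) (hessm_sym oU gf (PhiU n) Uq) (hessm_sym oU gf (PhiU m) Uq).
  rewrite mulmxA; apply/matrixP => i l; rewrite -!(hess_product oU gf PhiU _ _ _ _ Uq).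
  by case: pot => _ _ r3 _; exact: r3.
have K m := poincare oU Up (ths m) (cl m).
have [V HV] := choice K.
have [W [oW Wp WV]] := common_ball (fun m => let: And4 o _ _ _ := HV m in o) (fun m => let: And4 _ o _ _ := HV m in o).
have KP m : exists Q : 'rV[R]_N -> R, smooth_on (V m) Q /\ forall q i, V m q -> pd i Q q = th m i q.
  by case: (HV m).
have [Q HQ] := choice KP.
have WU : W `&` U `<=` U by move=> q [].
exists (W `&` U); split=> //; first exact: openI.
exists (Phi n), Q; split.
- exact: smooth_on_sub WU (PhiU n).
- by move=> m; apply: (smooth_on_sub _ (HQ m).1) => q [Wq _]; exact: WV.
- by move=> m s q [Wq _]; rewrite ((HQ m).2 q s (WV m q Wq)).
- by move=> q i k _; rewrite mul1r mul0r addr0.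
Qed.

(** With zero density only the constants of integration are left. Taking for them column n of the
    inverse of [mu] singles out the n-th Hessian. *)
Lemma hamiltonian_system_nonlocal n : mu \in unitmx -> hamiltonian_system U g mu Phi 0 1 (hess_up g (Phi n)).
Proof.
move=> muu p Up; exists U; split=> //.
exists (fun=> 0), (fun k _ => invmx mu k n); split.
- exact: smooth_cst_set oU 0.
- by move=> k; exact: smooth_cst_set oU _.
- by move=> k s q _; rewrite /pd derive_cst big1// => j _; rewrite derive_cst mulr0.
- move=> q i k _; rewrite mul0r add0r mul1r.
  transitivity (\sum_m hess_up g (Phi m) q i k * (mu *m invmx mu) m n).
    rewrite mulmxV// (bigD1 n)//= [X in _ * X + _]mxE eqxx mulr1 big1 ?addr0// => m /negbTE mn.
    by rewrite [X in _ * X]mxE mn mulr0.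
  apply: eq_bigr => m _; rewrite [X in _ * X]mxE mulr_sumr; apply: eq_bigr => l _; ring.
Qed.

End systems.

(** * Localization *)

Section flat_function.
Context {R : realType}.

(** The negative powers are included because differentiating exp(-1/x) produces them; the linear
    span of the family is closed under derivation. *)
Definition fl (n : nat) (x : R) : R := if 0 < x then x^-1 ^+ n * expR (- x^-1) else 0.

(** With y = 1/x, this is y^(n+1) <= (n+1)^(n+1) exp y, from 1 + t <= exp t at t = y/(n+1) raised to
    the power n+1. *)
Lemma fl_bound n : exists2 C : R, 0 <= C & forall x, `|fl n x| <= C * `|x|.
Proof.
exists ((n.+1%:R) ^+ n.+1); first by rewrite exprn_ge0.
move=> x; rewrite /fl; case: ifP => x0; last by rewrite normr0 mulr_ge0// exprn_ge0.
have i0 : 0 < x^-1 by rewrite invr_gt0.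
have e0 := expR_gt0 (- x^-1).
rewrite (gtr0_norm x0) ger0_norm; last by rewrite mulr_ge0// ltW// exprn_gt0.
have n0 : (0 : R) < n.+1%:R by rewrite ltr0n.
have H : x^-1 ^+ n.+1 <= (n.+1%:R) ^+ n.+1 * expR x^-1.
  have xE : n.+1%:R * (x^-1 / n.+1%:R) = x^-1 by rewrite mulrC divfK// gt_eqF.
  rewrite -xE exprMn expRM_natl ler_wpM2l ?exprn_ge0//.
  apply: lerXn2r; rewrite ?nnegrE ?(ltW (expR_gt0 _)) ?(ltW (divr_gt0 _ _))//.
  by apply: le_trans (expR_ge1Dx _); rewrite lerDr.
have -> : x^-1 ^+ n * expR (- x^-1) = x^-1 ^+ n.+1 * expR (- x^-1) * x.
  by rewrite exprS; field; rewrite gt_eqF.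
rewrite ler_wpM2r ?(ltW x0)//.
have E : (n.+1%:R ^+ n.+1 * expR x^-1) * expR (- x^-1) = n.+1%:R ^+ n.+1 by rewrite -mulrA -expRD subrr expR0 mulr1.
by rewrite -E ler_wpM2r// ltW.
Qed.

Lemma fl_derive n (x : R) : is_derive x 1 (fl n) (- n%:R * fl n.+1 x + fl n.+2 x).
Proof.
have [x0|x0|x0] := ltgtP x 0.
- have -> : - n%:R * fl n.+1 x + fl n.+2 x = 0 by rewrite /fl ltNge ltW// mulr0 addr0.
  have h := is_derive_cst (0 : R) x 1; apply: (near_eq_is_derive _ h).
  have := open_nbhs_nbhs (conj (@open_lt R 0) x0); apply: filterS => y /= y0.
  by rewrite /fl ltNge ltW.
- have xn : x != 0 by rewrite gt_eqF.
  have h1 : is_derive x 1 (fun y : R => y^-1) (- (x^-1 * x^-1)).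
    have := is_deriveV (f := id) xn (is_derive_id x 1) => H; apply: (is_derive_eqg H).
    by rewrite /GRing.scale /= mulr1 expr2 invfM.
  have h2 := is_deriveX n h1.
  have hN : is_derive x 1 (fun y : R => - y^-1) (x^-1 * x^-1).
    by have := is_deriveN h1 => H; apply: (is_derive_eqg H); rewrite opprK.
  have h3 := @is_derive1_comp R expR (fun y : R => - y^-1) x _ _ (is_derive_expR (- x^-1)) hN.
  have := is_deriveM h2 h3 => H.
  apply: (near_eq_is_derive (f := (fun y : R => y^-1) ^+ n * (expR \o (fun y => - y^-1)))).
    have := open_nbhs_nbhs (conj (@open_gt R 0) x0); apply: filterS => y /= y0.
    by rewrite /fl y0 !fctE.
  apply: (is_derive_eqg H); rewrite /fl x0 !fctE /GRing.scale /=.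
  case: n {h2 H} => [|n]; first by rewrite !mulr0n !scale0r || idtac; ring.
  by rewrite -mulr_natl !exprS; ring.
- have -> : - n%:R * fl n.+1 x + fl n.+2 x = 0 by rewrite x0 /fl ltxx mulr0 addr0.
  (* At 0 the quotient is [fl n.+1 h], which tends to 0 by the linear bound. *)
  rewrite x0; apply/is_derive_approxP => eta eta0; have [C C0 HC] := fl_bound n.+1.
  have C1 : 0 < C + 1 by rewrite ltr_wpDl.
  apply: filterS (@near0_norm_lt R R (eta / (C + 1)) (divr_gt0 eta0 C1)) => h.
  rewrite ltr_pdivlMr// => hh.
  rewrite add0r [h *: (1 : R)]mulr1 scaler0 subr0 {2}/fl ltxx subr0.
  have -> : fl n h = fl n.+1 h * h.
    by rewrite /fl; case: ifP => h0; [rewrite exprS; field; rewrite gt_eqF|rewrite mul0r].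
  rewrite normrM ler_wpM2r//; apply: le_trans (HC h) _; apply: le_trans (ltW hh).
  by rewrite mulrC ler_wpM2l// lerDl.
Qed.

Lemma fl_smooth n : smooth_on [set: R] (fl n).
Proof.
pose F (s : seq (R * nat)) (x : R) := \sum_(z <- s) z.1 * fl z.2 x.
have FD s (v : R) : exists s', forall x : R, is_derive x v (F s) (F s' x).
  elim: s => [|[a m] s [s' IH]].
    exists [::] => x; rewrite /F big_nil.
    by under eq_fun do rewrite big_nil; exact: is_derive_cst.
  exists [:: (v * a * - m%:R, m.+1), (v * a, m.+2) & s'] => x.
  have H := is_deriveD (is_derive_scalel v (is_deriveZ a (fl_derive m x))) (IH x).
  have -> : F ((a, m) :: s) = a \*: fl m + F s by apply/funext => y; rewrite /F big_cons.
  by apply: (is_derive_eqg H); rewrite /F !big_cons /GRing.scale /=; ring.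
refine (@smooth_coind R R [set: R] (fun f => exists s, f = F s) openT _ _ _ _); last first.
- exists [:: (1, n)]; apply/funext => x; rewrite /F big_cons big_nil /=.
  by rewrite mul1r addr0.
- by move=> f v [s ->]; have [s' H] := FD s v; exists (F s'); [exists s'|move=> x _; exact: H].
- move=> f [s ->] x _; have [s' H] := FD s 1; have [/derivable1_diffP/differentiable_continuous C _] := H x.
  exact: C.
Qed.

Lemma fl_ge0 n (x : R) : 0 <= fl n x.
Proof.
by rewrite /fl; case: ifP => // x0; rewrite mulr_ge0// ?expR_ge0// exprn_ge0// invr_ge0 ltW.
Qed.

Lemma fl_gt0 n (x : R) : 0 < x -> 0 < fl n x.
Proof. by move=> x0; rewrite /fl x0 mulr_gt0// ?expR_gt0// exprn_gt0// invr_gt0. Qed.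

Lemma fl_le0 n (x : R) : x <= 0 -> fl n x = 0.
Proof. by move=> x0; rewrite /fl ltNge x0. Qed.

Definition sstep (x : R) : R := fl 0 x * (fl 0 x + fl 0 (1 - x))^-1.

Lemma sstep_den (x : R) : 0 < fl 0 x + fl 0 (1 - x).
Proof.
have [x0|x0] := ltP 0 x; first by rewrite ltr_pwDl ?fl_gt0 ?fl_ge0.
by rewrite ltr_wpDl ?fl_ge0 ?fl_gt0// subr_gt0 (le_lt_trans x0).
Qed.

(** The variable is wrapped in a row of length 1, since the composition rule is stated for maps into
    rows. *)
Lemma smR_comp (f h : R -> R) : smooth_on [set: R] f -> smooth_on [set: R] h ->
  smooth_on [set: R] (fun x => f (h x)).
Proof.
move=> fs hs.
have [l [lE lc]] := @coord_linear R 1 0.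
have fs' : smooth_on [set: 'rV[R]_1] (fun q => f (l q)) by apply: (smooth_on_linear openT fs lc) => x _.
have -> : (fun x => f (h x)) = (fun x => f (l (\row_(_ < 1) h x))).
  by apply/funext => x; rewrite lE mxE.
apply: (smooth_on_comp (p := fun x => \row_(_ < 1) h x) openT openT fs') => [x _|i]; first exact: I.
by under eq_fun do rewrite mxE; exact: hs.
Qed.

Lemma sstep_smooth : smooth_on [set: R] sstep.
Proof.
apply: (smR_M (fl_smooth 0)); apply: (smooth_onV openT) => [|x _]; last by rewrite gt_eqF// sstep_den.
apply: (smR_D (fl_smooth 0)); apply: (smR_comp (fl_smooth 0)).
exact: smR_D (smR_cst 1) (smR_N smR_id).
Qed.

Lemma sstep0 (x : R) : x <= 0 -> sstep x = 0. Proof. by move=> x0; rewrite /sstep fl_le0// mul0r. Qed.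

Lemma sstep1 (x : R) : 1 <= x -> sstep x = 1.
Proof.
move=> x1; rewrite /sstep (fl_le0 _ (_ : 1 - x <= 0)) ?subr_le0// addr0 divff// gt_eqF// fl_gt0//.
exact: lt_le_trans x1.
Qed.

Lemma sstep_in01 (x : R) : 0 <= sstep x <= 1.
Proof.
have d := sstep_den x; apply/andP; split; first by rewrite mulr_ge0 ?fl_ge0// invr_ge0 ltW.
by rewrite ler_pdivrMr// mul1r lerDl fl_ge0.
Qed.

(** With t = (x - c) / e the argument 2 - 4 t^2 is at least 1 for |t| <= 1/2 and negative for |t| >=
    1. The square keeps the function smooth where an absolute value would not. *)
Definition cutoff (c e x : R) : R := sstep (2 - 4 * ((x - c) * e^-1) ^+ 2).

Lemma cutoff_smooth c e : smooth_on [set: R] (cutoff c e).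
Proof.
apply: (smR_comp sstep_smooth).
have h : smooth_on [set: R] (fun x : R => (x - c) * e^-1).
  exact: smR_M (smR_D smR_id (smR_cst _)) (smR_cst _).
have h2 := smR_M h h; apply: (smR_D (smR_cst 2)); apply: smR_N; apply: (smR_M (smR_cst 4)).
exact: h2.
Qed.

Lemma cutoff_in01 c e x : 0 <= cutoff c e x <= 1. Proof. exact: sstep_in01. Qed.

Lemma cutoff1 c e x : 0 < e -> `|x - c| <= e / 2 -> cutoff c e x = 1.
Proof.
move=> e0 xc; apply: sstep1; have h : `|(x - c) / e| <= 2^-1.
  by rewrite normrM normfV (gtr0_norm e0) ler_pdivrMr// mulrC.
have : ((x - c) / e) ^+ 2 <= 2^-1 ^+ 2 by rewrite -real_normK ?num_real// lerXn2r// nnegrE.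
by rewrite !expr2; lra.
Qed.

Lemma cutoff0 c e x : 0 < e -> e <= `|x - c| -> cutoff c e x = 0.
Proof.
move=> e0 xc; apply: sstep0; have h : 1 <= `|(x - c) / e|.
  by rewrite normrM normfV (gtr0_norm e0) ler_pdivlMr// mul1r.
have : 1 <= ((x - c) / e) ^+ 2 by rewrite -real_normK ?num_real// exprn_ege1.
by rewrite !expr2; lra.
Qed.

End flat_function.

Section fundamental_lemma.
Context {R : realType}.

Lemma Int_nonneg_zero (r : R) f x : 0 <= r -> cont_ball (r + 1) f -> (forall y, `|y| <= r -> 0 <= f y) ->
  Int r f = 0 -> `|x| < r -> f x = 0.
Proof.
move=> r0 fc f0 I0 xr.
have D (y : R) : `|y| < r + 1 -> is_derive y 1 (prim f) (f y) by move=> yr; exact: prim_derive fc yr.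
have mono a b : `|a| <= r -> `|b| <= r -> a <= b -> prim f a <= prim f b.
  move=> ar br; rewrite le_eqVlt => /orP[/eqP-> //|ab].
  have mid y : a <= y <= b -> `|y| <= r.
    by move: ar br; rewrite !ler_norml => /andP[? ?] /andP[? ?] /andP[? ?]; apply/andP; split; lra.
  have rr1 (y : R) : `|y| <= r -> `|y| < r + 1 by move=> /le_lt_trans; apply; rewrite ltrDl.
  have [||y yab E] := @MVT R (prim f) f a b ab.
  - by move=> y; rewrite in_itv/= => /andP[y1 y2]; apply: D; apply: rr1; apply: mid; rewrite !ltW.
  - apply: derivable_within_continuous => y; rewrite in_itv/= => y12.
    by have [] := D y (rr1 _ (mid _ y12)).
  - rewrite -subr_ge0 E mulr_ge0//; last by rewrite subr_ge0 ltW.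
    by apply: f0; apply: mid; move: yab; rewrite in_itv/= => /andP[? ?]; rewrite !ltW.
have cst y : `|y| <= r -> prim f y = prim f (- r).
  move=> yr; apply/eqP; rewrite eq_le; have := yr; rewrite ler_norml => /andP[y1 y2].
  have I0' : prim f r = prim f (- r) by apply/eqP; rewrite -subr_eq0; apply/eqP.
  have rr : `|r| <= r by rewrite ger0_norm.
  have nr : `|- r| <= r by rewrite normrN.
  by rewrite (mono _ _ nr yr y1) -I0' (mono _ _ yr rr y2).
have xr1 : `|x| < r + 1 by rewrite (lt_trans xr)// ltrDl.
apply: (is_derive_unique (D x xr1)).
have h := is_derive_cst (prim f (- r)) x 1; apply: (near_eq_is_derive _ h).
have [e e0 He] : exists2 e : R, 0 < e & forall y, `|y - x| < e -> `|y| < r.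
  exists (r - `|x|) => [|y yx]; first by rewrite subr_gt0.
  by have := ler_normD (y - x) x; rewrite subrK; lra.
apply/nbhs_ballP; exists e => // y; rewrite -ball_normE /= distrC => /He yr.
by rewrite cst// ltW.
Qed.

(** For small [d] the function keeps its sign near [c], so a vanishing integral against one
    nonnegative test function is already contradictory. One test function per [d] suffices, which
    admits squares of cutoffs. *)
Lemma fundamental (r c : R) (f : R -> R) : 0 <= r -> `|c| < r -> cont_ball (r + 1) f ->
  (forall d : R, 0 < d -> exists2 h : R -> R,
     [/\ cont_ball (r + 1) h, forall x, 0 <= h x, h c != 0 & forall x, d <= `|x - c| -> h x = 0] &
     Int r (fun x => h x * f x) = 0) -> f c = 0.
Proof.
move=> r0 cr fc H; apply/eqP/negPn/negP => fn.
have cr1 : `|c| < r + 1 by rewrite (lt_trans cr)// ltrDl.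
have f2 : 0 < `|f c| / 2 by rewrite divr_gt0// normr_gt0.
have [e e0 He] := near_norm_ball (cont_near (fc c cr1) f2).
have [h [hc h0 hn hs] hI] := H e e0.
have fpos x : `|x - c| < e -> 0 <= f c * f x.
  move=> /He; have [fc0|fc0] := leP 0 (f c).
    rewrite (ger0_norm fc0) ler_norml => /andP[_ h1]; rewrite mulr_ge0//; lra.
  rewrite (ltr0_norm fc0) ler_norml => /andP[h1 _]; rewrite mulr_le0// ?ltW//; lra.
have I0 : Int r (fun x => f c * (h x * f x)) = 0.
  by rewrite IntZ ?hI ?mulr0//; exact: cont_ballM hc fc.
have gc : cont_ball (r + 1) (fun x => f c * (h x * f x)).
  by apply: cont_ballM; [exact: cont_ball_cst|exact: cont_ballM hc fc].
have := Int_nonneg_zero r0 gc _ I0 cr; move=> /(_ _) E.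
have : f c * (h c * f c) = 0.
  apply: E => y _; have [yc|yc] := ltP `|y - c| e.
    by rewrite mulrCA mulr_ge0// fpos.
  by rewrite hs// mul0r mulr0.
by move/eqP; rewrite !mulf_eq0 (negbTE fn) (negbTE hn).
Qed.

End fundamental_lemma.

Section linear_functional.
Context {R : realType} {N : nat} (U : set 'rV[R]_N).
Variables (xi : R -> 'rV[R]_N) (r : R).
Hypotheses (r0 : 0 <= r) (xs : smooth_map xi) (xr : forall x, r < `|x| -> xi x = 0).

Lemma linear_vderP (m : nat) (S : set 'rV[R]_m) (u : 'rV[R]_m -> R -> 'rV[R]_N) :
  open S -> smooth_family S u -> (forall s x, S s -> `|x| <= r -> U (u s x)) ->
  smooth_family S (fun=> xi) /\
  forall s v, S s -> is_derive s v (fun s' => pairing xi (u s')) (pairing xi (fun x => 'D_v (u ^~ x) s)).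
Proof.
move=> oS us _; split.
  by move=> i; have := smooth_on_snd (open_fst oS) (xs i).
move=> s v Ss; pose rho := r + 1; have rho0 : 0 <= rho by rewrite addr_ge0.
have sup : supp rho xi by move=> x rx; apply: xr; rewrite (lt_le_trans _ rx)// ltrDl.
have cx : cont_ballm (rho + 1) xi by exact: smooth_map_cont.
pose phi (i : 'I_N) (p : ('rV[R]_m * R)%type) := u p.1 p.2 0 i.
have H i := UD_smooth (r := rho) v (open_fst oS) (us i) (fun x _ => conj Ss I : (S `*` [set: R]) (s, x)).
have K := UD_Int rho0 (UD_sum (index_enum 'I_N) (fun i => UDM (UD_cst (cx 0 i)) (H i))).
have cs (t : 'rV[R]_m) : S t -> cont_ballm (rho + 1) (u t).
  move=> St a i; rewrite (ord1 a).
  have := UD_cont0 (UD_smooth (r := rho) 0 (open_fst oS) (us i) (fun x _ => conj St I : (S `*` [set: R]) (t, x))).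
  by rewrite scale0r addr0.
have PE (f : R -> 'rV[R]_N) : cont_ballm (rho + 1) f -> pairing xi f = Int rho (fun x => \sum_i xi x 0 i * f x 0 i).
  move=> fc; rewrite (pairingE rho0 cx fc sup); apply: (eq_Int rho0) => x _.
  by rewrite mxE; apply: eq_bigr => i _; rewrite mxE.
have DE x i : ('D_v (u ^~ x) s : 'rV[R]_N) 0 i = 'D_(v, 0) (phi i) (s, x).
  have D j := is_derive_slicel (smooth_on_is_derive (v, 0 : R) (us j) (conj Ss I : (S `*` [set: R]) (s, x))).
  have DD : is_derive s v (u ^~ x) (\row_j 'D_(v, 0) (phi j) (s, x)).
    by apply: is_derive_mx => a j; rewrite (ord1 a) mxE; exact: D.
  by have [_ ->] := DD; rewrite mxE.
have dc : cont_ballm (rho + 1) (fun x => 'D_v (u ^~ x) s : 'rV[R]_N).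
  move=> a i; rewrite (ord1 a); have := UD_dcont (H i); congr cont_ball.
  by apply/funext => x; rewrite -DE.
rewrite (PE _ dc).
have E : Int rho (fun x => \sum_i xi x 0 i * ('D_v (u ^~ x) s : 'rV[R]_N) 0 i) =
   Int rho (fun x => \sum_i (0 * u (s + 0 *: v) x 0 i + xi x 0 i * 'D_(v, 0) (phi i) (s, x))).
  by apply: (eq_Int rho0) => x _; apply: eq_bigr => i _; rewrite mul0r add0r DE.
rewrite E.
have K' : is_derive (0 : R) 1 (fun e : R => pairing xi (u (s + e *: v)))
   (Int rho (fun x => \sum_i (0 * u (s + 0 *: v) x 0 i + xi x 0 i * 'D_(v, 0) (phi i) (s, x)))).
  apply: (near_eq_is_derive _ K).
  have [e e0 He] := near_line v (open_nbhs_nbhs (conj oS Ss)).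
  apply: filterS (@near0_norm_lt R R e e0) => h /He Sh.
  by rewrite (PE _ (cs _ Sh)).
have := (is_derive_line (fun s' => pairing xi (u s')) s v 0 _).2 K'.
by rewrite scale0r addr0.
Qed.

(** Its variational derivative is [xi] for every field, so arbitrary compactly supported covectors
    can be inserted into the brackets and no second variation arises. *)
Definition linear_functional : functional U :=
  @Functional R N U (fun u => pairing xi u) (fun=> xi) r (fun _ x => @xr x) linear_vderP.

Lemma vder_linear u : vder linear_functional u = xi. Proof. by []. Qed.

End linear_functional.

Section curves.
Context {R : realType} {N : nat}.

Definition sv (f : R -> R) (e : 'rV[R]_N) (x : R) : 'rV[R]_N := f x *: e.

Lemma sv_smooth f e : smooth_on [set: R] f -> smooth_map (sv f e).
Proof. by move=> fs i; under eq_fun do rewrite mxE; exact: smR_M fs (smR_cst _). Qed.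

Lemma dx_sv f e x : smooth_on [set: R] f -> dx (sv f e) x = sv ('D_1 f) e x.
Proof.
move=> fs; apply: is_derive_eq_dx; apply: is_derive_mx => i j; rewrite (ord1 i) mxE.
under eq_fun do rewrite mxE.
have H := is_deriveM (smooth_on_is_derive (1 : R) fs (I : [set: R] x)) (is_derive_cst (e 0 j) x 1).
by apply: (is_derive_eqg H); rewrite scaler0 add0r /GRing.scale /= mulrC.
Qed.

Lemma sv_supp f e r : (forall x, r <= `|x| -> f x = 0) -> supp r (sv f e).
Proof. by move=> f0 x /f0; rewrite /sv => ->; rewrite scale0r. Qed.

Lemma germ_curve (U : set 'rV[R]_N) p v z (d : R) : open U -> U p -> 0 < d ->
  exists u : R -> 'rV[R]_N, [/\ smooth_field U u, u 0 = p, dx u 0 = v, dx (dx u) 0 = z &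
    forall x, d <= `|x| -> u x = p].
Proof.
move=> oU Up d0; have [rho rho0 Hrho] := near_norm_ball (open_nbhs_nbhs (conj oU Up)).
pose K := `|v| + `|z| + 1; have K0 : 0 < K by rewrite ltr_wpDl// addr_ge0.
(* [e <= 1] bounds the quadratic term by a linear one, [e * K <= rho] then keeps the curve in the
   ball inside U, and [e <= d] makes it constant where required. *)
pose e := Num.min d (Num.min 1 (rho / K)).
have e0 : 0 < e by rewrite !lt_min d0 ltr01 divr_gt0.
have [ed e1 eK] : [/\ e <= d, e <= 1 & e * K <= rho].
  by split; rewrite -?ler_pdivlMr// !ge_min lexx ?orbT.
pose c := cutoff (0 : R) e.
pose y (x : R) := x *: v + (2^-1 * (x * x)) *: z.
pose u x := p + c x *: y x.
have cs : smooth_on [set: R] c by exact: cutoff_smooth.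
have ys : smooth_map y.
  move=> i; under eq_fun do rewrite !mxE.
  apply: smR_D; first exact: smR_M smR_id (smR_cst _).
  have h := smR_M (@smR_id R) smR_id; exact: smR_M (smR_M (smR_cst _) h) (smR_cst _).
have us : smooth_map u.
  by move=> i; under eq_fun do rewrite !mxE; have := smR_D (smR_cst (p 0 i)) (smR_M cs (ys i)); under eq_fun do rewrite !mxE.
have yd (x : R) : is_derive x 1 y (v + x *: z).
  apply: is_derive_mx => i j; rewrite (ord1 i); under eq_fun do rewrite !mxE.
  have h1 := is_deriveM (is_derive_id x 1) (is_derive_cst (v 0 j) x 1).
  have h2 := is_deriveM (is_derive_cst (2^-1 : R) x 1) (is_deriveM (is_derive_id x 1) (is_derive_id x 1)).
  have h3 := is_deriveD h1 (is_deriveM h2 (is_derive_cst (z 0 j) x 1)).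
  by apply: (is_derive_eqg h3); rewrite !mxE /GRing.scale /=; field.
have near (x : R) : `|x| < e / 2 -> \forall t \near x, u t = p + y t.
  move=> xe; exists (e / 2 - `|x|); first by rewrite /= subr_gt0.
  move=> t; rewrite /= => xt; rewrite /u /c cutoff1// ?scale1r// subr0.
  by have := ler_normD (t - x) x; rewrite subrK distrC in xt *; lra.
have dxu (x : R) : `|x| < e / 2 -> dx u x = v + x *: z.
  move=> xe; apply: is_derive_eq_dx; apply: is_derive_mx => i j.
  have h := is_derive_entry i j (is_deriveD (is_derive_cst p x 1) (yd x)); rewrite add0r in h.
  by apply: (near_eq_is_derive _ h); apply: filterS (near x xe) => t ->.
have n0 : `|0 : R| < e / 2 by rewrite normr0 divr_gt0.
exists u; split.
- split=> // x; apply: Hrho; rewrite /u addrAC subrr add0r.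
  have [xe|xe] := ltP `|x| e; last by rewrite /c cutoff0 ?subr0// scale0r normr0.
  have /andP[c0 c1] := cutoff_in01 0 e x.
  rewrite normrZ ger0_norm//; apply: le_lt_trans (_ : 1 * `|y x| < _).
    by rewrite ler_wpM2r.
  rewrite mul1r; apply: lt_le_trans eK.
  apply: le_lt_trans (_ : `|x| * (`|v| + `|z|) < _).
    have x1 : `|x| <= 1 by rewrite (le_trans (ltW xe)).
    have hx : `|2^-1 * (x * x)| <= `|x|.
      rewrite !normrM (ger0_norm (_ : (0 : R) <= 2^-1)) ?invr_ge0//.
      by have := normr_ge0 x; nra.
    rewrite /y; apply: le_trans (ler_normD _ _) _; rewrite !normrZ mulrDr; apply: lerD => //.
    by rewrite ler_wpM2r// -!normrM.
  apply: le_lt_trans (_ : e * (`|v| + `|z|) < _).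
    by rewrite ler_wpM2r ?addr_ge0// ltW.
  by rewrite ltr_pM2l// /K ltrDl.
- by rewrite /u /y !scale0r mul0r mulr0 scale0r addr0 scaler0 addr0.
- by rewrite dxu// scale0r addr0.
- apply: is_derive_eq_dx; apply: is_derive_mx => i j.
  have h0 : is_derive (0 : R) 1 (fun x : R => v i j + x * z i j) (z i j).
    have h1 := is_deriveM (is_derive_id (0 : R) 1) (is_derive_cst (z i j) (0 : R) 1).
    have h2 := is_deriveD (is_derive_cst (v i j) (0 : R) 1) h1.
    by apply: (is_derive_eqg h2); rewrite scaler0 !add0r /GRing.scale /= mulr1.
  apply: (near_eq_is_derive _ h0).
  apply: filterS (@near0_norm_lt R R (e / 2) (divr_gt0 e0 (ltr0Sn _ 1))) => t /dxu ->.
  by rewrite !mxE.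
- by move=> x dx_; rewrite /u /c cutoff0 ?subr0 ?(le_trans ed)// scale0r addr0.
Qed.

End curves.

(** * Necessity of the conditions *)

Section levi_civita_necessity.
Context {R : realType} {N L : nat} (U : set 'rV[R]_N) (oU : open U).
Variables (g : 'rV[R]_N -> 'M[R]_N) (b : 'I_N -> 'I_N -> 'I_N -> 'rV[R]_N -> R)
  (mu : 'M[R]_L) (w : 'I_L -> 'rV[R]_N -> 'M[R]_N).
Hypotheses (gs : forall i j, smooth_on U (fun p => g p i j)) (gsym : forall p, U p -> (g p)^T = g p)
  (bs : forall i j k, smooth_on U (b i j k)) (ws : forall m i j, smooth_on U (fun p => w m p i j))
  (mu_sym : mu^T = mu) (ham : hamiltonian U (hydro_op g b mu w)).

Notation P := (hop g b mu w).

Lemma sv_form (A : 'M[R]_N) (f h : R) i j :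
  ((f *: (delta_mx 0 i : 'rV[R]_N)) *m A *m (h *: (delta_mx 0 j : 'rV[R]_N))^T) 0 0 = f * h * A i j.
Proof.
rewrite linearZ /= -scalemxAl -scalemxAr -scalemxAl !mxZE mulrA [h * f]mulrC; congr (_ * _).
by rewrite -rowE trmx_delta -colE !mxE.
Qed.

(** Both covectors are one cutoff times a basis vector. By [opx_skew_defect] the bracket relation
    leaves only the integral of an entry of the defect against the square of the cutoff. *)
Lemma skew_metric p a : U p -> dmx g p a = bv b p a + (bv b p a)^T.
Proof.
move=> Up; have [u [uU u0 ud _ _]] := germ_curve a 0 oU Up (ltr01 : (0 : R) < 1).
have [us uin] := uU; have dus := smooth_map_dx us; have [sk _] := ham.
apply/matrixP => i j; apply/eqP; rewrite eq_sym -subr_eq0; apply/eqP.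
pose B x := bv b (u x) (dx u x); pose dg x := dmx g (u x) (dx u x).
have Bs : smm B := smm_bv oU bs uU dus.
have Gs : smm (fun x => g (u x)) := smm_G oU gs uU.
have gd (x : R) : is_derive x 1 (fun x => g (u x)) (dg x) by exact: (dmx_curve oU x gs uU).
have dgs : smm dg.
  move=> k l; have := smm_mdx Gs k l; congr smooth_on; apply/funext => x.
  by rewrite (mdx_eq (gd x)).
have Ws : smm (fun x => wm w (u x) (dx u x)) := smm_wm oU ws uU dus.
pose f x := (B x + (B x)^T - dg x) i j.
have fs : smooth_on [set: R] f := smmD (smmD Bs (smm_tr Bs)) (smmN dgs) i j.
have r0 : (0 : R) <= 1 by [].
have -> : (bv b p a + (bv b p a)^T) i j - dmx g p a i j = f 0.
  by rewrite /f /B /dg u0 ud !addoppE.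
apply: (@fundamental R 1 0 f r0); first by rewrite normr0.
  exact: smooth_on_cont_ball fs.
move=> d d0; pose e := Num.min d 1; have e0 : 0 < e by rewrite lt_min d0 ltr01.
pose c := cutoff (0 : R) e; have cs : smooth_on [set: R] c := cutoff_smooth 0 e.
have c_out x : e <= `|x| -> c x = 0 by move=> ex; rewrite /c cutoff0// subr0.
exists (fun x => c x * c x); first split.
- by apply: cont_ballM; exact: smooth_on_cont_ball cs.
- by move=> x; rewrite -expr2 sqr_ge0.
- rewrite mulf_neq0// /c cutoff1 ?oner_neq0// subrr normr0; exact: ltW (divr_gt0 e0 (ltr0Sn _ 1)).
- by move=> x; rewrite subr0 => dx_; rewrite c_out ?mul0r// ge_min dx_.
pose xi := sv c (delta_mx 0 i); pose eta := sv c (delta_mx 0 j).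
have xs : smooth_map xi := sv_smooth _ cs; have es : smooth_map eta := sv_smooth _ cs.
have e1 : e <= 1 by rewrite ge_min lexx orbT.
have supc (v : 'rV[R]_N) : supp 1 (sv c v) by apply: sv_supp => x x1; apply: c_out; exact: le_trans x1.
have out (v : 'rV[R]_N) x : 1 < `|x| -> sv c v x = 0 by move=> /ltW; exact: supc.
pose I := linear_functional U r0 xs (out _); pose J := linear_functional U r0 es (out _).
have cn (v : R -> 'rV[R]_N) : smooth_map v -> cont_ballm (1 + 1) v by exact: smooth_map_cont.
have cB := smm_cont (rho := 1 + 1) Bs; have cG := smm_cont (rho := 1 + 1) Gs; have cW := smm_cont (rho := 1 + 1) Ws.
have := sk I J u uU; rewrite /bracket -/(hop g b mu w) !vder_linear.
have E1 := bracket_Int mu_sym r0 (supc _) (supc _) (cn _ xs) (cn _ es) (cn _ (smooth_map_dx es)) cG cB cW.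
have E2 := bracket_Int mu_sym r0 (supc _) (supc _) (cn _ es) (cn _ xs) (cn _ (smooth_map_dx xs)) cG cB cW.
have S := opx_skew_defect mu_sym r0 (fun x _ => gsym (uin x)) (fun x _ => gd x) (smm_cont dgs) cB cW
  (fun x _ => smooth_map_derive x xs) (cn _ (smooth_map_dx xs)) (fun x _ => smooth_map_derive x es) (cn _ (smooth_map_dx es)) (supc _) (supc _).
have alg (a1 a2 i1 i2 i3 : R) : a1 = i1 -> a2 = i2 -> i1 = i3 - i2 -> a1 = - a2 -> i3 = 0.
  by move=> -> -> -> /eqP; rewrite subr_eq addNr => /eqP.
move=> H; have := alg _ _ _ _ _ E1 E2 S H => <-.
by apply: (eq_Int r0) => x _; rewrite /xi /eta /sv sv_form.
Qed.

Lemma hop_cst p xi x : P (fun=> p) xi x = dx xi x *m (g p)^T.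
Proof.
have d0 y : dx (fun _ : R => p) y = 0 by apply: is_derive_eq_dx; exact: is_derive_cst.
apply/rowP => i; rewrite /hop /hydro_op /local_op /nonlocal_op addmxE !mxE.
rewrite [X in _ + X + _]big1 ?addr0 => [|j _]; last first.
  by rewrite big1// => k _; rewrite d0 mxE mulr0 mul0r.
rewrite [X in _ + X]big1 ?addr0 => [|m _]; last first.
  rewrite big1// => n _; rewrite [X in _ * X * _]big1 ?mulr0 ?mul0r// => k _.
  by rewrite d0 mxE mulr0.
by apply: eq_bigr => j _; rewrite [_^T _ _]mxE mulrC.
Qed.

Lemma wm0 p : wm w p 0 = 0. Proof. exact: (ct0 (fun m i k p => w m p i k)). Qed.

Lemma NN0 r (Y : R -> 'rV[R]_L) x : (forall y, Y y = 0) -> NN r Y x = 0.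
Proof.
move=> Y0; apply/rowP => n; rewrite !mxE /Nr.
have E y : prim (fun y => Y y 0 n) y = 0.
  rewrite (_ : (fun y => Y y 0 n) = fun=> 0); last by apply/funext => t; rewrite Y0 mxE.
  have E0 (s t : R) : \int[lebesgue_measure]_(t in `[s, t]) (0 : R) = 0.
    by rewrite /Rintegral integral0.
  by rewrite /prim !E0 subrr.
by rewrite !E; ring.
Qed.

(** At a constant field the nonlocal part drops out to first order because it is quadratic in u_x.
    Adding the vanishing integral of the derivative of [xi B eta^T] brings the rest into
    antisymmetric form. *)
Lemma outer_bracket_cst (I J K : functional U) rho p xi eta zeta : 0 <= rho ->
  Defs.rad I < rho -> Defs.rad J < rho ->
  smooth_map xi -> smooth_map eta -> smooth_map zeta ->
  (forall u, vder I u = xi) -> (forall u, vder J u = eta) -> (forall u, vder K u = zeta) -> U p ->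
  outer_bracket P (bracket P I J) K (fun=> p) =
  Int rho (fun x => (dx eta x *m bv b p (dx zeta x *m (g p)^T) *m (xi x)^T) 0 0)
  - Int rho (fun x => (dx xi x *m bv b p (dx zeta x *m (g p)^T) *m (eta x)^T) 0 0).
Proof.
move=> rho0 Ir Jr xs es zs vI vJ vK Up; pose u : R -> 'rV[R]_N := fun=> p.
have uU : smooth_field U u.
  by split; [apply: smooth_map_smm; exact: smm_cst|move=> x; exact: Up].
have d0 y : dx u y = 0 by apply: is_derive_eq_dx; exact: is_derive_cst.
pose a (x : R) := dx zeta x *m (g p)^T.
have as_ : smooth_map a.
  by apply: smooth_map_smm; apply: smm_mul; [exact: smm_map (smooth_map_dx zs)|exact: smm_cst].
have dv (A : functional U) f : (forall u, vder A u = f) -> dvder A u a = fun=> 0.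
  move=> vA; apply/funext => y; apply/rowP => i; rewrite /dvder mxE.
  by under eq_fun do rewrite vA; rewrite derive_cst mxE.
have [_ E] := bracket_derive oU gs bs ws mu_sym rho0 uU as_ Ir Jr.
have aE : P u (vder K u) = a by rewrite vK; apply/funext => x; rewrite hop_cst.
rewrite /outer_bracket -/u aE.
apply: (etrans E); pose B x := bv b p (a x).
have Bs : smm B := smm_bv oU bs uU as_.
have Bd (x : R) : is_derive x 1 B (bv b p (dx a x)).
  have := ct_curve oU x bs uU as_; rewrite d0.
  have -> : dct b (u x) 0 (a x) = 0.
    apply/matrixP => i j; rewrite !mxE big1// => k _.
    have -> : 'D_0 (b i j k) (u x) = 0; last by rewrite mul0r.
    by rewrite (smooth_derive_sum _ oU (bs i j k) Up) big1// => l _; rewrite mxE mul0r.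
  by rewrite add0r.
have supx : supp rho xi by move=> x rx; rewrite -(vI u); exact: supp_vder Ir x rx.
have cK f h (fs : smooth_map f) (hs : smooth_map h) : cont_ball (rho + 1) (fun x => (f x *m B x *m (h x)^T) 0 0) :=
  smm_cont (smm_mul (smm_mul (smm_map fs) Bs) (smm_tr (smm_map hs))) (i := 0) (j := 0).
have c1 := cK _ _ (smooth_map_dx es) xs; have c2 := cK _ _ (smooth_map_dx xs) es.
pose F x := xi x *m B x *m (eta x)^T.
have Fd (x : R) := is_derive_entry 0 0 (is_derive_mulmx (is_derive_mulmx (smooth_map_derive x xs) (Bd x))
  (is_derive_trmx (smooth_map_derive x es))).
have c3 : cont_ball (rho + 1) (fun x => ((dx xi x *m B x + xi x *m bv b p (dx a x)) *m (eta x)^T + xi x *m B x *m (dx eta x)^T) 0 0).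
  have h1 := smm_mul (smm_map (smooth_map_dx xs)) Bs.
  have h2 := smm_mul (smm_map xs) (smm_bv oU bs uU (smooth_map_dx as_)).
  have h3 := smm_mul (smm_mul (smm_map xs) Bs) (smm_tr (smm_map (smooth_map_dx es))).
  exact: smm_cont (smmD (smm_mul (smmD h1 h2) (smm_tr (smm_map es))) h3) 0 0.
have F0 : Int rho (fun x => ((dx xi x *m B x + xi x *m bv b p (dx a x)) *m (eta x)^T + xi x *m B x *m (dx eta x)^T) 0 0) = 0.
  rewrite (Int_derive rho0 c3 (fun x _ => Fd x)).
  have rr : rho <= `|rho| by rewrite ger0_norm.
  have rr' : rho <= `|- rho| by rewrite normrN ger0_norm.
  by rewrite !(supx _ rr) !(supx _ rr') !mul0mx mxE subrr.
rewrite -(IntB rho0 c1 c2) -[RHS]addr0 -[in RHS]F0 -(IntD rho0 (cont_ballD c1 (cont_ballN c2)) c3).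
apply: (eq_Int rho0) => x _; rewrite (dv I _ vI) (dv J _ vJ) vI vJ mul0mx add0r.
have -> : opu g b mu w rho u (fun=> 0) x = 0.
  rewrite /opu /opx d0 wm0 !mulmx0 mul0mx addr0.
  have -> : dx (fun=> 0 : 'rV[R]_N) x = 0 by apply: is_derive_eq_dx; exact: is_derive_cst.
  by rewrite mul0mx addr0.
rewrite trmx0 mulmx0 add0r /opvar d0 wm0 mulmx0 add0r.
rewrite (@NN0 rho (fun y => eta y *m (wm w (u y) (dx u y))^T) x) => [|y]; last by rewrite d0 wm0 trmx0 mulmx0.
rewrite !mul0mx addr0.
have -> : dbv b (u x) (a x) 0 = 0 by exact: (dct0r b).
rewrite add0r (skew_metric (a x) Up) -/(B x) !(trDE, trmx_mul, trmxK).
rewrite !(mulmxDl, mulmxDr, mulmxA) !addoppE.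
rewrite [(xi x *m (B x)^T *m (dx eta x)^T) 0 0]sc_tr !trmx_mul !trmxK mulmxA.
rewrite -/u; move: (_ *m (eta x)^T) => z; ring.
Qed.

(** Otherwise the cutoff would have zero derivative and could not pass from 1 to 0. *)
Lemma cutoff_energy : Int 6 (fun x => 'D_1 (cutoff (0 : R) 1) x * 'D_1 (cutoff (0 : R) 1) x) != 0.
Proof.
pose c := cutoff (0 : R) 1; have cs : smooth_on [set: R] c := cutoff_smooth 0 1.
have dcs := smooth_onD (1 : R) cs.
apply/negP => /eqP H.
have r0 : (0 : R) <= 6 by [].
have cc : cont_ball ((6 : R) + 1) (fun x => 'D_1 c x * 'D_1 c x) := smooth_on_cont_ball (smR_M dcs dcs).
have D0 (x : R) : `|x| < 6 -> is_derive x 1 c 0.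
  move=> x6; have D := smooth_on_is_derive (1 : R) cs (I : [set: R] x).
  have /eqP := Int_nonneg_zero r0 cc (fun y _ => sqr_ge0 ('D_1 c y)) H x6.
  rewrite mulf_eq0 orbb => /eqP E; exact: (is_derive_eqv D E).
have c1 : c 0 = 1 by rewrite /c cutoff1// subrr normr0 divr_ge0.
have c0 : c 1 = 0 by rewrite /c cutoff0// subr0 normr1.
have := @derive_ball_cst R 6 c 0 1 D0.
rewrite normr0 normr1 ltr0n ltr1n c0 c1 => /(_ isT isT) /eqP.
by move/eqP => h; have := @oner_neq0 R; rewrite h eqxx.
Qed.

(** The covector [xi] is constant on the supports of the other two. Of the six integrals in the
    Jacobi identity only the two without a derivative of [xi] survive, each a component times
    [I0]. *)
Lemma torsion_form p j l i : U p ->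
  ((delta_mx 0 j : 'rV[R]_N) *m bv b p ((delta_mx 0 l : 'rV[R]_N) *m (g p)^T)) 0 i =
  ((delta_mx 0 l : 'rV[R]_N) *m bv b p ((delta_mx 0 j : 'rV[R]_N) *m (g p)^T)) 0 i.
Proof.
move=> Up.
(* [c] vanishes for |x| >= 1, while [th] is 1 for |x| <= 2 and vanishes for |x| >= 4; the radii 5
   and 6 leave room beyond both. *)
pose c := cutoff (0 : R) 1; pose th := cutoff (0 : R) 4.
have cs : smooth_on [set: R] c := cutoff_smooth 0 1; have ts : smooth_on [set: R] th := cutoff_smooth 0 4.
have r0 : (0 : R) <= 5 by []; have rho0 : (0 : R) <= 6 by [].
pose xi := sv th (delta_mx 0 i); pose eta := sv c (delta_mx 0 j); pose zeta := sv c (delta_mx 0 l).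
have xs : smooth_map xi := sv_smooth _ ts; have es : smooth_map eta := sv_smooth _ cs.
have zs : smooth_map zeta := sv_smooth _ cs.
have c_out (x : R) : 1 <= `|x| -> c x = 0 by move=> x1; rewrite /c cutoff0// subr0.
have t_out (x : R) : 5 < `|x| -> th x = 0.
  by move=> x5; rewrite /th cutoff0// subr0; apply: le_trans (ltW x5); rewrite ler_nat.
have sx (x : R) : 5 < `|x| -> xi x = 0 by move=> /t_out; rewrite /xi /sv => ->; rewrite scale0r.
have c5 (x : R) : 5 < `|x| -> c x = 0.
  by move=> x5; apply: c_out; apply: le_trans (ltW x5); rewrite ler1n.
have se (x : R) : 5 < `|x| -> eta x = 0 by move=> /c5; rewrite /eta /sv => ->; rewrite scale0r.
have sz (x : R) : 5 < `|x| -> zeta x = 0 by move=> /c5; rewrite /zeta /sv => ->; rewrite scale0r.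
pose FI := linear_functional U r0 xs sx; pose FJ := linear_functional U r0 es se; pose FK := linear_functional U r0 zs sz.
have r56 : (5 : R) < 6 by rewrite ltr_nat.
have uU : smooth_field U (fun _ : R => p).
  by split; [apply: smooth_map_smm; exact: smm_cst|move=> x; exact: Up].
have [_ ja] := ham; have := ja FI FJ FK _ uU; rewrite -/(hop g b mu w).
have E1 := outer_bracket_cst (I := FI) (J := FJ) (K := FK) rho0 r56 r56 xs es zs (fun _ => erefl) (fun _ => erefl) (fun _ => erefl) Up.
have E2 := outer_bracket_cst (I := FJ) (J := FK) (K := FI) rho0 r56 r56 es zs xs (fun _ => erefl) (fun _ => erefl) (fun _ => erefl) Up.
have E3 := outer_bracket_cst (I := FK) (J := FI) (K := FJ) rho0 r56 r56 zs xs es (fun _ => erefl) (fun _ => erefl) (fun _ => erefl) Up.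
pose I0 := Int 6 (fun x : R => 'D_1 c x * 'D_1 c x).
have dc_out (x : R) : 1 < `|x| -> 'D_1 c x = 0.
  move=> x1; have oO : open [set y : R | 1 < `|y|].
    have -> : [set y : R | 1 < `|y|] = (fun y : R => `|y|) @^-1` [set z | 1 < z] by [].
    by apply: open_comp; [move=> y _; exact: norm_continuous|exact: open_gt].
  have -> : 'D_1 c x = 'D_1 (fun _ : R => 0 : R) x.
    apply: near_eq_derive; apply: (near_open oO x1) => y /ltW; exact: c_out.
  by rewrite derive_cst.
have dt_in (x : R) : `|x| < 2 -> 'D_1 th x = 0.
  move=> x1; have oO : open [set y : R | `|y| < 2].
    have -> : [set y : R | `|y| < 2] = (fun y : R => `|y|) @^-1` [set z | z < 2] by [].
    by apply: open_comp; [move=> y _; exact: norm_continuous|exact: open_lt].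
  have -> : 'D_1 th x = 'D_1 (fun _ : R => 1 : R) x.
    apply: near_eq_derive; apply: (near_open oO x1) => y y2; rewrite /th cutoff1// subr0.
    by apply: (le_trans (ltW y2)); rewrite ler_pdivlMr// -natrM ler_nat.
  by rewrite derive_cst.
have dct (x : R) : 'D_1 c x * 'D_1 th x = 0.
  have [x1|x1] := ltP 1 `|x|; first by rewrite dc_out ?mul0r.
  by rewrite dt_in ?mulr0// (le_lt_trans x1)// ltr1n.
have cdt (x : R) : c x * 'D_1 th x = 0.
  have [x1|x1] := leP 1 `|x|; first by rewrite c_out ?mul0r.
  by rewrite dt_in ?mulr0// (lt_trans x1)// ltr1n.
have dct1 (x : R) : 'D_1 c x * th x = 'D_1 c x.
  have [x1|x1] := ltP 1 `|x|; first by rewrite dc_out ?mul0r.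
  by rewrite /th cutoff1 ?mulr1// subr0; apply: le_trans x1 _; rewrite ler_pdivlMr// mul1r ler_nat.
have form f1 f2 f3 (e1 e2 : 'rV[R]_N) k x : smooth_on [set: R] f1 -> smooth_on [set: R] f2 ->
    (dx (sv f1 e1) x *m bv b p (dx (sv f2 e2) x *m (g p)^T) *m (sv f3 (delta_mx 0 k) x)^T) 0 0 =
    'D_1 f1 x * 'D_1 f2 x * f3 x * (e1 *m bv b p (e2 *m (g p)^T)) 0 k.
  move=> s1 s2; rewrite !dx_sv// /sv -scalemxAl.
  rewrite -[('D_1 f2 x *: e2) *m _]scalemxAl.
  have -> : bv b p ('D_1 f2 x *: (e2 *m (g p)^T)) = 'D_1 f2 x *: bv b p (e2 *m (g p)^T).
    apply/matrixP => a d; rewrite !mxE mulr_sumr; apply: eq_bigr => s _.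
    by rewrite mxE; ring.
  move: (bv b p _) => M.
  have -> : (f3 x *: (delta_mx 0 k : 'rV[R]_N))^T = f3 x *: (delta_mx 0 k : 'rV[R]_N)^T by rewrite linearZ.
  rewrite -scalemxAr -scalemxAr -scalemxAl -scalemxAl !mxZE trmx_delta -colE [(col _ _) _ _]mxE.
  move: ((e1 *m M) 0 k) => z; ring.
pose T (e1 e2 : 'rV[R]_N) := (e1 *m bv b p (e2 *m (g p)^T)) 0 i.
have cD : cont_ball ((6 : R) + 1) (fun x => 'D_1 c x * 'D_1 c x).
  by have dcs := smooth_onD (1 : R) cs; exact: (smooth_on_cont_ball (smR_M dcs dcs)).
have K1 (e1 e2 : 'rV[R]_N) : Int 6 (fun x => (dx (sv c e1) x *m bv b p (dx (sv c e2) x *m (g p)^T) *m (xi x)^T) 0 0) = T e1 e2 * I0.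
  rewrite -(IntZ _ rho0 cD); apply: (eq_Int rho0) => x _.
  by rewrite (form _ _ _ _ _ _ _ cs cs) -[_ * th x]mulrA dct1 [RHS]mulrC.
have K2 (e1 e2 : 'rV[R]_N) k : Int 6 (fun x => (dx xi x *m bv b p (dx (sv c e1) x *m (g p)^T) *m (sv c (delta_mx 0 k) x)^T) 0 0) = 0.
  rewrite -[RHS](Int_cst0 6); apply: (eq_Int rho0) => x _.
  by rewrite (form _ _ _ _ _ _ _ ts cs) ['D_1 th x * _]mulrC dct !mul0r.
have K3 (e1 e2 : 'rV[R]_N) k : Int 6 (fun x => (dx (sv c e1) x *m bv b p (dx xi x *m (g p)^T) *m (sv c (delta_mx 0 k) x)^T) 0 0) = 0.
  rewrite -[RHS](Int_cst0 6); apply: (eq_Int rho0) => x _.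
  by rewrite (form _ _ _ _ _ _ _ cs ts) dct !mul0r.
have I0n : I0 != 0 := cutoff_energy.
have alg (o1 o2 o3 t1 t2 k1 k2 k3 k4 k5 k6 : R) : o1 = k1 - k2 -> o2 = k3 - k4 -> o3 = k5 - k6 ->
    k1 = t1 * I0 -> k2 = 0 -> k3 = 0 -> k4 = 0 -> k5 = 0 -> k6 = t2 * I0 -> o1 + o2 + o3 = 0 -> t1 = t2.
  move=> -> -> -> -> -> -> -> -> -> H; apply: (mulIf I0n); apply/eqP; rewrite -subr_eq0 -H; apply/eqP; ring.
exact: (alg _ _ _ _ _ _ _ _ _ _ _ E1 E2 E3 (K1 _ _) (K2 _ _ _) (K3 _ _ _) (K3 _ _ _) (K2 _ _ _) (K1 _ _)).
Qed.

Hypothesis gf : flat_metric U g.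

(** The uniqueness argument for the Levi-Civita connection: the difference tensor is symmetric in
    one pair of indices and skew in another, hence zero. *)
Lemma levi_civita p i j k : U p -> b i j k p = lc_coef g i j k p.
Proof.
move=> Up; have FC := flat_connection_christoffel oU gf; have [_ _ gu _] := gf.
pose c := christoffel g; pose b' := lcb g c.
pose D (a : 'rV[R]_N) := bv b p a - bv b' p a.
pose B j l i := D ((delta_mx 0 l : 'rV[R]_N) *m g p) j i.
have entry (M : 'M[R]_N) j0 i0 : ((delta_mx 0 j0 : 'rV[R]_N) *m M) 0 i0 = M j0 i0 by rewrite -rowE mxE.
have sym j0 l0 i0 : B j0 l0 i0 = B l0 j0 i0.
  rewrite /B /D !addoppE -[bv b p _ j0 i0]entry -[bv b p _ l0 i0]entry.
  have := torsion_form j0 l0 i0 Up; rewrite !(gsym Up) => ->; congr (_ - _).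
  rewrite -[LHS]entry -[RHS]entry !bv_lcb !mulmxN !mulmxA (gam_sym FC _ _ Up).
  by [].
have skew j0 l0 i0 : B j0 l0 i0 = - B i0 l0 j0.
  rewrite /B /D; move: (_ *m g p) => a; rewrite !addoppE opprB.
  have E1 : (dmx g p a) j0 i0 = (bv b p a + (bv b p a)^T) j0 i0 by rewrite (skew_metric a Up).
  have E2 : (dmx g p a) j0 i0 = (bv b' p a + (bv b' p a)^T) j0 i0.
    rewrite (fc_met FC a Up) bv_lcb !linearN /= trmx_mul (gsym Up) addrC.
    by [].
  have := E1; rewrite E2 !addoppE => H.
  apply/eqP; rewrite -subr_eq0 opprB; apply/eqP.
  move: H; rewrite ![_^T _ _]mxE => /eqP; rewrite -subr_eq0 => /eqP H.
  by rewrite -[RHS]oppr0 -[in RHS]H; ring.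
have B0 j0 l0 i0 : B j0 l0 i0 = 0.
  have : B j0 l0 i0 = - B j0 l0 i0.
    (* Alternating the two symmetries returns to the same component after three sign changes. *)
    by rewrite {1}(sym j0 l0 i0) (skew l0 j0 i0) (sym i0 j0 l0) (skew j0 i0 l0) opprK (sym l0 i0 j0) (skew i0 l0 j0).
  move/eqP; rewrite -addr_eq0 -mulr2n mulrn_eq0 /= => /eqP; exact.
have D0 a : D a = 0.
  have -> : a = (a *m invmx (g p)) *m g p by rewrite -mulmxA mulVmx ?mulmx1 //; exact: gu.
  move: (a *m _) => be; apply/matrixP => j0 i0; rewrite [RHS]mxE.
  have -> : D (be *m g p) j0 i0 = \sum_l be 0 l * B j0 l i0.
    have lin b1 : bv b1 p (be *m g p) j0 i0 = \sum_l be 0 l * bv b1 p ((delta_mx 0 l : 'rV[R]_N) *m g p) j0 i0.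
      rewrite !mxE; under eq_bigr do rewrite mxE mulr_sumr.
      rewrite exchange_big /=; apply: eq_bigr => l _; rewrite mxE mulr_sumr; apply: eq_bigr => k0 _.
      by rewrite entry; ring.
    have -> : D (be *m g p) j0 i0 = bv b p (be *m g p) j0 i0 - bv b' p (be *m g p) j0 i0 by rewrite /D !addoppE.
    by rewrite !lin -sumrB; apply: eq_bigr => l _; rewrite /B /D !addoppE mulrBr.
  by rewrite big1// => l _; rewrite B0 mulr0.
have := congr1 (fun M : 'M[R]_N => M i j) (D0 (delta_mx 0 k)).
have pick (b1 : 'I_N -> 'I_N -> 'I_N -> 'rV[R]_N -> R) : bv b1 p (delta_mx 0 k) i j = b1 i j k p.
  rewrite mxE (bigD1 k) //= mxE !eqxx mulr1 big1 ?addr0 // => s /negPf sk.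
  by rewrite mxE sk andbF mulr0.
by rewrite /D !addoppE !pick mxE => /eqP; rewrite subr_eq0 => /eqP.
Qed.

End levi_civita_necessity.

(** * The Jacobi identity at a point where u_x = 0 *)

Section jacobi_germ.
Context {R : realType} {N L : nat} (U : set 'rV[R]_N) (oU : open U).
Variables (G : 'rV[R]_N -> 'M[R]_N) (c : 'I_N -> 'I_N -> 'I_N -> 'rV[R]_N -> R)
  (mu : 'M[R]_L) (w : 'I_L -> 'rV[R]_N -> 'M[R]_N).
Hypotheses (FC : flat_connection U G c) (ws : forall m i j, smooth_on U (fun p => w m p i j))
  (mu_sym : mu^T = mu).

Lemma wm_sum p a : wm w p a = \sum_l a 0 l *: wm w p (delta_mx 0 l).
Proof.
apply/matrixP => m i; rewrite summxE mxE; apply: eq_bigr => l _; rewrite !mxE (bigD1 l) //= mxE !eqxx mulr1.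
by rewrite big1 ?addr0 1?mulrC // => k /negPf kl; rewrite mxE kl andbF mulr0.
Qed.

Lemma gam_sum p a : gam c p a = \sum_l a 0 l *: gam c p (delta_mx 0 l).
Proof.
apply/matrixP => m i; rewrite summxE mxE; apply: eq_bigr => l _; rewrite !mxE (bigD1 l) //= mxE !eqxx mulr1.
by rewrite big1 ?addr0 1?mulrC // => k /negPf kl; rewrite mxE kl andbF mulr0.
Qed.

Lemma dwm_suml p a v : U p -> dwm w p a v = \sum_l a 0 l *: dwm w p (delta_mx 0 l) v.
Proof.
move=> Up; apply/matrixP => m i; rewrite summxE mxE.
under eq_bigr do rewrite (smooth_derive_sum _ oU (ws m i _) Up) mulr_suml.
rewrite exchange_big /=; apply: eq_bigr => l _; rewrite !mxE mulr_sumr; apply: eq_bigr => k _.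
by rewrite mulrA.
Qed.

Lemma dwm_sumr p a v : dwm w p v a = \sum_l a 0 l *: dwm w p v (delta_mx 0 l).
Proof.
apply/matrixP => m i; rewrite summxE mxE; apply: eq_bigr => l _; rewrite !mxE (bigD1 l) //= mxE !eqxx mulr1.
by rewrite big1 ?addr0 1?mulrC // => k /negPf kl; rewrite mxE kl andbF mulr0.
Qed.

Definition codazzi_defect p a v : 'M[R]_(L, N) :=
  dwm w p a v + wm w p v *m gam c p a - (dwm w p v a + wm w p a *m gam c p v).

Lemma codazzi_defect_sum p a v : U p ->
  codazzi_defect p a v = \sum_l a 0 l *: codazzi_defect p (delta_mx 0 l) v.
Proof.
move=> Up; rewrite /codazzi_defect (dwm_suml _ _ Up) (gam_sum p a) (dwm_sumr p a) (wm_sum p a).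
rewrite mulmx_sumr mulmx_suml -!big_split -sumrB /=; apply: eq_bigr => l _.
by rewrite -scalemxAr -scalemxAl -!scalerDr -scalerBr.
Qed.

Lemma form_sum n m (k : 'rV[R]_n) (a : 'rV[R]_N) (M : 'I_N -> 'M[R]_(n, m)) (y : 'cV[R]_m) :
  (k *m (\sum_l a 0 l *: M l) *m y) 0 0 = \sum_l (k *m M l *m y) 0 0 * a 0 l.
Proof.
rewrite mulmx_sumr mulmx_suml summxE; apply: eq_bigr => l _.
by rewrite -scalemxAr -scalemxAl mxE mulrC.
Qed.

Lemma ct_curve0 m n (F : 'I_m -> 'I_n -> 'I_N -> 'rV[R]_N -> R) (u a : R -> 'rV[R]_N) :
  (forall i j k, smooth_on U (F i j k)) -> smooth_field U u -> smooth_map a -> dx u 0 = 0 ->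
  is_derive (0 : R) 1 (fun y => ct F (u y) (a y)) (ct F (u 0) (dx a 0)).
Proof.
move=> Fs uU as_ du0; have := ct_curve oU 0 Fs uU as_; rewrite du0.
have -> : dct F (u 0) 0 (a 0) = 0; last by rewrite add0r.
have [_ uin] := uU; apply/matrixP => i j; rewrite !mxE big1// => k _.
by rewrite (smooth_derive_sum _ oU (Fs i j k) (uin 0)) big1 ?mul0r// => l _; rewrite mxE mul0r.
Qed.

Section along.
Variables (r : R) (u : R -> 'rV[R]_N).
Hypotheses (r0 : 0 <= r) (uU : smooth_field U u).

Let us : smooth_map u. Proof. by case: uU. Qed.
Let uin x : U (u x). Proof. by case: uU. Qed.
Let du : smooth_map (dx u). Proof. exact: smooth_map_dx. Qed.

Notation nab xi := (fun x => dx xi x - xi x *m (gam c (u x) (dx u x))^T).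
Notation Nw := (Nu w r u).
Notation Wx := (Wu w u).
Notation P := (opu G (lcb G c) mu w r u).

Definition dens xi eta x (a : 'rV[R]_N) : R :=
  (Nw eta x *m mu *m codazzi_defect (u x) a (dx u x) *m (xi x)^T) 0 0
  - (Nw eta x *m mu *m wm w (u x) a *m (nab xi x)^T) 0 0
  - (eta x *m (Wx x)^T *m mu *m wm w (u x) a *m (xi x)^T) 0 0.

(** [dens] is linear in [a] and hence a covector, to which the operator can be applied. *)
Definition densv xi eta x : 'rV[R]_N := \row_l dens xi eta x (delta_mx 0 l).

Lemma densvE xi eta x a : (densv xi eta x *m a^T) 0 0 = dens xi eta x a.
Proof.
rewrite /dens (codazzi_defect_sum a (dx u x) (uin x)) (wm_sum (u x) a) !form_sum -!sumrB mxE.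
by apply: eq_bigr => l _; rewrite mxE [_^T _ _]mxE /dens -!mulrBl.
Qed.

Lemma smm_defect a : smooth_map a -> smm (fun x => codazzi_defect (u x) (a x) (dx u x)).
Proof.
move=> as_.
have D1 : smm (fun x => dwm w (u x) (a x) (dx u x)) :=
  dct_smm (F := fun m i k p => w m p i k) oU (fun m i k => ws m i k) uU as_ du.
have D2 : smm (fun x => dwm w (u x) (dx u x) (a x)) :=
  dct_smm (F := fun m i k p => w m p i k) oU (fun m i k => ws m i k) uU du as_.
have swa := smm_wm oU ws uU as_; have sW := smm_W oU ws uU.
exact: smmD (smmD D1 (smm_mul sW (smm_gu oU FC uU as_))) (smmN (smmD D2 (smm_mul swa (smm_gu oU FC uU du)))).
Qed.

Lemma densv_smooth xi eta : smooth_map xi -> smooth_map eta -> smooth_map (densv xi eta).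
Proof.
move=> xs es l; pose a (_ : R) : 'rV[R]_N := delta_mx 0 l.
have as_ : smooth_map a by apply: smooth_map_smm; exact: smm_cst.
under eq_fun do rewrite mxE.
have sN := smm_N oU ws r uU es; have cmu := @smm_cst R _ _ mu; have sW := smm_W oU ws uU.
have swa := smm_wm oU ws uU as_; have nx := smm_nab oU FC uU xs; have xt := smm_tr (smm_map xs).
have S1 := smm_mul (smm_mul (smm_mul sN cmu) (smm_defect as_)) xt.
have S2 := smm_mul (smm_mul (smm_mul sN cmu) swa) (smm_tr nx).
have S3 := smm_mul (smm_mul (smm_mul (smm_mul (smm_map es) (smm_tr sW)) cmu) swa) xt.
have := smmD (smmD S1 (smmN S2)) (smmN S3) 0 0; congr smooth_on; apply/funext => x.
by rewrite !addoppE.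
Qed.

Lemma Sterm_dens a xi eta : smooth_map a -> smooth_map xi -> smooth_map eta -> supp r xi ->
  Sterm c mu w r u a xi eta = Int r (fun x => (densv xi eta x *m (a x)^T) 0 0).
Proof.
move=> as_ xs es xr.
have swa := smm_wm oU ws uU as_; have cmu := @smm_cst R _ _ mu; have sW := smm_W oU ws uU.
have sN := smm_N oU ws r uU es; have V := smm_V oU FC ws uU as_.
have xt := smm_tr (smm_map xs).
have C1 : cont_ballm (r + 1) _ := smm_cont (smm_mul (smm_mul (smm_mul sN cmu) V) xt).
have C2 : cont_ballm (r + 1) _ := smm_cont (smm_mul (smm_map (densv_smooth xs es)) (smm_tr (smm_map as_))).
apply/eqP; rewrite -subr_eq0 -(IntB r0 (C1 0 0) (C2 0 0)); apply/eqP.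
pose Z x := (Nw eta x *m mu *m wm w (u x) (a x) *m (xi x)^T).
have Fd0 (t : R) : `|t| < r + 1 -> is_derive t 1 (fun t => Z t 0 0)
   ((Nw eta t *m mu *m Vu c w u a t *m (xi t)^T) 0 0 - (densv xi eta t *m (a t)^T) 0 0).
  move=> tr.
  have sY : cont_ballm (r + 1) (fun x => eta x *m (Wu w u x)^T) := smm_cont (smm_mul (smm_map es) (smm_tr sW)).
  have dwa : is_derive t 1 (fun y => wm w (u y) (a y))
    (dwm w (u t) (dx u t) (a t) + wm w (u t) (dx a t)) := ct_curve (F := fun m i k p => w m p i k) oU t (fun m i k => ws m i k) uU as_.
  have H := is_derive_mulmx (is_derive_mulmx (is_derive_mulmx (NN_derive sY tr) (is_derive_cst mu t 1)) dwa)
    (is_derive_trmx (smooth_map_derive t xs)).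
  have := is_derive_entry 0 0 H; rewrite -[cst mu t]/mu -/(Nu _ _ _ _) => H'.
  apply: (is_derive_eqv H'); rewrite mulmx0 addr0 densvE /dens.
  have EV : Vu c w u a t = codazzi_defect (u t) (a t) (dx u t) + wm w (u t) (dx a t) +
      (dwm w (u t) (dx u t) (a t) + wm w (u t) (a t) *m gam c (u t) (dx u t)).
    rewrite /codazzi_defect /Vu /dW /Wu /gu.
    by rewrite [RHS]addrAC subrK addrAC.
  rewrite EV.
  move: (Nw eta t) (wm w (u t) (a t)) (wm w (u t) (dx a t)) (dwm w (u t) (dx u t) (a t)) (codazzi_defect _ _ _) => n1 wa wda dw cd.
  rewrite trDE trNE trmx_mul trmxK !(mulmxDl, mulmxDr, mulmxN, mulmxA) !addoppE /Wu.
  by ring.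
rewrite (Int_derive r0 (cont_ballD (C1 0 0) (cont_ballN (C2 0 0))) Fd0) /Z.
have rr : r <= `|r| by rewrite ger0_norm.
have rr' : r <= `|- r| by rewrite normrN ger0_norm.
by rewrite !(xr _ rr) !(xr _ rr') trmx0 !mulmx0 mxE subrr.
Qed.

Lemma densv_supp xi eta x : xi x = 0 -> dx xi x = 0 -> densv xi eta x = 0.
Proof.
move=> x0 d0; apply/rowP => l; rewrite mxE /dens x0 d0 trmx0 !mulmx0 mul0mx subr0 trmx0 mulmx0.
by rewrite !mxE !subr0.
Qed.

Section germ.
Hypothesis du0 : dx u 0 = 0.
Let z := dx (dx u) 0.

Lemma wm_du0 : Wx 0 = 0. Proof. by rewrite /Wu du0; exact: (ct0 (fun m i k p => w m p i k)). Qed.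

Lemma gam_du0 : gam c (u 0) (dx u 0) = 0. Proof. by rewrite du0; exact: (ct0 (fun s i k => c i s k)). Qed.

Lemma Wu_derive0 : is_derive (0 : R) 1 Wx (wm w (u 0) z).
Proof. exact: (ct_curve0 (F := fun m i k p => w m p i k) (fun m i k => ws m i k) uU du du0). Qed.

Lemma wm_derive0 (a : 'rV[R]_N) : is_derive (0 : R) 1 (fun x => wm w (u x) a) 0.
Proof.
have as_ : smooth_map (fun _ : R => a) by apply: smooth_map_smm; exact: smm_cst.
have := ct_curve0 (F := fun m i k p => w m p i k) (fun m i k => ws m i k) uU as_ du0.
have -> : dx (fun _ : R => a) 0 = 0 by apply: is_derive_eq_dx; exact: is_derive_cst.
by rewrite ct0.
Qed.

Lemma gam_derive0 (a : 'rV[R]_N) : is_derive (0 : R) 1 (fun x => gam c (u x) a) 0.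
Proof.
have as_ : smooth_map (fun _ : R => a) by apply: smooth_map_smm; exact: smm_cst.
have := ct_curve0 (F := fun s i k => c i s k) (fun s i k => fc_c FC i s k) uU as_ du0.
have -> : dx (fun _ : R => a) 0 = 0 by apply: is_derive_eq_dx; exact: is_derive_cst.
by rewrite ct0.
Qed.

Lemma gam_dx_derive0 : is_derive (0 : R) 1 (fun x => gam c (u x) (dx u x)) (gam c (u 0) z).
Proof. exact: (ct_curve0 (F := fun s i k => c i s k) (fun s i k => fc_c FC i s k) uU du du0). Qed.

(** The defect is linear in u_x, which vanishes at 0, so only the derivative of u_x contributes. *)
Lemma defect_derive0 (a : 'rV[R]_N) :
  is_derive (0 : R) 1 (fun x => codazzi_defect (u x) a (dx u x)) (codazzi_defect (u 0) a z).
Proof.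
pose F1 m i k p := 'D_a (fun q => w m q i k) p.
have F1s m i k : smooth_on U (F1 m i k) by exact: smooth_onD (ws m i k).
pose F2 m i l p := \sum_k 'D_(delta_mx 0 l) (fun q => w m q i k) p * a 0 k.
have F2s m i k : smooth_on U (F2 m i k).
  apply: (smooth_on_sum oU) => l; apply: (smooth_onM oU); first exact: smooth_onD (ws m i l).
  exact: (smooth_cst_set oU).
have F2E p v : U p -> dwm w p v a = ct F2 p v.
  move=> Up; apply/matrixP => m i; rewrite !mxE.
  under eq_bigr do rewrite (smooth_derive_sum _ oU (ws m i _) Up) mulr_suml.
  rewrite exchange_big /=; apply: eq_bigr => l _; rewrite /F2 mulr_suml; apply: eq_bigr => k _; rewrite /pd; ring.
have E x : codazzi_defect (u x) a (dx u x) = ct F1 (u x) (dx u x) + wm w (u x) (dx u x) *m gam c (u x) a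
    - (ct F2 (u x) (dx u x) + wm w (u x) a *m gam c (u x) (dx u x)).
  by rewrite /codazzi_defect (F2E _ _ (uin x)).
under eq_fun do rewrite E.
have H1 := ct_curve0 F1s uU du du0; have H2 := ct_curve0 F2s uU du du0.
have M1 := is_derive_mulmx Wu_derive0 (gam_derive0 a).
have M2 := is_derive_mulmx (wm_derive0 a) gam_dx_derive0.
have := is_deriveB (is_deriveD H1 M1) (is_deriveD H2 M2).
move=> H; apply: (is_derive_eqg H).
by rewrite wm_du0 !mul0mx addr0 add0r /codazzi_defect (F2E _ _ (uin 0)).
Qed.

Lemma nab_derive0 xi : smooth_map xi ->
  is_derive (0 : R) 1 (nab xi) (dx (dx xi) 0 - xi 0 *m (gam c (u 0) z)^T).
Proof.
move=> xs; have H1 := smooth_map_derive 0 (smooth_map_dx xs).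
have H2 := is_derive_mulmx (smooth_map_derive 0 xs) (is_derive_trmx gam_dx_derive0).
by have := is_deriveB H1 H2; rewrite gam_du0 trmx0 mulmx0 add0r.
Qed.

Lemma Nu_derive0 eta : smooth_map eta -> is_derive (0 : R) 1 (Nw eta) 0.
Proof.
move=> es; have sY : cont_ballm (r + 1) (fun x => eta x *m (Wu w u x)^T) :=
  smm_cont (smm_mul (smm_map es) (smm_tr (smm_W oU ws uU))).
have n0 : `|0 : R| < r + 1 by rewrite normr0 ltr_wpDl.
by have := NN_derive sY n0; rewrite wm_du0 trmx0 mulmx0.
Qed.

(** The derivative of [dens] at 0. Everything that carries a factor u_x is replaced by its value on
    z = u_xx, and the antiderivative behaves as a constant because [W] vanishes at 0. *)
Definition dens' xi eta (a : 'rV[R]_N) : R :=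
  (Nw eta 0 *m mu *m codazzi_defect (u 0) a z *m (xi 0)^T) 0 0
  - (Nw eta 0 *m mu *m wm w (u 0) a *m (dx (dx xi) 0 - xi 0 *m (gam c (u 0) z)^T)^T) 0 0
  - (eta 0 *m (wm w (u 0) z)^T *m mu *m wm w (u 0) a *m (xi 0)^T) 0 0.

Lemma dens_derive0 xi eta a : smooth_map xi -> smooth_map eta ->
  is_derive (0 : R) 1 (fun x => dens xi eta x a) (dens' xi eta a).
Proof.
move=> xs es; have N0 := Nu_derive0 es; have m0 := is_derive_cst mu (0 : R) 1.
have x0 := is_derive_trmx (smooth_map_derive 0 xs).
have T1 := is_derive_entry 0 0 (is_derive_mulmx (is_derive_mulmx (is_derive_mulmx N0 m0) (defect_derive0 a)) x0).
have T2 := is_derive_entry 0 0 (is_derive_mulmx (is_derive_mulmx (is_derive_mulmx N0 m0) (wm_derive0 a))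
  (is_derive_trmx (nab_derive0 xs))).
have T3 := is_derive_entry 0 0 (is_derive_mulmx (is_derive_mulmx (is_derive_mulmx (is_derive_mulmx (smooth_map_derive 0 es)
  (is_derive_trmx Wu_derive0)) m0) (wm_derive0 a)) x0).
have := is_deriveB (is_deriveB T1 T2) T3.
have -> : codazzi_defect (u 0) a (dx u 0) = 0.
  have e1 : wm w (u 0) (dx u 0) = 0 := wm_du0.
  rewrite /codazzi_defect gam_du0 e1 mulmx0 mul0mx !addr0 du0 (dwm_suml 0 _ (uin 0)).
  have -> : dwm w (u 0) a 0 = 0 by exact: (dct0r (fun m i k p => w m p i k)).
  by rewrite big1 ?subrr // => l _; rewrite mxE scale0r.
move=> H; apply: (is_derive_eqg H); rewrite wm_du0 trmx0 /dens' -[cst mu 0]/mu.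
by rewrite !(mulmx0, mul0mx, addr0, add0r).
Qed.

Lemma dens'E xi eta (a : 'rV[R]_N) :
  ((\row_l dens' xi eta (delta_mx 0 l)) *m a^T) 0 0 = dens' xi eta a.
Proof.
rewrite /dens' (codazzi_defect_sum a z (uin 0)) (wm_sum (u 0) a) !form_sum -!sumrB mxE.
by apply: eq_bigr => l _; rewrite mxE [_^T _ _]mxE /dens' -!mulrBl.
Qed.

Lemma dx_densv0 xi eta : smooth_map xi -> smooth_map eta ->
  dx (densv xi eta) 0 = \row_l dens' xi eta (delta_mx 0 l).
Proof.
move=> xs es; apply: is_derive_eq_dx; apply: is_derive_mx => i l; rewrite (ord1 i) mxE.
by under eq_fun do rewrite mxE; exact: dens_derive0.
Qed.

Lemma dx_opu0 eta : smooth_map eta ->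
  dx (P eta) 0 = (dx (dx eta) 0 - eta 0 *m (gam c (u 0) z)^T) *m G (u 0) + Nw eta 0 *m mu *m wm w (u 0) z.
Proof.
move=> es; have E x := opu_lcb mu w FC r uU eta x.
have -> : P eta = fun x => nab eta x *m G (u x) + Nw eta x *m mu *m Wx x by apply/funext => x; rewrite E.
apply: is_derive_eq_dx.
have dG : is_derive (0 : R) 1 (fun x => G (u x)) 0.
  have := dmx_curve oU 0 (fc_G FC) uU; rewrite (fc_met FC _ (uin 0)) gam_du0 trmx0 mul0mx mulmx0 oppr0 addr0.
  by [].
have H1 := is_derive_mulmx (nab_derive0 es) dG.
have H2 := is_derive_mulmx (is_derive_mulmx (Nu_derive0 es) (is_derive_cst mu (0 : R) 1)) Wu_derive0.
apply: (is_derive_eqg (is_deriveD H1 H2)).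
have alg (A B C : 'rV[R]_N) (k : 'rV[R]_L) (W : 'M[R]_(L, N)) :
    W = 0 -> A + B *m (0 : 'M[R]_N) + ((0 *m mu + k *m (0 : 'M[R]_L)) *m W + C) = A + C.
  by move=> ->; rewrite !mulmx0 addr0 add0r.
exact (alg _ _ _ _ _ wm_du0).
Qed.

Lemma Vu0 a : Vu c w u a 0 = wm w (u 0) (dx a 0).
Proof.
rewrite /Vu /dW wm_du0 mul0mx addr0 du0.
have -> : dwm w (u 0) (a 0) 0 = 0 by exact: (dct0r (fun m i k p => w m p i k)).
by rewrite add0r.
Qed.

End germ.
End along.

Hypothesis ham : hamiltonian U (hydro_op G (lcb G c) mu w).
Variables (s : R) (u xi eta : R -> 'rV[R]_N).
Hypotheses (s1 : 1 <= s) (uU : smooth_field U u) (xs : smooth_map xi) (es : smooth_map eta)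
  (xr : forall x, s < `|x| -> xi x = 0) (er : forall x, s < `|x| -> eta x = 0)
  (du0 : dx u 0 = 0).

Notation r := (s + 1).
Notation P := (hop G (lcb G c) mu w u).
Notation opP := (opu G (lcb G c) mu w r u).
Notation Nw := (Nu w r u).
Notation Wx := (Wu w u).
Notation V := (Vu c w u).

Let s0 : 0 <= s. Proof. exact: le_trans ler01 s1. Qed.
Let r0 : 0 <= r. Proof. by rewrite addr_ge0. Qed.
Let us : smooth_map u. Proof. by case: uU. Qed.

Let supr (f : R -> 'rV[R]_N) : (forall x, s < `|x| -> f x = 0) -> supp r f.
Proof. by move=> fr x rx; apply: fr; rewrite (lt_le_trans _ rx)// ltrDl. Qed.

Lemma supp_densv f h : smooth_map f -> (forall x, s < `|x| -> f x = 0) -> supp r (densv r u f h).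
Proof.
move=> fs fr x rx; have sx : s < `|x| by rewrite (lt_le_trans _ rx)// ltrDl.
apply: densv_supp; first exact: fr.
have oO : open [set y : R | s < `|y|].
  have -> : [set y : R | s < `|y|] = (fun y : R => `|y|) @^-1` [set z | s < z] by [].
  by apply: open_comp; [move=> y _; exact: norm_continuous|exact: open_gt].
apply: is_derive_eq_dx; apply: (near_eq_is_derive _ (is_derive_cst (0 : 'rV[R]_N) x 1)).
by apply: (near_open oO sx) => y /fr ->.
Qed.

(** The Jacobi identity for three linear functionals with every operator and antiderivative moved
    off [zeta]; [jac] is the coefficient of [zeta] in the resulting integral. *)
Definition jac x : 'rV[R]_N :=
  opP (densv r u eta xi) x - opP (densv r u xi eta) x
  - NN r (fun y => eta y *m (V (P xi) y)^T) x *m mu *m Wx x - Nw eta x *m mu *m V (P xi) x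
  + Nw xi x *m mu *m V (P eta) x + NN r (fun y => xi y *m (V (P eta) y)^T) x *m mu *m Wx x.

Let sxi := supr xr.
Let seta := supr er.

Let Pxs : smooth_map (P xi) := P_smooth oU mu FC ws r0 uU xs sxi.
Let Pes : smooth_map (P eta) := P_smooth oU mu FC ws r0 uU es seta.

Lemma smm_jac : smm jac.
Proof.
have cmu := @smm_cst R _ _ mu; have sW := smm_W oU ws uU.
have Vx := smm_V oU FC ws uU Pxs; have Ve := smm_V oU FC ws uU Pes.
have d1 := smm_P oU mu FC ws r uU (densv_smooth r uU es xs).
have d2 := smm_P oU mu FC ws r uU (densv_smooth r uU xs es).
have n1 := smm_mul (smm_mul (smm_NN r (smm_mul (smm_map es) (smm_tr Vx))) cmu) sW.
have n2 := smm_mul (smm_mul (smm_NN r (smm_mul (smm_map xs) (smm_tr Ve))) cmu) sW.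
have m1 := smm_mul (smm_mul (smm_N oU ws r uU es) cmu) Vx.
have m2 := smm_mul (smm_mul (smm_N oU ws r uU xs) cmu) Ve.
exact: smmD (smmD (smmD (smmD (smmD d1 (smmN d2)) (smmN n1)) (smmN m1)) m2) n2.
Qed.

Lemma Int_jac zeta : smooth_map zeta -> (forall x, s < `|x| -> zeta x = 0) ->
  Int r (fun x => (zeta x *m (jac x)^T) 0 0) = 0.
Proof.
move=> zs zr; have szeta := supr zr.
have cmu := @smm_cst R _ _ mu; have sW := smm_W oU ws uU.
have Vx := smm_V oU FC ws uU Pxs; have Ve := smm_V oU FC ws uU Pes.
have D1 := densv_smooth r uU es xs; have D2 := densv_smooth r uU xs es.
have d1 := smm_P oU mu FC ws r uU D1; have d2 := smm_P oU mu FC ws r uU D2.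
have n1 := smm_mul (smm_mul (smm_NN r (smm_mul (smm_map es) (smm_tr Vx))) cmu) sW.
have n2 := smm_mul (smm_mul (smm_NN r (smm_mul (smm_map xs) (smm_tr Ve))) cmu) sW.
have m1 := smm_mul (smm_mul (smm_N oU ws r uU es) cmu) Vx.
have m2 := smm_mul (smm_mul (smm_N oU ws r uU xs) cmu) Ve.
have K f (Hf : smm (f : R -> 'rV[R]_N)) :
    cont_ball (r + 1) (fun x => (zeta x *m (f x)^T) 0 0) := smm_cont (smm_mul (smm_map zs) (smm_tr Hf)) (i := 0) (j := 0).
have c1 := K _ d1; have c2 := K _ d2; have c3 := K _ n1; have c4 := K _ m1; have c5 := K _ m2; have c6 := K _ n2.
have C2 := cont_ballD c1 (cont_ballN c2); have C3 := cont_ballD C2 (cont_ballN c3).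
have C4 := cont_ballD C3 (cont_ballN c4); have C5 := cont_ballD C4 c5.
have dist (y A1 A2 A3 A4 A5 A6 : 'rV[R]_N) : (y *m (A1 - A2 - A3 - A4 + A5 + A6)^T) 0 0 =
    (y *m A1^T) 0 0 - (y *m A2^T) 0 0 - (y *m A3^T) 0 0 - (y *m A4^T) 0 0 + (y *m A5^T) 0 0 + (y *m A6^T) 0 0.
  by rewrite !trDE !trNE !mulmxDr !mulmxN !addoppE.
have E0 : Int r (fun x => (zeta x *m (jac x)^T) 0 0) =
   Int r (fun x => (zeta x *m (opP (densv r u eta xi) x)^T) 0 0) - Int r (fun x => (zeta x *m (opP (densv r u xi eta) x)^T) 0 0)
   - Int r (fun x => (zeta x *m (NN r (fun y => eta y *m (V (P xi) y)^T) x *m mu *m Wx x)^T) 0 0)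
   - Int r (fun x => (zeta x *m (Nw eta x *m mu *m V (P xi) x)^T) 0 0)
   + Int r (fun x => (zeta x *m (Nw xi x *m mu *m V (P eta) x)^T) 0 0)
   + Int r (fun x => (zeta x *m (NN r (fun y => xi y *m (V (P eta) y)^T) x *m mu *m Wx x)^T) 0 0).
  rewrite -(IntB r0 c1 c2) -(IntB r0 C2 c3) -(IntB r0 C3 c4) -(IntD r0 C4 c5) -(IntD r0 C5 c6).
  apply: (eq_Int r0) => x _; rewrite /jac.
  exact: dist.
have Pzs : smooth_map (P zeta) := P_smooth oU mu FC ws r0 uU zs szeta.
have dens_int f h : smooth_map f -> smooth_map h -> (forall x, s < `|x| -> f x = 0) ->
    Sterm c mu w r u (P zeta) f h = - Int r (fun x => (zeta x *m (opP (densv r u f h) x)^T) 0 0).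
  move=> fs hs fr; have D := densv_smooth r uU fs hs.
  apply: (etrans (Sterm_dens r0 uU Pzs fs hs (supr fr))).
  have sD : supp r (densv r u f h) by exact: (supp_densv h fs fr).
  have sk := P_skew oU FC ws mu_sym r0 uU D zs sD szeta.
  apply: (etrans _ sk).
  apply: (eq_Int r0) => x xr1; rewrite (hop_opu oU G c ws mu_sym r0 uU zs szeta)//.
  by rewrite (le_lt_trans xr1)// ltrDl.
have loc a h : Int r (fun x => (zeta x *m (Nw h x *m mu *m V a x)^T) 0 0) = Sterm c mu w r u a zeta h.
  by apply: (eq_Int r0) => x _; rewrite [LHS]sc_tr trmx_mul trmxK.
have p1 := S_parts oU FC ws mu_sym r0 uU Pxs zs es szeta seta.
have p2 := S_parts oU FC ws mu_sym r0 uU Pes zs xs szeta sxi.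
pose FI := linear_functional U s0 xs xr; pose FJ := linear_functional U s0 es er; pose FK := linear_functional U s0 zs zr.
have rs : s < r by rewrite ltrDl.
have [_ ja] := ham.
have J := jacobi_reduction oU FC ws mu_sym r0 uU (I := FI) (J := FJ) (K := FK) rs rs rs.
have alg (E a1 a2 a3 a4 a5 a6 t1 t2 t3 t4 t5 t6 o : R) :
  E = a1 - a2 - a3 - a4 + a5 + a6 -> t1 = - a2 -> t2 = - a1 -> a3 = - t3 -> a4 = t4 -> a5 = t5 -> a6 = - t6 ->
  o = (t1 - t2) + (t3 - t4) + (t5 - t6) -> o = 0 -> E = 0.
  by move=> -> -> -> -> -> -> -> -> <-; ring.
exact (alg _ _ _ _ _ _ _ _ _ _ _ _ _ _ E0 (dens_int _ _ xs es xr) (dens_int _ _ es xs er) p1 (loc _ _) (loc _ _) p2 J (ja FI FJ FK u uU)).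
Qed.

Lemma jac0 : jac 0 = 0.
Proof.
apply/rowP => l; rewrite [RHS]mxE; apply: (@fundamental R r 0 (fun x => jac x 0 l) r0).
- by rewrite normr0 ltr_wpDl.
- exact: smm_cont smm_jac 0 l.
move=> d d0; pose e := Num.min d 1; have e0 : 0 < e by rewrite lt_min d0 ltr01.
pose h := cutoff (0 : R) e; have hs : smooth_on [set: R] h := cutoff_smooth 0 e.
have h_out x : e <= `|x| -> h x = 0 by move=> ex; rewrite /h cutoff0// subr0.
exists h; first split.
- exact: smooth_on_cont_ball hs.
- by move=> x; have /andP[] := cutoff_in01 0 e x.
- rewrite /h cutoff1 ?oner_neq0// subrr normr0; exact: ltW (divr_gt0 e0 (ltr0Sn _ 1)).
- by move=> x; rewrite subr0 => dx_; rewrite h_out// ge_min dx_.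
have zr (x : R) : s < `|x| -> sv h (delta_mx 0 l) x = 0.
  move=> sx; rewrite /sv h_out ?scale0r//; apply: le_trans (le_trans s1 (ltW sx)).
  by rewrite ge_min lexx orbT.
have ev (y : R) (v : 'rV[R]_N) : y * v 0 l = ((y *: (delta_mx 0 l : 'rV[R]_N)) *m v^T) 0 0.
  by rewrite -scalemxAl mxZE -rowE !mxE.
have := Int_jac (sv_smooth (delta_mx 0 l) hs) zr.
move=> H; apply: (etrans _ H); apply: (eq_Int r0) => x _.
exact: ev.
Qed.

(** At 0 the terms of [jac] with the factor [W] vanish, and the local operator reduces to a
    derivative followed by the metric; [a] is the l-th basis covector raised. *)
Lemma jacobi_germ l : let a := (delta_mx 0 l : 'rV[R]_N) *m G (u 0) in
  let z := dx (dx u) 0 in let p := u 0 in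
  let A f := (dx (dx f) 0 - f 0 *m (gam c p z)^T) *m G p + Nw f 0 *m mu *m wm w p z in
  dens' r u eta xi a - dens' r u xi eta a
  - (Nw eta 0 *m mu *m wm w p (A xi)) 0 l + (Nw xi 0 *m mu *m wm w p (A eta)) 0 l = 0.
Proof.
move=> a z p A; have := congr1 (fun v : 'rV[R]_N => v 0 l) jac0; rewrite [RHS]mxE => H.
have DA f : smooth_map f -> supp r f -> dx (P f) 0 = A f.
  move=> fs fr; apply: (etrans _ (dx_opu0 r0 uU du0 fs)).
  apply: is_derive_eq_dx; have sP := smooth_map_smm (smm_P oU mu FC ws r uU fs).
  apply: (near_eq_is_derive _ (smooth_map_derive 0 sP)).
  have r1 : 0 < r + 1 by rewrite ltr_wpDl.
  by apply: filterS (@near0_norm_lt R R (r + 1) r1) => y yr; rewrite (hop_opu oU G c ws mu_sym r0 uU fs fr).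
have O f h : smooth_map f -> smooth_map h -> (opP (densv r u f h) 0) 0 l = dens' r u f h a.
  move=> fs hs; rewrite (opu_lcb mu w FC r uU) (wm_du0 du0) mulmx0 addr0 (gam_du0 du0) trmx0 mulmx0 subr0.
  rewrite (dx_densv0 r0 uU du0 fs hs) -(dens'E r uU f h a); have [_ uin] := uU.
  rewrite /a trmx_mul (fc_sym FC (uin 0)) mulmxA trmx_delta -colE [RHS]mxE.
  by [].
have V1 : V (P xi) 0 = wm w p (A xi) by rewrite (Vu0 du0) (DA _ xs sxi).
have V2 : V (P eta) 0 = wm w p (A eta) by rewrite (Vu0 du0) (DA _ es seta).
have alg (A1 A2 A3 A4 : 'rV[R]_N) (k1 k2 : 'rV[R]_L) (W : 'M[R]_(L, N)) :
   W = 0 -> (A1 - A2 - k1 *m mu *m W - A3 + A4 + k2 *m mu *m W) 0 l = A1 0 l - A2 0 l - A3 0 l + A4 0 l.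
  by move=> ->; rewrite !mulmx0 subr0 addr0 !addoppE.
have E := alg (opP (densv r u eta xi) 0) (opP (densv r u xi eta) 0) (Nw eta 0 *m mu *m V (P xi) 0) (Nw xi 0 *m mu *m V (P eta) 0)
  (NN r (fun y => eta y *m (V (P xi) y)^T) 0) (NN r (fun y => xi y *m (V (P eta) y)^T) 0) _ (wm_du0 du0).
rewrite -(O _ _ es xs) -(O _ _ xs es) -V1 -V2; exact (etrans (esym E) H).
Qed.

End jacobi_germ.

(** * Curves in U with prescribed jets *)

Section joined.
Context {R : realType} {N : nat} (U : set 'rV[R]_N) (oU : open U).

Lemma smooth_mapD (f h : R -> 'rV[R]_N) : smooth_map f -> smooth_map h -> smooth_map (fun x => f x + h x).
Proof. by move=> fs hs; apply: smooth_map_smm; exact: smmD (smm_map fs) (smm_map hs). Qed.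

Lemma smooth_map_cst (v : 'rV[R]_N) : smooth_map (fun _ : R => v).
Proof. by apply: smooth_map_smm; exact: smm_cst. Qed.

Lemma smooth_map_affine (f : R -> 'rV[R]_N) (k m : R) : smooth_map f -> smooth_map (fun x => f (k * x + m)).
Proof.
move=> fs i; have h : smooth_on [set: R] (fun x : R => k * x + m).
  exact: (smR_D (smR_M (smR_cst k) smR_id) (smR_cst m)).
exact: (smR_comp (fs i) h).
Qed.

(** The path is constant outside [0, 1], so that consecutive paths fit together smoothly. *)
Definition joined p q := exists s : R -> 'rV[R]_N,
  [/\ smooth_field U s, forall x, x <= 0 -> s x = p & forall x, 1 <= x -> s x = q].

Lemma joined_sym p q : joined p q -> joined q p.
Proof.
move=> [s [[ss sU] s0 s1]]; exists (fun x => s (-1 * x + 1)); split.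
- by split; [exact: smooth_map_affine|move=> x; exact: sU].
- by move=> x x0; apply: s1; lra.
- by move=> x x1; apply: s0; lra.
Qed.

Lemma joined_trans p q t : joined p q -> joined q t -> joined p t.
Proof.
move=> [s [[ss sU] s0 s1]] [s' [[ss' sU'] s0' s1']].
(* Adding the two paths and subtracting the common point glues them without a case distinction: on
   either half one of them equals [q]. *)
exists (fun x => s (2 * x + 0) + s' (2 * x + -1) + - q); split.
- split; first exact: (smooth_mapD (smooth_mapD (smooth_map_affine 2 0 ss) (smooth_map_affine 2 (-1) ss')) (smooth_map_cst (- q))).
  move=> x; have [x1|x1] := leP x 2^-1.
    by rewrite s0' ?addrK; [exact: sU|lra].
  by rewrite s1 1?addrC ?addKr; [exact: sU'|lra].
- by move=> x x0; rewrite s0 ?s0' ?addrK//; lra.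
- by move=> x x0; rewrite s1 ?s1'; [rewrite addrC addKr|lra|lra].
Qed.

Lemma joined_near p : U p -> exists2 e : R, 0 < e & forall q, `|q - p| < e -> joined p q.
Proof.
move=> Up; have [e e0 He] := near_norm_ball (open_nbhs_nbhs (conj oU Up)); exists e => // q qp.
exists (fun x => p + sstep x *: (q - p)); split.
- split.
    apply: (smooth_mapD (smooth_map_cst p)); exact: (sv_smooth (q - p) (@sstep_smooth R)).
  move=> x; apply: He; rewrite addrAC subrr add0r normrZ.
  have /andP[s0 s1] := sstep_in01 x; rewrite ger0_norm//; apply: le_lt_trans qp.
  by rewrite -[leRHS]mul1r ler_wpM2r.
- by move=> x x0; rewrite sstep0// scale0r addr0.
- by move=> x x1; rewrite sstep1// scale1r addrC subrK.
Qed.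

Lemma connected_joined p q : connected U -> U p -> U q -> joined p q.
Proof.
move=> cU Up Uq; pose A : set 'rV[R]_N := [set t | U t /\ joined p t].
pose A' : set 'rV[R]_N := [set t | U t /\ ~ joined p t].
have near t : U t -> \forall s \near t, U s /\ joined t s.
  move=> Ut; have [e e0 He] := joined_near Ut.
  have N1 : \forall s \near t, U s by exact: (open_nbhs_nbhs (conj oU Ut)).
  apply: filterS2 N1 (nbhsx_ballx t e e0) => s Us.
  by rewrite -ball_normE /= distrC => /He.
have oA : open A.
  rewrite openE => t [Ut pt]; apply: filterS (near t Ut) => s [Us ts].
  by split=> //; exact: joined_trans pt ts.
have oA' : open A'.
  rewrite openE => t [Ut pt]; apply: filterS (near t Ut) => s [Us ts].
  by split=> // ps; apply: pt; exact: joined_trans ps (joined_sym ts).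
have AU : A = U.
  apply: cU.
  - by exists p; split=> //; have [e e0 He] := joined_near Up; apply: He; rewrite subrr normr0.
  - by exists A => //; apply/seteqP; split=> [t [Ut pt]|t []//].
  - exists (~` A'); first exact: open_closedC.
    apply/seteqP; split=> [t [Ut pt]|t [Ut nt]]; first by split=> // -[_].
    by split=> //; apply: contrapT => h; apply: nt.
by move: Uq; rewrite -AU => -[].
Qed.

Lemma jet_translate (u f : R -> 'rV[R]_N) (d x0 : R) : 0 < d -> smooth_map f ->
  (forall x, `|x - x0| < d -> u x = f (x + - x0)) ->
  [/\ u x0 = f 0, dx u x0 = dx f 0 & dx (dx u) x0 = dx (dx f) 0].
Proof.
move=> d0 fs uf; have D (h : R -> 'rV[R]_N) (x : R) : smooth_map h -> is_derive x 1 (fun y => h (y + - x0)) (dx h (x + - x0)).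
  move=> hs; apply: is_derive_mx => i j; rewrite (ord1 i).
  have H0 : is_derive x 1 (fun y : R => y + - x0) (1 : R).
    by have := is_deriveD (is_derive_id x 1) (is_derive_cst (- x0) x 1); rewrite addr0.
  have H1 := is_derive_entry 0 j (smooth_map_derive (x + - x0) hs).
  by have := @is_derive1_comp _ _ (fun y => y + - x0) _ _ _ H1 H0; rewrite mulr1.
have n (x : R) : `|x - x0| < d -> \forall y \near x, `|y - x0| < d.
  move=> xd; exists (d - `|x - x0|); first by rewrite /= subr_gt0.
  move=> y; rewrite /= => xy; have := ler_distD x y x0; rewrite distrC in xy; lra.
have E (x : R) : `|x - x0| < d -> dx u x = dx f (x + - x0).
  move=> xd; apply: is_derive_eq_dx; apply: (near_eq_is_derive _ (D f x fs)).
  by apply: filterS (n x xd) => y /uf ->.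
have z : `|x0 - x0| < d by rewrite subrr normr0.
split; [by rewrite uf // subrr|by rewrite E // subrr|].
apply: is_derive_eq_dx; have H := D _ x0 (smooth_map_dx fs); rewrite subrr in H.
apply: (near_eq_is_derive _ H).
by apply: filterS (n x0 z) => y /E ->.
Qed.

Lemma curve_through p z q1 a1 q2 a2 : connected U -> U p -> U q1 -> U q2 ->
  exists u : R -> 'rV[R]_N, [/\ smooth_field U u,
    [/\ u 0 = p, dx u 0 = 0 & dx (dx u) 0 = z], u 1 = q1 /\ dx u 1 = a1 & u 2 = q2 /\ dx u 2 = a2].
Proof.
move=> cU Up U1 U2; have d0 : (0 : R) < 4^-1 by rewrite invr_gt0.
have [f0 [[f0s f0U] f00 f01 f02 f0o]] := germ_curve 0 z oU Up d0.
have [f1 [[f1s f1U] f10 f11 _ f1o]] := germ_curve a1 0 oU U1 d0.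
have [f2 [[f2s f2U] f20 f21 _ f2o]] := germ_curve a2 0 oU U2 d0.
have [s1 [[s1s s1U] s10 s11]] := connected_joined cU Up U1.
have [s2 [[s2s s2U] s20 s21]] := connected_joined cU U1 U2.
have tr (f : R -> 'rV[R]_N) (m : R) : smooth_map f -> smooth_map (fun x => f (x + m)).
  by move=> fs; have := smooth_map_affine 1 m fs; under eq_fun do rewrite mul1r.
(* On each of the five intervals cut at 1/4, 3/4, 5/4 and 7/4 all summands but one are constant and
   the constants cancel; the germs occupy the first, third and fifth, the connecting paths the other
   two. *)
pose u x := f0 x + (s1 (2 * x + - 2^-1) - p) + (f1 (x + - 1) - q1) + (s2 (2 * x + - (5 / 2)) - q1) + (f2 (x + - 2) - q2).
have us : smooth_map u.
  have cst := @smooth_map_cst.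
  have t1 := smooth_mapD (smooth_map_affine 2 (- 2^-1) s1s) (cst (- p)).
  have t2 := smooth_mapD (tr _ (-1) f1s) (cst (- q1)).
  have t3 := smooth_mapD (smooth_map_affine 2 (- (5 / 2)) s2s) (cst (- q1)).
  have t4 := smooth_mapD (tr _ (-2) f2s) (cst (- q2)).
  exact: (smooth_mapD (smooth_mapD (smooth_mapD (smooth_mapD f0s t1) t2) t3) t4).
have out (f : R -> 'rV[R]_N) q (x : R) : (forall x, 4^-1 <= `|x| -> f x = q) -> x <= - 4^-1 \/ 4^-1 <= x -> f x = q.
  by move=> h hx; apply: h; rewrite ler_normr; apply/orP; case: hx; [right|left]; lra.
have o0 (x : R) : 4^-1 <= x -> f0 x = p by move=> h; apply: (out f0) => //; right.
have l1 (x : R) : x <= 3 / 4 -> f1 (x + - 1) = q1 by move=> h; apply: (out f1) => //; left; lra.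
have r1 (x : R) : 5 / 4 <= x -> f1 (x + - 1) = q1 by move=> h; apply: (out f1) => //; right; lra.
have l2 (x : R) : x <= 7 / 4 -> f2 (x + - 2) = q2 by move=> h; apply: (out f2) => //; left; lra.
have z1 (x : R) : x <= 4^-1 -> s1 (2 * x + - 2^-1) = p by move=> h; apply: s10; lra.
have w1 (x : R) : 3 / 4 <= x -> s1 (2 * x + - 2^-1) = q1 by move=> h; apply: s11; lra.
have z2 (x : R) : x <= 5 / 4 -> s2 (2 * x + - (5 / 2)) = q1 by move=> h; apply: s20; lra.
have w2 (x : R) : 7 / 4 <= x -> s2 (2 * x + - (5 / 2)) = q2 by move=> h; apply: s21; lra.
have R0 (x : R) : x <= 4^-1 -> u x = f0 x.
  move=> h; have [h1 h2 h3] : [/\ x <= 3 / 4, x <= 5 / 4 & x <= 7 / 4] by split; lra.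
  by rewrite /u (z1 x h) (l1 x h1) (z2 x h2) (l2 x h3) !subrr !addr0.
have R1 (x : R) : 4^-1 <= x -> x <= 3 / 4 -> u x = s1 (2 * x + - 2^-1).
  move=> h h1; have [h2 h3] : x <= 5 / 4 /\ x <= 7 / 4 by split; lra.
  by rewrite /u (o0 x h) (l1 x h1) (z2 x h2) (l2 x h3) !subrr !addr0 addrC subrK.
have R2 (x : R) : 3 / 4 <= x -> x <= 5 / 4 -> u x = f1 (x + - 1).
  move=> h h1; have [h2 h3] : 4^-1 <= x /\ x <= 7 / 4 by split; lra.
  by rewrite /u (o0 x h2) (w1 x h) (z2 x h1) (l2 x h3) !subrr !addr0 [p + _]addrC subrK addrC subrK.
have R3 (x : R) : 5 / 4 <= x -> x <= 7 / 4 -> u x = s2 (2 * x + - (5 / 2)).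
  move=> h h1; have [h2 h3] : 4^-1 <= x /\ 3 / 4 <= x by split; lra.
  by rewrite /u (o0 x h2) (w1 x h3) (r1 x h) (l2 x h1) !subrr !addr0 [p + _]addrC subrK addrC subrK.
have R4 (x : R) : 7 / 4 <= x -> u x = f2 (x + - 2).
  move=> h; have [h1 h2 h3] : [/\ 4^-1 <= x, 3 / 4 <= x & 5 / 4 <= x] by split; lra.
  by rewrite /u (o0 x h1) (w1 x h2) (r1 x h3) (w2 x h) !subrr !addr0 [p + _]addrC subrK [q1 + _]addrC subrK addrC subrK.
exists u; split.
- split=> // x; have [x0|x0] := leP x 4^-1; first by rewrite R0.
  have [x1|x1] := leP x (3 / 4); first by rewrite R1 // ltW.
  have [x2|x2] := leP x (5 / 4); first by rewrite R2 // ltW.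
  have [x3|x3] := leP x (7 / 4); first by rewrite R3 // ltW.
  by rewrite R4 // ltW.
- have [] := @jet_translate u f0 4^-1 0 d0 f0s.
    by move=> x; rewrite subr0 => /ltr_normlW h; rewrite R0 // ltW.
  by move=> -> -> ->; rewrite f00 f01 f02.
- have [] := @jet_translate u f1 4^-1 1 d0 f1s.
    by move=> x; rewrite ltr_norml => /andP[h1 h2]; rewrite R2 //; lra.
  by move=> -> -> _; rewrite f10 f11.
- have [] := @jet_translate u f2 4^-1 2 d0 f2s.
    by move=> x; rewrite ltr_norml => /andP[h1 h2]; rewrite R4 //; lra.
  by move=> -> -> _; rewrite f20 f21.
Qed.

End joined.

(** * Arbitrary values of the antiderivatives at 0 *)

Section spanning.
Context {R : realType} {N L : nat} (U : set 'rV[R]_N) (oU : open U) (cU : connected U).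
Variables (mu : 'M[R]_L) (w : 'I_L -> 'rV[R]_N -> 'M[R]_N).
Hypotheses (ws : forall m i j, smooth_on U (fun p => w m p i j))
  (mu_sym : mu^T = mu) (mu_unit : mu \in unitmx) (li : lin_indep U w).

(** For [x0] equal to 1 or 2 such a covector vanishes near 0 together with its jets and acts there
    only through its antiderivative. *)
Definition bump_at (x0 : R) (xi : R -> 'rV[R]_N) :=
  smooth_map xi /\ forall x, 2^-1 <= `|x - x0| -> xi x = 0.

Lemma bump_at_out x0 xi x : 1 <= x0 <= 2 -> bump_at x0 xi -> 3 < `|x| -> xi x = 0.
Proof.
move=> /andP[a1 a2] [_ H] x3; apply: H; rewrite ler_normr; move: x3; rewrite ltr_normr => /orP[h|h]; apply/orP.
  by left; lra.
by right; lra.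
Qed.

Lemma bump_at_jet x0 xi : 1 <= x0 <= 2 -> bump_at x0 xi ->
  [/\ xi 0 = 0, dx xi 0 = 0 & dx (dx xi) 0 = 0].
Proof.
move=> /andP[a1 a2] [xs H]; have d0 : (0 : R) < 2^-1 by rewrite invr_gt0.
have zs : smooth_map (fun _ : R => 0 : 'rV[R]_N) := smooth_map_cst 0.
have z1 x : dx (fun _ : R => 0 : 'rV[R]_N) x = 0 by apply: is_derive_eq_dx; exact: is_derive_cst.
have [] := @jet_translate R N xi (fun=> 0) 2^-1 0 d0 zs.
  move=> x; rewrite subr0 ltr_norml => /andP[h1 h2]; apply: H; rewrite ler_normr; apply/orP; right; lra.
move=> -> -> ->; rewrite z1 (_ : dx (fun _ : R => 0 : 'rV[R]_N) = fun=> 0) ?z1//.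
by apply/funext.
Qed.

Lemma lin_indep_wm (c : 'cV[R]_L) : (forall q a, U q -> (wm w q a)^T *m c = 0) -> c = 0.
Proof.
move=> H; apply/colP => n; rewrite [RHS]mxE; apply: (li (c := fun n => c n 0)) => q Uq.
apply/matrixP => i k; rewrite summxE [RHS]mxE.
have := congr1 (fun M : 'cV[R]_N => M i 0) (H q (delta_mx 0 k) Uq); rewrite [RHS]mxE => E.
apply: (etrans _ E); rewrite [RHS]mxE; apply: eq_bigr => m _; rewrite !mxE (bigD1 k) //= mxE !eqxx mulr1.
by rewrite big1 ?addr0 1?mulrC // => j /negPf jk; rewrite mxE jk andbF mulr0.
Qed.

Section along.
Variable u : R -> 'rV[R]_N.
Hypothesis uU : smooth_field U u.
Notation r := (3 + 1 : R).

Lemma Nu_bump x0 xi (c : 'cV[R]_L) : 1 <= x0 <= 2 -> bump_at x0 xi ->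
  (Nu w r u xi 0 *m c) 0 0 = - 2^-1 * Int r (fun x => (xi x *m (Wu w u x)^T *m c) 0 0).
Proof.
move=> x01 b; have [xs H] := b; have r0 : 0 <= r by rewrite addr_ge0.
have sY := smm_mul (smm_map xs) (smm_tr (smm_W oU ws uU)).
have cY n : cont_ball (r + 1) (fun x => (xi x *m (Wu w u x)^T) 0 n) := smm_cont sY (i := 0) (j := n).
have cYc n : cont_ball (r + 1) (fun x => c n 0 * (xi x *m (Wu w u x)^T) 0 n) := cont_ballM (@cont_ball_cst R (r + 1) (c n 0)) (cY n).
have E n : Nr r (fun x => (xi x *m (Wu w u x)^T) 0 n) 0 = - 2^-1 * Int r (fun x => (xi x *m (Wu w u x)^T) 0 n).
  apply: (Nr_right r0) => x h.
  rewrite H ?mul0mx ?mxE//; rewrite ler_normr; move/andP: x01 => [h1 h2]; apply/orP; right; lra.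
rewrite mxE; under eq_bigr => n _ do rewrite [Nu _ _ _ _ _ _ _]mxE E mulrC mulrCA -(IntZ _ r0 (cY n)).
rewrite -mulr_sumr -(Int_sum _ r0 cYc); congr (_ * _); apply: (eq_Int r0) => x _.
by rewrite [RHS]mxE; apply: eq_bigr => n _; rewrite mulrC.
Qed.

(** The antiderivative at 0 is -1/2 times an integral over the bump; shrinking the bump localizes
    the relation at [x0]. *)
Lemma Nu_span x0 (c : 'cV[R]_L) : 1 <= x0 <= 2 ->
  (forall xi, bump_at x0 xi -> (Nu w r u xi 0 *m c) 0 0 = 0) -> (Wu w u x0)^T *m c = 0.
Proof.
move=> x01 H; have r0 : 0 <= r by rewrite addr_ge0.
have sW : smm (fun x => (Wu w u x)^T *m c) := smm_mul (smm_tr (smm_W oU ws uU)) (smm_cst c).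
apply/colP => l; rewrite [RHS]mxE.
apply: (@fundamental R r x0 (fun x => ((Wu w u x)^T *m c) l 0) r0).
- by move/andP: x01 => [h1 h2]; rewrite ger0_norm; lra.
- exact: (smm_cont sW (i := l) (j := 0)).
move=> d d0; pose e := Num.min d 2^-1; have e0 : 0 < e by rewrite lt_min d0 invr_gt0 ltr0n.
pose h := cutoff x0 e; have hs : smooth_on [set: R] h := cutoff_smooth x0 e.
exists h; first split.
- exact: smooth_on_cont_ball hs.
- by move=> x; have /andP[] := cutoff_in01 x0 e x.
- rewrite /h cutoff1 ?oner_neq0// subrr normr0; exact: ltW (divr_gt0 e0 (ltr0Sn _ 1)).
- by move=> x dx_; rewrite /h cutoff0// ge_min dx_.
have b : bump_at x0 (sv h (delta_mx 0 l)).
  split; first exact: sv_smooth.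
  by move=> x dx_; rewrite /sv /h cutoff0 ?scale0r// ge_min dx_ orbT.
have ev (y : R) (v : 'cV[R]_N) : y * v l 0 = ((y *: (delta_mx 0 l : 'rV[R]_N)) *m v) 0 0.
  by rewrite -scalemxAl mxZE -rowE !mxE.
have alg (x y : R) : x = - 2^-1 * y -> x = 0 -> y = 0.
  by move=> -> /eqP; rewrite mulf_eq0 oppr_eq0 invr_eq0 pnatr_eq0 /= => /eqP.
have := alg _ _ (Nu_bump c x01 b) (H _ b) => H0; apply: (etrans _ H0).
by apply: (eq_Int r0) => x _; rewrite -mulmxA; exact: ev.
Qed.

End along.

Definition germ (p z : 'rV[R]_N) (u : R -> 'rV[R]_N) :=
  [/\ smooth_field U u, u 0 = p, dx u 0 = 0 & dx (dx u) 0 = z].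

Lemma one_in : 1 <= (1 : R) <= 2. Proof. by rewrite lexx ler1n. Qed.
Lemma two_in : 1 <= (2 : R) <= 2. Proof. by rewrite lexx ler1n. Qed.

(** The curve can be sent through any point with any velocity at x = 1 without changing its 2-jet at
    0, so the values at 0 are orthogonal to a nonzero vector only if the w_n are linearly
    dependent. *)
Lemma span_linear p z (c : 'cV[R]_L) : U p ->
  (forall u xi, germ p z u -> bump_at 1 xi -> (Nu w (3 + 1) u xi 0 *m mu *m c) 0 0 = 0) -> c = 0.
Proof.
move=> Up H; have mc : mu *m c = 0.
  apply: lin_indep_wm => q a Uq; have [u [uU [u0 u1 u2] [q1 qa] _]] := curve_through oU z a 0 cU Up Uq Up.
  have := Nu_span uU (c := mu *m c) one_in; rewrite /Wu q1 qa; apply => xi b.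
  by rewrite mulmxA; apply: H.
by rewrite -[c]mul1mx -(mulVmx mu_unit) -mulmxA mc mulmx0.
Qed.

Lemma span_bilinear p z (D : 'M[R]_L) : U p ->
  (forall u xi eta, germ p z u -> bump_at 1 xi -> bump_at 2 eta ->
    (Nu w (3 + 1) u xi 0 *m mu *m D *m (Nu w (3 + 1) u eta 0 *m mu)^T) 0 0 = 0) -> D = 0.
Proof.
move=> Up H; pose C := mu *m D *m mu^T.
have C1 q a : U q -> C *m wm w q a = 0.
  move=> Uq; apply/matrixP => i j.
  have : col j (C *m wm w q a) = 0.
    apply: lin_indep_wm => q' a' Uq'.
    have [u [uU [u0 u1 u2] [q1 qa1] [q2 qa2]]] := curve_through oU z a' a cU Up Uq' Uq.
    have gu_ : germ p z u by split.
    have := Nu_span uU (c := col j (C *m wm w q a)) one_in; rewrite {1}/Wu q1 qa1; apply => xi bx.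
    pose k := Nu w (3 + 1) u xi 0.
    have := Nu_span uU (c := (k *m C)^T) two_in; rewrite /Wu q2 qa2 => K.
    have K0 : (k *m C *m wm w q a)^T = 0.
      rewrite trmx_mul; apply: K => eta be; have := H u xi eta gu_ bx be.
      rewrite -/k => E; rewrite [LHS]sc_tr -[RHS]E /C !trmx_mul !trmxK !mulmxA.
      by rewrite mxE.
    rewrite -/k colE mulmxA mulmxA -[k *m C *m _]trmxK K0 trmx0 mul0mx mxE.
    by [].
  by move=> /(congr1 (fun M : 'cV[R]_L => M i 0)); rewrite !mxE.
have C0 : C = 0.
  apply/matrixP => i j; have : row i C = 0.
    rewrite -[row i C]trmxK; apply/eqP; rewrite trmx_eq0; apply/eqP.
    apply: lin_indep_wm => q a Uq; rewrite -trmx_mul -row_mul C1//.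
    by rewrite linear0 trmx0.
  by move=> /(congr1 (fun M : 'rV[R]_L => M 0 j)); rewrite !mxE.
have -> : D = invmx mu *m C *m invmx mu.
  by rewrite /C mu_sym !mulmxA mulVmx// mul1mx -mulmxA mulmxV// mulmx1.
by rewrite C0 mulmx0 mul0mx.
Qed.

End spanning.

Section germs_of_covectors.
Context {R : realType} {N : nat}.

Lemma constant_germ (e : 'rV[R]_N) : exists xi : R -> 'rV[R]_N,
  [/\ smooth_map xi, forall x, 3 < `|x| -> xi x = 0, xi 0 = e & dx (dx xi) 0 = 0].
Proof.
have cs : smooth_map (fun _ : R => e) := smooth_map_cst e.
have z1 x : dx (fun _ : R => e) x = 0 by apply: is_derive_eq_dx; exact: is_derive_cst.
have z2 : dx (dx (fun _ : R => e)) 0 = 0.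
  rewrite (_ : dx (fun _ : R => e) = fun=> 0); first by apply: is_derive_eq_dx; exact: is_derive_cst.
  exact/funext.
have d0 : (0 : R) < 1 by [].
pose xi := sv (cutoff (0 : R) 2) e.
have [] := @jet_translate R N xi (fun=> e) 1 0 d0 cs.
  by move=> x; rewrite subr0 => x1; rewrite /xi /sv cutoff1 ?scale1r// subr0 divff// ltW.
rewrite z2 => e0 _ e2; exists xi; split; [exact: sv_smooth (cutoff_smooth 0 2)| |exact: e0|exact: e2].
move=> x x3; rewrite /xi /sv cutoff0 ?scale0r// subr0; apply: le_trans (ltW x3); by rewrite ler_nat.
Qed.

Lemma quadratic_germ (e : 'rV[R]_N) : exists xi : R -> 'rV[R]_N,
  [/\ smooth_map xi, forall x, 3 < `|x| -> xi x = 0, xi 0 = 0 & dx (dx xi) 0 = e].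
Proof.
have [xi [[xs _] x0 _ x2 xo]] := @germ_curve R N setT 0 0 e 1 openT I ltr01.
exists xi; split; [exact: xs| |exact: x0|exact: x2].
by move=> x x3; apply: xo; apply: le_trans (ltW x3); rewrite ler1n.
Qed.

End germs_of_covectors.

Section germ_equation.
Context {R : realType} {N L : nat}.
Variables (G : 'rV[R]_N -> 'M[R]_N) (c : 'I_N -> 'I_N -> 'I_N -> 'rV[R]_N -> R)
  (mu : 'M[R]_L) (w : 'I_L -> 'rV[R]_N -> 'M[R]_N).
Variables (p z : 'rV[R]_N) (l : 'I_N).

Let a := (delta_mx 0 l : 'rV[R]_N) *m G p.
Let g := gam c p z.

Definition germ_dens (k : 'rV[R]_L) (h x0 x2 : 'rV[R]_N) : R :=
  (k *m codazzi_defect c w p a z *m x0^T) 0 0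
  - (k *m wm w p a *m (x2 - x0 *m g^T)^T) 0 0
  - (h *m (wm w p z)^T *m mu *m wm w p a *m x0^T) 0 0.

Definition germ_var (k : 'rV[R]_L) (x0 x2 : 'rV[R]_N) : 'rV[R]_N :=
  (x2 - x0 *m g^T) *m G p + k *m wm w p z.

(* The Jacobi identity tested at a point where u_x = 0 and u_xx = z; k1, k2
   stand for the values there of the antiderivatives of xi W^T mu, eta W^T mu. *)
Definition germ_eq (x0 x2 y0 y2 : 'rV[R]_N) (k1 k2 : 'rV[R]_L) : Prop :=
  germ_dens k1 x0 y0 y2 - germ_dens k2 y0 x0 x2
  - (k2 *m wm w p (germ_var k1 x0 x2)) 0 l + (k1 *m wm w p (germ_var k2 y0 y2)) 0 l = 0.

Lemma wmN b : wm w p (- b) = - wm w p b.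
Proof. exact: (ctN (fun m i k p => w m p i k)). Qed.

End germ_equation.

Section germ_consequences.
Context {R : realType} {N L : nat}.
Variables (G : 'rV[R]_N -> 'M[R]_N) (c : 'I_N -> 'I_N -> 'I_N -> 'rV[R]_N -> R)
  (mu : 'M[R]_L) (w : 'I_L -> 'rV[R]_N -> 'M[R]_N) (p : 'rV[R]_N).
Implicit Types (k : 'rV[R]_L) (z e f : 'rV[R]_N).
Notation germ_eq := (germ_eq G c mu w p).
Notation bas l := (delta_mx 0 l : 'rV[R]_N).

Lemma mx0E m n i j : (0 : 'M[R]_(m, n)) i j = 0. Proof. by rewrite mxE. Qed.

Lemma germ_dens0 z l k h : germ_dens G c mu w p z l k h 0 0 = 0.
Proof. by rewrite /germ_dens mul0mx subr0 trmx0 !mulmx0 mxE !subr0. Qed.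

Lemma germ_var0 z k : germ_var G c w p z k 0 0 = k *m wm w p z.
Proof. by rewrite /germ_var mul0mx subr0 mul0mx add0r. Qed.

Lemma germ_quadratic l e k1 k2 : germ_eq 0 l 0 0 0 e k1 k2 ->
  (k1 *m wm w p (e *m G p)) 0 l = (k1 *m wm w p (bas l *m G p) *m e^T) 0 0.
Proof.
rewrite /germ_eq germ_dens0 germ_var0 wm0 mulmx0 wm0 mulmx0 subr0 /germ_dens /germ_var.
rewrite !wm0 !mul0mx !trmx0 !mulmx0 !mx0E subr0 addr0 sub0r !subr0 => /eqP.
by rewrite addrC subr_eq0 => /eqP.
Qed.

Lemma germ_commute z l k1 k2 : germ_eq z l 0 0 0 0 k1 k2 ->
  (k2 *m wm w p (k1 *m wm w p z)) 0 l = (k1 *m wm w p (k2 *m wm w p z)) 0 l.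
Proof.
rewrite /germ_eq !germ_dens0 !germ_var0 subr0 sub0r => /eqP.
by rewrite addrC subr_eq0 eq_sym => /eqP.
Qed.

Lemma entry_form (v : 'rV[R]_N) l : v 0 l = (v *m (bas l)^T) 0 0.
Proof. by rewrite trmx_delta -colE mxE. Qed.

Hypothesis sa : forall m, G p *m (w m p)^T = w m p *m G p.
Hypothesis cm : forall m n, w m p *m w n p = w n p *m w m p.

Let sak k : G p *m (wcomb w k p)^T = wcomb w k p *m G p.
Proof.
rewrite /wcomb linear_sum /= mulmx_sumr mulmx_suml; apply: eq_bigr => m _.
by rewrite linearZ /= -scalemxAr -scalemxAl sa.
Qed.

Let cmk k1 k2 : wcomb w k1 p *m wcomb w k2 p = wcomb w k2 p *m wcomb w k1 p.
Proof.
rewrite /wcomb !mulmx_sumr; under eq_bigr do rewrite mulmx_suml.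
under [RHS]eq_bigr do rewrite mulmx_suml.
rewrite exchange_big /=; apply: eq_bigr => m _; apply: eq_bigr => n _.
by rewrite -!scalemxAr -!scalemxAl cm // !scalerA mulrC.
Qed.

Hypothesis Gs : (G p)^T = G p.

Lemma germ_adjoint k e f : (k *m wm w p (e *m G p) *m f^T) 0 0 = (k *m wm w p (f *m G p) *m e^T) 0 0.
Proof.
rewrite !mul_wm [LHS]sc_tr !trmx_mul !trmxK Gs !mulmxA -[f *m wcomb _ _ _ *m _]mulmxA -sak.
by rewrite mulmxA.
Qed.

Lemma adjoint_entry k e l :
  (k *m wm w p (e *m G p)) 0 l = (k *m wm w p (bas l *m G p) *m e^T) 0 0.
Proof. by rewrite entry_form germ_adjoint. Qed.

Lemma germ_swap k1 k2 z l : (k2 *m wm w p (k1 *m wm w p z)) 0 l = (k1 *m wm w p (k2 *m wm w p z)) 0 l.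
Proof. by rewrite !mul_wm -!mulmxA -!trmx_mul cmk. Qed.

Lemma germ_linear z l e k1 k2 : germ_eq z l 0 0 e 0 k1 k2 ->
  (k1 *m codazzi_defect c w p (bas l *m G p) z *m e^T) 0 0 = 0.
Proof.
rewrite /germ_eq germ_dens0 germ_var0 /germ_dens /germ_var sub0r mul0mx.
move: (codazzi_defect _ _ _ _ _) => cd.
rewrite !mul0mx !mulNmx !(wmD, wmN) mulmxDr mulmxN !addoppE germ_swap trNE mulmxN !addoppE !mx0E adjoint_entry.
move: ((_ *m cd *m _) 0 0) => A; move: ((k1 *m _ *m _) 0 0) ((k1 *m _) 0 l) => B C H.
rewrite -[RHS]H; ring.
Qed.

Lemma germ_constant z l e f k1 k2 : (forall a, codazzi_defect c w p a z = 0) -> germ_eq z l e 0 f 0 k1 k2 ->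
  (e *m (wm w p z)^T *m mu *m wm w p (bas l *m G p) *m f^T) 0 0 =
  (f *m (wm w p z)^T *m mu *m wm w p (bas l *m G p) *m e^T) 0 0.
Proof.
move=> cd; rewrite /germ_eq /germ_dens /germ_var !cd !mulmx0 !mul0mx !sub0r.
rewrite !mulNmx !(wmD, wmN) !mulmxDr !mulmxN !addoppE germ_swap !trNE !mulmxN !addoppE !mx0E.
rewrite !adjoint_entry.
move: ((_ *m _^T *m _ *m _ *m f^T) 0 0) ((_ *m _^T *m _ *m _ *m e^T) 0 0) => A B.
move: ((k1 *m _ *m _) 0 0) ((k2 *m _ *m _) 0 0) ((k1 *m _) 0 l) => A' B' C' H.
apply/eqP; rewrite eq_sym -subr_eq0 -[X in _ == X]H; apply/eqP; ring.
Qed.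

End germ_consequences.

Section necessity.
Context {R : realType} {N L : nat} (U : set 'rV[R]_N) (oU : open U) (cU : connected U).
Variables (G : 'rV[R]_N -> 'M[R]_N) (c : 'I_N -> 'I_N -> 'I_N -> 'rV[R]_N -> R)
  (mu : 'M[R]_L) (w : 'I_L -> 'rV[R]_N -> 'M[R]_N).
Hypotheses (FC : flat_connection U G c) (G_unit : forall p, U p -> G p \in unitmx)
  (ws : forall m i j, smooth_on U (fun p => w m p i j))
  (mu_sym : mu^T = mu) (mu_unit : mu \in unitmx) (li : lin_indep U w)
  (ham : hamiltonian U (hydro_op G (lcb G c) mu w)).

Notation K u xi := (Nu w (3 + 1) u xi 0 *m mu).
Notation bas l := (delta_mx 0 l : 'rV[R]_N).

Lemma germ_condition p z u xi eta l : germ U p z u -> smooth_map xi -> smooth_map eta ->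
  (forall x, 3 < `|x| -> xi x = 0) -> (forall x, 3 < `|x| -> eta x = 0) ->
  germ_eq G c mu w p z l (xi 0) (dx (dx xi) 0) (eta 0) (dx (dx eta) 0) (K u xi) (K u eta).
Proof.
move=> [uU u0 u1 u2] xs es xr er.
have s1 : (1 : R) <= 3 by rewrite ler1n.
have := jacobi_germ oU FC ws mu_sym ham s1 uU xs es xr er u1 l.
by rewrite /dens' u0 u2.
Qed.

Lemma necessary_self_adjoint p m : U p -> G p *m (w m p)^T = w m p *m G p.
Proof.
move=> Up; have Gs := fc_sym FC Up.
have H j l : wm w p (bas l *m G p) *m (bas j)^T = wm w p (bas j *m G p) *m (bas l)^T.
  apply/eqP; rewrite -subr_eq0; apply/eqP; apply: (span_linear oU cU ws mu_unit li (z := 0) Up) => u xi gu_ b.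
  have [eta [es er e0 e2]] := quadratic_germ (bas j).
  have [xs _] := b; have [x0 _ x2] := bump_at_jet one_in b.
  have xr x : 3 < `|x| -> xi x = 0 by exact: bump_at_out one_in b.
  have := germ_condition l gu_ xs es xr er; rewrite x0 x2 e0 e2 => /germ_quadratic.
  by rewrite entry_form mulmxBr !mulmxA addmxE oppmxE => ->; rewrite subrr.
have E j l : (w m p *m G p) j l = (wm w p (bas l *m G p) *m (bas j)^T) m 0.
  rewrite trmx_delta -colE !mxE; apply: eq_bigr => k _; congr (_ * _).
  by rewrite -rowE mxE -[in LHS]Gs mxE.
apply/matrixP => j l; rewrite -[in LHS]Gs -trmx_mul [LHS]mxE !E.
by rewrite H.
Qed.

Lemma necessary_commute p m n : U p -> w m p *m w n p = w n p *m w m p.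
Proof.
move=> Up; apply/trmx_inj/matrixP => i l.
have D k1 k2 (z : 'rV[R]_N) : (z *m (wcomb w k1 p *m wcomb w k2 p)^T) 0 l =
   (k2 *m (\matrix_(a, d) (z *m (w d p *m w a p)^T) 0 l) *m k1^T) 0 0.
  rewrite /wcomb mulmx_suml linear_sum /= mulmx_sumr summxE mxE.
  apply: eq_bigr => d _; rewrite mulmx_sumr linear_sum /= mulmx_sumr summxE [_^T _ _]mxE [(_ *m _) 0 d]mxE mulr_suml.
  apply: eq_bigr => a _; rewrite -scalemxAl -scalemxAr scalerA linearZ /= -scalemxAr mxZE [(\matrix_(_, _) _) _ _]mxE.
  move: ((z *m _) 0 l) => y; ring.
pose M (a d : 'I_L) : R := (bas i *m (w d p *m w a p)^T) 0 l.
have M0 : (\matrix_(a, d) M a d) - (\matrix_(a, d) M a d)^T = 0.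
  apply: (span_bilinear oU cU ws mu_sym mu_unit li (z := bas i) Up) => u xi eta gu_ bx be.
  have [xs _] := bx; have [x0 _ x2] := bump_at_jet one_in bx.
  have [es _] := be; have [e0 _ e2] := bump_at_jet two_in be.
  have xr x : 3 < `|x| -> xi x = 0 by exact: bump_at_out one_in bx.
  have er x : 3 < `|x| -> eta x = 0 by exact: bump_at_out two_in be.
  have := germ_condition l gu_ xs es xr er; rewrite x0 x2 e0 e2 => /germ_commute.
  have E2 k1 k2 : (k2 *m wm w p (k1 *m wm w p (bas i))) 0 l = (bas i *m (wcomb w k2 p *m wcomb w k1 p)^T) 0 l.
    by rewrite !mul_wm -mulmxA -trmx_mul.
  move: (K u xi) (K u eta) => k1 k2; rewrite !E2 !D => E.
  rewrite mulmxBr mulmxBl addmxE oppmxE.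
  rewrite [X in _ - X]sc_tr !trmx_mul !trmxK mulmxA; apply/eqP; rewrite subr_eq0; apply/eqP.
  by rewrite E.
have := congr1 (fun A : 'M[R]_L => A n m) M0; rewrite addmxE oppmxE mx0E => /eqP; rewrite subr_eq0 => /eqP.
have e (A : 'M[R]_N) : (bas i *m A) 0 l = A i l by rewrite -rowE mxE.
by rewrite -!e [X in X = _]mxE [X in _ = X]mxE [X in _ = X]mxE.
Qed.

Lemma necessary_codazzi p a z : U p -> codazzi_defect c w p a z = 0.
Proof.
move=> Up; have Gs := fc_sym FC Up.
have sa m := necessary_self_adjoint m Up; have cm m n := necessary_commute m n Up.
have H l : codazzi_defect c w p (bas l *m G p) z = 0.
  apply/matrixP => m j; have : codazzi_defect c w p (bas l *m G p) z *m (bas j)^T = 0.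
    apply: (span_linear oU cU ws mu_unit li (z := z) Up) => u xi gu_ b.
    have [eta [es er e0 e2]] := constant_germ (bas j).
    have [xs _] := b; have [x0 _ x2] := bump_at_jet one_in b.
    have xr x : 3 < `|x| -> xi x = 0 by exact: bump_at_out one_in b.
    have := germ_condition l gu_ xs es xr er; rewrite x0 x2 e0 e2 => /(germ_linear sa cm Gs).
    by rewrite mulmxA.
  move=> /(congr1 (fun A : 'cV[R]_L => A m 0)); rewrite trmx_delta -colE [LHS]mxE !mx0E.
  by [].
have -> : a = (a *m invmx (G p)) *m G p by rewrite -mulmxA mulVmx ?mulmx1 //; exact: G_unit.
move: (a *m _) => b; rewrite (codazzi_defect_sum oU c ws _ _ Up).
under eq_bigr => k _ do rewrite mxE scaler_suml.
rewrite exchange_big big1 // => l _ /=.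
have := H l; rewrite (codazzi_defect_sum oU c ws _ _ Up) => Hl.
have : b 0 l *: (\sum_k (bas l *m G p) 0 k *: codazzi_defect c w p (bas k) z) = 0 by rewrite Hl scaler0.
rewrite scaler_sumr => E; apply: (etrans _ E); apply: eq_bigr => k _.
by rewrite scalerA -rowE [row _ _ _ _]mxE.
Qed.

Lemma necessary_gauss p a v : U p -> ((wm w p v)^T *m mu *m wm w p a)^T = (wm w p v)^T *m mu *m wm w p a.
Proof.
move=> Up; have Gs := fc_sym FC Up.
have sa m := necessary_self_adjoint m Up; have cm m n := necessary_commute m n Up.
have H l (e f : 'rV[R]_N) : (e *m ((wm w p v)^T *m mu *m wm w p (bas l *m G p)) *m f^T) 0 0 =
    (f *m ((wm w p v)^T *m mu *m wm w p (bas l *m G p)) *m e^T) 0 0.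
  have [u [uU u0 u1 u2 _]] := germ_curve 0 v oU Up (ltr01 : (0 : R) < 1).
  have [xi [xs xr x0 x2]] := constant_germ e; have [eta [es er e0 e2]] := constant_germ f.
  have gu_ : germ U p v u by split.
  have := germ_condition l gu_ xs es xr er; rewrite x0 x2 e0 e2.
  move=> /(germ_constant sa cm Gs (fun a => necessary_codazzi a v Up)).
  by rewrite !mulmxA.
have E i j y : (bas i *m ((wm w p v)^T *m mu *m wm w p y) *m (bas j)^T) 0 0 = ((wm w p v)^T *m mu *m wm w p y) i j.
  by rewrite -entry_form -rowE mxE.
apply/matrixP => i j; rewrite [LHS]mxE -!E.
have -> : a = (a *m invmx (G p)) *m G p by rewrite -mulmxA mulVmx ?mulmx1 //; exact: G_unit.
move: (a *m _) => b.
have F (e f y : 'rV[R]_N) : (e *m ((wm w p v)^T *m mu *m wm w p (y *m G p)) *m f^T) 0 0 =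
    (y *m (G p *m (wcomb w (e *m (wm w p v)^T *m mu) p)^T *m f^T)) 0 0.
  by rewrite !mulmxA mul_wm.
rewrite !F; congr ((b *m _) 0 0); apply/colP => l.
have := H l (bas j) (bas i); rewrite !F.
by rewrite -!rowE ![row _ _ _ _]mxE.
Qed.

Lemma necessary_conditions : ferapontov_conditions U G c mu w.
Proof.
split.
- by move=> p m; exact: necessary_self_adjoint.
- move=> p a v Up; apply/eqP; rewrite -subr_eq0; apply/eqP; exact: (necessary_codazzi a v Up).
- by move=> p a v; exact: necessary_gauss.
- by move=> p m n; exact: necessary_commute.
Qed.

End necessity.

Theorem theorem4p2 (R : realType) (N L : nat) (U : set 'rV[R]_N)
    (g : 'rV[R]_N -> 'M[R]_N)
    (b : 'I_N -> 'I_N -> 'I_N -> 'rV[R]_N -> R)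
    (mu : 'M[R]_L) (w : 'I_L -> 'rV[R]_N -> 'M[R]_N)
    (U_open : open U) (U_connected : connected U)
    (g_flat : flat_metric U g)
    (b_smooth : forall i j k, smooth_on U (b i j k))
    (w_smooth : forall n i j, smooth_on U (fun u => w n u i j))
    (mu_sym : mu^T = mu) (mu_nondeg : mu \in unitmx) :
  let b_is_levi_civita :=
    forall u, U u -> forall i j k, b i j k u = lc_coef g i j k u in
  [/\ lin_indep U w -> hamiltonian U (hydro_op g b mu w) ->
        b_is_levi_civita /\ locally_potential U g mu w,
      b_is_levi_civita /\ locally_potential U g mu w ->
        hamiltonian U (hydro_op g b mu w) &
      forall (V : set 'rV[R]_N) (Phi : 'I_L -> 'rV[R]_N -> R),
        open V -> V `<=` U -> potentials V g mu w Phi ->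
        [/\ forall l1 l2 : R, hamiltonian V (M_op g mu Phi l1 l2),
            forall m n, commuting_flows V (hess_up g (Phi m)) (hess_up g (Phi n)) &
            forall n, bihamiltonian_system V g mu Phi (hess_up g (Phi n))]].
Proof.
have FC := flat_connection_christoffel U_open g_flat.
have [gs gsym gu _] := g_flat.
have ls := lcb_smooth U_open FC.
move=> LC; split.
- move=> li ham.
  have lc : LC by move=> p Up i j k; exact: (levi_civita U_open gs gsym b_smooth w_smooth mu_sym ham g_flat).
  split=> //; apply: (conditions_locally_potential U_open g_flat w_smooth).
  apply: (necessary_conditions U_open U_connected FC gu w_smooth mu_sym mu_nondeg li).
  have E p i j k : U p -> b i j k p = lcb g (christoffel g) i j k p by move=> Up; exact: lc.
  exact: (hamiltonian_ext U_open gs b_smooth w_smooth E ham).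
- move=> [lc pot].
  have ham := hydro_op_hamiltonian U_open FC w_smooth mu_sym (locally_potential_conditions g_flat pot).
  have E p i j k : U p -> lcb g (christoffel g) i j k p = b i j k p by move=> Up; exact: esym (lc p Up i j k).
  exact: (hamiltonian_ext U_open gs ls w_smooth E ham).
move=> V Phi oV VU [PhiV wV r3 r4].
have gV := flat_metric_sub VU g_flat.
have pot : potentials V g mu (fun n => hess_up g (Phi n)) Phi by split.
have [c2 c3 c4 c5] := conditions_of_potentials oV gV PhiV (fun n u _ => erefl) pot.
split.
- by move=> l1 l2; exact: (M_op_hamiltonian oV gV mu_sym pot).
- move=> m n; have hs k i j := hess_up_smooth oV gV PhiV k i j.
  exact: (flows_commute oV (w := fun n => hess_up g (Phi n)) hs (fc_tor (flat_connection_christoffel oV gV)) c3 c5 m n).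
- move=> n; split.
  + exact: (M_op_compatible oV gV mu_sym pot).
  + exact: (hamiltonian_system_local oV gV pot n).
  + exact: (hamiltonian_system_nonlocal oV g Phi n mu_nondeg).
Qed.
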